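(* Let $f$ be a nearly balanced Rogers function, $0<\tau_1<\tau_2$ and $0<\xi_1<\xi_2$. Then $$\frac{\kappa_f^{\uparrow}(\tau_1;\xi)}{\kappa_f^{\uparrow}(\tau_2;\xi)}\quad\text{and}\quad\frac{\kappa_f^{\downarrow}(\tau_1;\xi)}{\kappa_f^{\downarrow}(\tau_2;\xi)}$$ are complete Bernstein functions of $\xi$, and $$\frac{\kappa_f^{\uparrow}(\tau;\xi_1)}{\kappa_f^{\uparrow}(\tau;\xi_2)}\quad\text{and}\quad\frac{\kappa_f^{\downarrow}(\tau;\xi_1)}{\kappa_f^{\downarrow}(\tau;\xi_2)}$$ are complete Bernstein functions of $\tau$.
   Context: Let $\mathbf{C}_\to=\{\xi\in\mathbf{C}:\operatorname{Re}\xi>0\}$; $\operatorname{Arg}$ is the principal argument. Complete Bernstein function: a holomorphic function $g$ on $\mathbf{C}\setminus(-\infty,0]$ with $\operatorname{Im}g(\xi)\ge0$ whenever $\operatorname{Im}\xi>0$ and $g(\xi)\in[0,\infty)$ for $\xi\in(0,\infty)$. A function on $(0,\infty)$ is called a complete Bernstein function if it extends to such a function. Rogers function: a holomorphic function $f$ on $\mathbf{C}_\to$ with $\operatorname{Re}(f(\xi)/\xi)\ge0$ for all $\xi\in\mathbf{C}_\to$. It is nonzero if it is not identically $0$. Wiener--Hopf factors: every nonzero Rogers function $f$ has a unique factorisation $f(\xi)=f^{\uparrow}(-i\xi)f^{\downarrow}(i\xi)$, $\xi\in\mathbf{C}_\to$, with nonzero complete Bernstein functions $f^{\uparrow},f^{\downarrow}$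 such that $f^{\uparrow}(1)=f^{\downarrow}(1)$. For $\tau>0$, $f^{\uparrow}(\tau;\xi)=g^{\uparrow}(\xi)$ and $f^{\downarrow}(\tau;\xi)=g^{\downarrow}(\xi)$, where $g(\xi)=f(\xi)+\tau$. For $\tau>0$ and $\xi\in\mathbf{C}\setminus(-\infty,0]$ define (the limits exist and are positive numbers) $$\kappa_f^{\uparrow}(\tau;\xi)=\left(\lim_{\eta\nearrow\infty}\frac{f^{\uparrow}(1;\eta)}{f^{\uparrow}(\tau;\eta)}\right)f^{\uparrow}(\tau;\xi),\qquad \kappa_f^{\downarrow}(\tau;\xi)=\left(\lim_{\eta\nearrow\infty}\frac{f^{\downarrow}(1;\eta)}{f^{\downarrow}(\tau;\eta)}\right)f^{\downarrow}(\tau;\xi).$$ Let $f$ be a nonconstant Rogers function. For each $r>0$ there is at most one $\zeta\in\mathbf{C}_\to$ with $|\zeta|=r$ and $f(\zeta)\in(0,\infty)$; if it exists, it is denoted by $\zeta_f(r)$, and $|\gamma_f|\subseteq(0,\infty)$ is the set of those $r$ for which it exists. The function $\zeta_f$ extends to a continuous function on $(0,\infty)$ with $\zeta_f(r)\in\{-ir,ir\}$ for $r\in(0,\infty)\setminus|\gamma_f|$. $f$ is balanced if $|\gamma_f|=(0,\infty)$, $\sup_{r>0}|\operatorname{Arg}\zeta_f(r)|<\frac\pi2$ and $\int_0^\infty|\zeta_f'(r)|(1+r^2)^{-1}\log(r+1/r)\,dr<\infty$. $f$ is nearly balanced if $|\gamma_f|=(r_0,r_\infty)$ for some $0\le r_0<r_\infty\le\infty$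 and the Rogers function $g(\xi)=f(u(\xi))$ is balanced, where $\zeta_0=\zeta_f(r_0)$ ($\zeta_0=0$ if $r_0=0$), $\zeta_\infty=\zeta_f(r_\infty)$ (complex infinity if $r_\infty=\infty$) and $$u(\xi)=\zeta_0+\frac{(\zeta_\infty-\zeta_0)\xi}{\xi+(\zeta_\infty-\zeta_0)},$$ with $u(\xi)=\zeta_0+\xi$ if $\zeta_\infty$ is complex infinity. *)

(* Defs.v *)
(* Stdlib real numbers with Coquelicot's complex numbers C, limits and
   derivatives. *)
From Stdlib Require Import Reals ClassicalEpsilon.
From Coquelicot Require Import Coquelicot.

Open Scope R_scope.

Definition right_half_plane (xi : C) : Prop := 0 < Re xi.

Definition slit_plane (xi : C) : Prop := ~ (Im xi = 0 /\ Re xi <= 0).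

Definition positive_real (w : C) : Prop := Im w = 0 /\ 0 < Re w.

Definition nonneg_real (w : C) : Prop := Im w = 0 /\ 0 <= Re w.

(* Holomorphic functions on an open set are represented by total functions,
   of which only the values on that set matter. *)
Definition holomorphic_on (D : C -> Prop) (f : C -> C) : Prop :=
  forall xi : C, D xi -> @ex_derive C_AbsRing C_NormedModule f xi.

Definition nonzero_on (D : C -> Prop) (f : C -> C) : Prop :=
  exists xi : C, D xi /\ f xi <> RtoC 0.

Definition nonconstant_on (D : C -> Prop) (f : C -> C) : Prop :=
  ~ exists c : C, forall xi : C, D xi -> f xi = c.

(* Principal argument, with values in (-PI, PI], for z <> 0. *)
Definition Arg (z : C) : R :=
  if Rle_dec 0 (Im z) then acos (Re z / Cmod z) else - acos (Re z / Cmod z).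

Definition complete_bernstein (g : C -> C) : Prop :=
  holomorphic_on slit_plane g /\
  (forall xi : C, 0 < Im xi -> 0 <= Im (g xi)) /\
  (forall x : R, 0 < x -> nonneg_real (g (RtoC x))).

Definition complete_bernstein_pos (h : R -> C) : Prop :=
  exists g : C -> C,
    complete_bernstein g /\ forall t : R, 0 < t -> g (RtoC t) = h t.

Definition rogers (f : C -> C) : Prop :=
  holomorphic_on right_half_plane f /\
  forall xi : C, right_half_plane xi -> 0 <= Re (f xi / xi)%C.

Definition is_wiener_hopf (f : C -> C) (p : (C -> C) * (C -> C)) : Prop :=
  complete_bernstein (fst p) /\ nonzero_on slit_plane (fst p) /\
  complete_bernstein (snd p) /\ nonzero_on slit_plane (snd p) /\
  fst p (RtoC 1) = snd p (RtoC 1) /\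
  forall xi : C, right_half_plane xi ->
    f xi = (fst p (- Ci * xi) * snd p (Ci * xi))%C.

(* For a nonzero Rogers function the factors are determined on the slit plane
   by is_wiener_hopf; the choice affects only values outside of it. *)
Definition wiener_hopf (f : C -> C) : (C -> C) * (C -> C) :=
  epsilon (inhabits (fun _ => RtoC 0, fun _ => RtoC 0)) (is_wiener_hopf f).

Definition wh_up (f : C -> C) (tau : R) : C -> C :=
  fst (wiener_hopf (fun xi => f xi + RtoC tau)%C).

Definition wh_down (f : C -> C) (tau : R) : C -> C :=
  snd (wiener_hopf (fun xi => f xi + RtoC tau)%C).

(* The quotients under the limits are real since complete Bernstein functions
   are real on (0, +oo). *)
Definition kappa_up (f : C -> C) (tau : R) (xi : C) : C :=
  (RtoC (real (Lim (fun eta : R =>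
     Re (wh_up f 1 (RtoC eta) / wh_up f tau (RtoC eta))) p_infty))
   * wh_up f tau xi)%C.

Definition kappa_down (f : C -> C) (tau : R) (xi : C) : C :=
  (RtoC (real (Lim (fun eta : R =>
     Re (wh_down f 1 (RtoC eta) / wh_down f tau (RtoC eta))) p_infty))
   * wh_down f tau xi)%C.

Definition gamma_moduli (f : C -> C) (r : R) : Prop :=
  0 < r /\
  exists z : C, right_half_plane z /\ Cmod z = r /\ positive_real (f z).

Definition is_zeta (f : C -> C) (z : R -> C) : Prop :=
  forall r : R, 0 < r ->
    continuous z r /\
    (gamma_moduli f r ->
       right_half_plane (z r) /\ Cmod (z r) = r /\ positive_real (f (z r))) /\
    (~ gamma_moduli f r ->
       z r = (- Ci * RtoC r)%C \/ z r = (Ci * RtoC r)%C).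

(* For a nonconstant Rogers function is_zeta has a solution, which is unique
   on (0, +oo) if gamma_moduli f is nonempty. *)
Definition zeta (f : C -> C) : R -> C :=
  epsilon (inhabits (fun _ => RtoC 0)) (is_zeta f).

Definition derive_path (z : R -> C) (r : R) : C :=
  (Derive (fun s => Re (z s)) r, Derive (fun s => Im (z s)) r).

(* The integrand below is continuous and nonnegative on (0, +oo), so that
   convergence of the improper Riemann integral at both ends means finiteness
   of the integral. *)
Definition balanced (f : C -> C) : Prop :=
  rogers f /\ nonconstant_on right_half_plane f /\
  (forall r : R, 0 < r -> gamma_moduli f r) /\
  Rbar_lt (Lub_Rbar (fun a => exists r : R, 0 < r /\ a = Rabs (Arg (zeta f r))))
          (Finite (PI / 2)) /\
  ex_RInt_gen
    (fun r => Cmod (derive_path (zeta f) r) * / (1 + r ^ 2) * ln (r + 1 / r))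
    (at_right 0) (Rbar_locally p_infty).

Definition zeta_start (f : C -> C) (r0 : R) : C :=
  if Req_EM_T r0 0 then RtoC 0 else zeta f r0.

Definition nb_map (f : C -> C) (r0 : R) (rinf : Rbar) (xi : C) : C :=
  let z0 := zeta_start f r0 in
  match rinf with
  | Finite r => (z0 + (zeta f r - z0) * xi / (xi + (zeta f r - z0)))%C
  | _ => (z0 + xi)%C
  end.

Definition nearly_balanced (f : C -> C) : Prop :=
  rogers f /\ nonconstant_on right_half_plane f /\
  exists (r0 : R) (rinf : Rbar),
    0 <= r0 /\ Rbar_lt (Finite r0) rinf /\
    (forall r : R, gamma_moduli f r <-> r0 < r /\ Rbar_lt (Finite r) rinf) /\
    balanced (fun xi => f (nb_map f r0 rinf xi)).

(* Main.v *)
(* The theorem holds for every Rogers function f. In the Cayley coordinate the Schwarz formula splits log(f + tau) into two integrals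
   over the halves of the imaginary axis, which are logarithms of complete Bernstein functions with boundary angles given by
   -+ arg(f + tau). These angles decrease in tau, so the ratio of the factors for tau1 < tau2 has boundary angle in [0, pi] and is
   again a complete Bernstein function of xi.
   For the ratio at xi1 < xi2, let M = log((xi - i xi1) / (xi - i xi2)); its logarithm is Im of the integral of M' log(f + tau) along
   the arc from 0 to infinity, divided by pi. The contour is moved to the curve where f is real; integrating by parts there gives
   -(1/pi) int Im M / (tau + lambda) d lambda with lambda = f increasing along the curve and 0 <= Im M <= pi,
   which is the logarithm of a complete Bernstein function of tau.
   Both arguments are carried out for approximations of f that are holomorphic across the imaginary axis. Logarithms of complete
   Bernstein functions form a compact class, so one passes to the limit along an ultrafilter. The limits are the Wiener-Hopf factors
   by uniqueness: a quotient of two such factors continues to C \ {0} with growth O(|x|) at infinity and O(1/|x|) at 0, hence is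
   constant by Liouville's theorem and positivity on the real axis. *)
Require Import Defs.
From Stdlib Require Import Reals Lra Lia Psatz Classical ClassicalEpsilon FunctionalExtensionality.
From Coquelicot Require Import Coquelicot.
From mathcomp Require boot.ssrnat classical.classical_sets classical.filter.

Open Scope R_scope.
Set Bullet Behavior "Strict Subproofs".

(** The obstacle is the boundary: on the imaginary axis f need not have continuous boundary values,
    and the curve where f is real may run into the axis or be empty. The approximations replace
    f(xi)/xi by a dilation of it in the disc plus eta, and then the resulting z = xi P by z / (eta z
    + 1). After that f + tau is holomorphic and off the cut near the closed disc, and the
    Schwarz-Pick inequality makes f strictly monotone along its real curve, which becomes a graph
    over log |xi|. Limits are taken of logarithms, with bounds at x that depend on x alone. A
    second-order Taylor estimate with fixed constants is a closed condition, so a pointwise limit is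
    again holomorphic. For the constants in kappa it suffices that the quotient of the factors at
    two values of tau stays between positive constants as the argument tends to infinity. On the
    imaginary axis each quotient is comparable with its value at the modulus, and for real xi the
    product of the two quotients is |f + tau1| / |f + tau2| up to a constant, which is bounded
    because Re f >= 0 there. *)

Lemma Ceq (z w : C) : Re z = Re w -> Im z = Im w -> z = w.
Proof. destruct z, w; simpl; intros; subst; reflexivity. Qed.

Lemma re_minus (a b : C) : Re (a - b) = Re a - Re b.
Proof. unfold Re; simpl; ring. Qed.

Lemma im_minus (a b : C) : Im (a - b) = Im a - Im b.
Proof. unfold Im; simpl; ring. Qed.

Lemma Cmod_sq (z : C) : Cmod z * Cmod z = Re z * Re z + Im z * Im z.
Proof. pose proof (Cmod2_alt z); simpl in H; lra. Qed.

Lemma norm_pos (z : C) : z <> 0 -> 0 < Re z * Re z + Im z * Im z.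
Proof. intros H. rewrite <- Cmod_sq. apply Cmod_gt_0 in H. nra. Qed.

Lemma re_div (z w : C) : w <> 0 -> Re (z / w) = (Re z * Re w + Im z * Im w) / (Re w * Re w + Im w * Im w).
Proof. intros H. apply norm_pos in H. revert H. unfold Re, Im. simpl. intros H. field. lra. Qed.

Lemma im_div (z w : C) : w <> 0 -> Im (z / w) = (Im z * Re w - Re z * Im w) / (Re w * Re w + Im w * Im w).
Proof. intros H. apply norm_pos in H. revert H. unfold Re, Im. simpl. intros H. field. lra. Qed.

Lemma Cmod_le_ReIm (z : C) : Cmod z <= Rabs (Re z) + Rabs (Im z).
Proof.
  apply Rsqr_incr_0_var; [|generalize (Rabs_pos (Re z)) (Rabs_pos (Im z)); lra].
  unfold Rsqr. rewrite Cmod_sq.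
  assert (E1 := Rsqr_abs (Re z)). assert (E2 := Rsqr_abs (Im z)). unfold Rsqr in *.
  generalize (Rabs_pos (Re z)) (Rabs_pos (Im z)); nra.
Qed.

Lemma im_le_Cmod (z : C) : Rabs (Im z) <= Cmod z.
Proof. eapply Rle_trans; [|apply Rmax_Cmod]. apply Rmax_r. Qed.

Lemma Re_le_Cmod (z : C) : Re z <= Cmod z.
Proof. eapply Rle_trans; [apply Rle_abs|apply re_le_Cmod]. Qed.

Lemma Cmod_triangle_inv (a b : C) : Cmod a - Cmod b <= Cmod (a - b).
Proof.
  replace (Cmod a) with (Cmod ((a - b) + b)%C) by (f_equal; ring).
  generalize (Cmod_triangle (a - b) b); lra.
Qed.

Lemma Cmod_sub_sym (a b : C) : Cmod (a - b) = Cmod (b - a).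
Proof. rewrite <- Cmod_opp. f_equal. ring. Qed.

Lemma Cmod_sub_tri (a b c : C) : Cmod (a - c) <= Cmod (a - b) + Cmod (b - c).
Proof. replace (a - c)%C with ((a - b) + (b - c))%C by ring. apply Cmod_triangle. Qed.

(** * Continuity and derivatives of functions of a real or complex variable *)

Section Der.
Context {T : Type} (i : T -> C).

(** Distances are measured through the inclusion [i], so that one set of rules serves both curves
    and functions on the plane. *)
Definition Cont (g : T -> C) (t : T) :=
  forall eps, 0 < eps -> exists del, 0 < del /\
    forall s, Cmod (i s - i t) < del -> Cmod (g s - g t) < eps.

(* Caratheodory's form of the derivative: g(s) - g(t) = phi(s) (i(s) - i(t)) with phi continuous at t; i is the inclusion of R or C into C. *)
Definition Der (g : T -> C) (t : T) (d : C) :=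
  exists phi : T -> C, Cont phi t /\ phi t = d /\
    exists del, 0 < del /\ forall s, Cmod (i s - i t) < del -> (g s - g t = phi s * (i s - i t))%C.

Lemma Cont_ext_loc (g k : T -> C) (t : T) (del : R) :
  0 < del -> (forall s, Cmod (i s - i t) < del -> g s = k s) -> g t = k t ->
  Cont g t -> Cont k t.
Proof.
  intros Hd E Et H eps He. destruct (H eps He) as [d [Hd0 H']].
  exists (Rmin d del). split. apply Rmin_glb_lt; auto.
  intros s Hs. rewrite <- E, <- Et. apply H'.
  eapply Rlt_le_trans; [exact Hs|apply Rmin_l].
  eapply Rlt_le_trans; [exact Hs|apply Rmin_r].
Qed.

Lemma Cont_const (c : C) (t : T) : Cont (fun _ => c) t.
Proof.
  intros eps He. exists 1. split. lra. intros s _. 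
  replace (c - c)%C with (RtoC 0) by ring. rewrite Cmod_0. lra.
Qed.

Lemma Cont_id (t : T) : Cont i t.
Proof. intros eps He. exists eps. split; auto. Qed.

Lemma Cont_plus (g k : T -> C) (t : T) : Cont g t -> Cont k t -> Cont (fun s => g s + k s)%C t.
Proof.
  intros Hg Hk eps He.
  destruct (Hg (eps/2)) as [d1 [P1 H1]]. lra.
  destruct (Hk (eps/2)) as [d2 [P2 H2]]. lra.
  exists (Rmin d1 d2). split. apply Rmin_glb_lt; auto.
  intros s Hs.
  assert (A := H1 s (Rlt_le_trans _ _ _ Hs (Rmin_l _ _))).
  assert (B := H2 s (Rlt_le_trans _ _ _ Hs (Rmin_r _ _))).
  replace (g s + k s - (g t + k t))%C with ((g s - g t) + (k s - k t))%C by ring.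
  eapply Rle_lt_trans; [apply Cmod_triangle|lra].
Qed.

Lemma Cont_mult (g k : T -> C) (t : T) : Cont g t -> Cont k t -> Cont (fun s => g s * k s)%C t.
Proof.
  intros Hg Hk eps He.
  (* The summand eps makes eps / (3 M) at most 1/3, so the product of the two increments is at most
     eps / (3 M) as well. *)
  set (M := Cmod (g t) + Cmod (k t) + 1 + eps).
  assert (HM : 0 < M) by (unfold M; generalize (Cmod_ge_0 (g t)) (Cmod_ge_0 (k t)); lra).
  assert (HE : 0 < eps / (3 * M)) by (apply Rdiv_lt_0_compat; lra).
  assert (Hm : eps / (3 * M) <= 1/3).
  { apply Rmult_le_reg_r with (3 * M). lra. unfold Rdiv at 1. rewrite Rmult_assoc, Rinv_l by lra.
    unfold M. generalize (Cmod_ge_0 (g t)) (Cmod_ge_0 (k t)); lra. }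
  destruct (Hg _ HE) as [d1 [P1 H1]].
  destruct (Hk _ HE) as [d2 [P2 H2]].
  exists (Rmin d1 d2). split. apply Rmin_glb_lt; auto.
  intros s Hs.
  assert (A := H1 s (Rlt_le_trans _ _ _ Hs (Rmin_l _ _))).
  assert (B := H2 s (Rlt_le_trans _ _ _ Hs (Rmin_r _ _))).
  set (e := eps / (3 * M)) in *.
  assert (Ee : e * M = eps / 3) by (unfold e; field; lra).
  replace (g s * k s - g t * k t)%C with ((g s - g t) * (k s - k t) + (g s - g t) * k t + g t * (k s - k t))%C by ring.
  eapply Rle_lt_trans; [apply Cmod_triangle|].
  eapply Rle_lt_trans; [apply Rplus_le_compat_r, Cmod_triangle|].
  rewrite !Cmod_mult.
  generalize (Cmod_ge_0 (g t)) (Cmod_ge_0 (k t)) (Cmod_ge_0 (g s - g t)) (Cmod_ge_0 (k s - k t)).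
  unfold M in Ee. intros.
  assert (Cmod (g s - g t) * Cmod (k s - k t) <= e * 1) by (apply Rmult_le_compat; lra).
  assert (Cmod (g s - g t) * Cmod (k t) <= e * Cmod (k t)) by (apply Rmult_le_compat_r; lra).
  assert (Cmod (g t) * Cmod (k s - k t) <= Cmod (g t) * e) by (apply Rmult_le_compat_l; lra).
  assert (0 < e * eps) by nra. 
  nra.
Qed.

Lemma Cont_opp (g : T -> C) (t : T) : Cont g t -> Cont (fun s => - g s)%C t.
Proof.
  intros H eps He. destruct (H eps He) as [d [P Q]]. exists d. split; auto.
  intros s Hs. replace (- g s - - g t)%C with (- (g s - g t))%C by ring. rewrite Cmod_opp. auto.
Qed.

Lemma Cont_minus (g k : T -> C) (t : T) : Cont g t -> Cont k t -> Cont (fun s => g s - k s)%C t.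
Proof. intros. apply Cont_plus; auto. apply Cont_opp; auto. Qed.

Lemma Cont_inv (g : T -> C) (t : T) : Cont g t -> g t <> 0 -> Cont (fun s => / g s)%C t.
Proof.
  intros H Hn eps He.
  assert (Hp : 0 < Cmod (g t)) by (apply Cmod_gt_0; auto).
  set (m := Cmod (g t)) in *.
  (* The radius m/2 keeps |g s| above m/2; the second radius then bounds |g t - g s| / (|g s| m) by
     eps. *)
  destruct (H (Rmin (m/2) (eps * m * m / 2))) as [d [P Q]].
  { apply Rmin_glb_lt. lra. assert (0 < eps * m) by nra. assert (0 < eps * m * m) by nra. lra. }
  exists d; split; auto. intros s Hs. specialize (Q s Hs).
  assert (Q1 := Rlt_le_trans _ _ _ Q (Rmin_l _ _)).
  assert (Q2 := Rlt_le_trans _ _ _ Q (Rmin_r _ _)).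
  assert (Hgs : m / 2 < Cmod (g s)).
  { generalize (Cmod_triangle_inv (g t) (g s)). rewrite Cmod_sub_sym. fold m. lra. }
  assert (g s <> 0) by (apply Cmod_gt_0; lra).
  replace (/ g s - / g t)%C with ((g t - g s) * / g s * / g t)%C by (field; auto).
  rewrite !Cmod_mult, !Cmod_inv by auto. fold m. rewrite Cmod_sub_sym.
  apply Rmult_lt_reg_r with m; auto. rewrite Rmult_assoc, Rinv_l, Rmult_1_r by lra.
  apply Rmult_lt_reg_r with (Cmod (g s)). lra. rewrite Rmult_assoc, Rinv_l, Rmult_1_r by lra.
  assert (eps * m * (m/2) < eps * m * Cmod (g s)) by (apply Rmult_lt_compat_l; nra). nra.
Qed.

Lemma Cont_div (g k : T -> C) (t : T) : Cont g t -> Cont k t -> k t <> 0 -> Cont (fun s => g s / k s)%C t.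
Proof. intros. apply Cont_mult; auto. apply Cont_inv; auto. Qed.

Lemma Cont_conj (g : T -> C) (t : T) : Cont g t -> Cont (fun s => Cconj (g s)) t.
Proof.
  intros H eps He. destruct (H eps He) as [d [P Q]]. exists d; split; auto.
  intros s Hs. rewrite <- Cminus_conj, Cmod_conj. auto.
Qed.

Lemma Cont_Re (g : T -> C) (t : T) : Cont g t -> Cont (fun s => RtoC (Re (g s))) t.
Proof.
  intros H eps He. destruct (H eps He) as [d [P Q]]. exists d; split; auto.
  intros s Hs. rewrite <- RtoC_minus, Cmod_R.
  replace (Re (g s) - Re (g t)) with (Re (g s - g t)) by (unfold Re, Im; simpl; ring).
  eapply Rle_lt_trans; [apply re_le_Cmod|auto].
Qed.

Lemma Cont_Im (g : T -> C) (t : T) : Cont g t -> Cont (fun s => RtoC (Im (g s))) t.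
Proof.
  intros H eps He. destruct (H eps He) as [d [P Q]]. exists d; split; auto.
  intros s Hs. rewrite <- RtoC_minus, Cmod_R.
  replace (Im (g s) - Im (g t)) with (Im (g s - g t)) by (unfold Re, Im; simpl; ring).
  eapply Rle_lt_trans; [apply im_le_Cmod|auto].
Qed.

Lemma Cont_mod (g : T -> C) (t : T) : Cont g t -> Cont (fun s => RtoC (Cmod (g s))) t.
Proof.
  intros H eps He. destruct (H eps He) as [d [P Q]]. exists d; split; auto.
  intros s Hs. rewrite <- RtoC_minus, Cmod_R.
  eapply Rle_lt_trans; [|apply (Q s Hs)].
  apply Rabs_le. generalize (Cmod_triangle_inv (g s) (g t)) (Cmod_triangle_inv (g t) (g s)).
  rewrite (Cmod_sub_sym (g t)). lra.
Qed.

Lemma Cont_nz (g : T -> C) (t : T) : Cont g t -> g t <> 0 ->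
  exists del, 0 < del /\ forall s, Cmod (i s - i t) < del -> g s <> 0.
Proof.
  intros H Hn. destruct (H (Cmod (g t))) as [d [P Q]]. apply Cmod_gt_0; auto.
  exists d; split; auto. intros s Hs E. specialize (Q s Hs). rewrite E in Q.
  rewrite Cmod_sub_sym in Q. replace (g t - 0)%C with (g t) in Q by ring. lra.
Qed.

Lemma Der_Cont (g : T -> C) (t : T) (d : C) : Der g t d -> Cont g t.
Proof.
  intros [phi [Hc [E [del [P Q]]]]].
  apply Cont_ext_loc with (g := fun s => (g t + phi s * (i s - i t))%C) (del := del); auto.
  - intros s Hs. rewrite <- Q by auto. ring.
  - ring.
  - apply Cont_plus. apply Cont_const. apply Cont_mult; auto. apply Cont_minus. apply Cont_id. apply Cont_const.
Qed.

Lemma Der_ext_loc (g k : T -> C) (t : T) (d : C) (del : R) :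
  0 < del -> (forall s, Cmod (i s - i t) < del -> g s = k s) ->
  Der g t d -> Der k t d.
Proof.
  intros Hd E [phi [Hc [Ep [e [P Q]]]]]. exists phi. split; auto. split; auto.
  exists (Rmin e del). split. apply Rmin_glb_lt; auto.
  intros s Hs. rewrite <- !E.
  apply Q. eapply Rlt_le_trans; [exact Hs|apply Rmin_l].
  replace (i t - i t)%C with (RtoC 0) by ring. rewrite Cmod_0; auto.
  eapply Rlt_le_trans; [exact Hs|apply Rmin_r].
Qed.

Lemma Der_ext (g k : T -> C) (t : T) (d : C) :
  (forall s, g s = k s) -> Der g t d -> Der k t d.
Proof. intros E. apply (Der_ext_loc _ _ _ _ 1); auto; lra. Qed.

Lemma Der_const (c : C) (t : T) : Der (fun _ => c) t 0.
Proof.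
  exists (fun _ => RtoC 0). split. apply Cont_const. split; auto.
  exists 1. split. lra. intros; ring.
Qed.

Lemma Der_id (t : T) : Der i t 1.
Proof.
  exists (fun _ => RtoC 1). split. apply Cont_const. split; auto.
  exists 1. split. lra. intros; ring.
Qed.

Lemma Der_plus (g k : T -> C) (t : T) (d e : C) : Der g t d -> Der k t e -> Der (fun s => g s + k s)%C t (d + e)%C.
Proof.
  intros [p [Hc [Ep [d1 [P Q]]]]] [q [Hc' [Ep' [d2 [P' Q']]]]].
  exists (fun s => p s + q s)%C. split. apply Cont_plus; auto. split. congruence.
  exists (Rmin d1 d2). split. apply Rmin_glb_lt; auto. intros s Hs.
  transitivity ((g s - g t) + (k s - k t))%C. ring.
  rewrite Q, Q'. ring.
  eapply Rlt_le_trans; [exact Hs|apply Rmin_r].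
  eapply Rlt_le_trans; [exact Hs|apply Rmin_l].
Qed.

Lemma Der_mult (g k : T -> C) (t : T) (d e : C) :
  Der g t d -> Der k t e -> Der (fun s => g s * k s)%C t (d * k t + g t * e)%C.
Proof.
  intros Hg Hk. assert (Cg := Der_Cont _ _ _ Hg).
  destruct Hg as [p [Hc [Ep [d1 [P Q]]]]], Hk as [q [Hc' [Ep' [d2 [P' Q']]]]].
  exists (fun s => p s * k t + g s * q s)%C. split.
  apply Cont_plus. apply Cont_mult; auto. apply Cont_const. apply Cont_mult; auto.
  split. congruence.
  exists (Rmin d1 d2). split. apply Rmin_glb_lt; auto. intros s Hs.
  transitivity ((g s - g t) * k t + g s * (k s - k t))%C. ring.
  rewrite Q, Q'. ring.
  eapply Rlt_le_trans; [exact Hs|apply Rmin_r].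
  eapply Rlt_le_trans; [exact Hs|apply Rmin_l].
Qed.

Lemma Der_eq (g : T -> C) (t : T) (d e : C) : Der g t d -> d = e -> Der g t e.
Proof. intros; subst; auto. Qed.

Lemma Der_scal (c : C) (g : T -> C) (t : T) (d : C) : Der g t d -> Der (fun s => c * g s)%C t (c * d)%C.
Proof. intros H. eapply Der_eq. apply Der_mult. apply Der_const. exact H. cbv beta. ring. Qed.

Lemma Der_opp (g : T -> C) (t : T) (d : C) : Der g t d -> Der (fun s => - g s)%C t (- d)%C.
Proof.
  intros H. apply Der_ext with (g := fun s => ((-1) * g s)%C). intros; ring.
  eapply Der_eq. apply Der_scal; eauto. ring.
Qed.

Lemma Der_minus (g k : T -> C) (t : T) (d e : C) : Der g t d -> Der k t e -> Der (fun s => g s - k s)%C t (d - e)%C.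
Proof. intros. apply Der_plus; auto. apply Der_opp; auto. Qed.

Lemma Der_inv (g : T -> C) (t : T) (d : C) : Der g t d -> g t <> 0 -> Der (fun s => / g s)%C t (- d / (g t * g t))%C.
Proof.
  intros Hg Hn. assert (Cg := Der_Cont _ _ _ Hg).
  destruct (Cont_nz _ _ Cg Hn) as [e [Pe Qe]].
  destruct Hg as [p [Hc [Ep [d1 [P Q]]]]].
  exists (fun s => - p s / (g s * g t))%C. split.
  apply Cont_div. apply Cont_opp; auto. apply Cont_mult; auto. apply Cont_const. apply Cmult_neq_0; auto.
  split. congruence.
  exists (Rmin d1 e). split. apply Rmin_glb_lt; auto. intros s Hs.
  assert (g s <> 0). { apply Qe. eapply Rlt_le_trans; [exact Hs|apply Rmin_r]. }
  transitivity (- (g s - g t) / (g s * g t))%C. field; auto.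
  rewrite Q. field; auto.
  eapply Rlt_le_trans; [exact Hs|apply Rmin_l].
Qed.

Lemma Der_div (g k : T -> C) (t : T) (d e : C) : Der g t d -> Der k t e -> k t <> 0 ->
  Der (fun s => g s / k s)%C t ((d * k t - g t * e) / (k t * k t))%C.
Proof.
  intros Hg Hk Hn. eapply Der_eq. apply Der_mult. exact Hg. apply Der_inv; eauto.
  cbv beta; field; auto.
Qed.

End Der.

Notation CDer := (Der (fun z : C => z)).
Notation RDer := (Der RtoC).
Notation CCont := (Cont (fun z : C => z)).
Notation RCont := (Cont RtoC).

Section Comp.
Context {T : Type} (i : T -> C).

Lemma Cont_comp (f : C -> C) (g : T -> C) (t : T) : CCont f (g t) -> Cont i g t -> Cont i (fun s => f (g s)) t.
Proof.
  intros Hf Hg eps He. destruct (Hf eps He) as [d [P Q]]. destruct (Hg d P) as [e [P' Q']].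
  exists e; split; auto.
Qed.

Lemma Der_comp (f : C -> C) (g : T -> C) (t : T) (d e : C) :
  CDer f (g t) d -> Der i g t e -> Der i (fun s => f (g s)) t (d * e)%C.
Proof.
  intros Hf Hg. assert (Cg := Der_Cont _ _ _ _ Hg).
  destruct Hg as [p [Hc [Ep [d1 [P Q]]]]], Hf as [q [Hc' [Ep' [d2 [P' Q']]]]].
  destruct (Cg d2 P') as [d3 [P3 Q3]].
  exists (fun s => q (g s) * p s)%C. split.
  apply Cont_mult; auto. apply Cont_comp; auto. split. congruence.
  exists (Rmin d1 d3). split. apply Rmin_glb_lt; auto. intros s Hs.
  rewrite Q'. rewrite Q. ring.
  eapply Rlt_le_trans; [exact Hs|apply Rmin_l].
  apply Q3. eapply Rlt_le_trans; [exact Hs|apply Rmin_r].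
Qed.
End Comp.

Lemma Cmod_RR (s t : R) : Cmod (RtoC s - RtoC t) = Rabs (s - t).
Proof. rewrite <- RtoC_minus. apply Cmod_R. Qed.

Lemma Der_dom {T} (i : T -> C) (g : T -> C) (t : T) (d : C) : Der i g t d ->
  forall eps, 0 < eps -> exists del, 0 < del /\
    forall s, Cmod (i s - i t) < del -> Cmod (g s - g t - d * (i s - i t)) <= eps * Cmod (i s - i t).
Proof.
  intros [p [Hc [Ep [d1 [P Q]]]]] eps He.
  destruct (Hc eps He) as [d2 [P2 Q2]].
  exists (Rmin d1 d2). split. apply Rmin_glb_lt; auto. intros s Hs.
  rewrite Q, <- Ep by (eapply Rlt_le_trans; [exact Hs|apply Rmin_l]).
  replace (p s * (i s - i t) - p t * (i s - i t))%C with ((p s - p t) * (i s - i t))%C by ring.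
  rewrite Cmod_mult. apply Rmult_le_compat_r. apply Cmod_ge_0. left. apply Q2.
  eapply Rlt_le_trans; [exact Hs|apply Rmin_r].
Qed.

(** Converse of [Der_dom] on the plane: the difference quotient, completed by d at the point itself,
    serves as Caratheodory's factor. *)
Lemma dom_CDer (g : C -> C) (t : C) (d : C) :
  (forall eps, 0 < eps -> exists del, 0 < del /\
    forall s, Cmod (s - t) < del -> Cmod (g s - g t - d * (s - t)) <= eps * Cmod (s - t)) -> CDer g t d.
Proof.
  intros H.
  exists (fun s => if Ceq_dec s t then d else ((g s - g t) / (s - t))%C). split; [|split].
  - intros eps He. destruct (H (eps/2)) as [del [P Q]]. lra. exists del; split; auto.
    intros s Hs. destruct (Ceq_dec t t) as [_|]; [|congruence].
    destruct (Ceq_dec s t) as [E|E].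
    replace (d - d)%C with (RtoC 0) by ring. rewrite Cmod_0; auto.
    assert (Hn : (s - t)%C <> 0) by (intros E'; apply E; apply Ceq_minus; auto).
    assert (0 < Cmod (s - t)) by (apply Cmod_gt_0; auto).
    replace ((g s - g t) / (s - t) - d)%C with ((g s - g t - d * (s - t)) / (s - t))%C by (field; auto).
    rewrite Cmod_div by auto. apply Rmult_lt_reg_r with (Cmod (s - t)); auto.
    unfold Rdiv. rewrite Rmult_assoc, Rinv_l by lra. rewrite Rmult_1_r.
    eapply Rle_lt_trans. apply Q; auto. nra.
  - destruct (Ceq_dec t t); congruence.
  - exists 1. split. lra. intros s _. destruct (Ceq_dec s t). subst; ring.
    field. intros E'; apply n; apply Ceq_minus; auto.
Qed.

(** A quadratic remainder survives integration over a parameter and pointwise limits. It is the form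
    used for Cauchy-type integrals, for the class [log_cbf] and at a removable singularity. *)
Lemma quad_CDer (g : C -> C) (t d : C) (r K : R) : 0 < r ->
  (forall h, Cmod h < r -> Cmod (g (t + h)%C - g t - d * h) <= K * (Cmod h * Cmod h)) -> CDer g t d.
Proof.
  intros Hr H. apply dom_CDer. intros eps He.
  assert (HK : 0 < Rabs K + 1) by (generalize (Rabs_pos K); lra).
  exists (Rmin r (eps / (Rabs K + 1))). split. apply Rmin_glb_lt; auto. apply Rdiv_lt_0_compat; auto.
  intros s Hs. specialize (H (s - t)%C (Rlt_le_trans _ _ _ Hs (Rmin_l _ _))).
  assert (Hs2 := Rlt_le_trans _ _ _ Hs (Rmin_r _ _)).
  replace (t + (s - t))%C with s in H by ring.
  eapply Rle_trans. apply H.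
  generalize (Cmod_ge_0 (s - t)) (Rle_abs K) (Rabs_pos K). intros.
  assert (Cmod (s - t) * (Rabs K + 1) <= eps).
  { apply Rmult_le_reg_r with (/ (Rabs K + 1)). apply Rinv_0_lt_compat; auto.
    rewrite Rmult_assoc, Rinv_r by lra. unfold Rdiv in Hs2. lra. }
  rewrite <- Rmult_assoc. apply Rmult_le_compat_r; auto. nra.
Qed.

Lemma CDer_is_derive (f : C -> C) (z d : C) :
  CDer f z d <-> @is_derive C_AbsRing C_NormedModule f z d.
Proof.
  split.
  - intros H. split. apply is_linear_scal_l.
    intros x Hx. 
    assert (E := is_filter_lim_locally_unique (V := AbsRing_NormedModule C_AbsRing) z x Hx). subst x.
    intros eps. destruct (Der_dom _ _ _ _ H eps (cond_pos eps)) as [del [P Q]].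
    exists (mkposreal del P). intros y Hy.
    assert (Hy' : Cmod (y - z) < del) by apply Hy.
    specialize (Q y Hy'). replace (d * (y - z))%C with ((y - z) * d)%C in Q by ring. exact Q.
  - intros [_ H]. apply dom_CDer. intros eps He.
    destruct (H z (fun P HP => HP) (mkposreal eps He)) as [del Q].
    exists del. split. apply cond_pos. intros s Hs.
    specialize (Q s Hs). replace (d * (s - z))%C with ((s - z) * d)%C by ring. exact Q.
Qed.

Definition hol (D : C -> Prop) (f : C -> C) := forall z, D z -> exists d, CDer f z d.

Lemma hol_holomorphic (D : C -> Prop) (f : C -> C) : hol D f <-> holomorphic_on D f.
Proof.
  split; intros H z Hz; destruct (H z Hz) as [d Hd]; exists d; apply CDer_is_derive; auto.
Qed.

Lemma RDer_Re (g : R -> C) (t : R) (d : C) : RDer g t d -> is_derive (fun s => Re (g s)) t (Re d).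
Proof.
  intros H. split. apply is_linear_scal_l.
  intros x Hx.
  assert (E := is_filter_lim_locally_unique (V := AbsRing_NormedModule R_AbsRing) t x Hx). subst x.
  intros eps. destruct (Der_dom _ _ _ _ H eps (cond_pos eps)) as [del [P Q]].
  exists (mkposreal del P). intros y Hy. change (Rabs (y - t) < del) in Hy.
  rewrite <- Cmod_RR in Hy. specialize (Q y Hy). rewrite Cmod_RR in Q.
  eapply Rle_trans; [|apply Q].
  eapply Rle_trans; [|apply re_le_Cmod].
  right. change (Rabs (Re (g y) - Re (g t) - (y - t) * Re d) = Rabs (Re (g y - g t - d * (RtoC y - RtoC t)))).
  f_equal. unfold Re, Im; simpl; ring.
Qed.

Lemma RDer_Im (g : R -> C) (t : R) (d : C) : RDer g t d -> is_derive (fun s => Im (g s)) t (Im d).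
Proof.
  intros H. assert (H' := RDer_Re _ _ _ (Der_scal _ (- Ci)%C _ _ _ H)).
  replace (Re (- Ci * d)%C) with (Im d) in H' by (unfold Re, Im; simpl; ring).
  eapply is_derive_ext; [|exact H']. intros s. unfold Re, Im; simpl; ring.
Qed.

Lemma RDer_ReIm (g : R -> C) (t : R) (d : C) :
  is_derive (fun s => Re (g s)) t (Re d) -> is_derive (fun s => Im (g s)) t (Im d) -> RDer g t d.
Proof.
  intros H1 H2.
  assert (D : forall u l, is_derive u t l -> RDer (fun s => RtoC (u s)) t (RtoC l)).
  { intros u l [_ H]. 
    exists (fun s => if Req_EM_T s t then RtoC l else RtoC ((u s - u t) / (s - t))). split; [|split].
    - intros eps He. destruct (H t (fun P HP => HP) (mkposreal (eps/2) ltac:(lra))) as [del Q].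
      exists del. split. apply cond_pos. intros s Hs. destruct (Req_EM_T t t) as [_|]; [|congruence].
      destruct (Req_EM_T s t). replace (RtoC l - RtoC l)%C with (RtoC 0) by ring. rewrite Cmod_0; auto.
      rewrite Cmod_RR in *. specialize (Q s Hs). 
      change (Rabs (u s - u t - (s - t) * l) <= eps / 2 * Rabs (s - t)) in Q.
      assert (0 < Rabs (s - t)) by (apply Rabs_pos_lt; lra).
      apply Rmult_lt_reg_r with (Rabs (s - t)); auto. rewrite <- Rabs_mult.
      replace (((u s - u t) / (s - t) - l) * (s - t)) with (u s - u t - (s - t) * l) by (field; lra). nra.
    - destruct (Req_EM_T t t); congruence.
    - exists 1. split. lra. intros s _. destruct (Req_EM_T s t). subst; ring.
      rewrite <- !RtoC_minus, <- RtoC_mult. f_equal. field. lra. }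
  apply Der_ext with (g := fun s => (RtoC (Re (g s)) + Ci * RtoC (Im (g s)))%C).
  intros s. apply Ceq; unfold Re, Im; simpl; ring.
  eapply Der_eq. apply Der_plus. apply D, H1. apply Der_scal. apply D, H2.
  apply Ceq; unfold Re, Im; simpl; ring.
Qed.

Lemma RCont_Re_continuous (g : R -> C) (t : R) : RCont g t -> continuous (fun s => Re (g s)) t.
Proof.
  intros H P [eps HP]. destruct (H eps (cond_pos eps)) as [del [Pd Q]].
  exists (mkposreal del Pd). intros s Hs. apply HP. change (Rabs (s - t) < del) in Hs.
  rewrite <- Cmod_RR in Hs. specialize (Q s Hs).
  change (Rabs (Re (g s) - Re (g t)) < eps). replace (Re (g s) - Re (g t)) with (Re (g s - g t)) by (unfold Re, Im; simpl; ring).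
  eapply Rle_lt_trans; [apply re_le_Cmod|auto].
Qed.

Lemma RCont_Im_continuous (g : R -> C) (t : R) : RCont g t -> continuous (fun s => Im (g s)) t.
Proof.
  intros H. apply continuous_ext with (fun s => Re (- Ci * g s)). intros; unfold Re, Im; simpl; ring.
  apply (RCont_Re_continuous (fun s => - Ci * g s)%C). apply Cont_mult; auto. apply Cont_const.
Qed.

Lemma continuous_RCont (u : R -> R) (t : R) : continuous u t -> RCont (fun s => RtoC (u s)) t.
Proof.
  intros H eps He. destruct (H (ball (u t) (mkposreal eps He))) as [del Q]. apply locally_ball.
  exists del. split. apply cond_pos. intros s Hs. rewrite Cmod_RR in *. apply Q. exact Hs.
Qed.

Lemma RDer_real (u : R -> R) (t l : R) : is_derive u t l -> RDer (fun s => RtoC (u s)) t (RtoC l).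
Proof.
  intros H. apply RDer_ReIm.
  - apply is_derive_ext with u. reflexivity. exact H.
  - apply is_derive_ext with (fun _ => 0). reflexivity. apply (is_derive_const (V := R_NormedModule)).
Qed.

(** * Integrals of complex-valued functions over a real interval *)

Definition CI (g : R -> C) (a b : R) : C := (RInt (fun t => Re (g t)) a b, RInt (fun t => Im (g t)) a b).

Lemma CI_Re g a b : Re (CI g a b) = RInt (fun t => Re (g t)) a b.
Proof. reflexivity. Qed.

Lemma CI_Im g a b : Im (CI g a b) = RInt (fun t => Im (g t)) a b.
Proof. reflexivity. Qed.

(** Continuity is two-sided even at the end points, which avoids a notion of continuity relative to
    the interval. *)
Definition contI (g : R -> C) (a b : R) := forall t, Rmin a b <= t <= Rmax a b -> RCont g t.

Lemma contI_ex_Re g a b : contI g a b -> ex_RInt (fun t => Re (g t)) a b.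
Proof. intros H. apply (ex_RInt_continuous (V := R_CompleteNormedModule)). intros t Ht. apply RCont_Re_continuous; auto. Qed.

Lemma contI_ex_Im g a b : contI g a b -> ex_RInt (fun t => Im (g t)) a b.
Proof. intros H. apply (ex_RInt_continuous (V := R_CompleteNormedModule)). intros t Ht. apply RCont_Im_continuous; auto. Qed.

Lemma contI_le g a b : a <= b -> (forall t, a <= t <= b -> RCont g t) -> contI g a b.
Proof. intros H K t. rewrite Rmin_left, Rmax_right by auto. auto. Qed.

Lemma CI_ext g k a b : (forall t, Rmin a b < t < Rmax a b -> g t = k t) -> CI g a b = CI k a b.
Proof. intros H. apply Ceq; simpl; apply RInt_ext; intros t Ht; rewrite H; auto. Qed.

Lemma CI_plus g k a b : contI g a b -> contI k a b -> CI (fun t => g t + k t)%C a b = (CI g a b + CI k a b)%C.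
Proof.
  intros H K. apply Ceq; simpl.
  - etransitivity; [|apply (RInt_plus (V := R_CompleteNormedModule)); apply contI_ex_Re; auto]. apply RInt_ext; intros; reflexivity.
  - etransitivity; [|apply (RInt_plus (V := R_CompleteNormedModule)); apply contI_ex_Im; auto]. apply RInt_ext; intros; reflexivity.
Qed.

Lemma CI_scal c g a b : contI g a b -> CI (fun t => c * g t)%C a b = (c * CI g a b)%C.
Proof.
  intros H. assert (E1 := contI_ex_Re _ _ _ H). assert (E2 := contI_ex_Im _ _ _ H).
  apply Ceq.
  - apply is_RInt_unique. unfold CI, Cmult; simpl.
    apply (is_RInt_minus (V := R_NormedModule)); apply (is_RInt_scal (V := R_NormedModule)); apply (RInt_correct (V := R_CompleteNormedModule)); auto.
  - apply is_RInt_unique. unfold CI, Cmult; simpl.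
    apply (is_RInt_ext (V := R_NormedModule)) with (fun t => plus (scal (Re c) (Im (g t))) (scal (Im c) (Re (g t)))).
    intros t _. unfold plus, scal, Re, Im; simpl. unfold mult; simpl. ring.
    apply (is_RInt_plus (V := R_NormedModule)); apply (is_RInt_scal (V := R_NormedModule)); apply (RInt_correct (V := R_CompleteNormedModule)); auto.
Qed.

Lemma contI_scal c g a b : contI g a b -> contI (fun t => c * g t)%C a b.
Proof. intros H t Ht. apply Cont_mult; auto. apply Cont_const. Qed.

Lemma CI_minus g k a b : contI g a b -> contI k a b -> CI (fun t => g t - k t)%C a b = (CI g a b - CI k a b)%C.
Proof.
  intros H K. rewrite (CI_ext _ (fun t => g t + (-1) * k t)%C) by (intros; ring).
  rewrite CI_plus, CI_scal; auto. ring. apply contI_scal; auto.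
Qed.

Lemma CI_const c a b : CI (fun _ => c) a b = (RtoC (b - a) * c)%C.
Proof. apply Ceq; simpl; rewrite RInt_const; unfold scal, Re, Im; simpl; unfold mult; simpl; ring. Qed.

Lemma CI_FTC G g a b : (forall t, Rmin a b <= t <= Rmax a b -> RDer G t (g t)) -> contI g a b -> CI g a b = (G b - G a)%C.
Proof.
  intros H K. apply Ceq; simpl; apply is_RInt_unique.
  - apply (is_RInt_derive (V := R_CompleteNormedModule) (fun t => Re (G t))); intros t Ht.
    apply RDer_Re; auto. apply RCont_Re_continuous; auto.
  - apply (is_RInt_derive (V := R_CompleteNormedModule) (fun t => Im (G t))); intros t Ht.
    apply RDer_Im; auto. apply RCont_Im_continuous; auto.
Qed.

Lemma contI_ex_mod g a b : contI g a b -> ex_RInt (fun t => Cmod (g t)) a b.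
Proof.
  intros H. apply (ex_RInt_continuous (V := R_CompleteNormedModule)). intros t Ht.
  apply continuous_ext with (fun t => Re (RtoC (Cmod (g t)))). reflexivity.
  apply (RCont_Re_continuous (fun t => RtoC (Cmod (g t)))). apply Cont_mod; auto.
Qed.

Lemma CI_mod g a b : a <= b -> contI g a b -> Cmod (CI g a b) <= RInt (fun t => Cmod (g t)) a b.
Proof.
  intros Hab H. set (I := CI g a b).
  destruct (Req_dec (Cmod I) 0) as [E|E].
  - rewrite E. apply RInt_ge_0; auto. apply contI_ex_mod; auto. intros; apply Cmod_ge_0.
  - assert (HI : I <> 0) by (intros E'; apply E; rewrite E'; apply Cmod_0).
    (* rotate so that the integral becomes a positive real *)
    set (u := (Cconj I / RtoC (Cmod I))%C).
    assert (HM : RtoC (Cmod I) <> 0) by (intros E'; apply E; apply RtoC_inj; auto).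
    assert (Eu : (u * I = RtoC (Cmod I))%C).
    { unfold u. replace (Cconj I / RtoC (Cmod I) * I)%C with ((I * Cconj I) / RtoC (Cmod I))%C by (field; auto).
      rewrite <- Cmod2_conj. replace (RtoC (Cmod I ^ 2)) with (RtoC (Cmod I) * RtoC (Cmod I))%C by (rewrite <- RtoC_mult; f_equal; ring). field; auto. }
    assert (Mu : Cmod u = 1).
    { unfold u. rewrite Cmod_div by auto. rewrite Cmod_conj, Cmod_R, (Rabs_pos_eq (Cmod I)) by apply Cmod_ge_0. field; auto. }
    replace (Cmod I) with (Re (u * I)%C) by (rewrite Eu; reflexivity).
    unfold I. rewrite <- CI_scal by auto. rewrite CI_Re.
    apply RInt_le; auto. apply (contI_ex_Re (fun t => u * g t)%C), contI_scal; auto. apply contI_ex_mod; auto.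
    intros t Ht. eapply Rle_trans; [apply Re_le_Cmod|]. rewrite Cmod_mult, Mu. lra.
Qed.

Lemma CI_bound g a b M : a <= b -> contI g a b -> (forall t, a <= t <= b -> Cmod (g t) <= M) -> Cmod (CI g a b) <= M * (b - a).
Proof.
  intros Hab H K. eapply Rle_trans. apply CI_mod; auto.
  replace (M * (b - a)) with (RInt (fun _ => M) a b) by (rewrite RInt_const; unfold scal; simpl; unfold mult; simpl; ring).
  apply RInt_le; auto. apply contI_ex_mod; auto. apply ex_RInt_const. intros; apply K; lra.
Qed.

Lemma contI_sub g a b c d : contI g a b -> Rmin a b <= c <= Rmax a b -> Rmin a b <= d <= Rmax a b -> contI g c d.
Proof. intros H Hc Hd t Ht. apply H. revert Hc Hd Ht. unfold Rmin, Rmax. repeat destruct Rle_dec; lra. Qed.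

Lemma CI_Chasles g a b c : contI g a b -> contI g b c -> (CI g a b + CI g b c = CI g a c)%C.
Proof.
  intros H K. apply Ceq; simpl; apply (RInt_Chasles (V := R_CompleteNormedModule)).
  1,2: apply contI_ex_Re; auto. all: apply contI_ex_Im; auto.
Qed.

Lemma CI_swap g a b : contI g a b -> CI g b a = (- CI g a b)%C.
Proof.
  intros H. apply Ceq.
  - symmetry. apply (opp_RInt_swap (V := R_CompleteNormedModule)). apply contI_ex_Re; auto.
  - symmetry. apply (opp_RInt_swap (V := R_CompleteNormedModule)). apply contI_ex_Im; auto.
Qed.

Lemma CI_lin g u v a b : contI g (u * a + v) (u * b + v) ->
  CI (fun t => RtoC u * g (u * t + v)%R)%C a b = CI g (u * a + v) (u * b + v).
Proof.
  intros H. apply Ceq; simpl.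
  - rewrite <- (RInt_comp_lin (V := R_CompleteNormedModule) (fun t => Re (g t))) by (apply contI_ex_Re; auto).
    apply RInt_ext. intros. unfold scal; simpl; unfold mult; simpl. unfold Re; simpl; ring.
  - rewrite <- (RInt_comp_lin (V := R_CompleteNormedModule) (fun t => Im (g t))) by (apply contI_ex_Im; auto).
    apply RInt_ext. intros. unfold scal; simpl; unfold mult; simpl. unfold Im; simpl; ring.
Qed.

(** * Goursat's theorem and primitives on convex domains *)

Definition convex (D : C -> Prop) := forall a b t, D a -> D b -> 0 <= t <= 1 -> D (a + RtoC t * (b - a))%C.
Definition open_set (D : C -> Prop) := forall z, D z -> exists r, 0 < r /\ forall w, Cmod (w - z) < r -> D w.

Definition seg (a b : C) (t : R) : C := (a + RtoC t * (b - a))%C.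

Lemma RDer_seg a b t : RDer (seg a b) t (b - a)%C.
Proof.
  eapply Der_eq. apply Der_plus. apply Der_const. apply Der_mult. apply Der_id. apply Der_const.
  cbv beta. ring.
Qed.

Lemma hol_Cont D f z : hol D f -> D z -> CCont f z.
Proof. intros H Hz. destruct (H z Hz) as [d Hd]. eapply Der_Cont; eauto. Qed.

Definition contD (D : C -> Prop) (f : C -> C) := forall z, D z -> CCont f z.

(** The contour integral of f dz along the segment from a to b. *)
Definition SI (f : C -> C) (a b : C) : C := ((b - a) * CI (fun t => f (seg a b t)) 0 1)%C.

Section Conv.
Variable D : C -> Prop.
Hypothesis Dc : convex D.

Lemma cont_seg f a b : contD D f -> D a -> D b -> contI (fun t => f (seg a b t)) 0 1.
Proof.
  intros H Ha Hb. apply contI_le. lra. intros t Ht.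
  apply Cont_comp. apply H. apply Dc; auto. apply (Der_Cont _ _ _ _ (RDer_seg a b t)).
Qed.

Lemma SI_swap f a b : contD D f -> D a -> D b -> SI f b a = (- SI f a b)%C.
Proof.
  intros H Ha Hb. unfold SI.
  assert (E : CI (fun t => f (seg b a t)) 0 1 = CI (fun t => f (seg a b t)) 0 1); [|rewrite E; ring].
  assert (L := CI_lin (fun t => f (seg a b t)) (-1) 1 0 1).
  replace (-1 * 0 + 1) with 1 in L by ring. replace (-1 * 1 + 1) with 0 in L by ring.
  rewrite (CI_swap _ 0 1) in L by (apply cont_seg; auto).
  assert (K : contI (fun t => f (seg a b t)) 1 0) by (intros t Ht; rewrite Rmin_comm, Rmax_comm in Ht; apply (cont_seg f a b); auto).
  specialize (L K).
  assert (E : CI (fun t : R => (RtoC (-1) * f (seg a b (-1 * t + 1)))%C) 0 1 = (RtoC (-1) * CI (fun t => f (seg b a t)) 0 1)%C).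
  { rewrite <- CI_scal by (apply cont_seg; auto). apply CI_ext. intros t _. do 2 f_equal.
    unfold seg. rewrite RtoC_plus, RtoC_mult. ring. }
  rewrite E in L. replace (CI (fun t => f (seg a b t)) 0 1) with (- - CI (fun t => f (seg a b t)) 0 1)%C by ring.
  rewrite <- L. ring.
Qed.

Lemma SI_mid f a b : contD D f -> D a -> D b -> SI f a b = (SI f a ((a + b) / 2) + SI f ((a + b) / 2) b)%C.
Proof.
  intros H Ha Hb. set (m := ((a + b) / 2)%C).
  assert (E2 : RtoC 2 <> 0) by (intros E; apply RtoC_inj in E; lra).
  assert (Em : m = seg a b (1/2)).
  { unfold m, seg. rewrite RtoC_div by lra. field; auto. }
  assert (Hm : D m) by (rewrite Em; apply Dc; auto; lra).
  assert (K := cont_seg f a b H Ha Hb).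
  unfold SI.
  assert (L1 := CI_lin (fun t => f (seg a b t)) (1/2) 0 0 1).
  assert (L2 := CI_lin (fun t => f (seg a b t)) (1/2) (1/2) 0 1).
  replace (1/2*0+0) with 0 in L1 by ring. replace (1/2*1+0) with (1/2) in L1 by field.
  replace (1/2*0+1/2) with (1/2) in L2 by ring. replace (1/2*1+1/2) with 1 in L2 by field.
  assert (K1 : contI (fun t => f (seg a b t)) 0 (1/2)).
  { eapply contI_sub; [exact K| |]; rewrite Rmin_left, Rmax_right; lra. }
  assert (K2 : contI (fun t => f (seg a b t)) (1/2) 1).
  { eapply contI_sub; [exact K| |]; rewrite Rmin_left, Rmax_right; lra. }
  specialize (L1 K1). specialize (L2 K2).
  rewrite <- (CI_Chasles _ _ _ _ K1 K2), <- L1, <- L2.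
  rewrite (CI_ext (fun t => (RtoC (1/2) * f (seg a b (1/2 * t + 0)))%C) (fun t => (RtoC (1/2) * f (seg a m t))%C)).
  rewrite (CI_ext (fun t => (RtoC (1/2) * f (seg a b (1/2 * t + 1/2)))%C) (fun t => (RtoC (1/2) * f (seg m b t))%C)).
  rewrite !CI_scal by (apply cont_seg; auto). unfold m. rewrite RtoC_div by lra. field; auto.
  intros t _. do 2 f_equal. unfold m, seg. rewrite RtoC_plus, RtoC_mult, RtoC_div by lra. field; auto.
  intros t _. do 2 f_equal. unfold m, seg. rewrite RtoC_plus, RtoC_mult, RtoC_div by lra. field; auto.
Qed.

Definition TI f a b c : C := (SI f a b + SI f b c + SI f c a)%C.

Lemma SI_bound f a b M : contD D f -> D a -> D b -> (forall t, 0 <= t <= 1 -> Cmod (f (seg a b t)) <= M) ->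
  Cmod (SI f a b) <= Cmod (b - a) * M.
Proof.
  intros H Ha Hb K. unfold SI. rewrite Cmod_mult. apply Rmult_le_compat_l. apply Cmod_ge_0.
  replace M with (M * (1 - 0)) by ring. apply CI_bound; auto. lra. apply cont_seg; auto.
Qed.

Lemma SI_plus f g a b : contD D f -> contD D g -> D a -> D b -> SI (fun z => f z + g z)%C a b = (SI f a b + SI g a b)%C.
Proof.
  intros. unfold SI. rewrite CI_plus by (apply cont_seg; auto). ring.
Qed.

Lemma SI_FTC F f a b : contD D f -> (forall z, D z -> CDer F z (f z)) -> D a -> D b -> SI f a b = (F b - F a)%C.
Proof.
  intros H K Ha Hb. unfold SI. rewrite <- CI_scal by (apply cont_seg; auto).
  rewrite (CI_FTC (fun t => F (seg a b t))).
  - unfold seg. f_equal; [f_equal; ring| f_equal; f_equal; ring].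
  - intros t Ht. rewrite Rmin_left, Rmax_right in Ht by lra.
    eapply Der_eq. apply Der_comp. apply K. apply Dc; auto. apply RDer_seg. ring.
  - apply contI_scal. apply cont_seg; auto.
Qed.

End Conv.

(** The sequences u n - 2 K / 2^n and u n + 2 K / 2^n are monotone in opposite directions and never
    cross, so the supremum of the lower one is the limit, with an explicit rate. *)
Lemma geom_limit (u : nat -> R) (K : R) : (forall n, Rabs (u (S n) - u n) <= K / 2 ^ n) ->
  exists l, forall n, Rabs (l - u n) <= 2 * K / 2 ^ n.
Proof.
  intros H.
  assert (P : forall n, 0 < 2 ^ n) by (intros; apply pow_lt; lra).
  assert (E : forall n, 2 * K / 2 ^ (S n) = K / 2 ^ n) by (intros n; simpl; field; generalize (P n); lra).
  assert (E' : forall n, 2 * K / 2 ^ n = K / 2 ^ n + K / 2 ^ n) by (intros n; field; generalize (P n); lra).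
  assert (K0 : forall n, 0 <= K / 2 ^ n) by (intros n; eapply Rle_trans; [apply Rabs_pos|apply H]).
  assert (Vup : forall n m, (n <= m)%nat -> u n - 2 * K / 2 ^ n <= u m - 2 * K / 2 ^ m).
  { intros n m Hnm. induction Hnm. lra. eapply Rle_trans; [exact IHHnm|].
    rewrite E, E'. generalize (Rle_trans _ _ _ (Rle_abs _) (H m)).
    assert (Q := H m). apply Rabs_le_between in Q. lra. }
  assert (Wdn : forall n m, (n <= m)%nat -> u m + 2 * K / 2 ^ m <= u n + 2 * K / 2 ^ n).
  { intros n m Hnm. induction Hnm. lra. eapply Rle_trans; [|exact IHHnm].
    rewrite E, E'. assert (Q := H m). apply Rabs_le_between in Q. lra. }
  assert (VW : forall n m, u n - 2 * K / 2 ^ n <= u m + 2 * K / 2 ^ m).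
  { intros n m. destruct (Nat.le_ge_cases n m) as [Hnm|Hnm].
    - eapply Rle_trans; [apply Vup, Hnm|]. generalize (K0 m). rewrite E'. lra.
    - eapply Rle_trans; [|apply Wdn, Hnm]. generalize (K0 n). rewrite E'. lra. }
  destruct (completeness (fun x => exists n, x = u n - 2 * K / 2 ^ n)) as [l [L1 L2]].
  - exists (u 0%nat + 2 * K / 2 ^ 0). intros x [n ->]. apply VW.
  - exists (u 0%nat - 2 * K / 2 ^ 0). exists 0%nat; auto.
  - exists l. intros n. apply Rabs_le_between. split.
    + generalize (L1 _ (ex_intro _ n eq_refl)). lra.
    + assert (l <= u n + 2 * K / 2 ^ n) by (apply L2; intros x [m ->]; apply VW). lra.
Qed.

Lemma geom_small (K eps : R) : 0 < eps -> exists n, K / 2 ^ n < eps.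
Proof.
  intros He. destruct (Pow_x_infinity 2 ltac:(rewrite Rabs_pos_eq; lra) (K / eps + 1)) as [N HN].
  exists N. specialize (HN N (Nat.le_refl N)). assert (P : 0 < 2 ^ N) by (apply pow_lt; lra).
  rewrite Rabs_pos_eq in HN by lra.
  apply Rmult_lt_reg_r with (2 ^ N); auto. unfold Rdiv at 1. rewrite Rmult_assoc, Rinv_l by lra.
  assert (K / eps < 2 ^ N) by lra. apply Rmult_lt_compat_r with (r := eps) in H; auto.
  unfold Rdiv in H. rewrite Rmult_assoc, Rinv_l in H by lra. lra.
Qed.

Section Goursat.
Variable D : C -> Prop.
Hypothesis Dc : convex D.
Variable f : C -> C.
Hypothesis Hf : hol D f.
Variables a b c : C.
Hypothesis (Ha : D a) (Hb : D b) (Hc : D c).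

Let fc : contD D f.
Proof. intros z Hz. eapply hol_Cont; eauto. Qed.

(* Points of the triangle are tracked through their barycentric coordinates, so that limits stay inside it. *)
Let A (p : C) : C := (a + RtoC (Re p) * (b - a) + RtoC (Im p) * (c - a))%C.
Let Dl (p : C) := 0 <= Re p /\ 0 <= Im p /\ Re p + Im p <= 1.

(** The point is reached by two convex combinations, first on the edge from a to c and then towards
    b. The vertex b is separate because of the division by 1 - Re p. *)
Let A_D p : Dl p -> D (A p).
Proof.
  intros [H1 [H2 H3]]. destruct (Req_dec (Re p) 1) as [E|E].
  - replace (A p) with b; auto. unfold A. replace (Im p) with 0 by lra. rewrite E. ring.
  - set (x := (a + RtoC (Im p / (1 - Re p)) * (c - a))%C).
    replace (A p) with (x + RtoC (Re p) * (b - x))%C.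
    + apply Dc; auto; [|lra]. apply Dc; auto. split. apply Rdiv_le_0_compat; lra.
      apply Rmult_le_reg_r with (1 - Re p). lra. unfold Rdiv. rewrite Rmult_assoc, Rinv_l; lra.
    + unfold A, x.
      replace (RtoC (Im p)) with (RtoC (Im p / (1 - Re p)) * (1 - RtoC (Re p)))%C; [ring|].
      rewrite <- RtoC_minus, <- RtoC_mult. f_equal. field. lra.
Qed.

Let mid (p q : C) : C := (RtoC (/2) * (p + q))%C.

Let Re_mid p q : Re (mid p q) = (Re p + Re q) / 2.
Proof. unfold mid. rewrite re_scal_l, re_plus. field. Qed.
Let Im_mid p q : Im (mid p q) = (Im p + Im q) / 2.
Proof. unfold mid. rewrite im_scal_l, im_plus. field. Qed.

Let mid_Dl p q : Dl p -> Dl q -> Dl (mid p q).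
Proof. unfold Dl. rewrite Re_mid, Im_mid. lra. Qed.

Let A_mid p q : A (mid p q) = ((A p + A q) / 2)%C.
Proof.
  assert (E2 : RtoC 2 <> 0) by (intros E; apply RtoC_inj in E; lra).
  unfold A. rewrite Re_mid, Im_mid. rewrite !RtoC_div, !RtoC_plus by lra. field; auto.
Qed.

Let T (t : C * C * C) := let '(p, q, r) := t in TI f (A p) (A q) (A r).
Let per (t : C * C * C) := let '(p, q, r) := t in Cmod (p - q) + Cmod (q - r) + Cmod (r - p).
Let good (t : C * C * C) := let '(p, q, r) := t in Dl p /\ Dl q /\ Dl r.
Let hd (t : C * C * C) := fst (fst t).

Let step_rel t t' := good t' /\ Cmod (T t) <= 4 * Cmod (T t') /\ per t' = per t / 2 /\ Cmod (hd t' - hd t) <= per t.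

Let mod_half x : Cmod (RtoC (/2) * x) = Cmod x / 2.
Proof. rewrite Cmod_mult, Cmod_R, Rabs_pos_eq by lra. field. Qed.

(** The four midpoint triangles add up to the given one, as inner edges cancel, so one of them
    carries at least a quarter of the integral. Its first vertex stays within one perimeter of the
    old one, which makes the first vertices a Cauchy sequence. *)
Let step t : good t -> exists t', step_rel t t'.
Proof.
  destruct t as [[p q] r]. intros [Hp [Hq Hr]].
  set (m1 := mid p q). set (m2 := mid q r). set (m3 := mid r p).
  assert (G1 : Dl m1) by (apply mid_Dl; auto). assert (G2 : Dl m2) by (apply mid_Dl; auto). assert (G3 : Dl m3) by (apply mid_Dl; auto).
  assert (S : T (p, q, r) = (T (p, m1, m3) + T (m1, q, m2) + T (m3, m2, r) + T (m1, m2, m3))%C).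
  { unfold T, TI.
    assert (E1 := SI_mid D Dc f (A p) (A q) fc (A_D _ Hp) (A_D _ Hq)).
    assert (E2 := SI_mid D Dc f (A q) (A r) fc (A_D _ Hq) (A_D _ Hr)).
    assert (E3 := SI_mid D Dc f (A r) (A p) fc (A_D _ Hr) (A_D _ Hp)).
    rewrite <- A_mid in E1, E2, E3. fold m1 in E1. fold m2 in E2. fold m3 in E3.
    rewrite E1, E2, E3.
    assert (F1 := SI_swap D Dc f (A m1) (A m3) fc (A_D _ G1) (A_D _ G3)).
    assert (F2 := SI_swap D Dc f (A m1) (A m2) fc (A_D _ G1) (A_D _ G2)).
    assert (F3 := SI_swap D Dc f (A m2) (A m3) fc (A_D _ G2) (A_D _ G3)).
    rewrite F1, F2, F3. ring. }
  assert (Q : exists t', good t' /\ Cmod (T (p, q, r)) <= 4 * Cmod (T t') /\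
     (t' = (p, m1, m3) \/ t' = (m1, q, m2) \/ t' = (m3, m2, r) \/ t' = (m1, m2, m3))).
  { assert (B : Cmod (T (p,q,r)) <= Cmod (T (p, m1, m3)) + Cmod (T (m1, q, m2)) + Cmod (T (m3, m2, r)) + Cmod (T (m1, m2, m3))).
    { rewrite S. eapply Rle_trans; [apply Cmod_triangle|]. apply Rplus_le_compat_r.
      eapply Rle_trans; [apply Cmod_triangle|]. apply Rplus_le_compat_r. apply Cmod_triangle. }
    destruct (Rle_dec (Cmod (T (p,q,r))) (4 * Cmod (T (p, m1, m3)))). exists (p, m1, m3). unfold good; auto 10.
    destruct (Rle_dec (Cmod (T (p,q,r))) (4 * Cmod (T (m1, q, m2)))). exists (m1, q, m2). unfold good; auto 10.
    destruct (Rle_dec (Cmod (T (p,q,r))) (4 * Cmod (T (m3, m2, r)))). exists (m3, m2, r). unfold good; auto 10.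
    exists (m1, m2, m3). unfold good. split; [auto|]. split; [|auto]. lra. }
  destruct Q as [t' [Q1 [Q2 Q3]]]. exists t'. split; auto. split; auto.
  assert (Hi : RtoC (/2) = (/ RtoC 2)%C) by (apply RtoC_inv; lra).
  assert (N : forall x y z : C, x = (RtoC (/2) * (y - z))%C -> Cmod x = Cmod (y - z) / 2).
  { intros x y z ->. apply mod_half. }
  assert (Nn : 0 <= Cmod (p - q) /\ 0 <= Cmod (q - r) /\ 0 <= Cmod (r - p)) by (repeat split; apply Cmod_ge_0).
  assert (E2 : RtoC 2 <> 0) by (intros E; apply RtoC_inj in E; lra).
  destruct Q3 as [-> | [-> | [-> | ->]]]; unfold per, hd; cbn [fst snd]; split.
  - rewrite (N (p - m1)%C p q), (N (m1 - m3)%C q r), (N (m3 - p)%C r p). field.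
    all: unfold m1, m3, mid; rewrite Hi; field; auto.
  - replace (p - p)%C with (RtoC 0) by ring. rewrite Cmod_0. lra.
  - rewrite (N (m1 - q)%C p q), (N (q - m2)%C q r), (N (m2 - m1)%C r p). field.
    all: unfold m1, m2, mid; rewrite Hi; field; auto.
  - rewrite (N (m1 - p)%C q p). rewrite Cmod_sub_sym. lra. unfold m1, mid; rewrite Hi; field; auto.
  - rewrite (N (m3 - m2)%C p q), (N (m2 - r)%C q r), (N (r - m3)%C r p). field.
    all: unfold m2, m3, mid; rewrite Hi; field; auto.
  - rewrite (N (m3 - p)%C r p). lra. unfold m3, mid; rewrite Hi; field; auto.
  - rewrite (N (m1 - m2)%C p r), (N (m2 - m3)%C q p), (N (m3 - m1)%C r q).
    rewrite (Cmod_sub_sym p r), (Cmod_sub_sym q p), (Cmod_sub_sym r q). field.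
    all: unfold m1, m2, m3, mid; rewrite Hi; field; auto.
  - rewrite (N (m1 - p)%C q p). rewrite Cmod_sub_sym. lra. unfold m1, mid; rewrite Hi; field; auto.
Qed.

Let nxt t := epsilon (inhabits t) (step_rel t).
(** In barycentric coordinates 0, 1 and i stand for the vertices a, b and c. *)
Let t0 : C * C * C := (RtoC 0, RtoC 1, Ci).
Let tn n := Nat.iter n nxt t0.

Let tn_good n : good (tn n).
Proof.
  induction n.
  - unfold tn, t0, good, Dl, Ci, Re, Im; simpl. repeat split; lra.
  - change (good (nxt (tn n))). apply (epsilon_spec (inhabits (tn n)) (step_rel (tn n)) (step _ IHn)).
Qed.

Let tn_step n : step_rel (tn n) (tn (S n)).
Proof. change (step_rel (tn n) (nxt (tn n))). apply (epsilon_spec (inhabits (tn n)) (step_rel (tn n)) (step _ (tn_good n))). Qed.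

Let per_n n : per (tn n) = per t0 / 2 ^ n.
Proof.
  induction n. unfold tn; simpl. field.
  destruct (tn_step n) as [_ [_ [E _]]]. rewrite E, IHn. simpl. field. apply pow_nonzero; lra.
Qed.

Let T_n n : Cmod (T t0) <= 4 ^ n * Cmod (T (tn n)).
Proof.
  induction n. unfold tn; simpl. lra.
  destruct (tn_step n) as [_ [E _]]. eapply Rle_trans. apply IHn.
  rewrite <- tech_pow_Rmult, (Rmult_comm 4 (4 ^ n)), Rmult_assoc.
  apply Rmult_le_compat_l; auto. apply pow_le; lra.
Qed.

Let lim_ex : exists l, forall n, Cmod (l - hd (tn n)) <= 4 * per t0 / 2 ^ n.
Proof.
  assert (H : forall n, Cmod (hd (tn (S n)) - hd (tn n)) <= per t0 / 2 ^ n).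
  { intros n. destruct (tn_step n) as [_ [_ [_ E]]]. rewrite <- per_n. exact E. }
  destruct (geom_limit (fun n => Re (hd (tn n))) (per t0)) as [x Hx].
  { intros n. eapply Rle_trans; [|apply H]. rewrite <- re_minus. apply re_le_Cmod. }
  destruct (geom_limit (fun n => Im (hd (tn n))) (per t0)) as [y Hy].
  { intros n. eapply Rle_trans; [|apply H]. rewrite <- im_minus. apply im_le_Cmod. }
  exists (x, y). intros n. eapply Rle_trans; [apply Cmod_le_ReIm|].
  specialize (Hx n). specialize (Hy n).
  replace (Re ((x, y) - hd (tn n))) with (x - Re (hd (tn n))) by (unfold Re; simpl; ring).
  replace (Im ((x, y) - hd (tn n))) with (y - Im (hd (tn n))) by (unfold Im; simpl; ring).
  replace (4 * per t0 / 2 ^ n) with (2 * per t0 / 2 ^ n + 2 * per t0 / 2 ^ n) by (field; apply pow_nonzero; lra). lra.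
Qed.

(** The triangle is cut out by three linear inequalities. Each is tested on the first vertices of
    the nested triangles, and the error 8 per / 2^n vanishes. *)
Let lim_Dl l : (forall n, Cmod (l - hd (tn n)) <= 4 * per t0 / 2 ^ n) -> Dl l.
Proof.
  intros H.
  assert (K : forall u : C -> R, (forall z w, u (z - w)%C = u z - u w) -> (forall z, u z <= 2 * Cmod z) -> forall B,
     (forall p, Dl p -> u p <= B) -> u l <= B).
  { intros u Hu Hb' B HB. apply le_epsilon. intros eps He.
    destruct (geom_small (2 * (4 * per t0)) eps He) as [n Hn].
    specialize (H n). assert (Hg := tn_good n). destruct (tn n) as [[p q] r]. destruct Hg as [Hp _].
    specialize (HB p Hp). specialize (Hb' (l - p)%C). rewrite Hu in Hb'. unfold hd in H; cbn [fst snd] in H. fold t0 in H.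
    assert (2 * (4 * per t0 / 2 ^ n) < eps).
    { replace (2 * (4 * per t0 / 2 ^ n)) with (2 * (4 * per t0) / 2 ^ n); auto. unfold Rdiv; ring. }
    lra. }
  assert (M : forall z, Rabs (Re z) <= Cmod z) by apply re_le_Cmod.
  assert (M' := im_le_Cmod).
  assert (R1 : - Re l <= 0).
  { apply (K (fun z => - Re z)). intros; rewrite re_minus; ring.
    intros z. specialize (M z). apply Rabs_le_between in M. lra. unfold Dl; intros; lra. }
  assert (R2 : - Im l <= 0).
  { apply (K (fun z => - Im z)). intros; rewrite im_minus; ring.
    intros z. specialize (M' z). apply Rabs_le_between in M'. lra. unfold Dl; intros; lra. }
  assert (R3 : Re l + Im l <= 1).
  { apply (K (fun z => Re z + Im z)). intros; rewrite im_minus, re_minus; ring.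
    intros z. specialize (M' z). specialize (M z). apply Rabs_le_between in M'. apply Rabs_le_between in M. lra. unfold Dl; intros; lra. }
  unfold Dl; auto with real.
  split; [lra|split; lra].
Qed.

Let A_lip p q : Cmod (A p - A q) <= (Cmod (b - a) + Cmod (c - a)) * Cmod (p - q).
Proof.
  replace (A p - A q)%C with (RtoC (Re (p - q)) * (b - a) + RtoC (Im (p - q)) * (c - a))%C.
  - eapply Rle_trans; [apply Cmod_triangle|]. rewrite !Cmod_mult, !Cmod_R, Rmult_plus_distr_r.
    apply Rplus_le_compat; rewrite Rmult_comm; apply Rmult_le_compat_l; try apply Cmod_ge_0. apply re_le_Cmod. apply im_le_Cmod.
  - unfold A. rewrite re_minus, im_minus, !RtoC_minus. ring.
Qed.

Lemma goursat_triangle : TI f a b c = 0.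
Proof.
  replace (TI f a b c) with (T t0).
  2:{ unfold T, t0, A. unfold Ci, Re, Im; simpl. f_equal; ring. }
  destruct lim_ex as [l Hl]. assert (Dl_l := lim_Dl l Hl).
  set (z := A l). assert (Dz : D z) by (apply A_D; auto).
  destruct (Hf z Dz) as [d Hd].
  set (P := per t0) in *. set (Lp := Cmod (b - a) + Cmod (c - a)).
  assert (HP : 0 < P).
  { unfold P, per, t0. assert (0 < Cmod (RtoC 0 - RtoC 1)).
    { rewrite Cmod_RR. apply Rabs_pos_lt; lra. }
    generalize (Cmod_ge_0 (RtoC 1 - Ci)) (Cmod_ge_0 (Ci - RtoC 0)). lra. }
  assert (HL : 0 <= Lp) by (unfold Lp; generalize (Cmod_ge_0 (b - a)) (Cmod_ge_0 (c - a)); lra).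
  set (K := 15 * (Lp * P) * (Lp * P) + 1).
  assert (HLP : 0 <= Lp * P) by nra.
  assert (HK : 0 < K) by (unfold K; nra).
  destruct (Rle_lt_or_eq_dec _ _ (Cmod_ge_0 (T t0))) as [Hpos|E]; [|apply Cmod_eq_0; auto].
  exfalso.
  set (eps := Cmod (T t0) / (2 * K)).
  assert (Heps : 0 < eps) by (apply Rdiv_lt_0_compat; lra).
  destruct (Der_dom _ _ _ _ Hd eps Heps) as [del [Pd Q]].
  destruct (geom_small (Lp * (5 * P)) del Pd) as [n Hn].
  assert (P2 : 0 < 2 ^ n) by (apply pow_lt; lra).
  specialize (Hl n). assert (Hper := per_n n). assert (Hg := tn_good n). assert (HT := T_n n).
  destruct (tn n) as [[p q] r]. destruct Hg as [Hp [Hq Hr]]. unfold hd in Hl; simpl in Hl. unfold per in Hper. fold P in Hper.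
  set (e := P / 2 ^ n) in *.
  replace (4 * P / 2 ^ n) with (4 * e) in Hl by (unfold e; field; lra).
  replace (Lp * (5 * P) / 2 ^ n) with (Lp * (5 * e)) in Hn by (unfold e; field; lra).
  generalize (Cmod_ge_0 (p - q)) (Cmod_ge_0 (q - r)) (Cmod_ge_0 (r - p)); intros N1 N2 N3.
  assert (He0 : 0 < e) by (apply Rdiv_lt_0_compat; auto).
  assert (near : forall x, Cmod (x - p) <= e -> Cmod (A x - z) <= Lp * (5 * e)).
  { intros x Hx. unfold z. eapply Rle_trans; [apply A_lip|]. fold Lp. apply Rmult_le_compat_l; auto.
    generalize (Cmod_sub_tri x p l). rewrite (Cmod_sub_sym p l). lra. }
  (* On each edge f differs from its affine part by at most eps * |w - z|. *)
  set (g := fun w => (f z + d * (w - z))%C).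
  assert (gD : forall w, CDer (fun w => (f z * w + d * ((w - z) * (w - z)) / 2))%C w (g w)).
  { intros w. eapply Der_eq.
    apply Der_plus. apply Der_scal. apply Der_id.
    apply (Der_ext _ (fun w => (d / 2) * ((w - z) * (w - z)))%C).
    intros s. field. 
    apply Der_scal. apply Der_mult; (apply Der_minus; [apply Der_id|apply Der_const]).
    unfold g. cbv beta. field. }
  assert (gc : contD D g).
  { intros w _. unfold g. apply Cont_plus. apply Cont_const. apply Cont_mult. apply Cont_const. apply Cont_minus. apply Cont_id. apply Cont_const. }
  assert (edge : forall x y, Dl x -> Dl y -> Cmod (x - p) <= e -> Cmod (y - p) <= e -> Cmod (y - x) <= e ->
     Cmod (SI f (A x) (A y) - SI g (A x) (A y)) <= Lp * e * (eps * (Lp * (5 * e)))).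
  { intros x y Hx Hy Hxp Hyp Hxy.
    replace (SI f (A x) (A y) - SI g (A x) (A y))%C with (SI (fun w => f w + (-1) * g w)%C (A x) (A y)).
    - eapply Rle_trans. apply (SI_bound D Dc _ _ _ (eps * (Lp * (5 * e)))); auto.
      + intros w Hw. apply Cont_plus; auto. apply Cont_mult; auto. apply Cont_const.
      + intros t Ht.
        replace (seg (A x) (A y) t) with (A (x + RtoC t * (y - x))%C).
        * set (s := (x + RtoC t * (y - x))%C).
          assert (Hs : Cmod (s - p) <= e).
          { replace (s - p)%C with (RtoC (1 - t) * (x - p) + RtoC t * (y - p))%C by (unfold s; rewrite RtoC_minus; ring).
            eapply Rle_trans; [apply Cmod_triangle|]. rewrite !Cmod_mult, !Cmod_R, !Rabs_pos_eq by lra. nra. }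
          assert (Hn' := near s Hs).
          replace (f (A s) + -1 * g (A s))%C with (f (A s) - f z - d * (A s - z))%C by (unfold g; ring).
          eapply Rle_trans. apply Q. lra. apply Rmult_le_compat_l; lra.
        * unfold A, seg. rewrite re_plus, im_plus, re_scal_l, im_scal_l.
          rewrite re_minus, im_minus, !RtoC_plus, !RtoC_mult, !RtoC_minus. ring.
      + apply Rmult_le_compat_r. apply Rmult_le_pos; nra.
        eapply Rle_trans; [apply A_lip|]. fold Lp. apply Rmult_le_compat_l; auto.
    - rewrite (SI_plus D Dc); auto.
      + replace (SI (fun w => (-1) * g w)%C (A x) (A y)) with (- SI g (A x) (A y))%C. reflexivity.
        unfold SI. rewrite CI_scal. ring. apply (cont_seg D Dc); auto.
      + intros w Hw. apply Cont_mult; auto. apply Cont_const. }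
  assert (gT : TI g (A p) (A q) (A r) = 0).
  { unfold TI. assert (gF := fun x y => SI_FTC D Dc _ g x y gc (fun w _ => gD w)). rewrite !gF by auto. ring. }
  assert (TB : Cmod (T (p, q, r)) <= 3 * (Lp * e * (eps * (Lp * (5 * e))))).
  { unfold T. replace (TI f (A p) (A q) (A r)) with (TI f (A p) (A q) (A r) - TI g (A p) (A q) (A r))%C by (rewrite gT; ring).
    unfold TI.
    replace (SI f (A p) (A q) + SI f (A q) (A r) + SI f (A r) (A p) - (SI g (A p) (A q) + SI g (A q) (A r) + SI g (A r) (A p)))%C
      with ((SI f (A p) (A q) - SI g (A p) (A q)) + (SI f (A q) (A r) - SI g (A q) (A r)) + (SI f (A r) (A p) - SI g (A r) (A p)))%C by ring.
    eapply Rle_trans; [apply Cmod_triangle|]. eapply Rle_trans; [apply Rplus_le_compat_r, Cmod_triangle|].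
    assert (Epp : Cmod (p - p) = 0) by (replace (p - p)%C with (RtoC 0) by ring; apply Cmod_0).
    rewrite (Cmod_sub_sym p q) in *.
    assert (B1 := edge p q Hp Hq ltac:(lra) ltac:(lra) ltac:(lra)).
    rewrite (Cmod_sub_sym q r) in *.
    assert (B2 := edge q r Hq Hr ltac:(lra) ltac:(lra) ltac:(lra)).
    assert (B3 := edge r p Hr Hp ltac:(lra) ltac:(lra) ltac:(rewrite (Cmod_sub_sym p r); lra)).
    lra. }
  assert (HF : Cmod (T t0) <= eps * (15 * (Lp * P) * (Lp * P))).
  { eapply Rle_trans; [apply HT|].
    eapply Rle_trans. apply Rmult_le_compat_l. apply pow_le; lra. apply TB.
    right. unfold e. replace (4 ^ n) with (2 ^ n * 2 ^ n). field. lra.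
    rewrite <- Rpow_mult_distr. f_equal. }
  assert (eps * K = Cmod (T t0) / 2) by (unfold eps; field; lra).
  assert (eps * (15 * (Lp * P) * (Lp * P)) <= eps * K) by (apply Rmult_le_compat_l; unfold K; lra).
  lra.
Qed.
End Goursat.

(** The primitive is the integral from a base point. By Goursat's theorem its increment from z to s
    is the integral over the segment [z, s] alone, which continuity of f compares with f z (s -
    z). *)
Lemma primitive (D : C -> Prop) (f : C -> C) : convex D -> open_set D -> (exists z, D z) -> hol D f ->
  exists F, forall z, D z -> CDer F z (f z).
Proof.
  intros Dc Do [z0 H0] Hf. exists (fun z => SI f z0 z). intros z Hz.
  assert (fc : contD D f) by (intros w Hw; eapply hol_Cont; eauto).
  apply dom_CDer. intros eps He.
  destruct (Do z Hz) as [r [Pr Hr]]. destruct (fc z Hz eps He) as [del [Pd Q]].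
  exists (Rmin r del). split. apply Rmin_glb_lt; auto.
  intros s Hs. assert (Ds : D s) by (apply Hr; eapply Rlt_le_trans; [exact Hs|apply Rmin_l]).
  assert (Hs' : Cmod (s - z) < del) by (eapply Rlt_le_trans; [exact Hs|apply Rmin_r]).
  assert (G := goursat_triangle D Dc f Hf z0 z s H0 Hz Ds). unfold TI in G.
  rewrite (SI_swap D Dc f z0 s fc H0 Ds) in G.
  replace (SI f z0 s - SI f z0 z - f z * (s - z))%C with (SI (fun w => f w + (- f z))%C z s).
  - eapply Rle_trans. apply (SI_bound D Dc _ _ _ eps); auto.
    + intros w Hw. apply Cont_plus; auto. apply Cont_const.
    + intros t Ht. left. change (f (seg z s t) + - f z)%C with (f (seg z s t) - f z)%C. apply Q.
      replace (seg z s t - z)%C with (RtoC t * (s - z))%C by (unfold seg; ring).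
      rewrite Cmod_mult, Cmod_R, Rabs_pos_eq by lra. generalize (Cmod_ge_0 (s - z)). nra.
    + lra.
  - rewrite (SI_plus D Dc); auto. 2: intros w _; apply Cont_const.
    replace (SI (fun _ => (- f z)%C) z s) with (- f z * (s - z))%C.
    2:{ unfold SI. rewrite CI_const. replace (1 - 0) with 1 by ring. ring. }
    replace (SI f z0 s) with (SI f z0 z + SI f z s)%C. ring.
    apply Ceq_minus. rewrite <- G. ring.
Qed.

(** * Differentiation under the integral sign and Cauchy's formula *)

Lemma Cont_compR {T} (i : T -> C) (u : T -> R) (g : R -> C) (t : T) :
  RCont g (u t) -> Cont i (fun s => RtoC (u s)) t -> Cont i (fun s => g (u s)) t.
Proof.
  intros Hf Hg eps He. destruct (Hf eps He) as [d [P Q]]. destruct (Hg d P) as [e [P' Q']].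
  exists e; split; auto.
Qed.

Lemma continuity_2d_CCont (f : R -> R -> R) x y :
  CCont (fun z => RtoC (f (Re z) (Im z))) (x, y) -> continuity_2d_pt f x y.
Proof.
  intros H eps. destruct (H eps (cond_pos eps)) as [d [P Q]].
  assert (P2 : 0 < d / 2) by lra.
  exists (mkposreal _ P2). intros u v Hu Hv. simpl in Hu, Hv.
  specialize (Q (u, v)). rewrite Cmod_RR in Q. apply Q.
  eapply Rle_lt_trans; [apply Cmod_le_ReIm|]. unfold Re, Im; simpl.
  replace (u + - x) with (u - x) by ring. replace (v + - y) with (v - y) by ring. lra.
Qed.

(** Reduction to the real theorem for the two components; joint continuity of the derivative enters
    only at the points (x, t) of one line. *)
Lemma CI_param (F G : R -> R -> C) (a b x e : R) : 0 < e -> a <= b ->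
  (forall u t, Rabs (u - x) < e -> RDer (fun u => F u t) u (G u t)) ->
  (forall t, a <= t <= b -> CCont (fun z => G (Re z) (Im z)) (x, t)) ->
  (forall u t, Rabs (u - x) < e -> RCont (F u) t) ->
  RDer (fun u => CI (F u) a b) x (CI (G x) a b).
Proof.
  intros He Hab HD HG HF.
  assert (L : forall (P : R -> Prop), (forall u, Rabs (u - x) < e -> P u) -> locally x P).
  { intros P H. exists (mkposreal e He). intros u Hu. apply H. exact Hu. }
  apply RDer_ReIm.
  - assert (E : forall u t, Rabs (u - x) < e -> Derive (fun z => Re (F z t)) u = Re (G u t)).
    { intros u t Hu. apply is_derive_unique. apply RDer_Re; auto. }
    replace (Re (CI (G x) a b)) with (RInt (fun t => Derive (fun u => Re (F u t)) x) a b).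
    + apply (is_derive_RInt_param (fun u t => Re (F u t))).
      * apply L. intros u Hu t _. exists (Re (G u t)). apply RDer_Re; auto.
      * intros t Ht. rewrite Rmin_left, Rmax_right in Ht by auto.
        apply continuity_2d_pt_ext_loc with (fun u v => Re (G u v)).
        -- exists (mkposreal e He). intros u v Hu _. rewrite E; auto.
        -- apply (continuity_2d_CCont (fun u v => Re (G u v))). apply (Cont_Re _ (fun z => G (Re z) (Im z))). auto.
      * apply L. intros u Hu. apply (contI_ex_Re (F u)). intros t _; auto.
    + apply RInt_ext. intros t _. apply E. rewrite Rminus_diag, Rabs_R0; auto.
  - assert (E : forall u t, Rabs (u - x) < e -> Derive (fun z => Im (F z t)) u = Im (G u t)).
    { intros u t Hu. apply is_derive_unique. apply RDer_Im; auto. }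
    replace (Im (CI (G x) a b)) with (RInt (fun t => Derive (fun u => Im (F u t)) x) a b).
    + apply (is_derive_RInt_param (fun u t => Im (F u t))).
      * apply L. intros u Hu t _. exists (Im (G u t)). apply RDer_Im; auto.
      * intros t Ht. rewrite Rmin_left, Rmax_right in Ht by auto.
        apply continuity_2d_pt_ext_loc with (fun u v => Im (G u v)).
        -- exists (mkposreal e He). intros u v Hu _. rewrite E; auto.
        -- apply (continuity_2d_CCont (fun u v => Im (G u v))). apply (Cont_Im _ (fun z => G (Re z) (Im z))). auto.
      * apply L. intros u Hu. apply (contI_ex_Im (F u)). intros t _; auto.
    + apply RInt_ext. intros t _. apply E. rewrite Rminus_diag, Rabs_R0; auto.
Qed.

Lemma RDer_zero_const (g : R -> C) (a b : R) : a <= b -> (forall t, a <= t <= b -> RDer g t 0) -> g a = g b.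
Proof.
  intros Hab H.
  assert (E := CI_FTC g (fun _ => RtoC 0) a b). rewrite Rmin_left, Rmax_right in E by auto.
  specialize (E H). rewrite CI_const in E. apply eq_sym, Ceq_minus. rewrite <- E. ring.
  intros t _. apply Cont_const.
Qed.

Definition cis (t : R) : C := (cos t, sin t).

Lemma RDer_cis t : RDer cis t (Ci * cis t)%C.
Proof.
  apply RDer_ReIm; unfold cis, Ci, Re, Im; simpl.
  - replace (0 * cos t - 1 * sin t) with (- sin t) by ring. auto_derive; auto. ring.
  - replace (0 * sin t + 1 * cos t) with (cos t) by ring. auto_derive; auto. ring.
Qed.

Lemma Cmod_cis t : Cmod (cis t) = 1.
Proof.
  unfold Cmod, cis; cbn [fst snd]. replace (cos t ^ 2 + sin t ^ 2) with 1. apply sqrt_1.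
  generalize (sin2_cos2 t). unfold Rsqr. lra.
Qed.

Lemma cis_nz t : cis t <> 0.
Proof. apply Cmod_gt_0. rewrite Cmod_cis. lra. Qed.

Lemma cis_2PI : cis (2 * PI) = 1.
Proof. unfold cis. rewrite cos_2PI, sin_2PI. reflexivity. Qed.

Lemma cis_0 : cis 0 = 1.
Proof. unfold cis. rewrite cos_0, sin_0. reflexivity. Qed.

Lemma RCont_cis t : RCont cis t.
Proof. eapply Der_Cont. apply RDer_cis. Qed.

Lemma cis_conj t : Cconj (cis t) = (/ cis t)%C.
Proof.
  assert (E : (cis t * Cconj (cis t))%C = 1) by (rewrite <- Cmod2_conj, Cmod_cis; f_equal; ring).
  transitivity (/ cis t * (cis t * Cconj (cis t)))%C. field. apply cis_nz. rewrite E. ring.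
Qed.

Definition disc (c : C) (r : R) (z : C) := Cmod (z - c) < r.

Lemma disc_convex c r : convex (disc c r).
Proof.
  unfold convex, disc. intros a b t Ha Hb Ht.
  replace (a + RtoC t * (b - a) - c)%C with (RtoC (1 - t) * (a - c) + RtoC t * (b - c))%C by (rewrite RtoC_minus; ring).
  eapply Rle_lt_trans; [apply Cmod_triangle|]. rewrite !Cmod_mult, !Cmod_R, !Rabs_pos_eq by lra.
  destruct (Req_dec t 0). subst; lra. nra.
Qed.

Lemma disc_open c r : open_set (disc c r).
Proof.
  unfold open_set, disc. intros z Hz. exists (r - Cmod (z - c)). split. lra.
  intros w Hw. generalize (Cmod_sub_tri w z c). lra.
Qed.

Definition circ (c : C) (r : R) (t : R) : C := (c + RtoC r * cis t)%C.

Lemma circ_mod c r t : 0 <= r -> Cmod (circ c r t - c) = r.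
Proof. intros H. unfold circ. replace (c + RtoC r * cis t - c)%C with (RtoC r * cis t)%C by ring. rewrite Cmod_mult, Cmod_cis, Cmod_R, Rabs_pos_eq; lra. Qed.

Lemma RDer_circ c r t : RDer (circ c r) t (Ci * (RtoC r * cis t))%C.
Proof.
  eapply Der_eq. apply Der_plus. apply Der_const. apply Der_scal. apply RDer_cis. ring.
Qed.

Lemma RCont_circ c r t : RCont (circ c r) t.
Proof. eapply Der_Cont. apply RDer_circ. Qed.

Lemma circ_per c r : circ c r (2 * PI) = circ c r 0.
Proof. unfold circ. rewrite cis_2PI, cis_0. reflexivity. Qed.

Lemma circ_sub_nz c r a t : Cmod (a - c) < r -> (circ c r t - a)%C <> 0.
Proof.
  intros H E. assert (Hr : 0 <= r) by (generalize (Cmod_ge_0 (a - c)); lra).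
  assert (M := circ_mod c r t Hr). apply Ceq_minus in E. rewrite E in M. lra.
Qed.

Lemma two_PI_pos : 0 < 2 * PI.
Proof. generalize PI_RGT_0; lra. Qed.

(** The point a is moved to the centre c along [as_]. The derivative of the integral in s is the
    integral of an exact t-derivative over a closed circle, hence 0, and at the centre the integrand
    is 1. *)
Lemma winding c r a : Cmod (a - c) < r ->
  CI (fun t => RtoC r * cis t / (circ c r t - a))%C 0 (2 * PI) = RtoC (2 * PI).
Proof.
  intros Ha. assert (Hr : 0 < r) by (generalize (Cmod_ge_0 (a - c)); lra).
  set (rho := Cmod (a - c)) in *.
  assert (Hrho : 0 <= rho) by apply Cmod_ge_0.
  set (as_ := fun s : R => (c + RtoC s * (a - c))%C).
  (* Room beyond the segment is kept because the derivative in s is two-sided also at s = 0 and s =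
     1. *)
  assert (exists e, 0 < e /\ (1 + e) * rho < r) as [e [He He']].
  { exists ((r - rho) / (2 * r)). split. apply Rdiv_lt_0_compat; lra.
    assert ((r - rho) / (2 * r) * rho <= (r - rho) / (2 * r) * r).
    { apply Rmult_le_compat_l; [apply Rlt_le, Rdiv_lt_0_compat; lra|lra]. }
    replace ((r - rho) / (2 * r) * r) with ((r - rho) / 2) in H by (field; lra). lra. }
  assert (Hin : forall s, -e < s < 1 + e -> Cmod (as_ s - c) < r).
  { intros s Hs. unfold as_. replace (c + RtoC s * (a - c) - c)%C with (RtoC s * (a - c))%C by ring.
    rewrite Cmod_mult, Cmod_R. fold rho. apply Rle_lt_trans with ((1 + e) * rho); auto.
    apply Rmult_le_compat_r; auto. apply Rabs_le; lra. }
  assert (Cnum : forall t, RCont (fun t => RtoC r * cis t)%C t).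
  { intros t. apply Cont_mult. apply Cont_const. apply RCont_cis. }
  assert (N : CI (fun t => RtoC r * cis t / (circ c r t - as_ 0))%C 0 (2 * PI) = CI (fun t => RtoC r * cis t / (circ c r t - as_ 1%R))%C 0 (2 * PI)).
  { apply (RDer_zero_const (fun s => CI (fun t => RtoC r * cis t / (circ c r t - as_ s))%C 0 (2 * PI))). lra.
    intros s Hs.
    set (G := fun s t => (RtoC r * cis t * (a - c) / ((circ c r t - as_ s) * (circ c r t - as_ s)))%C).
    assert (Eabs : forall u, Rabs (u - s) < e -> -e < u < 1 + e) by (intros u Hu; apply Rabs_lt_between in Hu; lra).
    eapply Der_eq.
    apply (CI_param (fun s t => RtoC r * cis t / (circ c r t - as_ s))%C G 0 (2 * PI) s e); auto.
    - generalize two_PI_pos; lra.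
    - intros u t Hu. assert (H := circ_sub_nz c r _ t (Hin u (Eabs u Hu))).
      eapply Der_eq. apply Der_scal. apply Der_inv.
      apply Der_minus. apply Der_const. apply Der_plus. apply Der_const. apply Der_mult. apply Der_id. apply Der_const.
      exact H. unfold G, as_ in *. cbv beta. field. auto.
    - intros t _. unfold G.
      assert (Ci1 : CCont (fun z => circ c r (Im z)) (s, t)).
      { apply (Cont_compR _ Im (circ c r)). apply RCont_circ. apply (Cont_Im _ (fun z => z)). apply Cont_id. }
      assert (Ci2 : CCont (fun z => cis (Im z)) (s, t)).
      { apply (Cont_compR _ Im cis). apply RCont_cis. apply (Cont_Im _ (fun z => z)). apply Cont_id. }
      assert (Ca : CCont (fun z => as_ (Re z)) (s, t)).
      { unfold as_. apply Cont_plus. apply Cont_const. apply Cont_mult. apply (Cont_Re _ (fun z => z)), Cont_id. apply Cont_const. }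
      assert (H := circ_sub_nz c r _ t (Hin s (Eabs s ltac:(rewrite Rminus_diag, Rabs_R0; auto)))).
      apply Cont_div.
      apply Cont_mult. apply Cont_mult. apply Cont_const. auto. apply Cont_const.
      apply Cont_mult; apply Cont_minus; auto. apply Cmult_neq_0; auto.
    - intros u t Hu. assert (H := circ_sub_nz c r _ t (Hin u (Eabs u Hu))).
      apply Cont_div; auto. apply Cont_minus. apply RCont_circ. apply Cont_const.
    - assert (Hz : forall t, (circ c r t - as_ s)%C <> 0) by (intros t; apply circ_sub_nz; apply Hin; lra).
      rewrite (CI_FTC (fun t => (Ci * (a - c) / (circ c r t - as_ s))%C)).
      + rewrite circ_per. ring.
      + intros t _. eapply Der_eq. apply Der_scal. apply Der_inv. apply Der_minus. apply RDer_circ. apply Der_const. auto.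
        unfold G. cbv beta.
        transitivity (- (Ci * Ci) * (RtoC r * cis t * (a - c)) / ((circ c r t - as_ s) * (circ c r t - as_ s)))%C.
        field; auto. replace (Ci * Ci)%C with (- (1))%C by (apply Ceq; unfold Ci, Re, Im; simpl; ring). field; auto.
      + intros t _. unfold G. apply Cont_div.
        apply Cont_mult; auto. apply Cont_const.
        apply Cont_mult; apply Cont_minus; try apply RCont_circ; apply Cont_const. apply Cmult_neq_0; auto. }
  replace (as_ 1) with a in N by (unfold as_; ring). rewrite <- N.
  rewrite (CI_ext _ (fun _ => RtoC 1)). rewrite CI_const. rewrite Rminus_0_r. ring.
  intros t _. unfold as_, circ. assert (Hc := cis_nz t). assert (RtoC r <> 0) by (intros E; apply RtoC_inj in E; lra).
  replace (c + RtoC r * cis t - (c + RtoC 0 * (a - c)))%C with (RtoC r * cis t)%C by ring. field; auto.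
Qed.

(** The homotopy p contracts the circle to a. The s-derivative of the integral, multiplied by s, is
    the integral of a t-derivative over a closed curve. Continuity of F' is what permits
    differentiation under the integral sign; it is removed later through primitives. *)
Lemma cauchy_C1 (F F' : C -> C) c R0 r a :
  (forall z, disc c R0 z -> CDer F z (F' z)) -> (forall z, disc c R0 z -> CCont F' z) ->
  Cmod (a - c) < r -> r < R0 ->
  CI (fun t => F (circ c r t) * (RtoC r * cis t / (circ c r t - a)))%C 0 (2 * PI) = (RtoC (2 * PI) * F a)%C.
Proof.
  intros HF HF' Ha HR. assert (Hr : 0 < r) by (generalize (Cmod_ge_0 (a - c)); lra).
  set (rho := Cmod (a - c)) in *. assert (Hrho : 0 <= rho) by apply Cmod_ge_0.
  set (e := (R0 - r) / (4 * r)).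
  assert (He : 0 < e) by (apply Rdiv_lt_0_compat; lra).
  assert (He' : r + 2 * e * r < R0).
  { unfold e. replace (2 * ((R0 - r) / (4 * r)) * r) with ((R0 - r) / 2) by (field; lra). lra. }
  set (p := fun s t => (a + RtoC s * (circ c r t - a))%C).
  assert (Hin : forall s t, -e < s < 1 + e -> disc c R0 (p s t)).
  { intros s t Hs. unfold disc, p.
    replace (a + RtoC s * (circ c r t - a) - c)%C with (RtoC (1 - s) * (a - c) + RtoC s * (circ c r t - c))%C by (rewrite RtoC_minus; ring).
    eapply Rle_lt_trans; [apply Cmod_triangle|]. rewrite !Cmod_mult, !Cmod_R, circ_mod by lra. fold rho.
    apply Rle_lt_trans with (r + 2 * e * r); auto.
    unfold Rabs. destruct (Rcase_abs (1 - s)); destruct (Rcase_abs s); nra. }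
  set (k := fun t => (RtoC r * cis t / (circ c r t - a))%C).
  assert (Hz : forall t, (circ c r t - a)%C <> 0) by (intros t; apply circ_sub_nz; auto).
  assert (Cnum : forall t, RCont (fun t => RtoC r * cis t)%C t).
  { intros t. apply Cont_mult. apply Cont_const. apply RCont_cis. }
  assert (Ck : forall t, RCont k t).
  { intros t. unfold k. apply Cont_div; auto. apply Cont_minus. apply RCont_circ. apply Cont_const. }
  assert (Cp : forall s t, RCont (p s) t).
  { intros s t. unfold p. apply Cont_plus. apply Cont_const. apply Cont_mult. apply Cont_const. apply Cont_minus. apply RCont_circ. apply Cont_const. }
  assert (N : CI (fun t => F (p 0 t) * k t)%C 0 (2 * PI) = CI (fun t => F (p 1 t) * k t)%C 0 (2 * PI)).
  { apply (RDer_zero_const (fun s => CI (fun t => F (p s t) * k t)%C 0 (2 * PI))). lra.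
    intros s Hs.
    assert (Eabs : forall u, Rabs (u - s) < e -> -e < u < 1 + e) by (intros u Hu; apply Rabs_lt_between in Hu; lra).
    assert (Hs' : -e < s < 1 + e) by lra.
    set (G := fun s t => (F' (p s t) * (RtoC r * cis t))%C).
    eapply Der_eq.
    apply (CI_param (fun s t => F (p s t) * k t)%C G 0 (2 * PI) s e); auto.
    - generalize two_PI_pos; lra.
    - intros u t Hu. eapply Der_eq. apply Der_mult. apply (Der_comp RtoC F (fun u => p u t)).
      apply HF. apply Hin; auto. unfold p. apply Der_plus. apply Der_const. apply Der_mult. apply Der_id. apply Der_const.
      apply Der_const. unfold G, k. cbv beta. field; auto.
    - intros t _. unfold G.
      assert (Ci1 : CCont (fun z => circ c r (Im z)) (s, t)).
      { apply (Cont_compR _ Im (circ c r)). apply RCont_circ. apply (Cont_Im _ (fun z => z)). apply Cont_id. }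
      assert (Ci2 : CCont (fun z => cis (Im z)) (s, t)).
      { apply (Cont_compR _ Im cis). apply RCont_cis. apply (Cont_Im _ (fun z => z)). apply Cont_id. }
      apply Cont_mult. apply (Cont_comp _ F' (fun z => p (Re z) (Im z))). apply HF', Hin; auto.
      unfold p. apply Cont_plus. apply Cont_const. apply Cont_mult. apply (Cont_Re _ (fun z => z)), Cont_id.
      apply Cont_minus; auto. apply Cont_const. apply Cont_mult; auto. apply Cont_const.
    - intros u t Hu. apply Cont_mult; auto. apply Cont_comp; auto. eapply Der_Cont. apply HF, Hin; auto.
    - assert (CG : contI (G s) 0 (2 * PI)).
      { intros t _. unfold G. apply Cont_mult; auto. apply Cont_comp; auto. }
      assert (E : (RtoC s * CI (G s) 0 (2 * PI))%C = 0).
      { rewrite <- CI_scal by auto.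
        rewrite (CI_FTC (fun t => (- Ci * F (p s t))%C)).
        + unfold p. rewrite circ_per. ring.
        + intros t _. eapply Der_eq. apply Der_scal. apply Der_comp. apply HF, Hin; auto.
          unfold p. apply Der_plus. apply Der_const. apply Der_scal. apply Der_minus. apply RDer_circ. apply Der_const.
          unfold G. transitivity (- (Ci * Ci) * (RtoC s * (F' (p s t) * (RtoC r * cis t))))%C. unfold p; ring.
          replace (Ci * Ci)%C with (- (1))%C by (apply Ceq; unfold Ci, Re, Im; simpl; ring). ring.
        + apply contI_scal; auto. }
      (* The factor s cannot be cancelled at s = 0, where the integrand is F' a times the derivative
         of a closed curve. *)
      destruct (Req_dec s 0) as [E0|E0].
      + subst s. unfold G, p. rewrite (CI_ext _ (fun t => F' a * (RtoC r * cis t))%C).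
        2:{ intros t _. do 2 f_equal. ring. }
        rewrite CI_scal by (intros t _; auto).
        rewrite (CI_FTC (fun t => (- Ci * circ c r t)%C)).
        * rewrite circ_per. ring.
        * intros t _. eapply Der_eq. apply Der_scal. apply RDer_circ.
          transitivity (- (Ci * Ci) * ((RtoC r * cis t)))%C. ring.
          replace (Ci * Ci)%C with (- (1))%C by (apply Ceq; unfold Ci, Re, Im; simpl; ring). ring.
        * intros t _; auto.
      + assert (RtoC s <> 0) by (intros E1; apply RtoC_inj in E1; auto).
        transitivity (/ RtoC s * (RtoC s * CI (G s) 0 (2 * PI)))%C. field; auto. rewrite E. ring. }
  rewrite (CI_ext _ (fun t => F (p 1 t) * k t)%C).
  2:{ intros t _. unfold p. f_equal. f_equal. ring. }
  rewrite <- N. rewrite (CI_ext _ (fun t => F a * k t)%C).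
  2:{ intros t _. unfold p. f_equal. f_equal. ring. }
  rewrite CI_scal by (intros t _; auto). unfold k. rewrite winding by auto. ring.
Qed.

Lemma CI_quad_CDer (F : C -> R -> C) (G : R -> C) (a b : R) (z : C) (r K : R) : 0 < r -> a <= b ->
  (forall h, Cmod h < r -> contI (F (z + h)%C) a b) -> contI G a b ->
  (forall h t, Cmod h < r -> a <= t <= b -> Cmod (F (z + h)%C t - F z t - h * G t) <= K * (Cmod h * Cmod h)) ->
  CDer (fun z => CI (F z) a b) z (CI G a b).
Proof.
  intros Hr Hab HF HG H. apply (quad_CDer _ _ _ r (K * (b - a))); auto.
  intros h Hh.
  assert (Fz : contI (F z) a b) by (replace z with (z + RtoC 0)%C by ring; apply HF; rewrite Cmod_0; auto).
  replace (CI (F (z + h)%C) a b - CI (F z) a b - CI G a b * h)%C with (CI (fun t => F (z + h)%C t - F z t - h * G t)%C a b).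
  - replace (K * (b - a) * (Cmod h * Cmod h)) with (K * (Cmod h * Cmod h) * (b - a)) by ring.
    apply CI_bound; auto. intros t Ht. apply Cont_minus. apply Cont_minus. apply HF; auto. apply Fz; auto.
    apply Cont_mult. apply Cont_const. apply HG; auto.
  - rewrite CI_minus, CI_minus, CI_scal; auto. ring.
    intros t Ht. apply Cont_minus. apply HF; auto. apply Fz; auto. apply contI_scal; auto.
Qed.

Lemma contI_bounded g a b : a <= b -> contI g a b -> exists M, 0 <= M /\ forall t, a <= t <= b -> Cmod (g t) <= M.
Proof.
  intros Hab H.
  destruct (continuity_ab_maj (fun t => Cmod (g t)) a b Hab) as [m [Hm _]].
  - intros t Ht. apply continuity_pt_filterlim.
    apply (RCont_Re_continuous (fun t => RtoC (Cmod (g t)))). apply Cont_mod. apply H. rewrite Rmin_left, Rmax_right; auto.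
  - exists (Cmod (g m)). split. apply Cmod_ge_0. auto.
Qed.

Section CauchyType.
Variables (c : C) (r : R) (psi : R -> C).
Hypothesis Hpsi : forall t, RCont psi t.

Let cont_k n a : Cmod (a - c) < r -> contI (fun t => psi t / (circ c r t - a) ^ n)%C 0 (2 * PI).
Proof.
  intros Ha t _. apply Cont_div; auto.
  - induction n; simpl. apply Cont_const. apply Cont_mult; auto. apply Cont_minus. apply RCont_circ. apply Cont_const.
  - apply Cpow_nz, circ_sub_nz; auto.
Qed.

Let low a h t : Cmod (a - c) < r -> Cmod h < (r - Cmod (a - c)) / 2 ->
  Cmod (a + h - c) < r /\ r - Cmod (a - c) <= Cmod (circ c r t - a) /\ (r - Cmod (a - c)) / 2 <= Cmod (circ c r t - (a + h)).
Proof.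
  intros Ha Hh. assert (Hr : 0 <= r) by (generalize (Cmod_ge_0 (a - c)); lra).
  assert (M := circ_mod c r t Hr).
  assert (L : r - Cmod (a - c) <= Cmod (circ c r t - a)).
  { generalize (Cmod_sub_tri (circ c r t) a c). lra. }
  split; [|split]; auto.
  - replace (a + h - c)%C with ((a - c) + h)%C by ring. generalize (Cmod_triangle (a - c) h). lra.
  - generalize (Cmod_triangle (circ c r t - (a + h)) h). replace (circ c r t - (a + h) + h)%C with (circ c r t - a)%C by ring. lra.
Qed.

(** The remainder of 1 / (u - h) after its linear part is exactly h^2 / (u^2 (u - h)), and both
    denominators stay away from 0 uniformly on the circle. *)
Lemma cauchy_type_der1 a : Cmod (a - c) < r ->
  CDer (fun a => CI (fun t => psi t / (circ c r t - a))%C 0 (2 * PI)) a (CI (fun t => psi t / (circ c r t - a) ^ 2)%C 0 (2 * PI)).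
Proof.
  intros Ha. set (d := r - Cmod (a - c)). assert (Hd : 0 < d) by (unfold d; lra).
  destruct (contI_bounded psi 0 (2 * PI)) as [M [HM0 HM]]. generalize two_PI_pos; lra. intros t _; auto.
  apply (CI_quad_CDer (fun a t => psi t / (circ c r t - a))%C _ 0 (2 * PI) a (d / 2) (M * (/ d * / d * (2 * / d)))).
  - lra.
  - generalize two_PI_pos; lra.
  - intros h Hh. destruct (low a h 0 Ha Hh) as [L _].
    assert (K := cont_k 1 _ L). intros t Ht. specialize (K t Ht).
    apply (Cont_ext_loc RtoC (fun t => psi t / (circ c r t - (a + h)) ^ 1)%C _ t 1); auto. lra.
    intros; rewrite Cpow_1_r; auto. rewrite Cpow_1_r; auto.
  - apply cont_k; auto.
  - intros h t Hh Ht. destruct (low a h t Ha Hh) as [L1 [L2 L3]]. fold d in L2, L3.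
    assert (N1 := circ_sub_nz c r a t Ha). assert (N2 := circ_sub_nz c r _ t L1).
    set (u := (circ c r t - a)%C) in *. set (v := (circ c r t - (a + h))%C) in *.
    assert (E : (v = u - h)%C) by (unfold u, v; ring).
    replace (psi t / v - psi t / u - h * (psi t / u ^ 2))%C with (psi t * (/ u * / u * / v) * (h * h))%C.
    2:{ rewrite E in *. simpl. field. split; auto. }
    rewrite !Cmod_mult, !Cmod_inv by auto.
    apply Rmult_le_compat_r. apply Rmult_le_pos; apply Cmod_ge_0.
    apply Rmult_le_compat; auto. apply Cmod_ge_0.
    apply Rmult_le_pos. apply Rmult_le_pos. 1-3: apply Rlt_le, Rinv_0_lt_compat; lra.
    apply Rmult_le_compat. apply Rmult_le_pos. 1-3: apply Rlt_le, Rinv_0_lt_compat; lra.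
    apply Rmult_le_compat. 1-2: apply Rlt_le, Rinv_0_lt_compat; lra. 1-2: apply Rinv_le_contravar; lra.
    replace (2 * / d) with (/ (d / 2)) by (field; lra). apply Rinv_le_contravar; lra.
Qed.

Lemma cauchy_type_der2 a : Cmod (a - c) < r ->
  CDer (fun a => CI (fun t => psi t / (circ c r t - a) ^ 2)%C 0 (2 * PI)) a (CI (fun t => RtoC 2 * (psi t / (circ c r t - a) ^ 3))%C 0 (2 * PI)).
Proof.
  intros Ha. set (d := r - Cmod (a - c)). assert (Hd : 0 < d) by (unfold d; lra).
  destruct (contI_bounded psi 0 (2 * PI)) as [M [HM0 HM]]. generalize two_PI_pos; lra. intros t _; auto.
  apply (CI_quad_CDer (fun a t => psi t / (circ c r t - a) ^ 2)%C _ 0 (2 * PI) a (d / 2)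
    (M * (3 * (/ d * / d * ((2 * / d) * (2 * / d))) + d * (/ d * / d * / d * ((2 * / d) * (2 * / d)))))).
  - lra.
  - generalize two_PI_pos; lra.
  - intros h Hh. destruct (low a h 0 Ha Hh) as [L _]. apply cont_k; auto.
  - apply contI_scal, cont_k; auto.
  - intros h t Hh Ht. destruct (low a h t Ha Hh) as [L1 [L2 L3]]. fold d in L2, L3.
    assert (N1 := circ_sub_nz c r a t Ha). assert (N2 := circ_sub_nz c r _ t L1).
    set (u := (circ c r t - a)%C) in *. set (v := (circ c r t - (a + h))%C) in *.
    assert (E : (v = u - h)%C) by (unfold u, v; ring).
    replace (psi t / v ^ 2 - psi t / u ^ 2 - h * (RtoC 2 * (psi t / u ^ 3)))%C with (psi t * (RtoC 3 * (/ u * / u * (/ v * / v)) - RtoC 2 * h * (/ u * / u * / u * (/ v * / v))) * (h * h))%C.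
    2:{ rewrite E in *. simpl. field. split; auto. }
    rewrite Cmod_mult, (Cmod_mult h h), Cmod_mult.
    apply Rmult_le_compat_r. apply Rmult_le_pos; apply Cmod_ge_0.
    apply Rmult_le_compat; auto; try apply Cmod_ge_0.
    assert (Iu : 0 <= / Cmod u <= / d) by (split; [apply Rlt_le, Rinv_0_lt_compat; lra|apply Rinv_le_contravar; lra]).
    assert (Iv : 0 <= / Cmod v <= 2 * / d).
    { split; [apply Rlt_le, Rinv_0_lt_compat; lra|]. replace (2 * / d) with (/ (d / 2)) by (field; lra). apply Rinv_le_contravar; lra. }
    unfold Cminus. eapply Rle_trans; [apply Cmod_triangle|]. rewrite Cmod_opp, !Cmod_mult, !Cmod_inv, !Cmod_R by auto.
    rewrite !Rabs_pos_eq by lra.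
    assert (Id : 0 <= / d) by (apply Rlt_le, Rinv_0_lt_compat; lra).
    assert (Huu : 0 <= / Cmod u * / Cmod u <= / d * / d) by (split; [apply Rmult_le_pos; lra|apply Rmult_le_compat; lra]).
    assert (Hvv : 0 <= / Cmod v * / Cmod v <= 2 * / d * (2 * / d)) by (split; [apply Rmult_le_pos; lra|apply Rmult_le_compat; lra]).
    assert (Huuu : 0 <= / Cmod u * / Cmod u * / Cmod u <= / d * / d * / d) by (split; [apply Rmult_le_pos; lra|apply Rmult_le_compat; lra]).
    apply Rplus_le_compat.
    + apply Rmult_le_compat_l. lra. apply Rmult_le_compat; lra.
    + generalize (Cmod_ge_0 h); intros Hh0. apply Rmult_le_compat. lra. apply Rmult_le_pos; lra. lra. apply Rmult_le_compat; lra.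
Qed.

(** This gives continuity of the derivative of a holomorphic function, so that [cauchy_C1] applies
    to the function itself and not only to its primitive. *)
Lemma cauchy_type_cont3 a : Cmod (a - c) < r ->
  CCont (fun a => CI (fun t => RtoC 2 * (psi t / (circ c r t - a) ^ 3))%C 0 (2 * PI)) a.
Proof.
  intros Ha. set (d := r - Cmod (a - c)). assert (Hd : 0 < d) by (unfold d; lra).
  destruct (contI_bounded psi 0 (2 * PI)) as [M [HM0 HM]]. generalize two_PI_pos; lra. intros t _; auto.
  set (q := 2 * / d). set (K := 2 * M * (3 * (q * q * q * q)) * (2 * PI)).
  assert (Hid := Rinv_0_lt_compat d Hd). assert (Hq : 0 <= q) by (unfold q; lra).
  assert (HK : 0 <= K).
  { unfold K. assert (T := two_PI_pos). assert (0 <= q * q * q * q) by (apply Rmult_le_pos; [apply Rmult_le_pos; [apply Rmult_le_pos|]|]; exact Hq). apply Rmult_le_pos; [apply Rmult_le_pos|]; lra. }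
  assert (Hb : forall h, Cmod h < d / 2 -> Cmod (CI (fun t => RtoC 2 * (psi t / (circ c r t - (a + h)) ^ 3))%C 0 (2 * PI) -
     CI (fun t => RtoC 2 * (psi t / (circ c r t - a) ^ 3))%C 0 (2 * PI)) <= K * Cmod h).
  { intros h Hh. destruct (low a h 0 Ha Hh) as [L _].
    rewrite <- CI_minus by (apply contI_scal, cont_k; auto).
    replace (K * Cmod h) with ((2 * M * (3 * (q * q * q * q)) * Cmod h) * (2 * PI - 0)) by (unfold K; ring).
    apply CI_bound. generalize two_PI_pos; lra.
    { intros t Ht. apply Cont_minus; apply (contI_scal _ _ 0 (2 * PI)); auto; apply cont_k; auto. }
    intros t Ht. destruct (low a h t Ha Hh) as [L1 [L2 L3]]. fold d in L2, L3.
    assert (N1 := circ_sub_nz c r a t Ha). assert (N2 := circ_sub_nz c r _ t L1).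
    set (u := (circ c r t - a)%C) in *. set (v := (circ c r t - (a + h))%C) in *.
    assert (E : (v = u - h)%C) by (unfold u, v; ring).
    replace (RtoC 2 * (psi t / v ^ 3) - RtoC 2 * (psi t / u ^ 3))%C with
      (RtoC 2 * psi t * (/ u * / v * / v * / v + / u * / u * / v * / v + / u * / u * / u * / v) * h)%C.
    2:{ rewrite E in *. simpl. field. split; auto. }
    assert (Iv : 0 <= / Cmod v <= q).
    { split; [apply Rlt_le, Rinv_0_lt_compat; lra|]. unfold q. replace (2 * / d) with (/ (d / 2)) by (field; lra). apply Rinv_le_contravar; lra. }
    assert (Iu : 0 <= / Cmod u <= q).
    { split; [apply Rlt_le, Rinv_0_lt_compat; lra|]. unfold q. replace (2 * / d) with (/ (d / 2)) by (field; lra). apply Rinv_le_contravar; lra. }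
    rewrite (Cmod_mult _ h). apply Rmult_le_compat_r. apply Cmod_ge_0.
    rewrite (Cmod_mult (RtoC 2 * psi t)), (Cmod_mult (RtoC 2)), Cmod_R, Rabs_pos_eq by lra.
    assert (Q : forall x y z w, 0 <= x <= q -> 0 <= y <= q -> 0 <= z <= q -> 0 <= w <= q -> x * y * z * w <= q * q * q * q).
    { intros x y z w Hx Hy Hz Hw. apply Rmult_le_compat; try lra. repeat apply Rmult_le_pos; lra.
      apply Rmult_le_compat; try lra. repeat apply Rmult_le_pos; lra. apply Rmult_le_compat; lra. }
    apply Rmult_le_compat. generalize (Cmod_ge_0 (psi t)); lra. apply Cmod_ge_0. generalize (HM t Ht); lra.
    eapply Rle_trans; [apply Cmod_triangle|]. eapply Rle_trans; [apply Rplus_le_compat_r, Cmod_triangle|].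
    rewrite !Cmod_mult, !Cmod_inv by auto.
    assert (Q1 := Q _ _ _ _ Iu Iv Iv Iv). assert (Q2 := Q _ _ _ _ Iu Iu Iv Iv). assert (Q3 := Q _ _ _ _ Iu Iu Iu Iv). lra. }
  intros eps He. exists (Rmin (d / 2) (eps / (K + 1))). split. apply Rmin_glb_lt. lra. apply Rdiv_lt_0_compat; lra.
  intros s Hs. assert (Hs1 := Rlt_le_trans _ _ _ Hs (Rmin_l _ _)). assert (Hs2 := Rlt_le_trans _ _ _ Hs (Rmin_r _ _)).
  specialize (Hb (s - a)%C Hs1). replace (a + (s - a))%C with s in Hb by ring.
  eapply Rle_lt_trans. apply Hb.
  apply Rle_lt_trans with ((K + 1) * Cmod (s - a)). generalize (Cmod_ge_0 (s - a)); nra.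
  apply Rmult_lt_compat_l with (r := K + 1) in Hs2; [|lra]. unfold Rdiv in Hs2.
  replace ((K + 1) * (eps * / (K + 1))) with eps in Hs2 by (field; lra). auto.
Qed.
End CauchyType.

Lemma CDer_unique f z d e : CDer f z d -> CDer f z e -> d = e.
Proof.
  intros H K. apply Ceq_minus, Cmod_eq_0. apply Rle_antisym; [|apply Cmod_ge_0].
  apply le_epsilon. intros eps He.
  destruct (Der_dom _ _ _ _ H (eps/2) ltac:(lra)) as [d1 [P1 Q1]].
  destruct (Der_dom _ _ _ _ K (eps/2) ltac:(lra)) as [d2 [P2 Q2]].
  set (m := Rmin d1 d2 / 2). assert (Hm : 0 < m) by (unfold m; generalize (Rmin_glb_lt _ _ _ P1 P2); lra).
  set (s := (z + RtoC m)%C). assert (Es : (s - z)%C = RtoC m) by (unfold s; ring).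
  assert (Ms : Cmod (s - z) = m) by (rewrite Es, Cmod_R, Rabs_pos_eq; lra).
  specialize (Q1 s). specialize (Q2 s). rewrite Ms in Q1, Q2.
  assert (L1 : m < d1) by (unfold m; generalize (Rmin_l d1 d2) (Rmin_glb_lt _ _ _ P1 P2); lra).
  assert (L2 : m < d2) by (unfold m; generalize (Rmin_r d1 d2) (Rmin_glb_lt _ _ _ P1 P2); lra).
  specialize (Q1 L1). specialize (Q2 L2). rewrite Es in *.
  assert (Cmod ((d - e) * RtoC m) <= eps * m).
  { replace ((d - e) * RtoC m)%C with ((f s - f z - e * RtoC m) - (f s - f z - d * RtoC m))%C by ring.
    unfold Cminus at 1. eapply Rle_trans; [apply Cmod_triangle|]. rewrite Cmod_opp. lra. }
  rewrite Cmod_mult, Cmod_R, Rabs_pos_eq in H0 by lra. apply Rmult_le_reg_r with m; auto. lra.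
Qed.

Lemma hol_sub (D E : C -> Prop) f : (forall z, D z -> E z) -> hol E f -> hol D f.
Proof. intros H K z Hz. auto. Qed.

Lemma disc_mem c r : 0 < r -> disc c r c.
Proof. intros H. unfold disc. replace (c - c)%C with (RtoC 0) by ring. rewrite Cmod_0; auto. Qed.

Lemma two_PI_nz : RtoC (2 * PI) <> 0.
Proof. intros E; apply RtoC_inj in E; generalize two_PI_pos; lra. Qed.

(** Cauchy's formula for F on a slightly larger circle, differentiated once, presents F' near a as
    an integral that can be differentiated again. *)
Lemma C1_der_kernel c R0 F F' a : (forall z, disc c R0 z -> CDer F z (F' z)) -> (forall z, disc c R0 z -> CCont F' z) -> disc c R0 a ->
  exists r psi e, 0 < r /\ (forall t, RCont psi t) /\ 0 < e /\ forall b, Cmod (b - a) < e -> disc c R0 b /\ Cmod (b - c) < r /\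
    F' b = CI (fun t => psi t / (circ c r t - b) ^ 2)%C 0 (2 * PI).
Proof.
  intros HF HF' Ha. unfold disc in Ha.
  set (r := (Cmod (a - c) + R0) / 2). assert (Hr : Cmod (a - c) < r < R0) by (unfold r; lra).
  assert (Hr0 : 0 < r) by (generalize (Cmod_ge_0 (a - c)); lra).
  set (psi := fun t => (/ RtoC (2 * PI) * (F (circ c r t) * (RtoC r * cis t)))%C).
  assert (Cin : forall t, disc c R0 (circ c r t)) by (intros t; unfold disc; rewrite circ_mod; lra).
  assert (Hpsi : forall t, RCont psi t).
  { intros t. unfold psi. apply Cont_mult. apply Cont_const. apply Cont_mult. apply Cont_comp. eapply Der_Cont. apply HF; auto. apply RCont_circ.
    apply Cont_mult. apply Cont_const. apply RCont_cis. }
  assert (F0 : forall b, Cmod (b - c) < r -> F b = CI (fun t => psi t / (circ c r t - b))%C 0 (2 * PI)).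
  { intros b Hb. assert (K := cauchy_C1 F F' c R0 r b HF HF' Hb (proj2 Hr)).
    transitivity (/ RtoC (2 * PI) * (RtoC (2 * PI) * F b))%C. field; apply two_PI_nz. rewrite <- K.
    rewrite <- CI_scal. apply CI_ext. intros t _. unfold psi, Cdiv. ring.
    intros t _. apply Cont_mult. apply Cont_comp. eapply Der_Cont. apply HF; auto. apply RCont_circ.
    apply Cont_div. apply Cont_mult. apply Cont_const. apply RCont_cis. apply Cont_minus. apply RCont_circ. apply Cont_const. apply circ_sub_nz; auto. }
  assert (Nb : forall b, Cmod (b - c) < r -> exists e, 0 < e /\ forall s, Cmod (s - b) < e -> Cmod (s - c) < r).
  { intros b Hb. exists (r - Cmod (b - c)). split. lra. intros s Hs. generalize (Cmod_sub_tri s b c). lra. }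
  assert (F1 : forall b, Cmod (b - c) < r -> F' b = CI (fun t => psi t / (circ c r t - b) ^ 2)%C 0 (2 * PI)).
  { intros b Hb. apply (CDer_unique F b). apply HF. unfold disc; lra.
    destruct (Nb b Hb) as [e [Pe Qe]].
    apply (Der_ext_loc _ (fun b => CI (fun t => psi t / (circ c r t - b))%C 0 (2 * PI)) F b _ e Pe).
    intros s Hs. symmetry; apply F0; auto. apply cauchy_type_der1; auto. }
  destruct (Nb a (proj1 Hr)) as [e [Pe Qe]]. exists r, psi, e. split; [auto|]. split; [auto|]. split; [auto|].
  intros b Hb. specialize (Qe b Hb). split. unfold disc; lra. split. exact Qe. apply F1, Qe.
Qed.

Lemma C1_C2 c R0 F F' : (forall z, disc c R0 z -> CDer F z (F' z)) -> (forall z, disc c R0 z -> CCont F' z) ->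
  forall z, disc c R0 z -> exists d, CDer F' z d.
Proof.
  intros HF HF' a Ha. destruct (C1_der_kernel c R0 F F' a HF HF' Ha) as [r [psi [e [Hr [Hpsi [Pe Q]]]]]].
  eexists. eapply (Der_ext_loc _ (fun b => CI (fun t => psi t / (circ c r t - b) ^ 2)%C 0 (2 * PI)) F' a _ e Pe).
  intros s Hs. symmetry; apply Q; auto.
  apply cauchy_type_der2; auto. apply Q. replace (a - a)%C with (RtoC 0) by ring. rewrite Cmod_0; auto.
Qed.

Definition deriv (f : C -> C) (z : C) : C := epsilon (inhabits (RtoC 0)) (fun d => CDer f z d).

Lemma deriv_spec (D : C -> Prop) f z : hol D f -> D z -> CDer f z (deriv f z).
Proof. intros H Hz. exact (epsilon_spec (inhabits (RtoC 0)) (fun d => CDer f z d) (H z Hz)). Qed.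

(** Here the gap between Goursat's differentiability and C^1 is closed: a primitive has the
    continuous derivative f, so Cauchy's formula for the primitive represents both f and its
    derivative by integrals. *)
Lemma hol_deriv_Cont c R0 f : hol (disc c R0) f -> forall z, disc c R0 z -> CCont (deriv f) z.
Proof.
  intros Hf a Ha.
  destruct (primitive _ f (disc_convex c R0) (disc_open c R0)) as [P HP]; eauto.
  destruct (C1_der_kernel c R0 P f a HP (fun z Hz => hol_Cont _ _ _ Hf Hz) Ha) as [r [psi [e [Hr [Hpsi [Pe Q]]]]]].
  assert (F2 : forall b, Cmod (b - a) < e -> deriv f b = CI (fun t => RtoC 2 * (psi t / (circ c r t - b) ^ 3))%C 0 (2 * PI)).
  { intros b Hb. destruct (Q b Hb) as [Q1 [Q2 _]]. apply (CDer_unique f b). apply (deriv_spec (disc c R0)); auto.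
    apply (Der_ext_loc _ (fun b => CI (fun t => psi t / (circ c r t - b) ^ 2)%C 0 (2 * PI)) f b _ (e - Cmod (b - a)) ltac:(lra)).
    intros s Hs. symmetry; apply Q. generalize (Cmod_sub_tri s b a). lra. apply cauchy_type_der2; auto. }
  assert (A0 : Cmod (a - a) < e) by (replace (a - a)%C with (RtoC 0) by ring; rewrite Cmod_0; auto).
  apply (Cont_ext_loc _ (fun b => CI (fun t => RtoC 2 * (psi t / (circ c r t - b) ^ 3))%C 0 (2 * PI)) _ a e Pe).
  - intros s Hs. symmetry; apply F2; exact Hs.
  - symmetry. apply F2; auto.
  - apply cauchy_type_cont3; auto. apply Q; auto.
Qed.

Lemma hol_deriv (D : C -> Prop) f : open_set D -> hol D f -> hol D (deriv f).
Proof.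
  intros Ho Hf z Hz. destruct (Ho z Hz) as [r [Pr Hr]].
  assert (Hd : hol (disc z r) f) by (eapply hol_sub; [|exact Hf]; exact Hr).
  apply (C1_C2 z r f (deriv f)).
  - intros w Hw. apply (deriv_spec (disc z r)); auto.
  - apply hol_deriv_Cont; auto.
  - apply disc_mem; auto.
Qed.

Lemma cauchy_circle f c R0 r a : hol (disc c R0) f -> Cmod (a - c) < r -> r < R0 ->
  CI (fun t => f (circ c r t) * (RtoC r * cis t / (circ c r t - a)))%C 0 (2 * PI) = (RtoC (2 * PI) * f a)%C.
Proof.
  intros Hf. apply (cauchy_C1 f (deriv f) c R0).
  - intros z Hz. apply (deriv_spec (disc c R0)); auto.
  - apply hol_deriv_Cont; auto.
Qed.

Lemma cauchy_mean f R0 r : hol (disc 0 R0) f -> 0 < r < R0 ->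
  CI (fun t => f (circ 0 r t)) 0 (2 * PI) = (RtoC (2 * PI) * f (RtoC 0))%C.
Proof.
  intros Hf Hr. rewrite <- (cauchy_circle f 0 R0 r 0); auto; try lra.
  - apply CI_ext. intros t _. unfold circ. assert (cis t <> 0) by apply cis_nz.
    assert (RtoC r <> 0) by (intros E; apply RtoC_inj in E; lra).
    replace (RtoC 0 + RtoC r * cis t - RtoC 0)%C with (RtoC r * cis t)%C by ring. field; auto.
  - replace (RtoC 0 - RtoC 0)%C with (RtoC 0) by ring. rewrite Cmod_0. lra.
Qed.

Lemma cauchy_bound f c R0 r a M : hol (disc c R0) f -> Cmod (a - c) < r -> r < R0 ->
  (forall t, Cmod (f (circ c r t)) <= M) -> Cmod (f a) <= M * r / (r - Cmod (a - c)).
Proof.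
  intros Hf Ha Hr HM. assert (Hr0 : 0 < r) by (generalize (Cmod_ge_0 (a - c)); lra).
  assert (HM0 : 0 <= M) by (eapply Rle_trans; [apply Cmod_ge_0|apply (HM 0)]).
  assert (E := cauchy_circle f c R0 r a Hf Ha Hr).
  assert (B : Cmod (RtoC (2 * PI) * f a) <= M * (r / (r - Cmod (a - c))) * (2 * PI - 0)).
  { rewrite <- E. apply CI_bound. generalize two_PI_pos; lra.
    - intros t _. apply Cont_mult. apply Cont_comp. eapply hol_Cont; eauto. unfold disc; rewrite circ_mod; lra. apply RCont_circ.
      apply Cont_div. apply Cont_mult. apply Cont_const. apply RCont_cis. apply Cont_minus. apply RCont_circ. apply Cont_const. apply circ_sub_nz; auto.
    - intros t _. rewrite Cmod_mult. apply Rmult_le_compat; auto; try apply Cmod_ge_0.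
      rewrite Cmod_div, Cmod_mult, Cmod_cis, Cmod_R, Rabs_pos_eq by (try apply circ_sub_nz; auto; lra).
      rewrite Rmult_1_r. apply Rmult_le_compat_l. lra. apply Rinv_le_contravar. lra.
      generalize (Cmod_sub_tri (circ c r t) a c). rewrite circ_mod; lra. }
  rewrite Cmod_mult, Cmod_R, Rabs_pos_eq in B by (generalize two_PI_pos; lra).
  apply Rmult_le_reg_l with (2 * PI). apply two_PI_pos.
  replace (2 * PI * (M * r / (r - Cmod (a - c)))) with (M * (r / (r - Cmod (a - c))) * (2 * PI - 0)); auto. field. lra.
Qed.

(** Removable singularity of the difference quotient: off a it agrees near a with a Cauchy-type
    integral, which is holomorphic at a and supplies the missing value. *)
Lemma hol_quot (D : C -> Prop) f a : open_set D -> hol D f -> D a ->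
  exists q, hol D q /\ forall z, D z -> (f z - f a = (z - a) * q z)%C.
Proof.
  intros Ho Hf Ha. destruct (Ho a Ha) as [R0 [HR HD]].
  assert (Hd : hol (disc a R0) f) by (eapply hol_sub; [|exact Hf]; exact HD).
  set (r := R0 / 2). assert (Hr : 0 < r < R0) by (unfold r; lra).
  set (psi := fun t => (/ RtoC (2 * PI) * f (circ a r t))%C).
  set (Phi := fun z => CI (fun t => psi t / (circ a r t - z))%C 0 (2 * PI)).
  set (q := fun z => if Ceq_dec z a then Phi z else ((f z - f a) / (z - a))%C).
  assert (Cin : forall t, disc a R0 (circ a r t)) by (intros t; unfold disc; rewrite circ_mod; lra).
  assert (Cf : forall t, RCont (fun t => f (circ a r t)) t).
  { intros t. apply Cont_comp. eapply hol_Cont; eauto. apply RCont_circ. }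
  assert (Ea : Cmod (a - a) = 0) by (replace (a - a)%C with (RtoC 0) by ring; apply Cmod_0).
  assert (EP : forall z, Cmod (z - a) < r -> q z = Phi z).
  { intros z Hz. unfold q. destruct (Ceq_dec z a) as [|Hn]; auto.
    assert (Hza : (z - a)%C <> 0) by (intros E; apply Hn, Ceq_minus; auto).
    assert (E1 := cauchy_circle f a R0 r z Hd Hz (proj2 Hr)).
    assert (E2 := cauchy_circle f a R0 r a Hd ltac:(lra) (proj2 Hr)).
    assert (Ck : forall b, Cmod (b - a) < r -> contI (fun t => f (circ a r t) * (RtoC r * cis t / (circ a r t - b)))%C 0 (2 * PI)).
    { intros b Hb t _. apply Cont_mult. auto.
      apply Cont_div. apply Cont_mult. apply Cont_const. apply RCont_cis. apply Cont_minus. apply RCont_circ. apply Cont_const. apply circ_sub_nz; auto. }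
    transitivity ((RtoC (2 * PI) * f z - RtoC (2 * PI) * f a) * / (RtoC (2 * PI) * (z - a)))%C.
    field. split; auto. apply two_PI_nz.
    rewrite <- E1, <- E2, <- CI_minus by (apply Ck; lra).
    rewrite Cmult_comm, <- CI_scal.
    - apply CI_ext. intros t _. unfold psi.
      assert (N1 := circ_sub_nz a r z t Hz).
      assert (cis t <> 0) by apply cis_nz. assert (RtoC r <> 0) by (intros E; apply RtoC_inj in E; lra).
      assert (Ew : (circ a r t - a = RtoC r * cis t)%C) by (unfold circ; ring). rewrite Ew.
      replace (RtoC r * cis t)%C with (circ a r t - a)%C at 1 2 3 by (rewrite Ew; ring).
      assert ((circ a r t - a)%C <> 0) by (rewrite Ew; apply Cmult_neq_0; auto).
      field. repeat split; auto. apply two_PI_nz.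
    - intros t Ht. apply Cont_minus; [apply (Ck z Hz t Ht)|apply (Ck a ltac:(lra) t Ht)]. }
  exists q. split.
  - intros z Hz. destruct (Ceq_dec z a) as [->|Hn].
    + eexists. apply (Der_ext_loc _ Phi q a _ r). lra. intros s Hs; symmetry; apply EP; auto.
      apply cauchy_type_der1. intros t. unfold psi. apply Cont_mult; auto. apply Cont_const. lra.
    + assert (Hza : (z - a)%C <> 0) by (intros E; apply Hn, Ceq_minus; auto).
      destruct (Hf z Hz) as [d Hd']. eexists.
      apply (Der_ext_loc _ (fun z => (f z - f a) / (z - a))%C q z _ (Cmod (z - a))). apply Cmod_gt_0; auto.
      intros s Hs. unfold q. destruct (Ceq_dec s a); auto. subst. rewrite Cmod_sub_sym in Hs. lra.
      apply Der_div. apply Der_minus. exact Hd'. apply Der_const. apply Der_minus. apply Der_id. apply Der_const. auto.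
  - intros z Hz. unfold q. destruct (Ceq_dec z a) as [->|Hn]. ring.
    field. intros E; apply Hn, Ceq_minus; auto.
Qed.

Lemma circ0_mod r t : 0 <= r -> Cmod (circ 0 r t) = r.
Proof. intros H. replace (circ 0 r t) with (circ 0 r t - 0)%C by ring. apply circ_mod; auto. Qed.

(** * Liouville's theorem, polynomial growth and the identity theorem *)

Definition entire f := hol (fun _ => True) f.

Lemma open_True : open_set (fun _ => True).
Proof. intros z _. exists 1. split; auto; lra. Qed.

Lemma entire_disc f c r : entire f -> hol (disc c r) f.
Proof. intros H z _. apply H; auto. Qed.

(** The difference quotient at 0 is entire and at most 2 M / r on the circle of radius r, so it
    vanishes identically. *)
Lemma liouville f M : entire f -> (forall z, Cmod (f z) <= M) -> forall z, f z = f (RtoC 0).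
Proof.
  intros Hf HM z.
  destruct (hol_quot _ f (RtoC 0) open_True Hf I) as [q [Hq Eq]].
  assert (Z : q z = 0).
  { apply Cmod_eq_0. apply Rle_antisym; [|apply Cmod_ge_0]. apply le_epsilon. intros eps He.
    assert (HM0 : 0 <= M) by (eapply Rle_trans; [apply Cmod_ge_0|apply (HM z)]).
    (* Large enough for |z| < r / 2 and 4 M / r <= eps. *)
    set (r := 2 * Cmod z + 1 + 4 * M / eps).
    assert (0 <= M / eps) by (apply Rdiv_le_0_compat; auto).
    assert (Hz0 : 0 <= Cmod z) by apply Cmod_ge_0.
    assert (E0 : Cmod (z - 0) = Cmod z) by (f_equal; ring).
    assert (Hr : 0 < r) by (unfold r; lra).
    assert (Hr2 : Cmod z < r / 2) by (unfold r; lra).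
    eapply Rle_trans. apply (cauchy_bound q 0 (r + 1) r z (2 * M / r)).
    - apply entire_disc; auto.
    - rewrite E0. lra.
    - lra.
    - intros t. set (w := circ 0 r t).
      assert (Ew : Cmod w = r). { apply circ0_mod; lra. }
      assert (w <> 0). { intros E. rewrite E, Cmod_0 in Ew. lra. }
      replace (q w) with ((f w - f (RtoC 0)) / w)%C by (rewrite Eq by auto; field; auto).
      rewrite Cmod_div, Ew by auto. apply Rmult_le_compat_r. apply Rlt_le, Rinv_0_lt_compat; auto.
      unfold Cminus. eapply Rle_trans; [apply Cmod_triangle|]. rewrite Cmod_opp.
      generalize (HM w) (HM (RtoC 0)). lra.
    - rewrite E0. replace (2 * M / r * r) with (2 * M) by (field; lra). rewrite Rplus_0_l.
      apply Rmult_le_reg_r with (r - Cmod z). lra. unfold Rdiv. rewrite Rmult_assoc, Rinv_l by lra.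
      assert (eps * (4 * M / eps) = 4 * M) by (field; lra).
      assert (eps * (r / 2) <= eps * (r - Cmod z)) by (apply Rmult_le_compat_l; lra).
      assert (eps * (4 * M / eps) <= eps * r) by (apply Rmult_le_compat_l; unfold r; lra). lra. }
  assert (E := Eq z I). rewrite Z in E. apply Ceq_minus. rewrite E. ring.
Qed.

Fixpoint Cpoly (l : list C) (z : C) : C :=
  match l with nil => RtoC 0 | cons a l => (a + z * Cpoly l z)%C end.

(** The difference quotient at 0 loses one power of growth. Its bound is immediate for |z| >= 1 and
    comes from Cauchy's formula on |w| = 2 for |z| <= 1. *)
Lemma liouville_poly n : forall f K, entire f -> 0 <= K -> (forall z, Cmod (f z) <= K * (1 + Cmod z) ^ n) ->
  exists l, length l = S n /\ forall z, f z = Cpoly l z.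
Proof.
  induction n; intros f K Hf HK HB.
  - exists (cons (f (RtoC 0)) nil). split; auto. intros z. simpl.
    rewrite (liouville f K Hf) by (intros w; specialize (HB w); simpl in HB; lra). ring.
  - destruct (hol_quot _ f (RtoC 0) open_True Hf I) as [q [Hq Eq]].
    set (F0 := Cmod (f (RtoC 0))).
    assert (HF0 : 0 <= F0) by apply Cmod_ge_0.
    assert (P1 : forall z, 1 <= (1 + Cmod z) ^ n) by (intros z; apply pow_R1_Rle; generalize (Cmod_ge_0 z); lra).
    assert (Out : forall z, 1 <= Cmod z -> Cmod (q z) <= 2 * (K + F0) * (1 + Cmod z) ^ n).
    { intros z Hz. assert (Hn : z <> 0) by (apply Cmod_gt_0; lra).
      replace (q z) with ((f z - f (RtoC 0)) / z)%C by (rewrite Eq by auto; field; auto).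
      rewrite Cmod_div by auto. apply Rmult_le_reg_r with (Cmod z). lra. unfold Rdiv. rewrite Rmult_assoc, Rinv_l by lra.
      rewrite Rmult_1_r. eapply Rle_trans; [apply Cmod_triangle|]. rewrite Cmod_opp. fold F0.
      specialize (HB z). simpl in HB. specialize (P1 z).
      set (p := (1 + Cmod z) ^ n) in *.
      assert (K * ((1 + Cmod z) * p) <= K * (2 * Cmod z * p)) by (apply Rmult_le_compat_l; auto; apply Rmult_le_compat_r; lra).
      assert (F0 <= F0 * (p * Cmod z)).
      { rewrite <- (Rmult_1_r F0) at 1. apply Rmult_le_compat_l; auto. rewrite <- (Rmult_1_r 1). apply Rmult_le_compat; lra. }
      assert (0 <= F0 * (p * Cmod z)) by lra. nra. }
    (* 3 is 1 + |w| on the circle |w| = 2; the last factor bounds 2 / (2 - |z|) for |z| <= 1. *)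
    set (K2 := 2 * (K + F0) * 3 ^ n * 2).
    assert (H3 : 1 <= 3 ^ n) by (apply pow_R1_Rle; lra).
    assert (In : forall z, Cmod z <= 1 -> Cmod (q z) <= K2).
    { intros z Hz. eapply Rle_trans. apply (cauchy_bound q 0 3 2 z (2 * (K + F0) * 3 ^ n)).
      - apply entire_disc; auto.
      - replace (z - RtoC 0)%C with z by ring. lra.
      - lra.
      - intros t. assert (Ew : Cmod (circ 0 2 t) = 2). { apply circ0_mod; lra. }
        eapply Rle_trans. apply Out. lra. rewrite Ew. replace (1 + 2) with 3 by ring. lra.
      - replace (z - RtoC 0)%C with z by ring. unfold K2.
        apply Rmult_le_reg_r with (2 - Cmod z). lra. unfold Rdiv. rewrite Rmult_assoc, Rinv_l by lra.
        generalize (Cmod_ge_0 z); intros. assert (0 <= 2 * (K + F0) * 3 ^ n) by (apply Rmult_le_pos; lra). nra. }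
    assert (HK2 : 0 <= K2) by (unfold K2; apply Rmult_le_pos; [apply Rmult_le_pos|]; lra).
    destruct (IHn q (K2 + 2 * (K + F0)) Hq) as [l [Hl El]].
    + lra.
    + intros z. specialize (P1 z). destruct (Rle_dec 1 (Cmod z)) as [Hz|Hz].
      * eapply Rle_trans. apply Out; auto. apply Rmult_le_compat_r; lra.
      * eapply Rle_trans. apply In; lra. rewrite <- (Rmult_1_r K2). apply Rmult_le_compat; lra.
    + exists (cons (f (RtoC 0)) l). split. simpl; congruence.
      intros z. simpl. rewrite <- El. assert (E := Eq z I). rewrite <- (Cplus_0_r (f z)).
      replace (RtoC 0) with (f (RtoC 0) - f (RtoC 0))%C at 1 by ring.
      transitivity (f (RtoC 0) + (f z - f (RtoC 0)))%C. ring. rewrite E. ring.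
Qed.

Lemma identity_disc k R0 : hol (disc 0 R0) k -> (forall x : R, -R0 < x < R0 -> k (RtoC x) = 0) ->
  forall z, disc 0 R0 z -> k z = 0.
Proof.
  intros Hk H0 a Ha. unfold disc in Ha. replace (a - RtoC 0)%C with a in Ha by ring.
  assert (Ha0 : 0 <= Cmod a) by apply Cmod_ge_0.
  assert (HR : 0 < R0) by lra.
  set (r := (Cmod a + R0) / 2).
  assert (Hr : Cmod a < r < R0) by (unfold r; lra).
  assert (D0 : disc 0 R0 0) by (apply disc_mem; lra).
  (* Division by z preserves vanishing on the real diameter, at 0 itself by continuity. *)
  assert (Q : forall n, exists q, hol (disc 0 R0) q /\ (forall x : R, -R0 < x < R0 -> q (RtoC x) = 0) /\ forall z, disc 0 R0 z -> (k z = z ^ n * q z)%C).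
  { induction n as [|n [q [Hq [Zq Eq]]]].
    - exists k. split; [|split]; auto. intros; simpl; ring.
    - destruct (hol_quot _ q 0 (disc_open 0 R0) Hq D0) as [q' [Hq' Eq']].
      assert (Dx : forall x, -R0 < x < R0 -> disc 0 R0 (RtoC x)).
      { intros x Hx. unfold disc. rewrite Cmod_RR, Rminus_0_r. apply Rabs_def1; lra. }
      assert (Nz : forall x, -R0 < x < R0 -> x <> 0 -> q' (RtoC x) = 0).
      { intros x Hx Hn. assert (E := Eq' _ (Dx x Hx)). rewrite !Zq in E by lra.
        assert (RtoC x <> 0) by (intros E'; apply RtoC_inj in E'; auto).
        transitivity (/ RtoC x * ((RtoC x - RtoC 0) * q' (RtoC x)))%C. field; auto. rewrite <- E. ring. }
      exists q'. split; [|split]; auto.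
      + intros x Hx. destruct (Req_dec x 0) as [->|]; auto.
        apply Cmod_eq_0. apply Rle_antisym; [|apply Cmod_ge_0]. apply le_epsilon. intros eps He.
        destruct (hol_Cont _ _ _ Hq' D0 eps He) as [del [Pd Qd]].
        set (y := Rmin del R0 / 2). assert (Hy : 0 < y < del /\ y < R0).
        { unfold y. generalize (Rmin_l del R0) (Rmin_r del R0) (Rmin_glb_lt _ _ _ Pd HR). lra. }
        specialize (Qd (RtoC y)). rewrite Cmod_RR, Rminus_0_r, Rabs_pos_eq in Qd by lra.
        specialize (Qd (proj2 (proj1 Hy))). rewrite Nz in Qd by lra.
        rewrite Cmod_sub_sym in Qd. replace (q' (RtoC 0) - RtoC 0)%C with (q' (RtoC 0)) in Qd by ring. lra.
      + intros z Hz. rewrite Eq by auto. assert (E := Eq' z Hz). rewrite (Zq 0) in E by lra.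
        rewrite Cpow_S. replace (q z) with (q z - RtoC 0)%C by ring. rewrite E. ring. }
  destruct (contI_bounded (fun t => k (circ 0 r t)) 0 (2 * PI)) as [M [HM0 HM]].
  { generalize two_PI_pos; lra. }
  { intros t _. apply Cont_comp. eapply hol_Cont; eauto. unfold disc; rewrite circ_mod; lra. apply RCont_circ. }
  (* k is divisible by every power z^n, which gives a bound that tends to 0 with n *)
  assert (B : forall n, Cmod (k a) <= (Cmod a / r) ^ n * (M * r / (r - Cmod a))).
  { intros n. destruct (Q n) as [q [Hq [_ Eq]]].
    assert (Hac : Cmod (a - 0) < r) by (replace (a - RtoC 0)%C with a by ring; lra).
    assert (E := cauchy_circle q 0 R0 r a Hq Hac (proj2 Hr)).
    assert (Pr : 0 < r ^ n) by (apply pow_lt; lra).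
    assert (Bq : Cmod (RtoC (2 * PI) * q a) <= (M / r ^ n) * (r / (r - Cmod a)) * (2 * PI - 0)).
    { rewrite <- E. apply CI_bound. generalize two_PI_pos; lra.
      - intros t _. apply Cont_mult. apply Cont_comp. eapply hol_Cont; eauto. unfold disc; rewrite circ_mod; lra. apply RCont_circ.
        apply Cont_div. apply Cont_mult. apply Cont_const. apply RCont_cis. apply Cont_minus. apply RCont_circ. apply Cont_const. apply circ_sub_nz; auto.
      - intros t Ht. rewrite Cmod_mult.
        assert (Ew : Cmod (circ 0 r t) = r). { apply circ0_mod; lra. }
        assert (Ek := Eq (circ 0 r t)). 
        apply Rmult_le_compat; try apply Cmod_ge_0.
        + apply Rmult_le_reg_r with (r ^ n); auto. unfold Rdiv. rewrite Rmult_assoc, Rinv_l, Rmult_1_r by lra.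
          rewrite <- Ew at 2. rewrite <- Cmod_pow, <- Cmod_mult, Cmult_comm, <- Ek. apply HM; auto. unfold disc; rewrite circ_mod; lra.
        + rewrite Cmod_div, Cmod_mult, Cmod_cis, Cmod_R, Rabs_pos_eq by (try apply circ_sub_nz; auto; lra).
          rewrite Rmult_1_r. apply Rmult_le_compat_l. lra. apply Rinv_le_contravar. lra.
          generalize (Cmod_sub_tri (circ 0 r t) a 0). rewrite circ_mod by lra. replace (a - RtoC 0)%C with a by ring. lra. }
    rewrite Cmod_mult, Cmod_R, Rabs_pos_eq in Bq by (generalize two_PI_pos; lra).
    assert (Bq' : Cmod (q a) <= (M / r ^ n) * (r / (r - Cmod a))).
    { apply Rmult_le_reg_l with (2 * PI). apply two_PI_pos. rewrite Rminus_0_r in Bq. lra. }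
    rewrite Eq by (unfold disc; lra). rewrite Cmod_mult, Cmod_pow.
    replace ((Cmod a / r) ^ n * (M * r / (r - Cmod a))) with (Cmod a ^ n * ((M / r ^ n) * (r / (r - Cmod a)))).
    apply Rmult_le_compat_l; auto. apply pow_le; auto.
    assert (Ep : (Cmod a / r) ^ n = Cmod a ^ n * / r ^ n) by (unfold Rdiv; rewrite Rpow_mult_distr, pow_inv; ring).
    rewrite Ep. field. split; lra. }
  apply Cmod_eq_0. apply Rle_antisym; [|apply Cmod_ge_0].
  set (X := M * r / (r - Cmod a)) in *.
  assert (HX : 0 <= X) by (unfold X; apply Rdiv_le_0_compat; [apply Rmult_le_pos|]; lra).
  apply le_epsilon. intros eps He.
  assert (Hq1 : Rabs (Cmod a / r) < 1).
  { rewrite Rabs_pos_eq. apply Rmult_lt_reg_r with r. lra. unfold Rdiv; rewrite Rmult_assoc, Rinv_l; lra. apply Rdiv_le_0_compat; lra. }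
  destruct (pow_lt_1_zero _ Hq1 (eps / (X + 1))) as [N HN]. apply Rdiv_lt_0_compat; lra.
  specialize (HN N (Nat.le_refl N)). eapply Rle_trans. apply (B N).
  rewrite Rabs_pos_eq in HN by (apply pow_le, Rdiv_le_0_compat; lra).
  assert ((Cmod a / r) ^ N * X <= eps / (X + 1) * X) by (apply Rmult_le_compat_r; lra).
  assert (eps / (X + 1) * X <= eps).
  { apply Rmult_le_reg_r with (X + 1). lra. replace (eps / (X + 1) * X * (X + 1)) with (eps * X) by (field; lra). nra. }
  lra.
Qed.

(** * The Schwarz formula on the unit circle *)

(** The kernel whose real part is the Poisson kernel at a. *)
Definition schwarz_ker (a : C) (t : R) : C := ((cis t + a) / (cis t - a))%C.

Lemma cis_sub_nz a t : Cmod a < 1 -> (cis t - a)%C <> 0.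
Proof.
  intros H E. apply Ceq_minus in E. assert (M := Cmod_cis t). rewrite E in M. lra.
Qed.

Lemma RCont_schwarz_ker a t : Cmod a < 1 -> RCont (schwarz_ker a) t.
Proof.
  intros H. apply Cont_div. apply Cont_plus. apply RCont_cis. apply Cont_const.
  apply Cont_minus. apply RCont_cis. apply Cont_const. apply cis_sub_nz; auto.
Qed.

Lemma circ01 t : circ 0 1 t = cis t.
Proof. unfold circ. ring. Qed.

Lemma CI_conj g a b : contI g a b -> CI (fun t => Cconj (g t)) a b = Cconj (CI g a b).
Proof.
  intros H. apply Ceq.
  - rewrite re_conj, !CI_Re. apply RInt_ext; intros; apply re_conj.
  - rewrite im_conj, !CI_Im. rewrite <- (RInt_opp (V := R_CompleteNormedModule)) by (apply contI_ex_Im; auto).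
    apply RInt_ext; intros; apply im_conj.
Qed.

Lemma schwarz H R0 a : hol (disc 0 R0) H -> 1 < R0 -> Cmod a < 1 ->
  CI (fun t => RtoC (Re (H (cis t))) * schwarz_ker a t)%C 0 (2 * PI) = (RtoC (2 * PI) * (H a - Ci * RtoC (Im (H (RtoC 0)))))%C.
Proof.
  intros HH HR Ha.
  assert (Hd : forall t, disc 0 R0 (cis t)).
  { intros t. unfold disc. replace (cis t - RtoC 0)%C with (cis t) by ring. rewrite Cmod_cis; auto. }
  assert (CH : forall t, RCont (fun t => H (cis t)) t).
  { intros t. apply Cont_comp. eapply hol_Cont; eauto. apply RCont_cis. }
  assert (Nz : forall t, (cis t - a)%C <> 0) by (intros; apply cis_sub_nz; auto).
  assert (Ck : forall t, RCont (fun t => cis t / (cis t - a))%C t).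
  { intros t. apply Cont_div; auto. apply RCont_cis. apply Cont_minus. apply RCont_cis. apply Cont_const. }
  assert (Ck' : forall t, RCont (fun t => a / (cis t - a))%C t).
  { intros t. apply Cont_div; auto. apply Cont_const. apply Cont_minus. apply RCont_cis. apply Cont_const. }
  assert (E1 : CI (fun t => H (cis t) * (cis t / (cis t - a)))%C 0 (2 * PI) = (RtoC (2 * PI) * H a)%C).
  { rewrite <- (cauchy_circle H 0 R0 1 a); auto.
    - apply CI_ext. intros t _. rewrite circ01. f_equal. unfold Cdiv. ring.
    - replace (a - RtoC 0)%C with a by ring. auto. }
  assert (E0 : CI (fun t => H (cis t)) 0 (2 * PI) = (RtoC (2 * PI) * H (RtoC 0))%C).
  { rewrite <- (cauchy_mean H R0 1); auto; [|lra]. apply CI_ext. intros t _. rewrite circ01. auto. }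
  assert (Hca : Cmod (Cconj a) = Cmod a) by apply Cmod_conj.
  assert (Nz' : forall t, (1 - Cconj a * cis t)%C <> 0).
  { intros t E. apply Ceq_minus in E. assert (M : Cmod (Cconj a * cis t) = 1) by (rewrite <- E; apply Cmod_1).
    rewrite Cmod_mult, Cmod_cis, Hca in M. lra. }
  (* the reflected point 1/conj(a) lies outside the disc *)
  assert (E2 : CI (fun t => H (cis t) * (Cconj a * cis t / (1 - Cconj a * cis t)))%C 0 (2 * PI) = 0).
  { set (g := fun z => (H z * (Cconj a * z / (1 - Cconj a * z)))%C).
    set (R1 := Rmin R0 (2 / (1 + Cmod a))).
    assert (Ha0 := Cmod_ge_0 a).
    assert (HR1 : 1 < R1).
    { apply Rmin_glb_lt; auto. apply Rmult_lt_reg_r with (1 + Cmod a). lra. unfold Rdiv. rewrite Rmult_assoc, Rinv_l; lra. }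
    assert (Hg : hol (disc 0 R1) g).
    { intros z Hz. unfold disc in Hz. replace (z - RtoC 0)%C with z in Hz by ring.
      destruct (HH z) as [d Hd']. { unfold disc. replace (z - RtoC 0)%C with z by ring. eapply Rlt_le_trans; [exact Hz|apply Rmin_l]. }
      assert (N : (1 - Cconj a * z)%C <> 0).
      { intros E. apply Ceq_minus in E. assert (M : Cmod (Cconj a * z) = 1) by (rewrite <- E; apply Cmod_1).
        rewrite Cmod_mult, Hca in M. assert (Hz2 := Rlt_le_trans _ _ _ Hz (Rmin_r _ _)).
        assert (Cmod a * Cmod z <= Cmod a * (2 / (1 + Cmod a))) by (apply Rmult_le_compat_l; lra).
        assert (Cmod a * (2 / (1 + Cmod a)) < 1).
        { apply Rmult_lt_reg_r with (1 + Cmod a). lra. replace (Cmod a * (2 / (1 + Cmod a)) * (1 + Cmod a)) with (2 * Cmod a) by (field; lra). lra. }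
        lra. }
      eexists. apply Der_mult. exact Hd'. apply Der_div. apply Der_scal, Der_id. apply Der_minus. apply Der_const. apply Der_scal, Der_id. auto. }
    rewrite (CI_ext _ (fun t => g (circ 0 1 t))) by (intros; rewrite circ01; reflexivity).
    rewrite (cauchy_mean g R1 1 Hg) by lra. unfold g. unfold Cdiv. ring. }
  assert (E2' : CI (fun t => Cconj (H (cis t)) * (a / (cis t - a)))%C 0 (2 * PI) = 0).
  { rewrite (CI_ext _ (fun t => Cconj (H (cis t) * (Cconj a * cis t / (1 - Cconj a * cis t))))%C).
    - rewrite CI_conj, E2. apply Ceq; unfold Cconj, Re, Im; simpl; ring.
      intros t _. apply Cont_mult; auto. apply Cont_div; auto. apply Cont_mult. apply Cont_const. apply RCont_cis.
      apply Cont_minus. apply Cont_const. apply Cont_mult. apply Cont_const. apply RCont_cis.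
    - intros t _. rewrite Cmult_conj, Cdiv_conj, Cminus_conj, !Cmult_conj, Cconj_conj, cis_conj by auto.
      f_equal. replace (Cconj (RtoC 1)) with (RtoC 1) by (apply Ceq; unfold Cconj, Re, Im; simpl; ring).
      assert (cis t <> 0) by apply cis_nz. specialize (Nz t). 
      field. repeat split; auto. }
  assert (E0' : CI (fun t => Cconj (H (cis t))) 0 (2 * PI) = (RtoC (2 * PI) * Cconj (H (RtoC 0)))%C).
  { rewrite CI_conj, E0 by (intros t _; auto). rewrite Cmult_conj. f_equal. apply Ceq; unfold Cconj, Re, Im; simpl; ring. }
  (* Re H is (H + conj H) / 2. The kernel is 2 cis / (cis - a) - 1 for the half with H and 1 + 2 a /
     (cis - a) for the half with conj H, which leaves the four integrals found above. *)
  rewrite (CI_ext _ (fun t => (H (cis t) * (cis t / (cis t - a)) + RtoC (-1/2) * H (cis t)) + (RtoC (1/2) * Cconj (H (cis t)) + Cconj (H (cis t)) * (a / (cis t - a))))%C).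
  - assert (CHc : forall t, RCont (fun t => Cconj (H (cis t))) t) by (intros; apply Cont_conj; auto).
    rewrite CI_plus, CI_plus, CI_plus, CI_scal, CI_scal, E1, E0, E2', E0'.
    + assert (H2 : RtoC (1/2) = (/ RtoC 2)%C) by (rewrite <- RtoC_inv by lra; f_equal; lra).
      replace (RtoC (-1/2)) with (- / RtoC 2)%C by (rewrite <- H2, <- RtoC_opp; f_equal; lra). rewrite H2.
      replace (Ci * RtoC (Im (H (RtoC 0))))%C with ((H (RtoC 0) - Cconj (H (RtoC 0))) / RtoC 2)%C.
      field. apply Ceq; unfold Cconj, Ci, Re, Im; simpl; field.
    + intros t _; auto.
    + intros t _; auto.
    + intros t _; apply Cont_mult; auto; apply Cont_const.
    + intros t _; apply Cont_mult; auto.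
    + intros t _; apply Cont_mult; auto.
    + intros t _; apply Cont_mult; auto; apply Cont_const.
    + intros t _. apply Cont_plus; apply Cont_mult; auto; apply Cont_const.
    + intros t _. apply Cont_plus; apply Cont_mult; auto; apply Cont_const.
  - intros t _. specialize (Nz t). unfold schwarz_ker.
    rewrite re_alt. assert (H2 : RtoC (1/2) = (/ RtoC 2)%C) by (rewrite <- RtoC_inv by lra; f_equal; lra).
    replace (RtoC (-1/2)) with (- / RtoC 2)%C by (rewrite <- H2, <- RtoC_opp; f_equal; lra). rewrite H2. field. auto.
Qed.

(** * Functions with nonnegative real part: Harnack and Schwarz-Pick inequalities *)

Section Herglotz.
Variables (H : C -> C) (R0 : R).
Hypothesis HH : hol (disc 0 R0) H.
Hypothesis HR : 1 < R0.
Hypothesis Hpos : forall t, 0 <= Re (H (cis t)).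

Let Hd t : disc 0 R0 (cis t).
Proof. unfold disc. replace (cis t - RtoC 0)%C with (cis t) by ring. rewrite Cmod_cis; auto. Qed.

Let CH t : RCont (fun t => H (cis t)) t.
Proof. apply Cont_comp. eapply hol_Cont; eauto. apply RCont_cis. Qed.

Let exH : ex_RInt (fun t => Re (H (cis t))) 0 (2 * PI).
Proof. apply (contI_ex_Re (fun t => H (cis t))). intros t _; auto. Qed.

Let meanH : RInt (fun t => Re (H (cis t))) 0 (2 * PI) = 2 * PI * Re (H (RtoC 0)).
Proof.
  assert (E := cauchy_mean H R0 1 HH ltac:(lra)).
  rewrite <- re_scal_l, <- E, CI_Re. apply RInt_ext. intros. rewrite circ01; auto.
Qed.

Let scalC : forall k a b, ex_RInt k a b -> forall c, RInt (fun t => c * k t) a b = c * RInt k a b.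
Proof. intros k a b Hk c. apply (RInt_scal (V := R_CompleteNormedModule)). auto. Qed.

Let CRH t : RCont (fun t => RtoC (Re (H (cis t)))) t.
Proof. apply (Cont_Re _ (fun t => H (cis t))). auto. Qed.

Lemma Re_schwarz_ker a t : Cmod a < 1 -> Re (schwarz_ker a t) = (1 - Cmod a * Cmod a) * / (Cmod (cis t - a) * Cmod (cis t - a)).
Proof.
  intros Ha. assert (N := cis_sub_nz a t Ha). unfold schwarz_ker. rewrite re_div, !Cmod_sq by auto.
  unfold Rdiv. f_equal. rewrite re_minus, im_minus, re_plus, im_plus.
  assert (E := sin2_cos2 t). unfold Rsqr in E. unfold cis, Re, Im; simpl. lra.
Qed.

Lemma schwarz_Re a : Cmod a < 1 -> RInt (fun t => Re (H (cis t)) * Re (schwarz_ker a t)) 0 (2 * PI) = 2 * PI * Re (H a).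
Proof.
  intros Ha. assert (E := schwarz H R0 a HH HR Ha).
  replace (2 * PI * Re (H a)) with (Re (RtoC (2 * PI) * (H a - Ci * RtoC (Im (H (RtoC 0)))))%C).
  - rewrite <- E, CI_Re. apply RInt_ext. intros. rewrite re_scal_l; auto.
  - rewrite re_scal_l, re_minus. unfold Ci, Re, Im; simpl. ring.
Qed.

Lemma ex_schwarz_Re a : Cmod a < 1 -> ex_RInt (fun t => Re (H (cis t)) * Re (schwarz_ker a t)) 0 (2 * PI).
Proof.
  intros Ha. apply ex_RInt_ext with (fun t => Re (RtoC (Re (H (cis t))) * schwarz_ker a t)%C).
  intros; apply re_scal_l.
  apply (contI_ex_Re (fun t => RtoC (Re (H (cis t))) * schwarz_ker a t)%C).
  intros t _. apply Cont_mult; auto. apply RCont_schwarz_ker; auto.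
Qed.

(** Harnack's inequality: the Poisson kernel is at least (1 - |a|) / (1 + |a|), and the mean of Re H
    is its value at 0. *)
Lemma herglotz_lower a : Cmod a < 1 -> Re (H (RtoC 0)) * ((1 - Cmod a) / (1 + Cmod a)) <= Re (H a).
Proof.
  intros Ha. assert (Ha0 := Cmod_ge_0 a). apply Rmult_le_reg_l with (2 * PI). apply two_PI_pos.
  rewrite <- schwarz_Re by auto.
  replace (2 * PI * (Re (H (RtoC 0)) * ((1 - Cmod a) / (1 + Cmod a)))) with (((1 - Cmod a) / (1 + Cmod a)) * (2 * PI * Re (H (RtoC 0)))) by ring.
  rewrite <- meanH, <- scalC by auto.
  apply RInt_le. generalize two_PI_pos; lra. apply (ex_RInt_scal (V := R_NormedModule)); auto. apply ex_schwarz_Re; auto.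
  intros t _. rewrite Rmult_comm. apply Rmult_le_compat_l; auto. rewrite Re_schwarz_ker by auto.
  assert (U : Cmod (cis t - a) <= 1 + Cmod a).
  { unfold Cminus. eapply Rle_trans; [apply Cmod_triangle|]. rewrite Cmod_opp, Cmod_cis; lra. }
  assert (P : 0 < Cmod (cis t - a)) by (apply Cmod_gt_0, cis_sub_nz; auto).
  replace ((1 - Cmod a) / (1 + Cmod a)) with ((1 - Cmod a * Cmod a) * / ((1 + Cmod a) * (1 + Cmod a))) by (field; lra).
  apply Rmult_le_compat_l. nra. apply Rinv_le_contravar. nra. apply Rmult_le_compat; lra.
Qed.

Lemma herglotz_pos a : Cmod a < 1 -> 0 <= Re (H a).
Proof.
  intros Ha. apply Rmult_le_reg_l with (2 * PI). apply two_PI_pos. rewrite Rmult_0_r.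
  rewrite <- schwarz_Re by auto. apply RInt_ge_0. generalize two_PI_pos; lra. apply ex_schwarz_Re; auto.
  intros t _. apply Rmult_le_pos; auto. rewrite Re_schwarz_ker by auto.
  assert (P : 0 < Cmod (cis t - a)) by (apply Cmod_gt_0, cis_sub_nz; auto). assert (Ha0 := Cmod_ge_0 a).
  apply Rmult_le_pos. nra. apply Rlt_le, Rinv_0_lt_compat. nra.
Qed.

(** The modulus of the Schwarz kernel is at most (1 + |a|) / (1 - |a|). *)
Lemma herglotz_upper a : Cmod a < 1 ->
  Cmod (H a - Ci * RtoC (Im (H (RtoC 0)))) <= Re (H (RtoC 0)) * ((1 + Cmod a) / (1 - Cmod a)).
Proof.
  intros Ha. assert (Ha0 := Cmod_ge_0 a). apply Rmult_le_reg_l with (2 * PI). apply two_PI_pos.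
  assert (E := schwarz H R0 a HH HR Ha).
  rewrite <- (Rabs_pos_eq (2 * PI)) at 1 by (generalize two_PI_pos; lra). rewrite <- Cmod_R, <- Cmod_mult, <- E.
  replace (2 * PI * (Re (H (RtoC 0)) * ((1 + Cmod a) / (1 - Cmod a)))) with (((1 + Cmod a) / (1 - Cmod a)) * (2 * PI * Re (H (RtoC 0)))) by ring.
  rewrite <- meanH, <- scalC by auto.
  assert (Cc : contI (fun t => RtoC (Re (H (cis t))) * schwarz_ker a t)%C 0 (2 * PI)).
  { intros t _. apply Cont_mult; auto. apply RCont_schwarz_ker; auto. }
  eapply Rle_trans. apply CI_mod; auto. generalize two_PI_pos; lra.
  apply RInt_le. generalize two_PI_pos; lra. apply contI_ex_mod; auto. apply (ex_RInt_scal (V := R_NormedModule)); auto.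
  intros t _. rewrite Cmod_mult, Cmod_R, Rabs_pos_eq, Rmult_comm by auto. apply Rmult_le_compat_r; auto.
  assert (N := cis_sub_nz a t Ha). unfold schwarz_ker. rewrite Cmod_div by auto.
  assert (P : 0 < Cmod (cis t - a)) by (apply Cmod_gt_0; auto).
  apply Rmult_le_compat. apply Cmod_ge_0. apply Rlt_le, Rinv_0_lt_compat; auto.
  eapply Rle_trans; [apply Cmod_triangle|]. rewrite Cmod_cis; lra.
  apply Rinv_le_contravar. lra. generalize (Cmod_triangle_inv (cis t) a). rewrite Cmod_cis. lra.
Qed.

(** The Schwarz formula writes H as a constant plus a Cauchy-type integral. In the differentiated
    integral the kernel 2 cis / (cis - a)^2 has modulus 2 / (1 - |a|^2) times the Poisson kernel,
    which integrates Re H back to Re (H a). *)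
Lemma schwarz_pick a d : Cmod a < 1 -> CDer H a d -> Cmod d * (1 - Cmod a * Cmod a) <= 2 * Re (H a).
Proof.
  intros Ha Hda. assert (Ha0 := Cmod_ge_0 a).
  set (psi := fun t => (RtoC (/ PI) * (RtoC (Re (H (cis t))) * cis t))%C).
  assert (Hpsi : forall t, RCont psi t).
  { intros t. apply Cont_mult. apply Cont_const. apply Cont_mult; auto. apply RCont_cis. }
  assert (HPI : RtoC PI <> 0) by (intros E; apply RtoC_inj in E; generalize PI_RGT_0; lra).
  assert (H2 : RtoC 2 <> 0) by (intros E; apply RtoC_inj in E; lra).
  assert (PIp := PI_RGT_0).
  set (k := (Ci * RtoC (Im (H (RtoC 0))) - RtoC (/ (2 * PI)) * CI (fun t => RtoC (Re (H (cis t)))) 0 (2 * PI))%C).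
  assert (F : forall b, Cmod b < 1 -> H b = (k + CI (fun t => psi t / (circ 0 1 t - b))%C 0 (2 * PI))%C).
  { intros b Hb. assert (E := schwarz H R0 b HH HR Hb).
    assert (Cp : contI (fun t => psi t / (circ 0 1 t - b))%C 0 (2 * PI)).
    { intros t _. apply Cont_div; auto. apply Cont_minus. apply RCont_circ. apply Cont_const. rewrite circ01. apply cis_sub_nz; auto. }
    assert (E' : CI (fun t => RtoC (Re (H (cis t))) * schwarz_ker b t)%C 0 (2 * PI) = (RtoC (2 * PI) * CI (fun t => psi t / (circ 0 1 t - b))%C 0 (2 * PI) - CI (fun t => RtoC (Re (H (cis t)))) 0 (2 * PI))%C).
    { rewrite <- CI_scal, <- CI_minus; auto.
      - apply CI_ext. intros t _. unfold psi, schwarz_ker. rewrite circ01. assert (N := cis_sub_nz b t Hb).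
        rewrite RtoC_inv, RtoC_mult by lra. field. auto.
      - apply contI_scal; auto.
      - intros t _; auto. }
    rewrite E' in E. unfold k.
    transitivity (Ci * RtoC (Im (H (RtoC 0))) + RtoC (/ (2 * PI)) * (RtoC (2 * PI) * (H b - Ci * RtoC (Im (H (RtoC 0))))))%C.
    - rewrite RtoC_inv, RtoC_mult by lra. field. auto.
    - rewrite <- E. rewrite RtoC_inv, RtoC_mult by lra. field. auto. }
  assert (Ed : d = CI (fun t => psi t / (circ 0 1 t - a) ^ 2)%C 0 (2 * PI)).
  { apply (CDer_unique H a); auto.
    apply (Der_ext_loc _ (fun b => k + CI (fun t => psi t / (circ 0 1 t - b))%C 0 (2 * PI))%C H a _ (1 - Cmod a)). lra.
    - intros s Hs. symmetry. apply F. generalize (Cmod_triangle_inv s a). lra.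
    - assert (Ha' : Cmod (a - 0) < 1) by (replace (a - RtoC 0)%C with a by ring; auto).
      eapply Der_eq. apply Der_plus. apply Der_const. apply (cauchy_type_der1 0 1 psi Hpsi a Ha'). ring. }
  assert (Cc : contI (fun t => psi t / (circ 0 1 t - a) ^ 2)%C 0 (2 * PI)).
  { intros t _. assert (N := cis_sub_nz a t Ha). apply Cont_div; auto. simpl. apply Cont_mult. apply Cont_minus. apply RCont_circ. apply Cont_const.
    apply Cont_mult. apply Cont_minus. apply RCont_circ. apply Cont_const. apply Cont_const. apply Cpow_nz. rewrite circ01; auto. }
  assert (B := CI_mod _ 0 (2 * PI) ltac:(generalize two_PI_pos; lra) Cc). rewrite <- Ed in B.
  assert (B2 : RInt (fun t => Cmod (psi t / (circ 0 1 t - a) ^ 2)) 0 (2 * PI) = RInt (fun t => (/ (PI * (1 - Cmod a * Cmod a))) * (Re (H (cis t)) * Re (schwarz_ker a t))) 0 (2 * PI)).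
  { apply RInt_ext. intros t _. assert (N := cis_sub_nz a t Ha). rewrite circ01.
    assert (P : 0 < Cmod (cis t - a)) by (apply Cmod_gt_0; auto).
    rewrite Cmod_div by (apply Cpow_nz; auto). rewrite Cmod_pow. unfold psi. rewrite !Cmod_mult, Cmod_cis, !Cmod_R.
    rewrite (Rabs_pos_eq (/ PI)) by (apply Rlt_le, Rinv_0_lt_compat; auto). rewrite Rabs_pos_eq by auto.
    rewrite Re_schwarz_ker by auto. match goal with |- @eq _ ?a ?b => change (@eq R a b) end. field. repeat split; try lra; nra. }
  rewrite B2, scalC, schwarz_Re in B by (auto; apply ex_schwarz_Re; auto).
  assert (Q : 0 < 1 - Cmod a * Cmod a) by nra.
  apply Rmult_le_compat_r with (r := 1 - Cmod a * Cmod a) in B; [|lra].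
  replace (/ (PI * (1 - Cmod a * Cmod a)) * (2 * PI * Re (H a)) * (1 - Cmod a * Cmod a)) with (2 * Re (H a)) in B by (field; lra). auto.
Qed.
End Herglotz.

(** * Growth of typically real functions *)

Section TypicallyReal.
Variable g : C -> C.
Hypothesis Hg : hol (disc 0 1) g.
Hypothesis Him : forall w, disc 0 1 w -> 0 <= Im (g w) * Im w.
Hypothesis Hre : forall x : R, -1 < x < 1 -> Im (g (RtoC x)) = 0 /\ 0 <= Re (g (RtoC x)).

Let g0 := Re (g (RtoC 0)).
Let Eg0 : g (RtoC 0) = RtoC g0.
Proof. apply Ceq. reflexivity. rewrite im_RtoC. apply Hre. lra. Qed.

(* Rogosinski: for typically real g, (1 - w^2) (g(w) - g(0)) / w has positive real part; on the circle |w| = 1 its real part is 2 Im w Im g. *)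
Let rog r : 0 < r < 1 -> exists T t0, hol (disc 0 (/ r)) T /\ (forall t, 0 <= Re (T (cis t))) /\ T (RtoC 0) = RtoC t0 /\
  forall w, disc 0 (/ r) w -> ((1 - w * w) * (g (RtoC r * w) - RtoC g0) = w * T w)%C.
Proof.
  intros Hr.
  set (gr := fun w => g (RtoC r * w)%C).
  assert (Hir : 1 < / r) by (rewrite <- Rinv_1; apply Rinv_lt_contravar; lra).
  assert (Din : forall w, disc 0 (/ r) w -> disc 0 1 (RtoC r * w)%C).
  { unfold disc. intros w Hw. replace (w - RtoC 0)%C with w in Hw by ring. replace (RtoC r * w - RtoC 0)%C with (RtoC r * w)%C by ring.
    rewrite Cmod_mult, Cmod_R, Rabs_pos_eq by lra. apply Rmult_lt_compat_l with (r := r) in Hw; [|lra]. rewrite Rinv_r in Hw by lra. auto. }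
  assert (Hgr : hol (disc 0 (/ r)) gr).
  { intros w Hw. destruct (Hg _ (Din w Hw)) as [d Hd]. eexists. apply (Der_comp _ g (fun w => RtoC r * w)%C). exact Hd. apply Der_scal, Der_id. }
  destruct (hol_quot _ gr (RtoC 0) (disc_open 0 (/ r)) Hgr) as [q [Hq Eq]]. apply disc_mem; lra.
  assert (Egr0 : gr (RtoC 0) = RtoC g0). { unfold gr. replace (RtoC r * RtoC 0)%C with (RtoC 0) by ring. exact Eg0. }
  assert (Dx : forall x, -1 < x < 1 -> disc 0 (/ r) (RtoC x)).
  { intros x Hx. unfold disc. rewrite Cmod_RR, Rminus_0_r. apply Rabs_def1; lra. }
  assert (Imq : Im (q (RtoC 0)) = 0).
  { assert (Nz : forall x, -1 < x < 1 -> x <> 0 -> Im (q (RtoC x)) = 0).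
    { intros x Hx Hn. assert (E := Eq _ (Dx x Hx)). rewrite Egr0 in E. 
      apply (f_equal Im) in E. rewrite <- RtoC_minus, im_scal_l, im_minus, im_RtoC in E.
      unfold gr in E. rewrite <- RtoC_mult in E. destruct (Hre (r * x)) as [E1 _]. nra. rewrite E1 in E.
      assert (x * Im (q (RtoC x)) = 0) by (rewrite <- (Rminus_0_r x) at 1; lra). apply Rmult_integral in H. tauto. }
    apply cond_eq. intros eps He. rewrite Rminus_0_r.
    destruct (hol_Cont _ _ _ Hq (Dx 0 ltac:(lra)) eps He) as [del [Pd Qd]].
    set (y := Rmin del 1 / 2). assert (Hy : 0 < y < del /\ y < 1).
    { unfold y. generalize (Rmin_l del 1) (Rmin_r del 1) (Rmin_glb_lt _ _ _ Pd Rlt_0_1). lra. }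
    specialize (Qd (RtoC y)). rewrite Cmod_RR, Rminus_0_r, Rabs_pos_eq in Qd by lra. specialize (Qd (proj2 (proj1 Hy))).
    eapply Rle_lt_trans; [|exact Qd]. rewrite Cmod_sub_sym. eapply Rle_trans; [|apply im_le_Cmod]. rewrite im_minus, (Nz y) by lra. rewrite Rminus_0_r; lra. }
  exists (fun w => (1 - w * w) * q w)%C, (Re (q (RtoC 0))). split; [|split; [|split]].
  - intros w Hw. destruct (Hq w Hw) as [d Hd]. eexists. apply Der_mult. apply Der_minus. apply Der_const. apply Der_mult; apply Der_id. exact Hd.
  - intros t. assert (Dc : disc 0 (/ r) (cis t)). { unfold disc. replace (cis t - RtoC 0)%C with (cis t) by ring. rewrite Cmod_cis; auto. }
    assert (E := Eq _ Dc). rewrite Egr0 in E. replace (cis t - RtoC 0)%C with (cis t) in E by ring.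
    replace ((1 - cis t * cis t) * q (cis t))%C with ((Cconj (cis t) - cis t) * (gr (cis t) - RtoC g0))%C.
    2:{ rewrite E, cis_conj. field. apply cis_nz. }
    assert (K := Him _ (Din _ Dc)). fold (gr (cis t)) in K. rewrite im_scal_l in K.
    rewrite re_mult, re_minus, re_conj, im_minus, im_conj, im_minus, im_RtoC.
    assert (0 <= Im (gr (cis t)) * Im (cis t)).
    { apply Rmult_le_reg_l with r. lra. rewrite Rmult_0_r. lra. }
    nra.
  - apply Ceq. rewrite re_RtoC. rewrite re_mult. replace (1 - RtoC 0 * RtoC 0)%C with (RtoC 1) by ring. rewrite re_RtoC, im_RtoC. ring.
    replace (1 - RtoC 0 * RtoC 0)%C with (RtoC 1) by ring. rewrite im_scal_l, Imq, im_RtoC. ring.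
  - intros w Hw. assert (E := Eq w Hw). rewrite Egr0 in E. fold (gr w). rewrite E. ring.
Qed.

(** With t0 = T 0, nonnegativity of g at the points - r x and x tending to 1 give t0 <= 4 g0.
    Harnack's inequality for T then yields g <= g0 (1 + 4 v / (1 - v)^2) on the positive radius,
    which is the square in the statement; on the negative radius T >= 0 already gives g <= g0. *)
Lemma typ_real_bounds r v : 0 < r < 1 -> 0 < v < 1 ->
  Re (g (RtoC (r * v))) <= g0 * (((1 + v) / (1 - v)) * ((1 + v) / (1 - v))) /\ Re (g (RtoC (- (r * v)))) <= g0.
Proof.
  intros Hr Hv. destruct (rog r Hr) as [T [t0 [HT [PT [T0 ET]]]]].
  assert (Hir : 1 < / r) by (rewrite <- Rinv_1; apply Rinv_lt_contravar; lra).
  assert (Dx : forall x, -1 < x < 1 -> disc 0 (/ r) (RtoC x)).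
  { intros x Hx. unfold disc. rewrite Cmod_RR, Rminus_0_r. apply Rabs_def1; lra. }
  assert (R0 : Re (T (RtoC 0)) = t0) by (rewrite T0; apply re_RtoC).
  assert (Ereal : forall x, -1 < x < 1 -> (1 - x * x) * (Re (g (RtoC (r * x))) - g0) = x * Re (T (RtoC x))).
  { intros x Hx. assert (E := ET _ (Dx x Hx)). apply (f_equal Re) in E.
    rewrite <- !RtoC_mult, <- RtoC_minus, re_scal_l, re_minus, re_RtoC in E.
    rewrite re_scal_l in E. exact E. }
  assert (Pt0 : 0 <= t0). { rewrite <- R0. apply (herglotz_pos T (/ r)); auto. rewrite Cmod_0; lra. }
  assert (Lo : forall x, 0 < x < 1 -> t0 * ((1 - x) / (1 + x)) <= Re (T (RtoC (- x)))).
  { intros x Hx. assert (K := herglotz_lower T (/ r) HT Hir PT (RtoC (- x))). rewrite Cmod_R, Rabs_Ropp, Rabs_pos_eq, R0 in K by lra. apply K; lra. }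
  assert (t04 : t0 <= 4 * g0).
  { assert (S : forall x, 0 < x < 1 -> t0 * x <= 4 * g0).
    { intros x Hx. specialize (Lo x Hx). assert (E := Ereal (- x) ltac:(lra)).
      destruct (Hre (r * - x)) as [_ Gp]. nra.
      assert (H1 : x * (t0 * ((1 - x) / (1 + x))) <= (1 - x * x) * g0).
      { eapply Rle_trans. apply Rmult_le_compat_l. lra. apply Lo.
        assert (0 <= (1 - x * x) * Re (g (RtoC (r * - x)))) by (apply Rmult_le_pos; [nra|exact Gp]). lra. }
      apply Rmult_le_reg_r with ((1 - x) / (1 + x)). apply Rdiv_lt_0_compat; lra.
      replace (t0 * x * ((1 - x) / (1 + x))) with (x * (t0 * ((1 - x) / (1 + x)))) by ring.
      eapply Rle_trans. apply H1. replace ((1 - x * x) * g0) with (g0 * ((1 + x) * (1 + x)) * ((1 - x) / (1 + x))) by (field; lra).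
      apply Rmult_le_compat_r. apply Rlt_le, Rdiv_lt_0_compat; lra.
      assert (0 <= g0) by (apply (Hre 0); lra). assert ((1 + x) * (1 + x) <= 4) by nra. nra. }
    apply le_epsilon. intros eps He.
    set (x := 1 - Rmin (/2) (eps / (t0 + 1))).
    assert (Hm : 0 < Rmin (/2) (eps / (t0 + 1))) by (apply Rmin_glb_lt; [lra|apply Rdiv_lt_0_compat; lra]).
    assert (Hx : 0 < x < 1) by (unfold x; generalize (Rmin_l (/2) (eps / (t0 + 1))); lra).
    specialize (S x Hx). assert (t0 * Rmin (/2) (eps / (t0 + 1)) <= eps).
    { apply Rle_trans with (t0 * (eps / (t0 + 1))). apply Rmult_le_compat_l; auto. apply Rmin_r.
      apply Rmult_le_reg_r with (t0 + 1). lra. replace (t0 * (eps / (t0 + 1)) * (t0 + 1)) with (t0 * eps) by (field; lra). nra. }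
    unfold x in S. lra. }
  split.
  - assert (U := herglotz_upper T (/ r) HT Hir PT (RtoC v)). rewrite Cmod_R, Rabs_pos_eq, R0, T0, im_RtoC in U by lra.
    specialize (U ltac:(lra)). replace (T (RtoC v) - Ci * RtoC 0)%C with (T (RtoC v)) in U by ring.
    assert (E := Ereal v ltac:(lra)).
    assert (Tv : Re (T (RtoC v)) <= 4 * g0 * ((1 + v) / (1 - v))).
    { eapply Rle_trans; [apply Re_le_Cmod|]. eapply Rle_trans; [apply U|]. apply Rmult_le_compat_r; auto. apply Rlt_le, Rdiv_lt_0_compat; lra. }
    apply Rmult_le_reg_l with (1 - v * v). nra.
    apply Rle_trans with ((1 - v * v) * g0 + v * (4 * g0 * ((1 + v) / (1 - v)))).
    + apply Rmult_le_compat_l with (r := v) in Tv; lra.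
    + right. field. lra.
  - specialize (Lo v Hv). assert (E := Ereal (- v) ltac:(lra)).
    assert (0 <= Re (T (RtoC (- v)))). { eapply Rle_trans; [|apply Lo]. apply Rmult_le_pos; auto. apply Rlt_le, Rdiv_lt_0_compat; lra. }
    replace (- (r * v)) with (r * - v) by ring.
    assert (0 < 1 - - v * - v) by nra. nra.
Qed.

(** The dilation 3/4 turns |w| <= 1/2 into |z| <= 2/3, where T is at most 5 t0 and 1 - z^2 at least
    5/9. So g w - g0 is at most 6 t0, and t0 <= 20 g0 gives 121 = 1 + 6 * 20. *)
Lemma typ_real_sector w : Cmod w <= 1/2 -> Cmod (g w) <= 121 * g0.
Proof.
  intros Hw. destruct (rog (3/4) ltac:(lra)) as [T [t0 [HT [PT [T0 ET]]]]].
  assert (Hir : 1 < / (3/4)) by lra.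
  assert (R0 : Re (T (RtoC 0)) = t0) by (rewrite T0; apply re_RtoC).
  set (z := (RtoC (4/3) * w)%C).
  assert (Mz : Cmod z <= 2/3) by (unfold z; rewrite Cmod_mult, Cmod_R, Rabs_pos_eq; lra).
  assert (Ez : (RtoC (3/4) * z)%C = w).
  { unfold z. rewrite Cmult_assoc, <- RtoC_mult. replace (3/4*(4/3)) with 1 by field. ring. }
  assert (Dz : disc 0 (/ (3/4)) z). { unfold disc. replace (z - RtoC 0)%C with z by ring. lra. }
  assert (E := ET z Dz). rewrite Ez in E.
  assert (Mz0 := Cmod_ge_0 z).
  assert (Pt0 : 0 <= t0). { rewrite <- R0. apply (herglotz_pos T (/ (3/4))); auto. rewrite Cmod_0; lra. }
  assert (g0p : 0 <= g0) by (apply (Hre 0); lra).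
  assert (t04 : t0 <= 4 * g0 * 5).
  { (* crude form of the bound t0 <= 4 g0, from the point -1/2 *)
    assert (K := herglotz_lower T (/ (3/4)) HT Hir PT (RtoC (- (1/2)))). rewrite Cmod_R, Rabs_Ropp, Rabs_pos_eq, R0 in K by lra. specialize (K ltac:(lra)).
    assert (Dm : disc 0 (/ (3/4)) (RtoC (-(1/2)))). { unfold disc. rewrite Cmod_RR, Rminus_0_r, Rabs_Ropp, Rabs_pos_eq; lra. }
    assert (E' := ET _ Dm). apply (f_equal Re) in E'.
    rewrite <- !RtoC_mult, <- RtoC_minus, re_scal_l, re_minus, re_RtoC, re_scal_l in E'.
    destruct (Hre (3/4 * -(1/2))) as [_ Gp]. lra. lra. }
  assert (U := herglotz_upper T (/ (3/4)) HT Hir PT z). rewrite R0, T0, im_RtoC in U.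
  specialize (U ltac:(lra)). replace (T z - Ci * RtoC 0)%C with (T z) in U by ring.
  assert (Tz : Cmod (T z) <= t0 * 5).
  { eapply Rle_trans. apply U. apply Rmult_le_compat_l; auto.
    apply Rmult_le_reg_r with (1 - Cmod z). lra. unfold Rdiv. rewrite Rmult_assoc, Rinv_l; lra. }
  assert (M1 : 5/9 <= Cmod (1 - z * z)).
  { generalize (Cmod_triangle_inv 1 (z * z)). rewrite Cmod_1, Cmod_mult. nra. }
  assert (M2 : Cmod (1 - z * z) * Cmod (g w - RtoC g0) <= (2/3) * (t0 * 5)).
  { rewrite <- Cmod_mult, E, Cmod_mult. apply Rmult_le_compat; auto. apply Cmod_ge_0. }
  generalize (Cmod_ge_0 (g w - RtoC g0)). intros.
  assert (M3 : Cmod (g w - RtoC g0) <= 6 * t0) by nra.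
  generalize (Cmod_triangle (g w - RtoC g0) (RtoC g0)). replace (g w - RtoC g0 + RtoC g0)%C with (g w) by ring.
  rewrite Cmod_R, Rabs_pos_eq by auto. lra.
Qed.
End TypicallyReal.

(** * The exponential and the principal logarithm *)

Definition Cexp (z : C) : C := (RtoC (exp (Re z)) * cis (Im z))%C.

Lemma cis_plus s t : cis (s + t) = (cis s * cis t)%C.
Proof. unfold cis. rewrite cos_plus, sin_plus. apply Ceq; unfold Re, Im; simpl; ring. Qed.

Lemma Cexp_plus z w : Cexp (z + w) = (Cexp z * Cexp w)%C.
Proof. unfold Cexp. rewrite re_plus, im_plus, exp_plus, cis_plus, RtoC_mult. ring. Qed.

Lemma Cexp_0 : Cexp 0 = 1.
Proof. unfold Cexp. rewrite re_RtoC, im_RtoC, exp_0, cis_0. ring. Qed.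

Lemma Cmod_Cexp z : Cmod (Cexp z) = exp (Re z).
Proof. unfold Cexp. rewrite Cmod_mult, Cmod_cis, Cmod_R, Rabs_pos_eq. ring. apply Rlt_le, exp_pos. Qed.

Lemma Cexp_nz z : Cexp z <> 0.
Proof. apply Cmod_gt_0. rewrite Cmod_Cexp. apply exp_pos. Qed.

Lemma Cexp_RtoC x : Cexp (RtoC x) = RtoC (exp x).
Proof. unfold Cexp. rewrite re_RtoC, im_RtoC, cis_0. ring. Qed.

Lemma Im_Cexp z : Im (Cexp z) = exp (Re z) * sin (Im z).
Proof. unfold Cexp. rewrite im_scal_l. reflexivity. Qed.

Lemma Re_Cexp z : Re (Cexp z) = exp (Re z) * cos (Im z).
Proof. unfold Cexp. rewrite re_scal_l. reflexivity. Qed.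

Lemma Cexp_minus z w : Cexp (z - w) = (Cexp z / Cexp w)%C.
Proof.
  assert (E := Cexp_plus (z - w) w). replace (z - w + w)%C with z in E by ring. rewrite E. field. apply Cexp_nz.
Qed.

Lemma CDer_Cexp_0 : CDer Cexp 0 1.
Proof.
  apply dom_CDer. intros eps He.
  assert (De : is_derive exp 0 1) by (auto_derive; auto; rewrite exp_0; ring).
  assert (Dexp : RDer (fun t => RtoC (exp t)) 0 1).
  { apply (RDer_real exp 0 1); auto. }
  assert (Dcis : RDer cis 0 Ci). { eapply Der_eq. apply RDer_cis. rewrite cis_0. ring. }
  assert (Cexp0 := Der_Cont _ _ _ _ Dexp).
  destruct (Der_dom _ _ _ _ Dexp (eps/6) ltac:(lra)) as [d1 [P1 Q1]].
  destruct (Der_dom _ _ _ _ Dcis (eps/6) ltac:(lra)) as [d2 [P2 Q2]].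
  destruct (Cexp0 (Rmin 1 (eps/6))) as [d3 [P3 Q3]]. apply Rmin_glb_lt; lra.
  exists (Rmin d1 (Rmin d2 d3)). split. repeat apply Rmin_glb_lt; auto.
  intros s Hs. replace (s - RtoC 0)%C with s in * by ring.
  assert (L1 := Rlt_le_trans _ _ _ Hs (Rmin_l _ _)).
  assert (L23 := Rlt_le_trans _ _ _ Hs (Rmin_r _ _)).
  assert (L2 := Rlt_le_trans _ _ _ L23 (Rmin_l _ _)). assert (L3 := Rlt_le_trans _ _ _ L23 (Rmin_r _ _)).
  assert (Hx := re_le_Cmod s). assert (Hy := im_le_Cmod s).
  set (x := Re s) in *. set (y := Im s) in *.
  assert (Ex : Cmod (RtoC x - RtoC 0) = Rabs x) by (rewrite Cmod_RR, Rminus_0_r; auto).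
  assert (Ey : Cmod (RtoC y - RtoC 0) = Rabs y) by (rewrite Cmod_RR, Rminus_0_r; auto).
  specialize (Q1 x). specialize (Q2 y). specialize (Q3 x). rewrite Ex in Q1, Q3. rewrite Ey in Q2.
  specialize (Q1 ltac:(lra)). specialize (Q2 ltac:(lra)). specialize (Q3 ltac:(lra)).
  assert (Q3a := Rlt_le_trans _ _ _ Q3 (Rmin_l _ _)). assert (Q3b := Rlt_le_trans _ _ _ Q3 (Rmin_r _ _)).
  rewrite exp_0 in Q1, Q3, Q3a, Q3b. rewrite cis_0 in Q2.
  rewrite Cexp_0. unfold Cexp. fold x. fold y.
  assert (Es : s = (RtoC x + Ci * RtoC y)%C) by (apply Ceq; unfold x, y, Ci, Re, Im; simpl; ring).
  rewrite Es at 1.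
  replace (RtoC (exp x) * cis y - RtoC 1 - RtoC 1 * (RtoC x + Ci * RtoC y))%C with
    ((RtoC (exp x) - RtoC 1 - RtoC 1 * (RtoC x - RtoC 0)) + RtoC (exp x) * (cis y - RtoC 1 - Ci * (RtoC y - RtoC 0)) + (RtoC (exp x) - RtoC 1) * (Ci * RtoC y))%C by ring.
  eapply Rle_trans; [apply Cmod_triangle|]. eapply Rle_trans; [apply Rplus_le_compat_r, Cmod_triangle|].
  rewrite !Cmod_mult, Cmod_Ci, !Cmod_R in *.
  assert (U : Rabs (exp x) <= 2).
  { rewrite <- Cmod_R. generalize (Cmod_triangle_inv (RtoC (exp x)) 1). rewrite Cmod_1. lra. }
  generalize (Rabs_pos x) (Rabs_pos y) (Rabs_pos (exp x)) (Cmod_ge_0 s) (Cmod_ge_0 (RtoC (exp x) - RtoC 1)); intros.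
  rewrite ?Rminus_0_r in *.
  assert (Rabs (exp x) * Cmod (cis y - RtoC 1 - Ci * (RtoC y - RtoC 0)) <= 2 * (eps / 6 * Cmod s)).
  { apply Rmult_le_compat; auto. apply Cmod_ge_0. eapply Rle_trans; [apply Q2|]. apply Rmult_le_compat_l; lra. }
  assert (Cmod (RtoC (exp x) - RtoC 1) * (1 * Rabs y) <= eps / 6 * Cmod s).
  { apply Rmult_le_compat; lra. }
  assert (eps / 6 * Rabs x <= eps / 6 * Cmod s) by (apply Rmult_le_compat_l; lra).
  nra.
Qed.

Lemma CDer_Cexp z : CDer Cexp z (Cexp z).
Proof.
  apply Der_ext with (fun w => (Cexp z * Cexp (w - z))%C).
  intros w. rewrite <- Cexp_plus. f_equal. ring.
  eapply Der_eq. apply Der_scal. apply (Der_comp _ Cexp (fun w => w - z)%C).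
  replace (z - z)%C with (RtoC 0) by ring. apply CDer_Cexp_0.
  apply Der_minus. apply Der_id. apply Der_const. ring.
Qed.

(** The argument is written by the half-angle formula, a single expression on the whole slit plane,
    so that continuity needs no case distinction. *)
Definition Clog (z : C) : C := (ln (Cmod z), 2 * atan (Im z / (Cmod z + Re z))).

Lemma slit_pos z : slit_plane z -> 0 < Cmod z + Re z.
Proof.
  intros H. assert (K := Cmod_sq z). assert (M := Cmod_ge_0 z). assert (R := re_le_Cmod z). apply Rabs_le_between in R.
  destruct (Rle_lt_or_eq_dec 0 (Cmod z + Re z)) as [|E]; [lra|auto|].
  exfalso. apply H. split; [|lra]. assert (Re z = - Cmod z) by lra. rewrite H0 in K. apply Rsqr_0_uniq. unfold Rsqr. lra.
Qed.

Lemma slit_nz z : slit_plane z -> z <> 0.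
Proof. intros H E. apply H. subst. unfold Re, Im; simpl. lra. Qed.

Lemma slit_Re z : 0 < Re z -> slit_plane z.
Proof. intros H [_ K]. lra. Qed.

Lemma slit_Im z : Im z <> 0 -> slit_plane z.
Proof. intros H [K _]. lra. Qed.

Lemma slit_cases z : slit_plane z -> 0 < Re z \/ Im z <> 0.
Proof. intros H. destruct (Req_dec (Im z) 0); auto. destruct (Rlt_le_dec 0 (Re z)); auto. Qed.

Lemma slit_open : open_set slit_plane.
Proof.
  intros z H. destruct (slit_cases z H) as [K|K].
  - exists (Re z). split; auto. intros w Hw. apply slit_Re.
    assert (R := re_le_Cmod (w - z)). rewrite re_minus in R. apply Rabs_le_between in R. lra.
  - exists (Rabs (Im z)). split. apply Rabs_pos_lt; auto. intros w Hw. apply slit_Im. intros E.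
    assert (R := im_le_Cmod (w - z)). rewrite im_minus, E in R. replace (0 - Im z) with (- Im z) in R by ring. rewrite Rabs_Ropp in R. lra.
Qed.

Lemma Cexp_Clog z : slit_plane z -> Cexp (Clog z) = z.
Proof.
  intros H. assert (P := slit_pos z H). assert (N := slit_nz z H). apply Cmod_gt_0 in N.
  assert (K := Cmod_sq z).
  (* u is the tangent of half the argument, so cosine and sine are rational in u, and 1 + u^2 = 2 r
     / (r + Re z). *)
  set (r := Cmod z) in *. set (u := Im z / (r + Re z)).
  assert (Hu : u * (r + Re z) = Im z) by (unfold u; field; lra).
  assert (E1 : cos (2 * atan u) = (1 - u * u) / (1 + u * u)).
  { rewrite cos_2a, cos_atan, sin_atan. assert (0 < 1 + u²) by (unfold Rsqr; nra).
    assert (S : sqrt (1 + u²) * sqrt (1 + u²) = 1 + u²) by (apply sqrt_sqrt; lra).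
    assert (0 < sqrt (1 + u²)) by (apply sqrt_lt_R0; lra).
    replace (1 / sqrt (1 + u²) * (1 / sqrt (1 + u²)) - u / sqrt (1 + u²) * (u / sqrt (1 + u²))) with ((1 - u * u) / (sqrt (1 + u²) * sqrt (1 + u²))) by (field; lra).
    rewrite S. unfold Rsqr. reflexivity. }
  assert (E2 : sin (2 * atan u) = 2 * u / (1 + u * u)).
  { rewrite sin_2a, cos_atan, sin_atan. assert (0 < 1 + u²) by (unfold Rsqr; nra).
    assert (S : sqrt (1 + u²) * sqrt (1 + u²) = 1 + u²) by (apply sqrt_sqrt; lra).
    assert (0 < sqrt (1 + u²)) by (apply sqrt_lt_R0; lra).
    replace (2 * (u / sqrt (1 + u²)) * (1 / sqrt (1 + u²))) with (2 * u / (sqrt (1 + u²) * sqrt (1 + u²))) by (field; lra).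
    rewrite S. unfold Rsqr. reflexivity. }
  assert (F1 : (1 + u * u) * (r + Re z) = 2 * r).
  { apply Rmult_eq_reg_r with (r + Re z); [|lra].
    replace ((1 + u * u) * (r + Re z) * (r + Re z)) with ((r + Re z) * (r + Re z) + (u * (r + Re z)) * (u * (r + Re z))) by ring.
    rewrite Hu. nra. }
  assert (Hp : 0 < 1 + u * u) by nra.
  apply Ceq.
  - rewrite Re_Cexp. change (Re (Clog z)) with (ln r). change (Im (Clog z)) with (2 * atan u). rewrite exp_ln, E1 by auto.
    apply Rmult_eq_reg_r with (1 + u * u); [|lra]. replace (r * ((1 - u * u) / (1 + u * u)) * (1 + u * u)) with (r * (1 - u * u)) by (field; lra).
    apply Rmult_eq_reg_r with (r + Re z); [|lra].
    replace (r * (1 - u * u) * (r + Re z)) with (r * (2 * (r + Re z) - (1 + u * u) * (r + Re z))) by ring.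
    replace (Re z * (1 + u * u) * (r + Re z)) with (Re z * ((1 + u * u) * (r + Re z))) by ring. rewrite F1. ring.
  - rewrite Im_Cexp. change (Re (Clog z)) with (ln r). change (Im (Clog z)) with (2 * atan u). rewrite exp_ln, E2 by auto.
    rewrite <- Hu at 1. apply Rmult_eq_reg_r with (1 + u * u); [|lra].
    replace (r * (2 * u / (1 + u * u)) * (1 + u * u)) with (u * (2 * r)) by (field; lra). rewrite <- F1. ring.
Qed.

Lemma Im_Clog_bound z : - PI < Im (Clog z) < PI.
Proof. change (Im (Clog z)) with (2 * atan (Im z / (Cmod z + Re z))). generalize (atan_bound (Im z / (Cmod z + Re z))). lra. Qed.

Lemma Re_Clog z : Re (Clog z) = ln (Cmod z).
Proof. reflexivity. Qed.

Lemma Im_Clog_pos z : 0 < Im z -> 0 < Im (Clog z).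
Proof.
  intros H. assert (P := slit_pos z (slit_Im z ltac:(lra))). change (Im (Clog z)) with (2 * atan (Im z / (Cmod z + Re z))).
  assert (0 < atan (Im z / (Cmod z + Re z))). { rewrite <- atan_0. apply atan_increasing. apply Rdiv_lt_0_compat; auto. } lra.
Qed.

Lemma Im_Clog_neg z : Im z < 0 -> Im (Clog z) < 0.
Proof.
  intros H. assert (P := slit_pos z (slit_Im z ltac:(lra))). change (Im (Clog z)) with (2 * atan (Im z / (Cmod z + Re z))).
  assert (atan (Im z / (Cmod z + Re z)) < 0).
  { rewrite <- atan_0. apply atan_increasing. apply Rmult_lt_reg_r with (Cmod z + Re z); auto. unfold Rdiv. rewrite Rmult_assoc, Rinv_l; lra. } lra.
Qed.

Lemma Im_Clog_real z : Im z = 0 -> Im (Clog z) = 0.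
Proof. intros H. change (Im (Clog z)) with (2 * atan (Im z / (Cmod z + Re z))). rewrite H. unfold Rdiv. rewrite Rmult_0_l, atan_0. ring. Qed.

Lemma Clog_RtoC x : 0 < x -> Clog (RtoC x) = RtoC (ln x).
Proof.
  intros H. apply Ceq. rewrite Re_Clog, Cmod_R, Rabs_pos_eq, re_RtoC; lra. rewrite Im_Clog_real, im_RtoC; auto.
Qed.

Lemma Cont_comp_real {T} (i : T -> C) (u : R -> R) (g : T -> C) t :
  continuous u (Re (g t)) -> Cont i g t -> Cont i (fun s => RtoC (u (Re (g s)))) t.
Proof.
  intros Hu Hg. apply (Cont_compR i (fun s => Re (g s)) (fun x => RtoC (u x))).
  apply continuous_RCont; auto. apply Cont_Re; auto.
Qed.

Lemma CCont_Clog z : slit_plane z -> CCont Clog z.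
Proof.
  intros H. assert (P := slit_pos z H). assert (N := slit_nz z H). apply Cmod_gt_0 in N.
  assert (E : forall w, Clog w = (RtoC (ln (Cmod w)) + Ci * RtoC (2 * atan (Im w / (Cmod w + Re w))))%C).
  { intros w. unfold Clog. apply Ceq; unfold Ci, Re, Im; simpl; ring. }
  apply (Cont_ext_loc _ (fun w => (RtoC (ln (Cmod w)) + Ci * RtoC (2 * atan (Im w / (Cmod w + Re w))))%C) _ z 1); auto; try lra.
  assert (Cm : CCont (fun w => RtoC (Cmod w)) z) by (apply (Cont_mod _ (fun w => w)), Cont_id).
  assert (Cr : CCont (fun w => RtoC (Re w)) z) by (apply (Cont_Re _ (fun w => w)), Cont_id).
  assert (Ci' : CCont (fun w => RtoC (Im w)) z) by (apply (Cont_Im _ (fun w => w)), Cont_id).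
  apply Cont_plus.
  - apply (Cont_comp_real _ ln (fun w => RtoC (Cmod w))); auto. rewrite re_RtoC.
    apply continuity_pt_filterlim. apply derivable_continuous_pt. exists (/ Cmod z). apply derivable_pt_lim_ln; auto.
  - apply Cont_mult. apply Cont_const.
    assert (Cd : CCont (fun w => RtoC (Cmod w) + RtoC (Re w))%C z) by (apply Cont_plus; auto).
    assert (Nd : (RtoC (Cmod z) + RtoC (Re z))%C <> 0) by (rewrite <- RtoC_plus; intros E'; apply RtoC_inj in E'; lra).
    destruct (Cont_nz _ _ _ Cd Nd) as [del [Pd Qd]].
    assert (Eq : forall w, (RtoC (Cmod w) + RtoC (Re w))%C <> 0 -> Re (RtoC (Im w) / (RtoC (Cmod w) + RtoC (Re w))) = Im w / (Cmod w + Re w)).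
    { intros w Hw. rewrite <- RtoC_plus in *. rewrite <- RtoC_div. apply re_RtoC. intros E'. apply Hw. rewrite E'. reflexivity. }
    apply (Cont_ext_loc _ (fun w => RtoC ((fun x => 2 * atan x) (Re (RtoC (Im w) / (RtoC (Cmod w) + RtoC (Re w)))))) _ z del Pd).
    + intros s Hs. rewrite Eq; auto.
    + rewrite Eq; auto.
    + apply (Cont_comp_real _ (fun x => 2 * atan x) (fun w => RtoC (Im w) / (RtoC (Cmod w) + RtoC (Re w)))%C). apply continuity_pt_filterlim. apply derivable_continuous_pt. apply derivable_pt_mult. apply derivable_pt_const. apply derivable_pt_atan.
      apply Cont_div; auto.
Qed.

(** Inverse function rule in Caratheodory's form: the factor of [Cexp] at [Clog z] is nonzero and
    continuous along [Clog], and its reciprocal is a factor for [Clog]. *)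
Lemma CDer_Clog z : slit_plane z -> CDer Clog z (/ z)%C.
Proof.
  intros H. assert (Cl := CCont_Clog z H). assert (N := slit_nz z H).
  destruct (CDer_Cexp (Clog z)) as [phi [Cp [Ep [d [Pd Qd]]]]].
  rewrite Cexp_Clog in Ep by auto.
  destruct (Cl d Pd) as [d1 [P1 Q1]]. destruct (slit_open z H) as [d2 [P2 Q2]].
  assert (Cphi : CCont (fun w => phi (Clog w)) z) by (apply Cont_comp; auto).
  assert (Nphi : phi (Clog z) <> 0) by (rewrite Ep; auto).
  destruct (Cont_nz _ _ _ Cphi Nphi) as [d3 [P3 Q3]].
  exists (fun w => / phi (Clog w))%C. split; [|split].
  - apply Cont_inv; auto.
  - rewrite Ep; auto.
  - exists (Rmin d1 (Rmin d2 d3)). split. repeat apply Rmin_glb_lt; auto.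
    intros s Hs.
    assert (L1 := Rlt_le_trans _ _ _ Hs (Rmin_l _ _)). assert (L23 := Rlt_le_trans _ _ _ Hs (Rmin_r _ _)).
    assert (L2 := Rlt_le_trans _ _ _ L23 (Rmin_l _ _)). assert (L3 := Rlt_le_trans _ _ _ L23 (Rmin_r _ _)).
    assert (E := Qd _ (Q1 _ L1)). rewrite !Cexp_Clog in E by auto. rewrite E. field. auto.
Qed.

(** * Limits along a free ultrafilter *)

(** The tails make ordinary limits limits along U; the dichotomy for P and its negation makes every
    bounded sequence converge, so no subsequences have to be chosen. *)
Definition ultra (U : (nat -> Prop) -> Prop) :=
  (forall N, U (fun n => (N <= n)%nat)) /\
  (forall P Q, U P -> U Q -> U (fun n => P n /\ Q n)) /\
  (forall P Q : nat -> Prop, (forall n, P n -> Q n) -> U P -> U Q) /\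
  (forall P, U P \/ U (fun n => ~ P n)) /\ ~ U (fun _ => False).

Section Ultra.
Variable U : (nat -> Prop) -> Prop.
Hypothesis HU : ultra U.

Definition Ulim (z : nat -> C) (l : C) := forall eps, 0 < eps -> U (fun n => Cmod (z n - l) < eps).

Lemma U_and P Q : U P -> U Q -> U (fun n => P n /\ Q n).
Proof. apply HU. Qed.
Lemma U_imp (P Q : nat -> Prop) : (forall n, P n -> Q n) -> U P -> U Q.
Proof. apply HU. Qed.
Lemma U_ex (P : nat -> Prop) : U P -> exists n, P n.
Proof.
  intros H. apply NNPP. intros N. apply HU. eapply U_imp; [|exact H]. intros n Hn. apply N. exists n; auto.
Qed.
Lemma U_all (P : nat -> Prop) : (forall n, P n) -> U P.
Proof. intros H. apply (U_imp (fun n => (0 <= n)%nat)). auto. apply HU. Qed.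

Lemma Ulim_cont f z l : CCont f l -> Ulim z l -> Ulim (fun n => f (z n)) (f l).
Proof. intros Hf Hz eps He. destruct (Hf eps He) as [d [P Q]]. apply (U_imp _ _ (fun n => Q (z n)) (Hz d P)). Qed.

Lemma Ulim_plus z w l m : Ulim z l -> Ulim w m -> Ulim (fun n => z n + w n)%C (l + m)%C.
Proof.
  intros Hz Hw eps He. eapply U_imp; [|apply U_and; [apply (Hz (eps/2)); lra|apply (Hw (eps/2)); lra]].
  intros n [H1 H2]; cbv beta in *. cbv beta in *. replace (z n + w n - (l + m))%C with ((z n - l) + (w n - m))%C by ring.
  eapply Rle_lt_trans; [apply Cmod_triangle|lra].
Qed.

Lemma Ulim_scal c z l : Ulim z l -> Ulim (fun n => c * z n)%C (c * l)%C.
Proof. intros H. apply (Ulim_cont (fun w => c * w)%C); auto. apply Cont_mult. apply Cont_const. apply Cont_id. Qed.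

Lemma Ulim_opp z l : Ulim z l -> Ulim (fun n => - z n)%C (- l)%C.
Proof. intros H. apply (Ulim_cont (fun w => - w)%C); auto. apply Cont_opp, Cont_id. Qed.

Lemma Ulim_minus z w l m : Ulim z l -> Ulim w m -> Ulim (fun n => z n - w n)%C (l - m)%C.
Proof. intros. apply Ulim_plus; auto. apply Ulim_opp; auto. Qed.

Lemma Ulim_ext z w l : (forall n, z n = w n) -> Ulim z l -> Ulim w l.
Proof. intros E H eps He. eapply U_imp; [|apply (H eps He)]. intros n Hn. rewrite <- E; auto. Qed.

Lemma Ulim_unique z l m : Ulim z l -> Ulim z m -> l = m.
Proof.
  intros H K. apply Ceq_minus, Cmod_eq_0. apply Rle_antisym; [|apply Cmod_ge_0]. apply le_epsilon. intros eps He.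
  destruct (U_ex _ (U_and _ _ (H (eps/2) ltac:(lra)) (K (eps/2) ltac:(lra)))) as [n [H1 H2]]; cbv beta in *.
  generalize (Cmod_sub_tri l (z n) m). rewrite (Cmod_sub_sym l (z n)). lra.
Qed.

Lemma Ulim_closed z l (u : C -> R) B : (forall eps, 0 < eps -> exists del, 0 < del /\ forall w, Cmod (w - l) < del -> u l < u w + eps) ->
  Ulim z l -> U (fun n => u (z n) <= B) -> u l <= B.
Proof.
  intros Hu H HB. apply le_epsilon. intros eps He. destruct (Hu eps He) as [d [P Q]].
  destruct (U_ex _ (U_and _ _ (H d P) HB)) as [n [H1 H2]]; cbv beta in *. specialize (Q _ H1). lra.
Qed.

Lemma Ulim_mod_le z l B : Ulim z l -> (forall n, Cmod (z n) <= B) -> Cmod l <= B.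
Proof.
  intros H HB. apply (Ulim_closed z l Cmod); auto. 2: apply U_all; auto.
  intros eps He. exists eps; split; auto. intros w Hw. generalize (Cmod_triangle_inv l w). rewrite (Cmod_sub_sym l w). lra.
Qed.

Lemma Ulim_Re_le z l B : Ulim z l -> (forall n, Re (z n) <= B) -> Re l <= B.
Proof.
  intros H HB. apply (Ulim_closed z l Re); auto. 2: apply U_all; auto.
  intros eps He. exists eps; split; auto. intros w Hw. generalize (re_le_Cmod (w - l)). rewrite re_minus. intros A. apply Rabs_le_between in A. lra.
Qed.

Lemma Ulim_Im_le z l B : Ulim z l -> (forall n, Im (z n) <= B) -> Im l <= B.
Proof.
  intros H HB. replace (Im l) with (Re (- Ci * l)) by (unfold Re, Im; simpl; ring).
  apply (Ulim_Re_le (fun n => - Ci * z n)%C). apply Ulim_scal; auto.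
  intros n. replace (Re (- Ci * z n)) with (Im (z n)) by (unfold Re, Im; simpl; ring). auto.
Qed.

Lemma Ulim_Im_ge z l B : Ulim z l -> (forall n, B <= Im (z n)) -> B <= Im l.
Proof.
  intros H HB. assert (K := Ulim_Im_le _ _ (- B) (Ulim_opp _ _ H)). rewrite im_opp in K.
  cut (- Im l <= - B). lra. apply K. intros n. rewrite im_opp. specialize (HB n). lra.
Qed.

(** The limit is the supremum of the levels y that the sequence exceeds on a set of the ultrafilter;
    the dichotomy excludes oscillation. *)
Lemma Ulim_R (x : nat -> R) B : (forall n, Rabs (x n) <= B) -> exists l : R, forall eps, 0 < eps -> U (fun n => Rabs (x n - l) < eps).
Proof.
  intros HB.
  destruct (completeness (fun y => U (fun n => y <= x n))) as [l [L1 L2]].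
  - exists B. intros y Hy. destruct (U_ex _ Hy) as [n Hn]; cbv beta in *. specialize (HB n). apply Rabs_le_between in HB. lra.
  - exists (- B). apply U_all. intros n. specialize (HB n). apply Rabs_le_between in HB. lra.
  - exists l. intros eps He.
    assert (A : U (fun n => l - eps < x n)).
    { destruct (proj1 (proj2 (proj2 (proj2 HU))) (fun n => l - eps < x n)) as [|N]; auto.
      exfalso. assert (l <= l - eps); [|lra]. apply L2. intros y Hy. destruct (U_ex _ (U_and _ _ N Hy)) as [n [H1 H2]]; cbv beta in *. lra. }
    assert (A' : U (fun n => x n < l + eps)).
    { destruct (proj1 (proj2 (proj2 (proj2 HU))) (fun n => x n < l + eps)) as [|N]; auto.
      exfalso. assert (l + eps <= l); [|lra]. apply L1. eapply U_imp; [|exact N]. intros n Hn. cbv beta in *. lra. }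
    eapply U_imp; [|apply (U_and _ _ A A')]. intros n [H1 H2]; cbv beta in *. apply Rabs_def1; lra.
Qed.

Lemma Ulim_ex z B : (forall n, Cmod (z n) <= B) -> exists l, Ulim z l.
Proof.
  intros HB.
  destruct (Ulim_R (fun n => Re (z n)) B) as [x Hx]. intros n; eapply Rle_trans; [apply re_le_Cmod|auto].
  destruct (Ulim_R (fun n => Im (z n)) B) as [y Hy]. intros n; eapply Rle_trans; [apply im_le_Cmod|auto].
  exists (x, y). intros eps He. eapply U_imp; [|apply (U_and _ _ (Hx (eps/2) ltac:(lra)) (Hy (eps/2) ltac:(lra)))].
  intros n [H1 H2]; cbv beta in *. eapply Rle_lt_trans; [apply Cmod_le_ReIm|]. rewrite re_minus, im_minus.
  change (Re (x, y)) with x. change (Im (x, y)) with y. lra.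
Qed.

Lemma Ulim_seq z l : (forall eps, 0 < eps -> exists N, forall n, (N <= n)%nat -> Cmod (z n - l) < eps) -> Ulim z l.
Proof. intros H eps He. destruct (H eps He) as [N HN]. eapply U_imp; [exact HN|apply HU]. Qed.

End Ultra.

(** * Logarithms of complete Bernstein functions *)

Lemma slit_dist x : slit_plane x -> exists d, (0 < d <= 1) /\ forall p, 0 <= p <= PI / 2 -> d <= Cmod (x * RtoC (cos p) + RtoC (sin p)).
Proof.
  intros H.
  assert (K : forall m, 0 < m -> (forall p, 0 <= p <= PI / 2 -> m <= Cmod (x * RtoC (cos p) + RtoC (sin p))) ->
    exists d, (0 < d <= 1) /\ forall p, 0 <= p <= PI / 2 -> d <= Cmod (x * RtoC (cos p) + RtoC (sin p))).
  { intros m Hm Q. exists (Rmin m 1). split. split. apply Rmin_glb_lt; lra. apply Rmin_r.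
    intros p Hp. eapply Rle_trans; [apply Rmin_l|auto]. }
  assert (CS : forall p, 0 <= p <= PI / 2 -> 0 <= cos p /\ 0 <= sin p /\ sin p * sin p + cos p * cos p = 1).
  { intros p Hp. generalize PI_RGT_0; intros. split. apply cos_ge_0; lra. split. apply sin_ge_0; lra. generalize (sin2_cos2 p). unfold Rsqr; lra. }
  assert (E : forall p, Re (x * RtoC (cos p) + RtoC (sin p)) = Re x * cos p + sin p /\ Im (x * RtoC (cos p) + RtoC (sin p)) = Im x * cos p).
  { intros p. rewrite re_plus, im_plus, re_scal_r, im_scal_r, re_RtoC, im_RtoC. split; ring. }
  destruct (slit_cases x H) as [Hr|Hi].
  - apply (K (Rmin (Re x) 1)). apply Rmin_glb_lt; lra.
    intros p Hp. destruct (CS p Hp) as [C1 [C2 C3]]. eapply Rle_trans; [|apply Re_le_Cmod]. rewrite (proj1 (E p)).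
    generalize (Rmin_l (Re x) 1) (Rmin_r (Re x) 1). set (m := Rmin (Re x) 1). intros.
    assert (0 < m) by (apply Rmin_glb_lt; lra).
    assert (cos p * cos p <= cos p * 1) by (apply Rmult_le_compat_l; auto; apply COS_bound).
    assert (sin p * sin p <= sin p * 1) by (apply Rmult_le_compat_l; auto; apply SIN_bound).
    assert (m * cos p <= Re x * cos p) by (apply Rmult_le_compat_r; lra).
    assert (m * sin p <= 1 * sin p) by (apply Rmult_le_compat_r; lra).
    assert (m * 1 <= m * (cos p + sin p)) by (apply Rmult_le_compat_l; lra). lra.
  - set (D := Im x * Im x). assert (HD : 0 < D) by (unfold D; nra).
    set (T := 1 + Re x * Re x + Im x * Im x). assert (HT : 0 < T) by (unfold T; nra).
    assert (Hs : 0 < sqrt (D / T)) by (apply sqrt_lt_R0, Rdiv_lt_0_compat; auto).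
    apply (K (sqrt (D / T)) Hs). intros p Hp. destruct (CS p Hp) as [C1 [C2 C3]].
    apply Rsqr_incr_0_var; [|apply Cmod_ge_0]. unfold Rsqr. rewrite sqrt_sqrt by (apply Rlt_le, Rdiv_lt_0_compat; auto).
    rewrite Cmod_sq, (proj1 (E p)), (proj2 (E p)).
    (* smallest eigenvalue of a positive 2x2 matrix is at least det/trace *)
    apply Rmult_le_reg_r with T; auto. unfold Rdiv. rewrite Rmult_assoc, Rinv_l, Rmult_1_r by lra.
    set (c := cos p) in *. set (s := sin p) in *. unfold D, T. set (a := Re x). set (b := Im x).
    assert (((a * c + s) * (a * c + s) + b * c * (b * c)) * (1 + a * a + b * b) - b * b * (s * s + c * c) =
      (c * (a * a + b * b) + s * a) * (c * (a * a + b * b) + s * a) + (c * a + s) * (c * a + s)) by ring.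
    rewrite C3 in H0.
    assert (S1 := Rle_0_sqr (c * (a * a + b * b) + s * a)). assert (S2 := Rle_0_sqr (c * a + s)). unfold Rsqr in S1, S2.
    lra.
Qed.

(** A projective distance to the cut: with tan p = t the expression is cos p (x + t), so it bounds
    |x + t| / sqrt (1 + t^2) from below for all t >= 0 at once, with t = oo as the end point p = PI
    / 2. The cap 1 makes powers of its inverse increasing. *)
Definition sdist (x : C) : R := epsilon (inhabits 1) (fun d => (0 < d <= 1) /\ forall p, 0 <= p <= PI / 2 -> d <= Cmod (x * RtoC (cos p) + RtoC (sin p))).

Lemma sdist_spec x : slit_plane x -> (0 < sdist x <= 1) /\ forall p, 0 <= p <= PI / 2 -> sdist x <= Cmod (x * RtoC (cos p) + RtoC (sin p)).
Proof.
  intros H. exact (epsilon_spec (inhabits 1) (fun d => (0 < d <= 1) /\ forall p, 0 <= p <= PI / 2 -> d <= Cmod (x * RtoC (cos p) + RtoC (sin p))) (slit_dist x H)).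
Qed.

(** Three inverse powers of the distance come from the second-order remainder of the kernel, the
    factor 2 from its denominator at x + h with |h| < sdist x / 2, and 1 + |x| from the numerator of
    [angle_ker]. *)
Definition taylor_const (x : C) : R := (1 + Cmod x) * (2 * / sdist x * / sdist x * / sdist x).

Lemma taylor_const_pos x : slit_plane x -> 0 < taylor_const x.
Proof.
  intros H. destruct (sdist_spec x H) as [Hd _]. unfold taylor_const. assert (0 < / sdist x) by (apply Rinv_0_lt_compat; lra).
  generalize (Cmod_ge_0 x); intros. repeat apply Rmult_lt_0_compat; lra.
Qed.

(* Logarithms of complete Bernstein functions, with Taylor estimates that depend on the function only through B; this makes the class compact. *)
Definition log_cbf (B : R) (u : C -> C) :=
  (forall x, slit_plane x -> Cmod (u x) <= B * taylor_const x /\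
     exists d, Cmod d <= B * taylor_const x /\ forall h, Cmod h < sdist x / 2 -> Cmod (u (x + h)%C - u x - d * h) <= B * taylor_const x * (Cmod h * Cmod h)) /\
  (forall x, 0 < Im x -> 0 <= Im (u x) <= PI) /\
  (forall t, 0 < t -> Im (u (RtoC t)) = 0).

Lemma log_cbf_hol B u : log_cbf B u -> hol slit_plane u.
Proof.
  intros [H _] x Hx. destruct (H x Hx) as [_ [d [_ Q]]]. destruct (sdist_spec x Hx) as [Hd _].
  exists d. apply (quad_CDer _ _ _ (sdist x / 2) (B * taylor_const x)); auto. lra.
Qed.

Lemma hol_Cexp D u : hol D u -> hol D (fun z => Cexp (u z)).
Proof. intros H z Hz. destruct (H z Hz) as [d Hd]. eexists. apply Der_comp. apply CDer_Cexp. exact Hd. Qed.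

(** An imaginary part in [0, PI] has nonnegative sine, which is the sign of the imaginary part of
    the exponential. *)
Lemma log_cbf_exp_scal B u c : 0 <= c -> log_cbf B u -> complete_bernstein (fun x => RtoC c * Cexp (u x))%C.
Proof.
  intros Hc H. split; [|split].
  - apply hol_holomorphic. intros z Hz. destruct (hol_Cexp _ _ (log_cbf_hol B u H) z Hz) as [d Hd]. eexists. apply Der_scal. exact Hd.
  - intros x Hx. rewrite im_scal_l, Im_Cexp. destruct (proj1 (proj2 H) x Hx) as [A1 A2].
    apply Rmult_le_pos; auto. apply Rmult_le_pos. apply Rlt_le, exp_pos. apply sin_ge_0; lra.
  - intros t Ht. assert (A := proj2 (proj2 H) t Ht). split.
    + rewrite im_scal_l, Im_Cexp, A, sin_0. ring.
    + rewrite re_scal_l, Re_Cexp, A, cos_0. apply Rmult_le_pos; auto. generalize (exp_pos (Re (u (RtoC t)))). lra.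
Qed.

Lemma sdist_slit x h : slit_plane x -> Cmod h < sdist x / 2 -> slit_plane (x + h)%C.
Proof.
  intros Hx Hh K. destruct (sdist_spec x Hx) as [Hd Q]. destruct K as [K1 K2].
  (* a point -t of the cut is annihilated by the direction (cos p, sin p) with tan p = t *)
  set (t := - Re (x + h)). assert (Ht : 0 <= t) by (unfold t; lra).
  assert (E : (x + h = RtoC (- t))%C) by (apply Ceq; [rewrite re_RtoC; unfold t; ring|rewrite im_RtoC; auto]).
  assert (P := atan_bound t). assert (P0 : 0 <= atan t). { destruct Ht as [Ht|Ht]. rewrite <- atan_0. left. apply atan_increasing; auto. rewrite <- Ht, atan_0; lra. }
  specialize (Q (atan t) ltac:(lra)).
  assert (Ec : (x * RtoC (cos (atan t)) + RtoC (sin (atan t)))%C = (- h * RtoC (cos (atan t)))%C).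
  { replace x with (RtoC (- t) - h)%C by (rewrite <- E; ring). rewrite sin_atan, cos_atan.
    assert (0 < sqrt (1 + t²)) by (apply sqrt_lt_R0; unfold Rsqr; nra).
    rewrite !RtoC_div, RtoC_opp by lra. field. intros E'; apply RtoC_inj in E'; lra. }
  rewrite Ec, Cmod_mult, Cmod_opp, Cmod_R in Q.
  assert (Rabs (cos (atan t)) <= 1) by (apply Rabs_le; apply COS_bound).
  generalize (Cmod_ge_0 h) (Rabs_pos (cos (atan t))). nra.
Qed.

(** Compactness of the class: values and linear coefficients are bounded, hence converge along U,
    and the remainder estimate is a closed condition on both. *)
Lemma log_cbf_Ulim U B (u : nat -> C -> C) : ultra U -> (forall n, log_cbf B (u n)) -> exists v, log_cbf B v /\ forall x, slit_plane x -> Ulim U (fun n => u n x) (v x).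
Proof.
  intros HU H.
  set (v := fun x => epsilon (inhabits (RtoC 0)) (fun l => Ulim U (fun n => u n x) l)).
  assert (Hv : forall x, slit_plane x -> Ulim U (fun n => u n x) (v x)).
  { intros x Hx. apply (epsilon_spec (inhabits (RtoC 0)) (fun l => Ulim U (fun n => u n x) l)).
    apply (Ulim_ex U HU _ (B * taylor_const x)). intros n. apply (proj1 (H n) x Hx). }
  exists v. split; auto. split; [|split].
  - intros x Hx. split. apply (Ulim_mod_le U HU _ _ _ (Hv x Hx)). intros n. apply (proj1 (H n) x Hx).
    assert (Q : forall n, exists d, Cmod d <= B * taylor_const x /\ forall h, Cmod h < sdist x / 2 -> Cmod (u n (x + h)%C - u n x - d * h) <= B * taylor_const x * (Cmod h * Cmod h)).
    { intros n. apply (proj1 (H n) x Hx). }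
    set (d := fun n => epsilon (inhabits (RtoC 0)) (fun d => Cmod d <= B * taylor_const x /\ forall h, Cmod h < sdist x / 2 -> Cmod (u n (x + h)%C - u n x - d * h) <= B * taylor_const x * (Cmod h * Cmod h))).
    assert (Hd : forall n, Cmod (d n) <= B * taylor_const x /\ forall h, Cmod h < sdist x / 2 -> Cmod (u n (x + h)%C - u n x - d n * h) <= B * taylor_const x * (Cmod h * Cmod h)).
    { intros n. exact (epsilon_spec (inhabits (RtoC 0)) (fun d => Cmod d <= B * taylor_const x /\ forall h, Cmod h < sdist x / 2 -> Cmod (u n (x + h)%C - u n x - d * h) <= B * taylor_const x * (Cmod h * Cmod h)) (Q n)). }
    destruct (Ulim_ex U HU d (B * taylor_const x)) as [dl Hdl]. apply Hd.
    exists dl. split. apply (Ulim_mod_le U HU _ _ _ Hdl). apply Hd.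
    intros h Hh. assert (Hxh := sdist_slit x h Hx Hh).
    apply (Ulim_mod_le U HU (fun n => u n (x + h)%C - u n x - d n * h)%C). 2: intros n; apply Hd; auto.
    apply Ulim_minus; auto. apply Ulim_minus; auto.
    apply (Ulim_ext U HU (fun n => h * d n)%C). intros; ring. rewrite Cmult_comm. apply Ulim_scal; auto.
  - intros x Hx. assert (Sx := slit_Im x ltac:(lra)). split.
    apply (Ulim_Im_ge U HU _ _ _ (Hv x Sx)). intros n; apply H; auto.
    apply (Ulim_Im_le U HU _ _ _ (Hv x Sx)). intros n; apply H; auto.
  - intros t Ht. assert (St : slit_plane (RtoC t)) by (apply slit_Re; rewrite re_RtoC; auto).
    apply Rle_antisym. apply (Ulim_Im_le U HU _ _ _ (Hv _ St)). intros n; right; apply H; auto.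
    apply (Ulim_Im_ge U HU _ _ _ (Hv _ St)). intros n; right; symmetry; apply H; auto.
Qed.

Lemma free_ultrafilter : exists U, ultra U.
Proof.
  destruct (filter.ultraFilterLemma filter.eventually_filter) as [G [HU Hsub]].
  assert (HP := filter.ultra_proper (F := G)).
  exists G. split; [|split; [|split; [|split]]].
  - intros N. apply Hsub. exists N. exact Logic.I.
    intros n Hn. apply (Bool.reflect_iff _ _ ssrnat.leP). exact Hn.
  - intros P Q HP' HQ. exact (filter.filterI HP' HQ).
  - intros P Q H HP'. exact (filter.filterS H HP').
  - intros P. exact (filter.in_ultra_setVsetC P HU).
  - intros H. exact (filter.filter_not_empty G H).
Qed.

(** * Functions with prescribed boundary angle on the negative axis *)

Definition den (x : C) (p : R) : C := (x * RtoC (cos p) + RtoC (sin p))%C.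
(** With t = tan p, [angle_ker] dp is (t / (1 + t^2) - 1 / (x + t)) dt, the kernel of the
    exponential representation of complete Bernstein functions with angle th(t) on the cut at - t.
    In the variable p the half-line is compact. *)
Definition angle_ker (x : C) (p : R) : C := ((x * RtoC (sin p) - RtoC (cos p)) / den x p)%C.

Lemma PI2_pos : 0 < PI / 2.
Proof. generalize PI_RGT_0; lra. Qed.

Lemma den_low x p : slit_plane x -> 0 <= p <= PI / 2 -> sdist x <= Cmod (den x p).
Proof. intros Hx Hp. apply sdist_spec; auto. Qed.

Lemma den_nz x p : slit_plane x -> 0 <= p <= PI / 2 -> den x p <> 0.
Proof. intros Hx Hp. apply Cmod_gt_0. generalize (den_low x p Hx Hp) (proj1 (sdist_spec x Hx)). lra. Qed.

Lemma RDer_cosC p : RDer (fun p => RtoC (cos p)) p (RtoC (- sin p)).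
Proof. apply RDer_real. auto_derive; auto. ring. Qed.
Lemma RDer_sinC p : RDer (fun p => RtoC (sin p)) p (RtoC (cos p)).
Proof. apply RDer_real. auto_derive; auto. ring. Qed.

Lemma RDer_den x p : RDer (den x) p (x * RtoC (- sin p) + RtoC (cos p))%C.
Proof. apply Der_plus. apply Der_scal, RDer_cosC. apply RDer_sinC. Qed.

Lemma RCont_cosC p : RCont (fun p => RtoC (cos p)) p.
Proof. eapply Der_Cont, RDer_cosC. Qed.
Lemma RCont_sinC p : RCont (fun p => RtoC (sin p)) p.
Proof. eapply Der_Cont, RDer_sinC. Qed.

Lemma RCont_den x p : RCont (den x) p.
Proof. eapply Der_Cont, RDer_den. Qed.

Lemma RCont_angle_ker x p : slit_plane x -> 0 <= p <= PI / 2 -> RCont (angle_ker x) p.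
Proof.
  intros Hx Hp. apply Cont_div. apply Cont_minus. apply Cont_mult. apply Cont_const. apply RCont_sinC. apply RCont_cosC.
  apply RCont_den. apply den_nz; auto.
Qed.

Lemma RtoC_cs p : (RtoC (sin p) * RtoC (sin p) + RtoC (cos p) * RtoC (cos p))%C = 1.
Proof. rewrite <- !RtoC_mult, <- RtoC_plus. f_equal. generalize (sin2_cos2 p). unfold Rsqr. lra. Qed.

Lemma den_slit x p : slit_plane x -> 0 <= p <= PI / 2 -> slit_plane (den x p).
Proof.
  intros Hx Hp. assert (0 <= cos p) by (apply cos_ge_0; generalize PI_RGT_0; lra).
  assert (0 <= sin p) by (apply sin_ge_0; generalize PI_RGT_0; lra).
  assert (E := sin2_cos2 p). unfold Rsqr in E.
  assert (Er : Re (den x p) = Re x * cos p + sin p) by (unfold den; rewrite re_plus, re_scal_r, re_RtoC; ring).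
  assert (Ei : Im (den x p) = Im x * cos p) by (unfold den; rewrite im_plus, im_scal_r, im_RtoC; ring).
  destruct (slit_cases x Hx) as [K|K].
  - apply slit_Re. rewrite Er. destruct (Req_dec (cos p) 0) as [E0|E0]. rewrite E0 in *. nra. nra.
  - destruct (Req_dec (cos p) 0) as [E0|E0]. apply slit_Re. rewrite Er, E0 in *. nra.
    apply slit_Im. rewrite Ei. apply Rmult_integral_contrapositive; auto.
Qed.

(** The kernel is the p-derivative of - Clog (den x p). So the constant angle PI represents the
    function x itself, the comparison case for the bound of the imaginary part. *)
Lemma CI_angle_ker x : slit_plane x -> CI (angle_ker x) 0 (PI / 2) = Clog x.
Proof.
  intros Hx. assert (P := PI2_pos).
  rewrite (CI_FTC (fun p => - Clog (den x p))%C).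
  - unfold den. rewrite cos_PI2, sin_PI2, cos_0, sin_0.
    replace (x * RtoC 0 + RtoC 1)%C with (RtoC 1) by ring. replace (x * RtoC 1 + RtoC 0)%C with x by ring.
    rewrite Clog_RtoC, ln_1 by lra. ring.
  - intros p Hp. rewrite Rmin_left, Rmax_right in Hp by lra. eapply Der_eq. apply Der_opp, Der_comp. apply CDer_Clog, den_slit; auto. apply RDer_den.
    unfold angle_ker. rewrite RtoC_opp. field. apply den_nz; auto.
  - apply contI_le. lra. intros. apply RCont_angle_ker; auto.
Qed.

Lemma Im_angle_ker x p : slit_plane x -> 0 <= p <= PI / 2 -> Im (angle_ker x p) = Im x * / (Cmod (den x p) * Cmod (den x p)).
Proof.
  intros Hx Hp. unfold angle_ker. rewrite im_div, Cmod_sq by (apply den_nz; auto). unfold Rdiv. f_equal.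
  unfold den. rewrite im_minus, re_minus, im_plus, re_plus, !im_scal_r, !re_scal_r, !re_RtoC, !im_RtoC.
  assert (E := sin2_cos2 p). unfold Rsqr in E.
  transitivity (Im x * (sin p * sin p + cos p * cos p)); [ring|rewrite E; ring].
Qed.

Definition angle_int (th : R -> R) (x : C) : C := (RtoC (/ PI) * CI (fun p => (angle_ker x p * RtoC (th p))%C) 0 (PI / 2))%C.

Definition angle (th : R -> R) := forall p, 0 <= p <= PI / 2 -> RCont (fun p => RtoC (th p)) p /\ 0 <= th p <= PI.

Lemma contI_angle_int th x : angle th -> slit_plane x -> contI (fun p => angle_ker x p * RtoC (th p))%C 0 (PI / 2).
Proof.
  intros Ht Hx. assert (P := PI2_pos). apply contI_le. lra. intros p Hp. apply Cont_mult. apply RCont_angle_ker; auto. apply Ht; auto.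
Qed.

Lemma log_cbf_angle_int th : angle th -> log_cbf PI (angle_int th).
Proof.
  intros Ht. assert (P := PI2_pos). assert (PP := PI_RGT_0).
  assert (IPI : Rabs (/ PI) = / PI) by (apply Rabs_pos_eq; apply Rlt_le, Rinv_0_lt_compat; auto).
  split; [|split].
  - intros x Hx. destruct (sdist_spec x Hx) as [Hd _]. set (d := sdist x) in *.
    assert (Id : 1 <= / d) by (rewrite <- Rinv_1; apply Rinv_le_contravar; lra).
    assert (Id2 : / d <= / d * / d) by nra. assert (Id3 : / d * / d <= / d * / d * / d) by nra.
    assert (Mx := Cmod_ge_0 x).
    assert (EK : taylor_const x = (1 + Cmod x) * (2 * (/ d * / d * / d))) by (unfold taylor_const; fold d; ring).
    (* An angle is at most PI and the interval has length PI / 2, so the integral divided by PI is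
       at most PI * M / 2; this is the origin of the class constant PI. *)
    assert (B : forall (g : R -> C) M, 0 <= M -> contI (fun p => g p * RtoC (th p))%C 0 (PI / 2) -> (forall p, 0 <= p <= PI / 2 -> Cmod (g p) <= M) ->
       M / 2 <= taylor_const x -> Cmod (RtoC (/ PI) * CI (fun p => g p * RtoC (th p))%C 0 (PI / 2)) <= PI * taylor_const x).
    { intros g M HM Hc Hg HK. rewrite Cmod_mult, Cmod_R, IPI.
      assert (Q : Cmod (CI (fun p => g p * RtoC (th p))%C 0 (PI / 2)) <= M * PI * (PI / 2 - 0)).
      { apply CI_bound; auto. lra. intros p Hp. rewrite Cmod_mult, Cmod_R. destruct (Ht p Hp) as [_ T]. rewrite Rabs_pos_eq by lra.
        apply Rmult_le_compat; try lra. apply Cmod_ge_0. auto. }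
      apply Rmult_le_compat_l with (r := / PI) in Q; [|apply Rlt_le, Rinv_0_lt_compat; auto].
      replace (/ PI * (M * PI * (PI / 2 - 0))) with (PI * (M / 2)) in Q by (field; lra).
      eapply Rle_trans; [exact Q|]. apply Rmult_le_compat_l; lra. }
    assert (Hcs : forall p, 0 <= p <= PI / 2 -> 0 <= sin p <= 1 /\ 0 <= cos p <= 1).
    { intros p Hp. repeat split. apply sin_ge_0; lra. apply SIN_bound. apply cos_ge_0; lra. apply COS_bound. }
    split.
    + apply (B (angle_ker x) ((1 + Cmod x) * / d)).
      * apply Rmult_le_pos; lra.
      * apply contI_angle_int; auto.
      * intros p Hp. unfold angle_ker. rewrite Cmod_div by (apply den_nz; auto). apply Rmult_le_compat. apply Cmod_ge_0.
        apply Rlt_le, Rinv_0_lt_compat, Cmod_gt_0, den_nz; auto.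
        { eapply Rle_trans; [apply Cmod_triangle|]. rewrite Cmod_opp, Cmod_mult, !Cmod_R. destruct (Hcs p Hp). rewrite !Rabs_pos_eq by lra. nra. }
        apply Rinv_le_contravar. lra. apply den_low; auto.
      * rewrite EK. assert ((1 + Cmod x) * / d <= (1 + Cmod x) * (/ d * / d * / d)) by (apply Rmult_le_compat_l; lra).
        assert (0 <= (1 + Cmod x) * / d) by (apply Rmult_le_pos; lra). lra.
    + exists (RtoC (/ PI) * CI (fun p => (/ (den x p * den x p) * RtoC (th p))%C) 0 (PI / 2))%C.
      assert (Cg : contI (fun p => / (den x p * den x p) * RtoC (th p))%C 0 (PI / 2)).
      { apply contI_le. lra. intros p Hp. apply Cont_mult. apply Cont_inv. apply Cont_mult; apply RCont_den. apply Cmult_neq_0; apply den_nz; auto. apply Ht; auto. }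
      split.
      * apply (B (fun p => / (den x p * den x p))%C (/ d * / d)); auto.
        -- apply Rmult_le_pos; lra.
        -- intros p Hp. rewrite Cmod_inv, Cmod_mult by (apply Cmult_neq_0; apply den_nz; auto). rewrite <- Rinv_mult.
           apply Rinv_le_contravar. nra. assert (L := den_low x p Hx Hp). fold d in L. nra.
        -- rewrite EK. assert (1 * (/ d * / d * / d) <= (1 + Cmod x) * (/ d * / d * / d)) by (apply Rmult_le_compat_r; lra). lra.
      * intros h Hh. assert (Hxh := sdist_slit x h Hx Hh).
        assert (Dh : forall p, 0 <= p <= PI / 2 -> d / 2 <= Cmod (den (x + h)%C p)).
        { intros p Hp. assert (L := den_low x p Hx Hp). fold d in L. fold d in Hh.
          replace (den x p) with (den (x + h)%C p - h * RtoC (cos p))%C in L by (unfold den; ring).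
          assert (Tr := Cmod_triangle (den (x + h)%C p) (- (h * RtoC (cos p)))%C). rewrite Cmod_opp, Cmod_mult, Cmod_R in Tr.
          destruct (Hcs p Hp). rewrite Rabs_pos_eq in Tr by lra. generalize (Cmod_ge_0 h). unfold Cminus in L. nra. }
        unfold angle_int.
        match goal with |- Cmod ?e <= _ => replace e with (RtoC (/ PI) * CI (fun p => ((- (h * h) * RtoC (cos p) / (den x p * den x p * den (x + h)%C p)) * RtoC (th p))%C) 0 (PI / 2))%C end.
        -- rewrite Cmod_mult, Cmod_R, IPI.
           assert (Q : Cmod (CI (fun p => (- (h * h) * RtoC (cos p) / (den x p * den x p * den (x + h)%C p)) * RtoC (th p))%C 0 (PI / 2)) <= (Cmod h * Cmod h * (2 * (/ d * / d * / d)) * PI) * (PI / 2 - 0)).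
           { apply CI_bound. lra.
             - apply contI_le. lra. intros p Hp. apply Cont_mult. apply Cont_div. apply Cont_mult. apply Cont_const. apply RCont_cosC.
               apply Cont_mult. apply Cont_mult; apply RCont_den. apply RCont_den. repeat apply Cmult_neq_0; apply den_nz; auto. apply Ht; auto.
             - intros p Hp. assert (N1 := den_nz x p Hx Hp). assert (N2 := den_nz _ p Hxh Hp).
               rewrite Cmod_mult, Cmod_div, !Cmod_mult, Cmod_opp, Cmod_mult, !Cmod_R by (repeat apply Cmult_neq_0; auto).
               destruct (Hcs p Hp). destruct (Ht p Hp) as [_ T]. rewrite !Rabs_pos_eq by lra.
               assert (L := den_low x p Hx Hp). fold d in L. specialize (Dh p Hp). generalize (Cmod_ge_0 h). intros Hh0.
               apply Rmult_le_compat; try lra.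
               + apply Rdiv_le_0_compat. repeat apply Rmult_le_pos; lra. repeat apply Rmult_lt_0_compat; lra.
               + unfold Rdiv. apply Rmult_le_compat. repeat apply Rmult_le_pos; lra. apply Rlt_le, Rinv_0_lt_compat. repeat apply Rmult_lt_0_compat; lra.
                 rewrite <- (Rmult_1_r (Cmod h * Cmod h)) at 2. apply Rmult_le_compat_l. apply Rmult_le_pos; lra. lra.
                 replace (2 * (/ d * / d * / d)) with (/ (d * d * (d / 2))) by (field; lra).
                 apply Rinv_le_contravar. repeat apply Rmult_lt_0_compat; lra. apply Rmult_le_compat; try lra. apply Rmult_le_pos; lra. apply Rmult_le_compat; lra. }
           apply Rmult_le_compat_l with (r := / PI) in Q; [|apply Rlt_le, Rinv_0_lt_compat; auto].
           eapply Rle_trans; [exact Q|].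
           replace (/ PI * (Cmod h * Cmod h * (2 * (/ d * / d * / d)) * PI * (PI / 2 - 0))) with (PI * (/ d * / d * / d) * (Cmod h * Cmod h)) by (field; lra).
           apply Rmult_le_compat_r. apply Rmult_le_pos; apply Cmod_ge_0. apply Rmult_le_compat_l. lra. rewrite EK.
           assert (1 * (/ d * / d * / d) <= (1 + Cmod x) * (/ d * / d * / d)) by (apply Rmult_le_compat_r; lra). lra.
        -- rewrite (CI_ext _ (fun p => angle_ker (x + h)%C p * RtoC (th p) - angle_ker x p * RtoC (th p) - h * (/ (den x p * den x p) * RtoC (th p)))%C).
           ++ rewrite CI_minus, CI_minus, CI_scal; auto. ring. apply contI_angle_int; auto. apply contI_angle_int; auto.
              intros p Hp. apply Cont_minus; apply contI_angle_int; auto. apply contI_scal; auto.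
           ++ intros p Hp. rewrite Rmin_left, Rmax_right in Hp by lra. assert (Hp' : 0 <= p <= PI / 2) by lra.
              assert (N1 := den_nz x p Hx Hp'). assert (N2 := den_nz _ p Hxh Hp'). unfold angle_ker.
              assert (E1 := RtoC_cs p).
              assert (En : ((x + h) * RtoC (sin p) - RtoC (cos p))%C = ((x * RtoC (sin p) - RtoC (cos p)) + h * RtoC (sin p))%C) by ring.
              assert (Ed : den (x + h)%C p = (den x p + h * RtoC (cos p))%C) by (unfold den; ring).
              (* The numerator and [den] have coefficient determinant sin^2 + cos^2 = 1, so the
                 difference of two kernels is h over the product of the denominators. *)
              assert (Key : ((x * RtoC (sin p) + h * RtoC (sin p) - RtoC (cos p)) * den x p - (x * RtoC (sin p) - RtoC (cos p)) * den (x + h)%C p)%C = h).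
              { rewrite <- (Cmult_1_r h) at 3. rewrite <- E1. unfold den. ring. }
              transitivity (((((x * RtoC (sin p) + h * RtoC (sin p) - RtoC (cos p)) * den x p - (x * RtoC (sin p) - RtoC (cos p)) * den (x + h)%C p) * den x p - h * den (x + h)%C p) / (den x p * den x p * den (x + h)%C p)) * RtoC (th p))%C.
              { rewrite Key. rewrite Ed at 2. field. auto. }
              field. auto.
  - intros x Hx. assert (Sx := slit_Im x ltac:(lra)).
    assert (EI : Im (angle_int th x) = / PI * RInt (fun p => Im (angle_ker x p) * th p) 0 (PI / 2)).
    { unfold angle_int. rewrite im_scal_l, CI_Im. f_equal. apply RInt_ext. intros p _. apply im_scal_r. }
    assert (exI : ex_RInt (fun p => Im (angle_ker x p) * th p) 0 (PI / 2)).
    { apply ex_RInt_ext with (fun p => Im (angle_ker x p * RtoC (th p))%C). intros p _. apply im_scal_r. apply (contI_ex_Im (fun p => angle_ker x p * RtoC (th p))%C). apply contI_angle_int; auto. }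
    assert (Ck : contI (angle_ker x) 0 (PI / 2)) by (apply contI_le; [lra|intros; apply RCont_angle_ker; auto]).
    assert (Pk : forall p, 0 <= p <= PI / 2 -> 0 <= Im (angle_ker x p)).
    { intros p Hp. rewrite Im_angle_ker by auto. assert (0 < Cmod (den x p)) by (apply Cmod_gt_0, den_nz; auto).
      apply Rmult_le_pos. lra. apply Rlt_le, Rinv_0_lt_compat. nra. }
    rewrite EI. split.
    + apply Rmult_le_pos. apply Rlt_le, Rinv_0_lt_compat; auto. apply RInt_ge_0; auto. lra.
      intros p Hp. apply Rmult_le_pos. apply Pk; lra. apply Ht; lra.
    + assert (K : RInt (fun p => Im (angle_ker x p) * th p) 0 (PI / 2) <= RInt (fun p => PI * Im (angle_ker x p)) 0 (PI / 2)).
      { apply RInt_le; auto. lra. apply (ex_RInt_scal (V := R_NormedModule)), contI_ex_Im; auto.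
        intros p Hp. rewrite Rmult_comm. apply Rmult_le_compat_r. apply Pk; lra. apply Ht; lra. }
      assert (ES : RInt (fun p => PI * Im (angle_ker x p)) 0 (PI / 2) = PI * Im (Clog x)).
      { rewrite <- CI_angle_ker, CI_Im by auto. apply (RInt_scal (V := R_CompleteNormedModule)). apply contI_ex_Im; auto. }
      rewrite ES in K. apply Rmult_le_compat_l with (r := / PI) in K; [|apply Rlt_le, Rinv_0_lt_compat; auto].
      rewrite <- Rmult_assoc, Rinv_l, Rmult_1_l in K by lra. generalize (Im_Clog_bound x). lra.
  - intros t Ht0. assert (St : slit_plane (RtoC t)) by (apply slit_Re; rewrite re_RtoC; auto).
    unfold angle_int. rewrite im_scal_l, CI_Im.
    rewrite (RInt_ext _ (fun _ => 0)). rewrite RInt_const. unfold scal; simpl; unfold mult; simpl. match goal with |- @eq _ ?u ?v => change (@eq R u v) end. ring.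
    intros p Hp. rewrite Rmin_left, Rmax_right in Hp by lra. rewrite im_scal_r, Im_angle_ker, im_RtoC by (auto; lra). match goal with |- @eq _ ?u ?v => change (@eq R u v) end. ring.
Qed.

Lemma angle_int_minus th1 th2 x : angle th1 -> angle th2 -> slit_plane x -> (angle_int th1 x - angle_int th2 x)%C = angle_int (fun p => th1 p - th2 p) x.
Proof.
  intros H1 H2 Hx. unfold angle_int. 
  rewrite (CI_ext (fun p => angle_ker x p * RtoC (th1 p - th2 p))%C (fun p => angle_ker x p * RtoC (th1 p) - angle_ker x p * RtoC (th2 p))%C).
  rewrite CI_minus by (apply contI_angle_int; auto). ring. intros p _. rewrite RtoC_minus. ring.
Qed.

(** * Stieltjes transforms in an increasing parameter *)

Section Stieltjes.
Variables (lam lam' th : R -> R) (a b : R).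
Hypothesis Hab : a <= b.
Hypothesis Hlam : forall r, a <= r <= b -> is_derive lam r (lam' r) /\ 0 <= lam r /\ 0 <= lam' r.
Hypothesis Clam' : forall r, a <= r <= b -> RCont (fun r => RtoC (lam' r)) r.
Hypothesis HTh : forall r, a <= r <= b -> RCont (fun r => RtoC (th r)) r /\ 0 <= th r <= PI.

(** The integral of - th / (PI (x + lambda)) with respect to lambda, pulled back to a parameter r in
    which lambda is nondecreasing. *)
Definition stieltjes (x : C) : C := (RtoC (- / PI) * CI (fun r => (RtoC (th r * lam' r) / (x + RtoC (lam r)))%C) a b)%C.

Let Clam r : a <= r <= b -> RCont (fun r => RtoC (lam r)) r.
Proof. intros Hr. eapply Der_Cont. apply RDer_real. apply Hlam; auto. Qed.

(** The direction p = atan (lam r) in [sdist] gives |x + lambda| >= sdist x * sqrt (1 + lambda^2),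
    and the root is at least (1 + lambda) / 2. *)
Let low x r : slit_plane x -> a <= r <= b -> sdist x * (1 + lam r) / 2 <= Cmod (x + RtoC (lam r)) /\
   forall h, Cmod h < sdist x / 2 -> sdist x * (1 + lam r) / 4 <= Cmod (x + h + RtoC (lam r)).
Proof.
  intros Hx Hr. destruct (sdist_spec x Hx) as [Hd Q]. destruct (Hlam r Hr) as [_ [L0 _]].
  set (l := lam r) in *. set (q := sqrt (1 + l²)).
  assert (Hq : 0 < q) by (apply sqrt_lt_R0; unfold Rsqr; nra).
  assert (Hqq : q * q = 1 + l * l) by (unfold q; rewrite sqrt_sqrt; unfold Rsqr; nra).
  assert (Hq1 : (1 + l) / 2 <= q) by (apply Rnot_lt_le; intros K; assert (0 <= (1 - l) * (1 - l)) by apply Rle_0_sqr; nra).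
  assert (Hq2 : 1 <= q) by (apply Rnot_lt_le; intros K; nra).
  assert (P := atan_bound l). assert (P0 : 0 <= atan l). { destruct L0 as [L|L]. rewrite <- atan_0. left. apply atan_increasing; auto. rewrite <- L, atan_0; lra. }
  specialize (Q (atan l) ltac:(lra)).
  assert (Nq : RtoC q <> 0) by (intros E'; apply RtoC_inj in E'; lra).
  assert (E : (x * RtoC (cos (atan l)) + RtoC (sin (atan l)))%C = ((x + RtoC l) / RtoC q)%C).
  { rewrite sin_atan, cos_atan. fold q. rewrite !RtoC_div by lra. field. auto. }
  rewrite E, Cmod_div, Cmod_R, Rabs_pos_eq in Q by (auto; lra).
  apply Rmult_le_compat_r with (r := q) in Q; [|lra]. unfold Rdiv in Q. rewrite Rmult_assoc, Rinv_l, Rmult_1_r in Q by lra.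
  assert (sdist x * ((1 + l) / 2) <= sdist x * q) by (apply Rmult_le_compat_l; lra).
  split. lra.
  intros h Hh. replace (x + h + RtoC l)%C with ((x + RtoC l) - (- h))%C by ring.
  generalize (Cmod_triangle_inv (x + RtoC l) (- h)). rewrite Cmod_opp.
  assert (sdist x * 1 <= sdist x * q) by (apply Rmult_le_compat_l; lra).
  assert (0 <= sdist x * l) by (apply Rmult_le_pos; lra). nra.
Qed.

Let nz x r : slit_plane x -> a <= r <= b -> (x + RtoC (lam r))%C <> 0.
Proof.
  intros Hx Hr. apply Cmod_gt_0. generalize (proj1 (low x r Hx Hr)) (proj1 (sdist_spec x Hx)). destruct (Hlam r Hr) as [_ [L0 _]].
  intros. eapply Rlt_le_trans; [|exact H]. apply Rdiv_lt_0_compat; [|lra]. apply Rmult_lt_0_compat; lra.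
Qed.

Let Cw r : a <= r <= b -> RCont (fun r => RtoC (th r * lam' r)) r.
Proof.
  intros Hr. apply (Cont_ext_loc _ (fun r => RtoC (th r) * RtoC (lam' r))%C _ r 1); [lra| | |].
  intros; rewrite <- RtoC_mult; auto. rewrite <- RtoC_mult; auto. apply Cont_mult. apply HTh; auto. apply Clam'; auto.
Qed.

Let Cg x : slit_plane x -> contI (fun r => RtoC (th r * lam' r) / (x + RtoC (lam r)))%C a b.
Proof.
  intros Hx. apply contI_le; auto. intros r Hr. apply Cont_div. apply Cw; auto. apply Cont_plus. apply Cont_const. apply Clam; auto. apply nz; auto.
Qed.

Let IP : 0 < / PI.
Proof. apply Rinv_0_lt_compat, PI_RGT_0. Qed.

Let sl1 : slit_plane (RtoC 1).
Proof. apply slit_Re. rewrite re_RtoC. lra. Qed.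

Let mass := RInt (fun r => th r * lam' r / (1 + lam r)) a b.

Let ex_mass : ex_RInt (fun r => th r * lam' r / (1 + lam r)) a b.
Proof.
  apply ex_RInt_ext with (fun r => Re (RtoC (th r * lam' r) / (RtoC 1 + RtoC (lam r)))).
  - intros r Hr. rewrite Rmin_left, Rmax_right in Hr by auto. destruct (Hlam r ltac:(lra)) as [_ [L0 _]].
    rewrite <- RtoC_plus, <- RtoC_div by lra. apply re_RtoC.
  - apply (contI_ex_Re (fun r => RtoC (th r * lam' r) / (RtoC 1 + RtoC (lam r)))%C). apply Cg. apply sl1.
Qed.

Lemma stieltjes_1 : Re (stieltjes (RtoC 1)) = - / PI * mass.
Proof.
  unfold stieltjes. rewrite re_scal_l, CI_Re. f_equal. apply RInt_ext. intros r Hr. rewrite Rmin_left, Rmax_right in Hr by auto.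
  destruct (Hlam r ltac:(lra)) as [_ [L0 _]]. rewrite <- RtoC_plus, <- RtoC_div by lra. apply re_RtoC.
Qed.

Let wpos r : a <= r <= b -> 0 <= th r * lam' r.
Proof. intros Hr. apply Rmult_le_pos. apply HTh; auto. apply Hlam; auto. Qed.

(** All kernels are O(1 / (1 + lambda)), hence controlled by the integral of th dlambda / (1 +
    lambda), which is the value at x = 1. The class constant thus depends neither on the interval
    nor on the range of lambda. *)
Lemma log_cbf_stieltjes B : 8 * (- Re (stieltjes (RtoC 1))) <= B -> log_cbf B stieltjes.
Proof.
  intros HB. rewrite stieltjes_1 in HB.
  assert (Hmass : 0 <= mass). { apply RInt_ge_0; auto. intros r Hr. destruct (Hlam r ltac:(lra)) as [_ [L0 _]]. apply Rdiv_le_0_compat; [apply wpos; lra|lra]. }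
  split; [|split].
  - intros x Hx. destruct (sdist_spec x Hx) as [Hd _]. set (d := sdist x) in *.
    assert (Id : 1 <= / d) by (rewrite <- Rinv_1; apply Rinv_le_contravar; lra).
    assert (Id2 : / d <= / d * / d) by nra. assert (Id3 : / d * / d <= / d * / d * / d) by nra.
    assert (Mx := Cmod_ge_0 x).
    assert (HK : 2 * (/ d * / d * / d) <= taylor_const x).
    { unfold taylor_const. fold d. assert (1 * (/ d * / d * / d) <= (1 + Cmod x) * (/ d * / d * / d)) by (apply Rmult_le_compat_r; lra). lra. }
    assert (Bd : forall (g : R -> C) M, 0 <= M -> contI (fun r => RtoC (th r * lam' r) * g r)%C a b -> (forall r, a <= r <= b -> Cmod (g r) <= M / (1 + lam r)) ->
       Cmod (RtoC (- / PI) * CI (fun r => (RtoC (th r * lam' r) * g r)%C) a b) <= M * (/ PI * mass)).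
    { intros g M HM Hc Hg. rewrite Cmod_mult, Cmod_R, Rabs_Ropp, Rabs_pos_eq by lra.
      assert (Q : Cmod (CI (fun r => RtoC (th r * lam' r) * g r)%C a b) <= M * mass).
      { eapply Rle_trans. apply CI_mod; auto. unfold mass. rewrite <- (RInt_scal (V := R_CompleteNormedModule)) by auto.
        apply RInt_le; auto. apply contI_ex_mod; auto. apply (ex_RInt_scal (V := R_NormedModule)); auto.
        intros r Hr. assert (Hr' : a <= r <= b) by lra. rewrite Cmod_mult, Cmod_R, Rabs_pos_eq by (apply wpos; auto).
        unfold scal; simpl; unfold mult; simpl. replace (M * (th r * lam' r / (1 + lam r))) with (th r * lam' r * (M / (1 + lam r))) by (unfold Rdiv; ring).
        apply Rmult_le_compat_l; auto. }
      apply Rmult_le_compat_l with (r := / PI) in Q; [|lra]. lra. }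
    assert (IPm : 0 <= / PI * mass) by (apply Rmult_le_pos; lra).
    (* The largest kernel bound is 16 / d^3, and [taylor_const] is at least 2 / d^3; their quotient
       is the 8 in the hypothesis. *)
    assert (HBK : forall M, M <= 16 * (/ d * / d * / d) -> M * (/ PI * mass) <= B * taylor_const x).
    { intros M HM. apply Rle_trans with ((8 * taylor_const x) * (/ PI * mass)). apply Rmult_le_compat_r; lra.
      assert (0 < taylor_const x) by (apply taylor_const_pos; auto). replace (8 * taylor_const x * (/ PI * mass)) with ((8 * (/ PI * mass)) * taylor_const x) by ring.
      apply Rmult_le_compat_r; lra. }
    split.
    + unfold stieltjes. rewrite (CI_ext _ (fun r => RtoC (th r * lam' r) * / (x + RtoC (lam r)))%C) by reflexivity.
      eapply Rle_trans. apply (Bd (fun r => / (x + RtoC (lam r)))%C (2 * / d)). lra. apply Cg; auto.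
      * intros r Hr. destruct (low x r Hx Hr) as [L _]. destruct (Hlam r Hr) as [_ [L0 _]]. fold d in L.
        rewrite Cmod_inv by (apply nz; auto). replace (2 * / d / (1 + lam r)) with (/ (d * (1 + lam r) / 2)) by (field; lra).
        apply Rinv_le_contravar; auto. apply Rdiv_lt_0_compat; [apply Rmult_lt_0_compat|]; lra.
      * apply HBK. lra.
    + exists (RtoC (- / PI) * CI (fun r => (RtoC (th r * lam' r) * (- / ((x + RtoC (lam r)) * (x + RtoC (lam r)))))%C) a b)%C.
      assert (Cd : contI (fun r => RtoC (th r * lam' r) * (- / ((x + RtoC (lam r)) * (x + RtoC (lam r)))))%C a b).
      { apply contI_le; auto. intros r Hr. apply Cont_mult. apply Cw; auto. apply Cont_opp, Cont_inv.
        apply Cont_mult; (apply Cont_plus; [apply Cont_const|apply Clam; auto]). apply Cmult_neq_0; apply nz; auto. }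
      split.
      * eapply Rle_trans. apply (Bd _ (4 * (/ d * / d))). lra. auto.
        -- intros r Hr. destruct (low x r Hx Hr) as [L _]. destruct (Hlam r Hr) as [_ [L0 _]]. fold d in L. assert (N := nz x r Hx Hr).
           rewrite Cmod_opp, Cmod_inv, Cmod_mult by (apply Cmult_neq_0; auto).
           apply Rle_trans with (/ ((d * (1 + lam r) / 2) * (d * (1 + lam r) / 2))).
           apply Rinv_le_contravar. assert (0 < d * (1 + lam r) / 2) by (apply Rdiv_lt_0_compat; [apply Rmult_lt_0_compat|]; lra). nra.
           assert (0 < d * (1 + lam r) / 2) by (apply Rdiv_lt_0_compat; [apply Rmult_lt_0_compat|]; lra). apply Rmult_le_compat; lra.
           replace (/ (d * (1 + lam r) / 2 * (d * (1 + lam r) / 2))) with (4 * (/ d * / d) / (1 + lam r) * / (1 + lam r)) by (field; lra).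
           rewrite <- Rmult_1_r. apply Rmult_le_compat_l. apply Rdiv_le_0_compat; lra. rewrite <- Rinv_1. apply Rinv_le_contravar; lra.
        -- apply HBK. lra.
      * intros h Hh. assert (Hxh := sdist_slit x h Hx Hh). fold d in Hh.
        assert (E : (stieltjes (x + h)%C - stieltjes x - RtoC (- / PI) * CI (fun r => (RtoC (th r * lam' r) * (- / ((x + RtoC (lam r)) * (x + RtoC (lam r)))))%C) a b * h)%C =
          (h * h * (RtoC (- / PI) * CI (fun r => (RtoC (th r * lam' r) * / ((x + RtoC (lam r)) * (x + RtoC (lam r)) * (x + h + RtoC (lam r))))%C) a b))%C).
        { assert (Cq : contI (fun r => RtoC (th r * lam' r) * / ((x + RtoC (lam r)) * (x + RtoC (lam r)) * (x + h + RtoC (lam r))))%C a b).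
          { apply contI_le; auto. intros r Hr. apply Cont_mult. apply Cw; auto. apply Cont_inv.
            apply Cont_mult. apply Cont_mult; (apply Cont_plus; [apply Cont_const|apply Clam; auto]). apply Cont_plus; [apply Cont_const|apply Clam; auto].
            apply Cmult_neq_0. apply Cmult_neq_0; apply nz; auto. apply nz; auto. }
          unfold stieltjes. replace (h * h * (RtoC (- / PI) * CI (fun r => (RtoC (th r * lam' r) * / ((x + RtoC (lam r)) * (x + RtoC (lam r)) * (x + h + RtoC (lam r))))%C) a b))%C with
            (RtoC (- / PI) * (h * h * CI (fun r => (RtoC (th r * lam' r) * / ((x + RtoC (lam r)) * (x + RtoC (lam r)) * (x + h + RtoC (lam r))))%C) a b))%C by ring.
          rewrite <- (CI_scal (h * h)) by auto.
          rewrite (CI_ext (fun r => (h * h) * (RtoC (th r * lam' r) * / ((x + RtoC (lam r)) * (x + RtoC (lam r)) * (x + h + RtoC (lam r)))))%C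
             (fun r => (RtoC (th r * lam' r) / (x + h + RtoC (lam r)) - RtoC (th r * lam' r) / (x + RtoC (lam r))) - h * (RtoC (th r * lam' r) * (- / ((x + RtoC (lam r)) * (x + RtoC (lam r))))))%C).
          - rewrite CI_minus, CI_minus, CI_scal; auto. ring.
            intros r Hr. apply Cont_minus; apply Cg; auto. apply contI_scal; auto.
          - intros r Hr. rewrite Rmin_left, Rmax_right in Hr by auto. assert (N1 := nz x r Hx ltac:(lra)). assert (N2 := nz _ r Hxh ltac:(lra)). field. auto. }
        rewrite E, Cmod_mult, (Cmod_mult h h), Rmult_comm. apply Rmult_le_compat_r. apply Rmult_le_pos; apply Cmod_ge_0.
        eapply Rle_trans. apply (Bd _ (16 * (/ d * / d * / d))). assert (0 <= / d * / d * / d) by (repeat apply Rmult_le_pos; lra). lra.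
        -- apply contI_le; auto. intros r Hr. apply Cont_mult. apply Cw; auto. apply Cont_inv.
           apply Cont_mult. apply Cont_mult; (apply Cont_plus; [apply Cont_const|apply Clam; auto]). apply Cont_plus; [apply Cont_const|apply Clam; auto].
           apply Cmult_neq_0. apply Cmult_neq_0; apply nz; auto. apply nz; auto.
        -- intros r Hr. destruct (low x r Hx Hr) as [L L']. specialize (L' h Hh). destruct (Hlam r Hr) as [_ [L0 _]]. fold d in L, L'.
           assert (N := nz x r Hx Hr). assert (N2 := nz _ r Hxh Hr).
           rewrite Cmod_inv, !Cmod_mult by (repeat apply Cmult_neq_0; auto).
           set (m := d * (1 + lam r)) in *. assert (Hm : 0 < m) by (apply Rmult_lt_0_compat; lra).
           apply Rle_trans with (/ ((m / 2) * (m / 2) * (m / 4))).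
           apply Rinv_le_contravar. repeat apply Rmult_lt_0_compat; lra. apply Rmult_le_compat; try lra. apply Rmult_le_pos; lra. apply Rmult_le_compat; lra.
           unfold m. replace (/ (d * (1 + lam r) / 2 * (d * (1 + lam r) / 2) * (d * (1 + lam r) / 4))) with (16 * (/ d * / d * / d) / (1 + lam r) * (/ (1 + lam r) * / (1 + lam r))) by (field; lra).
           rewrite <- Rmult_1_r. assert (0 < / (1 + lam r) <= 1). { split. apply Rinv_0_lt_compat; lra. rewrite <- Rinv_1. apply Rinv_le_contravar; lra. }
           apply Rmult_le_compat_l; [|nra]. apply Rdiv_le_0_compat; [|lra]. assert (0 <= / d * / d * / d) by (repeat apply Rmult_le_pos; lra). lra.
        -- apply HBK. lra.
  - intros x Hx. assert (Sx := slit_Im x ltac:(lra)).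
    assert (Sxl : forall r, slit_plane (x + RtoC (lam r))%C) by (intros r; apply slit_Im; rewrite im_plus, im_RtoC; lra).
    (* k is the r-derivative of - Clog (x + lam r), so the constant angle PI integrates to a
       difference of two arguments, which is less than PI. *)
    set (k := fun r => (- RtoC (lam' r) / (x + RtoC (lam r)))%C).
    assert (Ck : contI k a b).
    { apply contI_le; auto. intros r Hr. apply Cont_div. apply Cont_opp, Clam'; auto. apply Cont_plus. apply Cont_const. apply Clam; auto. apply nz; auto. }
    assert (Ek : CI k a b = (- Clog (x + RtoC (lam b)) - - Clog (x + RtoC (lam a)))%C).
    { apply (CI_FTC (fun r => - Clog (x + RtoC (lam r)))%C); auto. intros r Hr. rewrite Rmin_left, Rmax_right in Hr by auto.
      eapply Der_eq. apply Der_opp, (Der_comp _ Clog (fun r => x + RtoC (lam r))%C). apply CDer_Clog; auto. apply Der_plus. apply Der_const. apply RDer_real. apply Hlam; auto.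
      unfold k. field. apply nz; auto. }
    assert (Pk : forall r, a <= r <= b -> 0 <= Im (k r)).
    { intros r Hr. unfold k. rewrite im_div by (apply nz; auto). rewrite im_opp, re_opp, !im_RtoC, re_RtoC.
      apply Rdiv_le_0_compat. 2: apply norm_pos, nz; auto. rewrite im_plus, im_RtoC. destruct (Hlam r Hr) as [_ [_ L]].
      replace (- 0 * Re (x + RtoC (lam r)) - - lam' r * (Im x + 0)) with (lam' r * Im x) by ring. apply Rmult_le_pos; lra. }
    assert (EI : Im (stieltjes x) = / PI * RInt (fun r => Im (k r) * th r) a b).
    { unfold stieltjes. replace (Im (RtoC (- / PI) * CI (fun r => (RtoC (th r * lam' r) / (x + RtoC (lam r)))%C) a b)) with (/ PI * Im (- CI (fun r => RtoC (th r * lam' r) / (x + RtoC (lam r)))%C a b)) by (rewrite im_scal_l, im_opp; ring).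
      f_equal. replace (- CI (fun r => RtoC (th r * lam' r) / (x + RtoC (lam r)))%C a b)%C with (RtoC (-1) * CI (fun r => RtoC (th r * lam' r) / (x + RtoC (lam r)))%C a b)%C by ring.
      rewrite <- CI_scal, CI_Im by (apply Cg; auto). apply RInt_ext. intros r _. rewrite <- im_scal_r. f_equal. unfold k. rewrite RtoC_mult. unfold Cdiv. ring. }
    assert (exI : ex_RInt (fun r => Im (k r) * th r) a b).
    { apply ex_RInt_ext with (fun r => Im (k r * RtoC (th r))%C). intros p _. apply im_scal_r. apply (contI_ex_Im (fun r => k r * RtoC (th r))%C). apply contI_le; auto.
      intros r Hr. apply Cont_mult. apply Ck. rewrite Rmin_left, Rmax_right; auto. apply HTh; auto. }
    rewrite EI. split.
    + apply Rmult_le_pos. lra. apply RInt_ge_0; auto. intros r Hr. apply Rmult_le_pos. apply Pk; lra. apply HTh; lra.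
    + assert (K : RInt (fun r => Im (k r) * th r) a b <= RInt (fun r => PI * Im (k r)) a b).
      { apply RInt_le; auto. apply (ex_RInt_scal (V := R_NormedModule)), contI_ex_Im; auto.
        intros r Hr. rewrite Rmult_comm. apply Rmult_le_compat_r. apply Pk; lra. apply HTh; lra. }
      assert (ES : RInt (fun r => PI * Im (k r)) a b = PI * Im (CI k a b)).
      { rewrite CI_Im. apply (RInt_scal (V := R_CompleteNormedModule)). apply contI_ex_Im; auto. }
      rewrite ES, Ek, im_minus, !im_opp in K. apply Rmult_le_compat_l with (r := / PI) in K; [|lra].
      rewrite <- Rmult_assoc, Rinv_l, Rmult_1_l in K by (generalize PI_RGT_0; lra).
      assert (A1 := Im_Clog_bound (x + RtoC (lam a))). assert (A2 := Im_Clog_pos (x + RtoC (lam b))). rewrite im_plus, im_RtoC in A2. specialize (A2 ltac:(lra)). lra.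
  - intros t Ht. unfold stieltjes. rewrite im_scal_l, CI_Im. rewrite (RInt_ext _ (fun _ => 0)). rewrite RInt_const. unfold scal; simpl; unfold mult; simpl. match goal with |- @eq _ ?u ?v => change (@eq R u v) end. ring.
    intros r Hr. rewrite Rmin_left, Rmax_right in Hr by auto. destruct (Hlam r ltac:(lra)) as [_ [L0 _]].
    rewrite <- RtoC_plus, <- RtoC_div by lra. apply im_RtoC.
Qed.
End Stieltjes.

(** * Regular functions in the Cayley coordinate and their Wiener-Hopf factors *)

(** Compactness of the closed disc: bad points at distance less than 1 / (n + 1) from it would have
    a limit along U inside the disc, near which D contains everything. *)
Lemma closed_disc_nbhd U (D : C -> Prop) : ultra U -> open_set D -> (forall w, Cmod w <= 1 -> D w) -> exists R1, 1 < R1 /\ forall w, disc 0 R1 w -> D w.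
Proof.
  intros HU Ho HD. apply NNPP. intros N.
  assert (Q : forall n, exists w, Cmod w < 1 + / (INR n + 1) /\ ~ D w).
  { intros n. apply NNPP. intros N'. apply N. exists (1 + / (INR n + 1)).
    assert (0 < / (INR n + 1)) by (apply Rinv_0_lt_compat; generalize (pos_INR n); lra).
    split. lra. intros w Hw. apply NNPP. intros Nw. apply N'. exists w. split; auto.
    unfold disc in Hw. replace (w - RtoC 0)%C with w in Hw by ring. auto. }
  set (w := fun n => epsilon (inhabits (RtoC 0)) (fun w => Cmod w < 1 + / (INR n + 1) /\ ~ D w)).
  assert (Hw : forall n, Cmod (w n) < 1 + / (INR n + 1) /\ ~ D (w n)).
  { intros n. exact (epsilon_spec (inhabits (RtoC 0)) (fun w => Cmod w < 1 + / (INR n + 1) /\ ~ D w) (Q n)). }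
  destruct (Ulim_ex U HU w 2) as [l Hl].
  { intros n. destruct (Hw n) as [A _]. assert (/ (INR n + 1) <= / 1) by (apply Rinv_le_contravar; generalize (pos_INR n); lra). lra. }
  assert (Hl1 : Cmod l <= 1).
  { apply le_epsilon. intros eps He.
    destruct (archimed_cor1 (eps / 2) ltac:(lra)) as [N0 [HN0 HN0']].
    destruct (U_ex U HU _ (U_and U HU _ _ (Hl (eps / 2) ltac:(lra)) (proj1 HU N0))) as [n [H1 H2]]; cbv beta in *.
    destruct (Hw n) as [A _].
    assert (/ (INR n + 1) <= / INR N0). { apply Rinv_le_contravar. apply lt_0_INR; lia. apply le_INR in H2. lra. }
    generalize (Cmod_triangle_inv l (w n)). rewrite (Cmod_sub_sym l (w n)). lra. }
  destruct (Ho l (HD l Hl1)) as [r [Pr Hr]].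
  destruct (U_ex U HU _ (Hl r Pr)) as [n Hn]. apply (proj2 (Hw n)). auto.
Qed.

(* The Cayley coordinate maps the right half-plane onto the unit disc, with 0 -> 1 and oo -> -1. *)
Definition cay (xi : C) : C := ((1 - xi) / (1 + xi))%C.

(* A Rogers function in the Cayley coordinate that is holomorphic across the unit circle, with strict inequalities.
   reg_spine says that f is positive, and decreasing in the direction from -1 to 1, along the curve where it is real. *)
Record regular (f : C -> C) (R0 : R) : Prop := {
  reg_R0 : 1 < R0;
  reg_hol : hol (disc 0 R0) f;
  reg_slit : forall w t, Cmod w <= 1 -> 0 < t -> slit_plane (f w + RtoC t)%C;
  reg_up : forall y, 0 < y -> Im (f (cay (- Ci * RtoC y))) < 0;
  reg_down : forall y, 0 < y -> 0 < Im (f (cay (Ci * RtoC y)));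
  reg_spine : forall w, Cmod w < 1 -> Im (f w) = 0 -> 0 < Re (f w) /\ Re ((1 - w * w) * deriv f w) < 0;
  reg_1 : Im (f (RtoC 1)) = 0;
  reg_m1 : Im (f (RtoC (-1))) = 0 }.

Lemma cis_neg t : cis (- t) = (/ cis t)%C.
Proof.
  assert (E := cis_plus t (- t)). rewrite Rplus_opp_r, cis_0 in E.
  transitivity (/ cis t * (cis t * cis (- t)))%C. field; apply cis_nz. rewrite <- E. ring.
Qed.

Lemma cisE t : cis t = (RtoC (cos t) + Ci * RtoC (sin t))%C.
Proof. apply Ceq; unfold cis, Ci, Re, Im; simpl; ring. Qed.

Lemma Ci2 : (Ci * Ci)%C = (- (1))%C.
Proof. apply Ceq; unfold Ci, Re, Im; simpl; ring. Qed.

Lemma one_plus_nz xi : 0 <= Re xi -> (1 + xi)%C <> 0.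
Proof. intros H E. apply (f_equal Re) in E. rewrite re_plus, !re_RtoC in E. lra. Qed.

Lemma cay_tan p : 0 <= p < PI / 2 -> cay (- Ci * RtoC (tan p)) = cis (2 * p).
Proof.
  intros Hp. assert (Hc : 0 < cos p) by (apply cos_gt_0; lra).
  assert (Nc : RtoC (cos p) <> 0) by (intros E; apply RtoC_inj in E; lra).
  replace (2 * p) with (p + p) by ring. rewrite cis_plus.
  assert (Nz : (RtoC (cos p) + - Ci * RtoC (sin p))%C <> 0).
  { replace (RtoC (cos p) + - Ci * RtoC (sin p))%C with (cis (- p)). apply cis_nz. rewrite cisE, cos_neg, sin_neg, RtoC_opp. ring. }
  unfold cay, tan. rewrite RtoC_div by lra.
  transitivity ((RtoC (cos p) + Ci * RtoC (sin p)) / (RtoC (cos p) + - Ci * RtoC (sin p)))%C.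
  - field. split; auto.
  - rewrite <- cisE. replace (RtoC (cos p) + - Ci * RtoC (sin p))%C with (cis (- p)). rewrite cis_neg. field. apply cis_nz.
    rewrite cisE, cos_neg, sin_neg, RtoC_opp. ring.
Qed.

(** The upper arc of the circle is the image of the negative imaginary axis, with - i tan p at the
    angle 2 p. There the Schwarz kernel becomes the kernel of [angle_int] at - Ci * xi; the lower
    arc gives the other factor. *)
Lemma schwarz_ker_up xi p : 0 < Re xi -> 0 <= p <= PI / 2 -> (- Ci * schwarz_ker (cay xi) (2 * p))%C = angle_ker (- Ci * xi) p.
Proof.
  intros Hx Hp. assert (N1 := one_plus_nz xi ltac:(lra)).
  assert (Nd : den (- Ci * xi) p <> 0). { apply den_nz; auto. apply slit_Im. replace (Im (- Ci * xi)) with (- Re xi) by (unfold Ci, Re, Im; simpl; ring). lra. }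
  assert (Nc := cis_nz p). unfold schwarz_ker, angle_ker. replace (2 * p) with (p + p) by ring. rewrite cis_plus.
  set (c := RtoC (cos p)) in *. set (s := RtoC (sin p)) in *.
  assert (Ec : cis p = (c + Ci * s)%C) by apply cisE.
  assert (E1 := RtoC_cs p). fold c in E1. fold s in E1.
  assert (A : (cis p * cis p + 1)%C = (cis p * (RtoC 2 * c))%C).
  { rewrite Ec. rewrite <- E1 at 1. ring_simplify. replace (Ci ^ 2)%C with (- (1))%C by (rewrite <- Ci2; ring). ring. }
  assert (B : (cis p * cis p - 1)%C = (cis p * (RtoC 2 * Ci * s))%C).
  { rewrite Ec. rewrite <- E1 at 1. ring_simplify. replace (Ci ^ 2)%C with (- (1))%C by (rewrite <- Ci2; ring). ring. }
  assert (H2 : RtoC 2 <> 0) by (intros E; apply RtoC_inj in E; lra).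
  assert (NCi : Ci <> 0) by apply Ci_nz.
  assert (Num : (cis p * cis p + cay xi)%C = (cis p * RtoC 2 * (c + Ci * xi * s) / (1 + xi))%C).
  { unfold cay. transitivity (((cis p * cis p + 1) + xi * (cis p * cis p - 1)) / (1 + xi))%C. field; auto. rewrite A, B. field; auto. }
  assert (Den : (cis p * cis p - cay xi)%C = (cis p * RtoC 2 * Ci * den (- Ci * xi) p / (1 + xi))%C).
  { unfold cay. transitivity (((cis p * cis p - 1) + xi * (cis p * cis p + 1)) / (1 + xi))%C. field; auto. rewrite A, B. unfold den. fold c. fold s.
    transitivity (cis p * RtoC 2 * (Ci * s + - (Ci * Ci) * xi * c) / (1 + xi))%C. rewrite Ci2. field; auto. field; auto. }
  rewrite Num, Den.
  transitivity (- (c + Ci * xi * s) / den (- Ci * xi) p)%C. field; auto.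
  f_equal. ring.
Qed.

Lemma angle_ker_neg_schwarz_ker xi p : 0 < Re xi -> 0 <= p <= PI / 2 -> (Ci * schwarz_ker (cay xi) (- (2 * p)))%C = angle_ker (Ci * xi) p.
Proof.
  intros Hx Hp. assert (N1 := one_plus_nz xi ltac:(lra)).
  assert (Nd : den (Ci * xi) p <> 0). { apply den_nz; auto. apply slit_Im. replace (Im (Ci * xi)) with (Re xi) by (unfold Ci, Re, Im; simpl; ring). lra. }
  assert (Nc := cis_nz (- p)). unfold schwarz_ker, angle_ker. replace (- (2 * p)) with (- p + - p) by ring. rewrite cis_plus.
  set (c := RtoC (cos p)) in *. set (s := RtoC (sin p)) in *.
  assert (Ec : cis (- p) = (c - Ci * s)%C). { rewrite cisE, cos_neg, sin_neg, RtoC_opp. unfold c, s. ring. }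
  assert (E1 := RtoC_cs p). fold c in E1. fold s in E1.
  set (z := cis (- p)) in *.
  assert (A : (z * z + 1)%C = (z * (RtoC 2 * c))%C).
  { rewrite Ec. rewrite <- E1 at 1. ring_simplify. replace (Ci ^ 2)%C with (- (1))%C by (rewrite <- Ci2; ring). ring. }
  assert (B : (z * z - 1)%C = (- (z * (RtoC 2 * Ci * s)))%C).
  { rewrite Ec. rewrite <- E1 at 1. ring_simplify. replace (Ci ^ 2)%C with (- (1))%C by (rewrite <- Ci2; ring). ring. }
  assert (H2 : RtoC 2 <> 0) by (intros E; apply RtoC_inj in E; lra).
  assert (NCi : Ci <> 0) by apply Ci_nz.
  assert (Num : (z * z + cay xi)%C = (z * RtoC 2 * (c - Ci * xi * s) / (1 + xi))%C).
  { unfold cay. transitivity (((z * z + 1) + xi * (z * z - 1)) / (1 + xi))%C. field; auto. rewrite A, B. field; auto. }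
  assert (Den : (z * z - cay xi)%C = (- (z * RtoC 2 * Ci * den (Ci * xi) p) / (1 + xi))%C).
  { unfold cay. transitivity (((z * z - 1) + xi * (z * z + 1)) / (1 + xi))%C. field; auto. rewrite A, B. unfold den. fold c. fold s.
    transitivity (z * RtoC 2 * (- Ci * s + - (Ci * Ci) * xi * c) / (1 + xi))%C. rewrite Ci2. field; auto. field; auto. }
  rewrite Num, Den.
  transitivity (- (c - Ci * xi * s) / den (Ci * xi) p)%C. field; auto.
  f_equal. ring.
Qed.

Lemma cay_mod xi : 0 < Re xi -> Cmod (cay xi) < 1.
Proof.
  intros H. assert (N := one_plus_nz xi ltac:(lra)). unfold cay. rewrite Cmod_div by auto. apply Cmod_gt_0 in N.
  apply Rmult_lt_reg_r with (Cmod (1 + xi)); auto. unfold Rdiv. rewrite Rmult_assoc, Rinv_l, Rmult_1_l, Rmult_1_r by lra.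
  apply Rsqr_incrst_0; try apply Cmod_ge_0. unfold Rsqr. rewrite !Cmod_sq, re_minus, im_minus, re_plus, im_plus, re_RtoC, im_RtoC. nra.
Qed.

Lemma cay_invol xi : (1 + xi)%C <> 0 -> cay (cay xi) = xi.
Proof.
  intros N. unfold cay. assert (H2 : RtoC 2 <> 0) by (intros E; apply RtoC_inj in E; lra).
  assert (E1 : (1 + (1 - xi) / (1 + xi))%C = (RtoC 2 / (1 + xi))%C) by (field; auto).
  assert (E2 : (1 - (1 - xi) / (1 + xi))%C = (RtoC 2 * xi / (1 + xi))%C) by (field; auto).
  rewrite E1, E2. field; auto.
Qed.

Section Regular.
Variables (U : (nat -> Prop) -> Prop) (f : C -> C) (R0 : R).
Hypothesis HU : ultra U.
Hypothesis HR : regular f R0.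

Definition log_shift (t : R) (w : C) : C := Clog (f w + RtoC t)%C.

(* Up to sign, the arguments of f + t on the two halves of the imaginary axis, at xi = -i tan p and xi = i tan p. *)
Definition angle_up (t : R) (p : R) : R := - Im (log_shift t (cis (2 * p))).
Definition angle_down (t : R) (p : R) : R := Im (log_shift t (cis (- (2 * p)))).

Lemma log_shift_hol t : 0 < t -> exists R1, 1 < R1 /\ hol (disc 0 R1) (log_shift t) /\ forall w, disc 0 R1 w -> disc 0 R0 w.
Proof.
  intros Ht.
  destruct (closed_disc_nbhd U (fun w => disc 0 R0 w /\ slit_plane (f w + RtoC t)%C) HU) as [R1 [H1 H2]].
  - intros z [D1 D2]. destruct (disc_open 0 R0 z D1) as [r1 [P1 Q1]]. destruct (slit_open _ D2) as [r2 [P2 Q2]].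
    destruct (hol_Cont _ _ _ (reg_hol _ _ HR) D1 r2 P2) as [r3 [P3 Q3]].
    exists (Rmin r1 r3). split. apply Rmin_glb_lt; auto. intros w Hw. split.
    apply Q1. eapply Rlt_le_trans; [exact Hw|apply Rmin_l].
    apply Q2. replace (f w + RtoC t - (f z + RtoC t))%C with (f w - f z)%C by ring. apply Q3. eapply Rlt_le_trans; [exact Hw|apply Rmin_r].
  - intros w Hw. split. unfold disc. replace (w - RtoC 0)%C with w by ring. generalize (reg_R0 _ _ HR); lra. apply (reg_slit _ _ HR); auto.
  - exists R1. split; [|split]; auto. 2: intros w Hw; apply H2; auto.
    intros w Hw. destruct (H2 w Hw) as [D1 D2]. destruct (reg_hol _ _ HR w D1) as [d Hd].
    eexists. apply (Der_comp _ Clog (fun w => f w + RtoC t)%C). apply CDer_Clog; auto. apply Der_plus. exact Hd. apply Der_const.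
Qed.

Lemma cis_disc R1 s : 1 < R1 -> disc 0 R1 (cis s).
Proof. intros H. unfold disc. replace (cis s - RtoC 0)%C with (cis s) by ring. rewrite Cmod_cis; auto. Qed.

Lemma RCont_log_shift_cis t s : 0 < t -> RCont (fun s => log_shift t (cis s)) s.
Proof.
  intros Ht. destruct (log_shift_hol t Ht) as [R1 [H1 [H2 _]]]. apply Cont_comp. eapply hol_Cont; eauto. apply cis_disc; auto. apply RCont_cis.
Qed.

Lemma cis_PI : cis PI = RtoC (-1).
Proof. unfold cis. rewrite cos_PI, sin_PI. reflexivity. Qed.

Lemma Im_f_up p : 0 <= p <= PI / 2 -> Im (f (cis (2 * p))) <= 0.
Proof.
  intros Hp. destruct (Req_dec p 0) as [->|N0]. { rewrite Rmult_0_r, cis_0, (reg_1 _ _ HR). lra. }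
  destruct (Req_dec p (PI / 2)) as [->|N1]. { replace (2 * (PI / 2)) with PI by field. rewrite cis_PI, (reg_m1 _ _ HR). lra. }
  rewrite <- cay_tan by lra. left. apply (reg_up _ _ HR). apply tan_gt_0; lra.
Qed.

Lemma cay_conj y : cay (Ci * RtoC y) = Cconj (cay (- Ci * RtoC y)).
Proof.
  assert (N : (1 + - Ci * RtoC y)%C <> 0). { apply one_plus_nz. unfold Ci, Re; simpl. lra. }
  unfold cay. rewrite Cdiv_conj by auto. f_equal; [|f_equal]; apply Ceq; unfold Cconj, Ci, Re, Im; simpl; ring.
Qed.

Lemma Im_f_down p : 0 <= p <= PI / 2 -> 0 <= Im (f (cis (- (2 * p)))).
Proof.
  intros Hp. destruct (Req_dec p 0) as [->|N0]. { rewrite Rmult_0_r, Ropp_0, cis_0, (reg_1 _ _ HR). lra. }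
  destruct (Req_dec p (PI / 2)) as [->|N1].
  { replace (cis (- (2 * (PI / 2)))) with (RtoC (-1)). rewrite (reg_m1 _ _ HR). lra.
    replace (2 * (PI / 2)) with PI by field. unfold cis. rewrite cos_neg, sin_neg, cos_PI, sin_PI, Ropp_0. reflexivity. }
  replace (cis (- (2 * p))) with (cay (Ci * RtoC (tan p))). left. apply (reg_down _ _ HR). apply tan_gt_0; lra.
  rewrite cay_conj, cay_tan, cis_conj, cis_neg by lra. reflexivity.
Qed.

Lemma Im_log_shift_neg t w : Im (f w) <= 0 -> Im (log_shift t w) <= 0.
Proof.
  intros H. unfold log_shift. assert (E : Im (f w + RtoC t) = Im (f w)) by (rewrite im_plus, im_RtoC; ring).
  destruct H as [H|H]. left; apply Im_Clog_neg; lra. right; apply Im_Clog_real; lra.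
Qed.

Lemma Im_log_shift_pos t w : 0 <= Im (f w) -> 0 <= Im (log_shift t w).
Proof.
  intros H. unfold log_shift. assert (E : Im (f w + RtoC t) = Im (f w)) by (rewrite im_plus, im_RtoC; ring).
  destruct H as [H|H]. left; apply Im_Clog_pos; lra. right; symmetry; apply Im_Clog_real; lra.
Qed.

Lemma RCont_lin (g : R -> C) (u p : R) : RCont g (u * p) -> RCont (fun p => g (u * p)%R) p.
Proof. intros H. apply (Cont_compR RtoC (fun p => u * p) g); auto. eapply Der_Cont. apply (RDer_real (fun p => u * p) p u). auto_derive; auto. ring. Qed.

Lemma RCont_angle_up t p : 0 < t -> RCont (fun p => RtoC (angle_up t p)) p.
Proof.
  intros Ht. apply (Cont_ext_loc _ (fun p => - RtoC (Im (log_shift t (cis (2 * p)))))%C _ p 1). lra.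
  intros; unfold angle_up; rewrite RtoC_opp; auto. unfold angle_up; rewrite RtoC_opp; auto.
  apply Cont_opp, (Cont_Im _ (fun p => log_shift t (cis (2 * p)))). apply (RCont_lin (fun s => log_shift t (cis s))). apply RCont_log_shift_cis; auto.
Qed.

Lemma RCont_angle_down t p : 0 < t -> RCont (fun p => RtoC (angle_down t p)) p.
Proof.
  intros Ht. apply (Cont_Im _ (fun p => log_shift t (cis (- (2 * p))))).
  apply (Cont_ext_loc _ (fun p => log_shift t (cis (-2 * p))) _ p 1). lra.
  intros; do 2 f_equal; ring. do 2 f_equal; ring.
  apply (RCont_lin (fun s => log_shift t (cis s))). apply RCont_log_shift_cis; auto.
Qed.

Lemma angle_angle_up t : 0 < t -> angle (angle_up t).
Proof.
  intros Ht p Hp. split. apply RCont_angle_up; auto. unfold angle_up. assert (A := Im_log_shift_neg t _ (Im_f_up p Hp)).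
  assert (B := Im_Clog_bound (f (cis (2 * p)) + RtoC t)). unfold log_shift in *. lra.
Qed.

Lemma angle_angle_down t : 0 < t -> angle (angle_down t).
Proof.
  intros Ht p Hp. split. apply RCont_angle_down; auto. unfold angle_down. assert (A := Im_log_shift_pos t _ (Im_f_down p Hp)).
  assert (B := Im_Clog_bound (f (cis (- (2 * p))) + RtoC t)). unfold log_shift in *. lra.
Qed.

(* Im Clog (b + t) is monotone in t, with derivative - Im b / |b + t|^2. *)
Lemma Im_Clog_mono b t1 t2 : (forall t, 0 < t -> slit_plane (b + RtoC t)%C) -> 0 < t1 -> t1 <= t2 ->
  (Im b <= 0 -> Im (Clog (b + RtoC t1)) <= Im (Clog (b + RtoC t2))) /\ (0 <= Im b -> Im (Clog (b + RtoC t2)) <= Im (Clog (b + RtoC t1))).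
Proof.
  intros Hb H1 H2.
  set (k := fun t => (/ (b + RtoC t))%C).
  assert (Ck : contI k t1 t2).
  { apply contI_le; auto. intros t Ht. apply Cont_inv. apply Cont_plus. apply Cont_const. apply Cont_id. apply slit_nz, Hb. lra. }
  assert (E : CI k t1 t2 = (Clog (b + RtoC t2) - Clog (b + RtoC t1))%C).
  { apply (CI_FTC (fun t => Clog (b + RtoC t))); auto. intros t Ht. rewrite Rmin_left, Rmax_right in Ht by auto.
    eapply Der_eq. apply (Der_comp _ Clog (fun t => b + RtoC t)%C). apply CDer_Clog, Hb; lra. apply Der_plus. apply Der_const. apply Der_id. unfold k; ring. }
  apply (f_equal Im) in E. rewrite CI_Im, im_minus in E.
  assert (Ik : forall t, t1 <= t <= t2 -> Im (k t) = - Im b * / (Re (b + RtoC t) * Re (b + RtoC t) + Im (b + RtoC t) * Im (b + RtoC t)) /\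
    0 < / (Re (b + RtoC t) * Re (b + RtoC t) + Im (b + RtoC t) * Im (b + RtoC t))).
  { intros t Ht. assert (N := slit_nz _ (Hb t ltac:(lra))). split. unfold k. replace (/ (b + RtoC t))%C with (RtoC 1 / (b + RtoC t))%C by (field; auto).
    rewrite im_div, re_RtoC, im_RtoC by auto. unfold Rdiv. f_equal. rewrite im_plus, im_RtoC. ring.
    apply Rinv_0_lt_compat, norm_pos; auto. }
  split; intros Hi.
  - assert (0 <= RInt (fun t => Im (k t)) t1 t2).
    { apply RInt_ge_0; auto. apply contI_ex_Im; auto. intros t Ht. destruct (Ik t ltac:(lra)) as [-> P]. apply Rmult_le_pos; lra. }
    lra.
  - assert (0 <= RInt (fun t => - Im (k t)) t1 t2).
    { apply RInt_ge_0; auto. apply (ex_RInt_opp (V := R_NormedModule)), contI_ex_Im; auto. intros t Ht. destruct (Ik t ltac:(lra)) as [-> P].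
      replace (- (- Im b * / (Re (b + RtoC t) * Re (b + RtoC t) + Im (b + RtoC t) * Im (b + RtoC t)))) with (Im b * / (Re (b + RtoC t) * Re (b + RtoC t) + Im (b + RtoC t) * Im (b + RtoC t))) by ring. apply Rmult_le_pos; lra. }
    assert (E2 : RInt (fun t => - Im (k t)) t1 t2 = - RInt (fun t => Im (k t)) t1 t2).
    { apply (RInt_opp (V := R_CompleteNormedModule)). apply contI_ex_Im; auto. }
    lra.
Qed.

Lemma angle_up_decr t1 t2 : 0 < t1 -> t1 <= t2 -> angle (fun p => angle_up t1 p - angle_up t2 p).
Proof.
  intros H1 H2 p Hp. split.
  - apply (Cont_ext_loc _ (fun p => RtoC (angle_up t1 p) - RtoC (angle_up t2 p))%C _ p 1). lra.
    intros; rewrite RtoC_minus; auto. rewrite RtoC_minus; auto. apply Cont_minus; apply RCont_angle_up; lra.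
  - destruct (angle_angle_up t1 H1 p Hp) as [_ A]. destruct (angle_angle_up t2 ltac:(lra) p Hp) as [_ B].
    destruct (Im_Clog_mono (f (cis (2 * p))) t1 t2) as [M _]; auto.
    intros t Ht. apply (reg_slit _ _ HR); auto. rewrite Cmod_cis; lra.
    specialize (M (Im_f_up p Hp)). unfold angle_up, log_shift in *. lra.
Qed.

Lemma angle_down_decr t1 t2 : 0 < t1 -> t1 <= t2 -> angle (fun p => angle_down t1 p - angle_down t2 p).
Proof.
  intros H1 H2 p Hp. split.
  - apply (Cont_ext_loc _ (fun p => RtoC (angle_down t1 p) - RtoC (angle_down t2 p))%C _ p 1). lra.
    intros; rewrite RtoC_minus; auto. rewrite RtoC_minus; auto. apply Cont_minus; apply RCont_angle_down; lra.
  - destruct (angle_angle_down t1 H1 p Hp) as [_ A]. destruct (angle_angle_down t2 ltac:(lra) p Hp) as [_ B].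
    destruct (Im_Clog_mono (f (cis (- (2 * p)))) t1 t2) as [_ M]; auto.
    intros t Ht. apply (reg_slit _ _ HR); auto. rewrite Cmod_cis; lra.
    specialize (M (Im_f_down p Hp)). unfold angle_down, log_shift in *. lra.
Qed.

Lemma wh_formula t xi : 0 < t -> 0 < Re xi ->
  log_shift t (cay xi) = (RtoC (Re (log_shift t (RtoC 0))) + angle_int (angle_up t) (- Ci * xi) + angle_int (angle_down t) (Ci * xi))%C.
Proof.
  intros Ht Hxi. destruct (log_shift_hol t Ht) as [R1 [H1 [H2 _]]]. assert (P := PI2_pos). assert (PP := PI_RGT_0).
  assert (Ha := cay_mod xi Hxi). set (a := cay xi) in *.
  (* The factor - i turns the argument of f + t into the real part, from which the Schwarz formula
     recovers a function. *)
  assert (HH : hol (disc 0 R1) (fun w => - Ci * log_shift t w)%C). { intros w Hw. destruct (H2 w Hw) as [d Hd]. eexists. apply Der_scal; eauto. }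
  assert (S := schwarz _ R1 a HH H1 Ha). cbv beta in S.
  replace (Im (- Ci * log_shift t (RtoC 0))) with (- Re (log_shift t (RtoC 0))) in S by (unfold Ci, Re, Im; simpl; ring).
  set (G := fun s => (RtoC (Im (log_shift t (cis s))) * schwarz_ker a s)%C).
  assert (CG : forall s, RCont G s). { intros s. apply Cont_mult. apply (Cont_Im _ (fun s => log_shift t (cis s))), RCont_log_shift_cis; auto. apply RCont_schwarz_ker; auto. }
  rewrite (CI_ext _ G) in S.
  2:{ intros s _. unfold G. do 2 f_equal. unfold Ci, Re, Im; simpl; ring. }
  assert (Split : CI G 0 (2 * PI) = (CI G 0 PI + CI G PI (2 * PI))%C) by (symmetry; apply CI_Chasles; intros s _; auto).
  assert (L1 : CI G 0 PI = (RtoC 2 * CI (fun p => G (2 * p)%R) 0 (PI / 2))%C).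
  { assert (K := CI_lin G 2 0 0 (PI / 2)). replace (2 * 0 + 0) with 0 in K by ring. replace (2 * (PI / 2) + 0) with PI in K by field.
    rewrite <- K by (intros s _; auto). rewrite <- CI_scal by (intros s _; apply RCont_lin; auto). apply CI_ext. intros s _. rewrite Rplus_0_r. reflexivity. }
  assert (L2 : CI G PI (2 * PI) = (RtoC 2 * CI (fun p => G (- (2 * p))%R) 0 (PI / 2))%C).
  { assert (K := CI_lin G (-2) (2 * PI) 0 (PI / 2)). replace (-2 * 0 + 2 * PI) with (2 * PI) in K by ring. replace (-2 * (PI / 2) + 2 * PI) with PI in K by field.
    rewrite (CI_swap G (2 * PI) PI), <- K by (intros s _; auto).
    assert (Per : forall s, G (-2 * s + 2 * PI) = G (- (2 * s))).
    { intros s. unfold G, schwarz_ker. replace (cis (-2 * s + 2 * PI)) with (cis (- (2 * s))). reflexivity.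
      rewrite cis_plus, cis_2PI, Cmult_1_r. f_equal. ring. }
    rewrite (CI_ext _ (fun p => RtoC (-2) * G (- (2 * p))%R)%C) by (intros s _; rewrite Per; auto).
    rewrite CI_scal. replace (RtoC (-2)) with (- RtoC 2)%C by (rewrite <- RtoC_opp; reflexivity). ring.
    intros s _. apply (Cont_ext_loc _ (fun p => G (-2 * p)) _ s 1). lra. intros; f_equal; ring. f_equal; ring. apply RCont_lin; auto. }
  rewrite Split, L1, L2 in S.
  assert (K1 : CI (fun p => angle_ker (- Ci * xi) p * RtoC (angle_up t p))%C 0 (PI / 2) = (Ci * CI (fun p => G (2 * p)%R) 0 (PI / 2))%C).
  { rewrite <- CI_scal by (intros s _; apply RCont_lin; auto). apply CI_ext. intros p Hp. rewrite Rmin_left, Rmax_right in Hp by lra.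
    rewrite <- schwarz_ker_up by (auto; lra). fold a. unfold G, angle_up. rewrite RtoC_opp. ring. }
  assert (K2 : CI (fun p => angle_ker (Ci * xi) p * RtoC (angle_down t p))%C 0 (PI / 2) = (Ci * CI (fun p => G (- (2 * p))%R) 0 (PI / 2))%C).
  { rewrite <- CI_scal. apply CI_ext. intros p Hp. rewrite Rmin_left, Rmax_right in Hp by lra.
    rewrite <- angle_ker_neg_schwarz_ker by (auto; lra). fold a. unfold G, angle_down. ring.
    intros s _. apply (Cont_ext_loc _ (fun p => G (-2 * p)) _ s 1). lra. intros; f_equal; ring. f_equal; ring. apply RCont_lin; auto. }
  unfold angle_int. rewrite K1, K2.
  assert (N2 := two_PI_nz). assert (NP : RtoC PI <> 0) by (intros E; apply RtoC_inj in E; lra).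
  transitivity (RtoC (Re (log_shift t (RtoC 0))) + Ci * / RtoC (2 * PI) * (RtoC (2 * PI) * (- Ci * log_shift t a - Ci * RtoC (- Re (log_shift t (RtoC 0))))))%C.
  - rewrite RtoC_opp. transitivity (RtoC (Re (log_shift t (RtoC 0))) + (- (Ci * Ci)) * log_shift t a + (Ci * Ci) * RtoC (Re (log_shift t (RtoC 0))))%C.
    rewrite Ci2. ring. field. auto.
  - rewrite <- S. rewrite RtoC_inv, RtoC_mult by lra. field. auto.
Qed.
End Regular.

(** * Functions that cross zero only upwards *)

Definition contR (u : R -> R) t := RCont (fun s => RtoC (u s)) t.

Lemma contR_eps u t : contR u t -> forall eps, 0 < eps -> exists del, 0 < del /\ forall s, Rabs (s - t) < del -> Rabs (u s - u t) < eps.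
Proof.
  intros H eps He. destruct (H eps He) as [d [P Q]]. exists d; split; auto. intros s Hs. specialize (Q s). rewrite !Cmod_RR in Q. auto.
Qed.

Lemma derive_pos_sign u z l : is_derive u z l -> 0 < l -> u z = 0 ->
  exists del, 0 < del /\ (forall s, z - del < s < z -> u s < 0) /\ (forall s, z < s < z + del -> 0 < u s).
Proof.
  intros H Hl Hz. destruct (Der_dom _ _ _ _ (RDer_real u z l H) (l/2) ltac:(lra)) as [d [P Q]].
  exists d. split; auto.
  assert (K : forall s, Rabs (s - z) < d -> Rabs (u s - l * (s - z)) <= l / 2 * Rabs (s - z)).
  { intros s Hs. specialize (Q s). rewrite Cmod_RR in Q. specialize (Q Hs). rewrite Hz in Q.
    replace (RtoC (u s) - RtoC 0 - RtoC l * (RtoC s - RtoC z))%C with (RtoC (u s - l * (s - z))) in Q by (rewrite !RtoC_minus, RtoC_mult, RtoC_minus; ring).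
    rewrite Cmod_R in Q. auto. }
  split; intros s Hs.
  - specialize (K s). rewrite (Rabs_left (s - z)) in K by lra. specialize (K ltac:(lra)). apply Rabs_le_between in K. nra.
  - specialize (K s). rewrite (Rabs_pos_eq (s - z)) in K by lra. specialize (K ltac:(lra)). apply Rabs_le_between in K. nra.
Qed.

(** Let z be the supremum of the times up to which u is positive. A zero at z would force negative
    values just before z, and the other two signs of u z contradict the choice of z by
    continuity. *)
Lemma stays_pos u p q : p <= q -> (forall t, p <= t <= q -> contR u t) -> 0 < u p ->
  (forall z, p < z <= q -> u z = 0 -> exists del, 0 < del /\ forall s, z - del < s < z -> u s < 0) -> 0 < u q.
Proof.
  intros Hpq Hc Hp Hz. apply NNPP. intros N. apply Rnot_lt_le in N.
  destruct (completeness (fun t => p <= t <= q /\ forall s, p <= s <= t -> 0 < u s)) as [z [L1 L2]].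
  - exists q. intros t [Ht _]. lra.
  - exists p. split. lra. intros s Hs. replace s with p by lra. auto.
  - assert (Hpz : p <= z). { apply L1. split. lra. intros s Hs. replace s with p by lra. auto. }
    assert (Hzq : z <= q). { apply L2. intros t [Ht _]. lra. }
    assert (Below : forall s, p <= s < z -> 0 < u s).
    { intros s Hs. apply NNPP. intros Ns. assert (z <= s); [|lra]. apply L2. intros t [Ht1 Ht2].
      apply Rnot_lt_le. intros Hst. apply Ns. apply Ht2. lra. }
    assert (Hzc := Hc z (conj Hpz Hzq)).
    destruct (Rtotal_order (u z) 0) as [Hn|[E|Hpos]].
    + destruct (contR_eps u z Hzc (- u z) ltac:(lra)) as [d [Pd Qd]].
      destruct (Rle_lt_or_eq_dec _ _ Hpz) as [Hlt|Heq]; [|subst; lra].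
      set (s := Rmax p (z - d / 2)). assert (Hs : p <= s < z). { split. apply Rmax_l. apply Rmax_lub_lt; lra. }
      assert (Hs2 : z - d / 2 <= s) by apply Rmax_r.
      specialize (Qd s ltac:(apply Rabs_def1; lra)). apply Rabs_def2 in Qd. generalize (Below s Hs). lra.
    + destruct (Rle_lt_or_eq_dec _ _ Hpz) as [Hlt|Heq]; [|subst; lra].
      destruct (Hz z (conj Hlt Hzq) E) as [d [Pd Qd]].
      set (s := Rmax p (z - d / 2)). assert (Hs : p <= s < z). { split. apply Rmax_l. apply Rmax_lub_lt; lra. }
      assert (Hs2 : z - d / 2 <= s) by apply Rmax_r.
      generalize (Below s Hs) (Qd s ltac:(lra)). lra.
    + destruct (contR_eps u z Hzc (u z) ltac:(lra)) as [d [Pd Qd]].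
      destruct (Rle_lt_or_eq_dec _ _ Hzq) as [Hlt|Heq]; [|subst; lra].
      set (t := Rmin q (z + d / 2)). assert (Ht : z < t <= q). { split. apply Rmin_glb_lt; lra. apply Rmin_l. }
      assert (Ht2 : t <= z + d / 2) by apply Rmin_r.
      assert (t <= z); [|lra]. apply L1. split. lra. intros s Hs.
      destruct (Rlt_le_dec s z). apply Below; lra.
      specialize (Qd s ltac:(apply Rabs_def1; lra)). apply Rabs_def2 in Qd. lra.
Qed.

Lemma upcrossing u a b : a < b -> (forall t, a <= t <= b -> contR u t) -> u a < 0 -> 0 < u b ->
  (forall z, a < z < b -> u z = 0 -> exists l, is_derive u z l /\ 0 < l) ->
  exists c, a < c < b /\ u c = 0 /\ (forall t, a <= t < c -> u t < 0) /\ (forall t, c < t <= b -> 0 < u t).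
Proof.
  intros Hab Hc Ha Hb Hz.
  destruct (Ranalysis5.IVT_interv u a b) as [c [Hc1 Hc2]]; auto.
  { intros t Ht. apply continuity_pt_filterlim. apply (RCont_Re_continuous (fun s => RtoC (u s))). apply Hc; auto. }
  assert (Hca : a < c < b). { split; apply Rnot_le_lt; intros K. assert (c = a) by lra; subst; lra. assert (c = b) by lra; subst; lra. }
  destruct (Hz c Hca Hc2) as [l [Hl Hl0]]. destruct (derive_pos_sign u c l Hl Hl0 Hc2) as [d [Pd [Q1 Q2]]].
  exists c. split; [|split; [|split]]; auto.
  - intros t Ht. apply Ropp_lt_cancel. rewrite Ropp_0.
    (* the reflected function s |-> - u (- s) crosses zero upwards as well *)
    set (q := Rmax t (c - d / 2)). assert (Hq : t <= q < c). { split. apply Rmax_l. apply Rmax_lub_lt; lra. }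
    assert (Hq2 : c - d / 2 <= q) by apply Rmax_r.
    assert (K := stays_pos (fun s => - u (- s)) (- q) (- t) ltac:(lra)). cbv beta in K. rewrite !Ropp_involutive in K. apply K.
    + intros s Hs eps He. destruct (contR_eps u (- s) (Hc (- s) ltac:(lra)) eps He) as [e [Pe Qe]]. exists e; split; auto.
      intros s' Hs'. rewrite Cmod_RR in *. replace (- u (- s') - - u (- s)) with (- (u (- s') - u (- s))) by ring. rewrite Rabs_Ropp. apply Qe.
      replace (- s' - - s) with (- (s' - s)) by ring. rewrite Rabs_Ropp. auto.
    + specialize (Q1 q ltac:(lra)). lra.
    + intros z Hzz Ez. assert (u (- z) = 0) by lra. destruct (Rle_lt_or_eq_dec a (- z)) as [H1|H1]; [lra| |rewrite <- H1 in H; lra].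
      destruct (Hz (- z) ltac:(lra) H) as [l' [Hl' Hl0']]. destruct (derive_pos_sign u (- z) l' Hl' Hl0' H) as [d' [Pd' [_ Q2']]].
      exists d'. split; auto. intros s Hs. specialize (Q2' (- s) ltac:(lra)). lra.
  - intros t Ht. set (q := Rmin t (c + d / 2)). assert (Hq : c < q <= t). { split. apply Rmin_glb_lt; lra. apply Rmin_l. }
    assert (Hq2 : q <= c + d / 2) by apply Rmin_r.
    apply (stays_pos u q t); try lra.
    + intros s Hs. apply Hc; lra.
    + apply Q2; lra.
    + intros z Hzz Ez. destruct (Rle_lt_or_eq_dec z b) as [H1|H1]; [lra| |rewrite H1 in Ez; lra].
      destruct (Hz z ltac:(lra) Ez) as [l' [Hl' Hl0']]. destruct (derive_pos_sign u z l' Hl' Hl0' Ez) as [d' [Pd' [Q1' _]]].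
      exists d'. split; auto.
Qed.

(** Implicit differentiation: the increment of F along the curve is a real number D, and that of s
    is D / phi with Caratheodory's factor phi. The normalisation Re (s q) = q gives D = (q - r) / Re
    (1 / phi), which shows both derivatives at once. *)
Lemma level_curve_der (F : C -> C) (s : R -> C) (r : R) (d : C) : CDer F (s r) d -> 0 < Re d -> RCont s r ->
  (forall q, Re (s q) = q) -> (forall q, Im (F (s q)) = 0) ->
  RDer (fun q => F (s q)) r (RtoC (/ Re (/ d)%C)) /\ RDer s r (RtoC (/ Re (/ d)%C) / d)%C /\ 0 < / Re (/ d)%C.
Proof.
  intros HF Hd Hs Hre Him.
  assert (Nd : d <> 0) by (apply slit_nz, slit_Re; auto).
  assert (Hd2 : 0 < Re (/ d)%C).
  { replace (/ d)%C with (1 / d)%C by (field; auto). rewrite re_div, re_RtoC, im_RtoC by auto. apply Rdiv_lt_0_compat. lra. apply norm_pos; auto. }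
  destruct HF as [phi [Cp [Ep [e [Pe Qe]]]]].
  destruct (Hs e Pe) as [e1 [Pe1 Qe1]].
  assert (Cps : RCont (fun q => phi (s q)) r) by (apply Cont_comp; auto).
  destruct (Cont_nz RtoC (fun q => phi (s q)) r Cps) as [e2 [Pe2 Qe2]]. rewrite Ep; auto.
  assert (Cinv' : RCont (fun q => / phi (s q))%C r) by (apply Cont_inv; auto; rewrite Ep; auto).
  assert (Cre : RCont (fun q => RtoC (Re (/ phi (s q)))) r) by (apply (Cont_Re RtoC (fun q => / phi (s q))%C); auto).
  assert (Nre : RtoC (Re (/ phi (s r))%C) <> 0). { rewrite Ep. intros E; apply RtoC_inj in E; lra. }
  destruct (Cont_nz RtoC _ r Cre Nre) as [e3 [Pe3 Qe3]].
  set (psi := fun q => (/ RtoC (Re (/ phi (s q))))%C).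
  assert (Cpsi : RCont psi r) by (apply Cont_inv; auto).
  assert (Epsi : psi r = RtoC (/ Re (/ d)%C)). { unfold psi. rewrite Ep, RtoC_inv by lra. auto. }
  set (m := Rmin e1 (Rmin e2 e3)). assert (Pm : 0 < m) by (repeat apply Rmin_glb_lt; auto).
  assert (Main : forall q, Cmod (RtoC q - RtoC r) < m -> (F (s q) - F (s r) = psi q * (RtoC q - RtoC r))%C /\ (s q - s r = (/ phi (s q) * psi q) * (RtoC q - RtoC r))%C).
  { intros q Hq. assert (L1 := Rlt_le_trans _ _ _ Hq (Rmin_l _ _)). assert (L23 := Rlt_le_trans _ _ _ Hq (Rmin_r _ _)).
    assert (L2 := Rlt_le_trans _ _ _ L23 (Rmin_l _ _)). assert (L3 := Rlt_le_trans _ _ _ L23 (Rmin_r _ _)).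
    specialize (Qe (s q) (Qe1 q L1)). specialize (Qe2 q L2). specialize (Qe3 q L3). cbv beta in *.
    assert (Es : (s q - s r = / phi (s q) * (F (s q) - F (s r)))%C) by (rewrite Qe; field; auto).
    set (D := Re (F (s q) - F (s r))).
    assert (ED : (F (s q) - F (s r))%C = RtoC D). { apply Ceq. unfold D; rewrite re_RtoC; auto. rewrite im_minus, !Him, im_RtoC; ring. }
    rewrite ED in Es |- *.
    assert (Er : q - r = Re (/ phi (s q))%C * D). { rewrite <- (Hre q) at 1. rewrite <- (Hre r). rewrite <- re_minus, Es, re_scal_r. auto. }
    assert (Nr : Re (/ phi (s q))%C <> 0) by (intros E; apply Qe3; rewrite E; auto).
    assert (E1 : RtoC D = (psi q * (RtoC q - RtoC r))%C). { unfold psi. rewrite <- RtoC_minus, Er, RtoC_mult. field; auto. }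
    split; auto. rewrite Es, E1. ring. }
  split; [|split].
  - exists psi. split; [|split]; auto. exists m. split; auto. intros q Hq. apply Main; auto.
  - exists (fun q => / phi (s q) * psi q)%C. split; [|split]. apply Cont_mult; auto. rewrite Ep, Epsi. unfold Cdiv. ring.
    exists m. split; auto. intros q Hq. apply Main; auto.
  - apply Rinv_0_lt_compat; auto.
Qed.

Lemma CDer_cay xi : (1 + xi)%C <> 0 -> CDer cay xi (- RtoC 2 / ((1 + xi) * (1 + xi)))%C.
Proof.
  intros N. eapply Der_eq. apply Der_div. apply Der_minus. apply Der_const. apply Der_id. apply Der_plus. apply Der_const. apply Der_id. auto.
  field; auto.
Qed.

Lemma cay_mod_le xi : 0 <= Re xi -> Cmod (cay xi) <= 1.
Proof.
  intros H. assert (N := one_plus_nz xi H). unfold cay. rewrite Cmod_div by auto. apply Cmod_gt_0 in N.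
  apply Rmult_le_reg_r with (Cmod (1 + xi)); auto. unfold Rdiv. rewrite Rmult_assoc, Rinv_l, Rmult_1_l, Rmult_1_r by lra.
  apply Rsqr_incr_0; try apply Cmod_ge_0. unfold Rsqr. rewrite !Cmod_sq, re_minus, im_minus, re_plus, im_plus, re_RtoC, im_RtoC. nra.
Qed.

Lemma cay_sq xi : (1 + xi)%C <> 0 -> (1 - cay xi * cay xi)%C = (RtoC 4 * xi / ((1 + xi) * (1 + xi)))%C.
Proof. intros N. unfold cay. field; auto. Qed.

Definition polar_pt (r t : R) : C := Cexp (RtoC r + Ci * RtoC t).

Lemma polar_ptE r t : polar_pt r t = (RtoC (exp r) * cis t)%C.
Proof. unfold polar_pt, Cexp. rewrite re_plus, im_plus, re_RtoC, im_RtoC. f_equal; f_equal. unfold Ci, Re; simpl; f_equal; ring. unfold Ci, Im; simpl; ring. Qed.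

Lemma Re_polar_pt r t : Re (polar_pt r t) = exp r * cos t.
Proof. rewrite polar_ptE, re_scal_l. reflexivity. Qed.

Lemma Re_polar_pt_ge r t : - (PI / 2) <= t <= PI / 2 -> 0 <= Re (polar_pt r t).
Proof. intros H. rewrite Re_polar_pt. apply Rmult_le_pos. apply Rlt_le, exp_pos. apply cos_ge_0; lra. Qed.

Lemma Re_polar_pt_gt r t : - (PI / 2) < t < PI / 2 -> 0 < Re (polar_pt r t).
Proof. intros H. rewrite Re_polar_pt. apply Rmult_lt_0_compat. apply exp_pos. apply cos_gt_0; lra. Qed.

(** * The curve along which the function is real *)

Section Spine.
Variables (f : C -> C) (R0 : R).
Hypothesis HR : regular f R0.

Let fD w : disc 0 R0 w -> CDer f w (deriv f w).
Proof. intros H. apply (deriv_spec (disc 0 R0)); auto. apply (reg_hol _ _ HR). Qed.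

Let in_disc w : Cmod w <= 1 -> disc 0 R0 w.
Proof. intros H. unfold disc. replace (w - RtoC 0)%C with w by ring. generalize (reg_R0 _ _ HR). lra. Qed.

(** f in the coordinate s = log xi. Half-circles |xi| = exp r become vertical segments with end
    points at height -+ PI / 2 on the imaginary axis of xi, and the derivative in s carries the
    factor 1 - w^2 of [reg_spine]. *)
Definition Fs (s : C) : C := f (cay (Cexp s)).

Lemma CDer_Fs s : 0 <= Re (Cexp s) -> CDer Fs s (- (RtoC (/2) * ((1 - cay (Cexp s) * cay (Cexp s)) * deriv f (cay (Cexp s)))))%C.
Proof.
  intros H. assert (N := one_plus_nz _ H).
  eapply Der_eq. apply (Der_comp _ f (fun s => cay (Cexp s))). apply fD, in_disc, cay_mod_le; auto.
  apply Der_comp. apply CDer_cay; auto. apply CDer_Cexp.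
  assert (H2 : RtoC 2 <> 0) by (intros E; apply RtoC_inj in E; lra).
  rewrite RtoC_inv, cay_sq by (auto; lra). field. auto.
Qed.

Let u (r t : R) : R := Im (Fs (RtoC r + Ci * RtoC t)).

Let u_cont_t r t : - (PI / 2) <= t <= PI / 2 -> contR (u r) t.
Proof.
  intros Ht. apply (Cont_Im _ (fun t => Fs (RtoC r + Ci * RtoC t))). apply (Cont_comp RtoC Fs (fun t => RtoC r + Ci * RtoC t)%C).
  eapply Der_Cont, CDer_Fs. apply Re_polar_pt_ge; auto. apply Cont_plus. apply Cont_const. apply Cont_mult. apply Cont_const. apply Cont_id.
Qed.

Let u_cont_r r t : - (PI / 2) <= t <= PI / 2 -> contR (fun r => u r t) r.
Proof.
  intros Ht. apply (Cont_Im _ (fun r => Fs (RtoC r + Ci * RtoC t))). apply (Cont_comp RtoC Fs (fun r => RtoC r + Ci * RtoC t)%C).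
  eapply Der_Cont, CDer_Fs. apply Re_polar_pt_ge; auto. apply Cont_plus. apply Cont_id. apply Cont_const.
Qed.

Let Dpos s : 0 < Re (Cexp s) -> Im (Fs s) = 0 -> 0 < Re (- (RtoC (/2) * ((1 - cay (Cexp s) * cay (Cexp s)) * deriv f (cay (Cexp s)))))%C.
Proof.
  intros H E. destruct (reg_spine _ _ HR (cay (Cexp s))) as [_ K]; auto. apply cay_mod; auto. rewrite re_opp, re_scal_l. lra.
Qed.

(** On the half-circle |xi| = exp r the imaginary part of f goes from negative to positive. By
    Cauchy-Riemann its derivative in the angle is the real part of the derivative of [Fs], which
    [reg_spine] makes positive at every zero, so there is exactly one zero. *)
Lemma spine_exists r : exists c, - (PI / 2) < c < PI / 2 /\ u r c = 0 /\ (forall t, - (PI / 2) <= t < c -> u r t < 0) /\ (forall t, c < t <= PI / 2 -> 0 < u r t).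
Proof.
  assert (P := PI2_pos). apply (upcrossing (u r) (- (PI / 2)) (PI / 2)).
  - lra.
  - intros t Ht. apply u_cont_t; auto.
  - unfold u, Fs. change (Cexp (RtoC r + Ci * RtoC (- (PI / 2)))) with (polar_pt r (- (PI / 2))). rewrite polar_ptE.
    replace (RtoC (exp r) * cis (- (PI / 2)))%C with (- Ci * RtoC (exp r))%C. apply (reg_up _ _ HR). apply exp_pos.
    rewrite cisE, cos_neg, sin_neg, cos_PI2, sin_PI2, RtoC_opp. ring.
  - unfold u, Fs. change (Cexp (RtoC r + Ci * RtoC (PI / 2))) with (polar_pt r (PI / 2)). rewrite polar_ptE.
    replace (RtoC (exp r) * cis (PI / 2))%C with (Ci * RtoC (exp r))%C. apply (reg_down _ _ HR). apply exp_pos.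
    rewrite cisE, cos_PI2, sin_PI2. ring.
  - intros z Hz Ez. set (s := (RtoC r + Ci * RtoC z)%C).
    assert (Hs : 0 < Re (Cexp s)) by (apply (Re_polar_pt_gt r z); auto).
    assert (K := Dpos s Hs Ez). eexists. split; [|exact K].
    set (d := (- (RtoC (/2) * ((1 - cay (Cexp s) * cay (Cexp s)) * deriv f (cay (Cexp s)))))%C).
    replace (Re d) with (Im (d * Ci)%C) by (unfold Ci, Re, Im; simpl; ring).
    apply (RDer_Im (fun t => Fs (RtoC r + Ci * RtoC t))). apply (Der_comp RtoC Fs (fun t => RtoC r + Ci * RtoC t)%C).
    apply CDer_Fs. apply Rlt_le; exact Hs. eapply Der_eq. apply Der_plus. apply Der_const. apply Der_scal, Der_id. ring.
Qed.

Definition spine_arg (r : R) : R := epsilon (inhabits 0) (fun c => - (PI / 2) < c < PI / 2 /\ u r c = 0 /\ (forall t, - (PI / 2) <= t < c -> u r t < 0) /\ (forall t, c < t <= PI / 2 -> 0 < u r t)).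

Let spine_arg_spec r : - (PI / 2) < spine_arg r < PI / 2 /\ u r (spine_arg r) = 0 /\ (forall t, - (PI / 2) <= t < spine_arg r -> u r t < 0) /\ (forall t, spine_arg r < t <= PI / 2 -> 0 < u r t).
Proof. exact (epsilon_spec (inhabits 0) (fun c => - (PI / 2) < c < PI / 2 /\ u r c = 0 /\ (forall t, - (PI / 2) <= t < c -> u r t < 0) /\ (forall t, c < t <= PI / 2 -> 0 < u r t)) (spine_exists r)). Qed.

(** The strict signs of u at spine_arg r -+ e persist for nearby radii and trap the zero between
    them. *)
Let spa_cont r : contR spine_arg r.
Proof.
  intros eps He. destruct (spine_arg_spec r) as [B [Z [L G]]]. set (c := spine_arg r) in *.
  set (e := Rmin (eps / 2) (Rmin ((c + PI / 2) / 2) ((PI / 2 - c) / 2))).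
  assert (Pe : 0 < e) by (repeat apply Rmin_glb_lt; lra).
  assert (E1 : e <= eps / 2) by apply Rmin_l.
  assert (E2 : e <= (c + PI / 2) / 2) by (eapply Rle_trans; [apply Rmin_r|apply Rmin_l]).
  assert (E3 : e <= (PI / 2 - c) / 2) by (eapply Rle_trans; [apply Rmin_r|apply Rmin_r]).
  assert (Hl : u r (c - e) < 0) by (apply L; lra). assert (Hg : 0 < u r (c + e)) by (apply G; lra).
  destruct (contR_eps _ _ (u_cont_r r (c - e) ltac:(lra)) (- u r (c - e)) ltac:(lra)) as [d1 [P1 Q1]].
  destruct (contR_eps _ _ (u_cont_r r (c + e) ltac:(lra)) (u r (c + e)) ltac:(lra)) as [d2 [P2 Q2]].
  exists (Rmin d1 d2). split. apply Rmin_glb_lt; auto. intros q Hq. rewrite Cmod_RR in *.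
  specialize (Q1 q (Rlt_le_trans _ _ _ Hq (Rmin_l _ _))). specialize (Q2 q (Rlt_le_trans _ _ _ Hq (Rmin_r _ _))).
  apply Rabs_def2 in Q1. apply Rabs_def2 in Q2. destruct (spine_arg_spec q) as [B' [Z' [L' G']]].
  apply Rabs_def1.
  - apply Rnot_le_lt. intros K. assert (u q (c + e) < 0) by (apply L'; lra). lra.
  - apply Rnot_le_lt. intros K. assert (0 < u q (c - e)) by (apply G'; lra). lra.
Qed.

Definition spine_log (r : R) : C := (RtoC r + Ci * RtoC (spine_arg r))%C.
Definition spine_disc (r : R) : C := cay (Cexp (spine_log r)).
Definition spine_val (r : R) : R := Re (f (spine_disc r)).
(** The derivative of [Fs] at the point of the curve, as given by [CDer_Fs]. *)
Definition spine_slope (r : R) : C := (- (RtoC (/2) * ((1 - spine_disc r * spine_disc r) * deriv f (spine_disc r))))%C.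
Definition spine_val' (r : R) : R := / Re (/ spine_slope r)%C.

Let sps_cont r : RCont spine_log r.
Proof. apply Cont_plus. apply Cont_id. apply Cont_mult. apply Cont_const. apply spa_cont. Qed.

Lemma Re_Cexp_spine_log r : 0 < Re (Cexp (spine_log r)).
Proof. apply (Re_polar_pt_gt r (spine_arg r)). apply spine_arg_spec. Qed.

Lemma spine_disc_mod r : Cmod (spine_disc r) < 1.
Proof. apply cay_mod, Re_Cexp_spine_log. Qed.

Let RCont_spw r : RCont spine_disc r.
Proof.
  apply (Cont_comp RtoC cay (fun r => Cexp (spine_log r))). eapply Der_Cont, CDer_cay, one_plus_nz, Rlt_le, Re_Cexp_spine_log.
  apply Cont_comp; auto. eapply Der_Cont, CDer_Cexp.
Qed.

Lemma f_spine_disc r : f (spine_disc r) = RtoC (spine_val r).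
Proof. apply Ceq. unfold spine_val. rewrite re_RtoC; auto. rewrite im_RtoC. apply (spine_arg_spec r). Qed.

Lemma spine_val_pos r : 0 < spine_val r.
Proof. apply (reg_spine _ _ HR). apply spine_disc_mod. rewrite f_spine_disc. apply im_RtoC. Qed.

Lemma spine_der r : is_derive spine_val r (spine_val' r) /\ RDer spine_log r (RtoC (spine_val' r) / spine_slope r)%C /\ 0 < spine_val' r /\ spine_slope r <> 0.
Proof.
  assert (K := Dpos (spine_log r) (Re_Cexp_spine_log r) (proj1 (proj2 (spine_arg_spec r)))).
  destruct (level_curve_der Fs spine_log r (spine_slope r)) as [A [B Cc]]; auto.
  - apply CDer_Fs. apply Rlt_le, Re_Cexp_spine_log.
  - intros q. unfold spine_log. rewrite re_plus, re_RtoC. unfold Ci, Re; simpl; ring.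
  - intros q. apply (spine_arg_spec q).
  - split; [|split; [|split]]; auto.
    + apply RDer_Re in A. rewrite re_RtoC in A. eapply is_derive_ext; [|exact A]. reflexivity.
    + apply slit_nz, slit_Re, K.
Qed.

Lemma RCont_spine_val' r : RCont (fun r => RtoC (spine_val' r)) r.
Proof.
  assert (Cd : forall r, RCont spine_slope r).
  { intros q. unfold spine_slope. apply Cont_opp. apply Cont_mult. apply Cont_const. apply Cont_mult.
    apply Cont_minus. apply Cont_const. apply Cont_mult; auto. apply Cont_comp; auto.
    eapply hol_Cont. apply hol_deriv. apply disc_open. apply (reg_hol _ _ HR). apply in_disc. generalize (spine_disc_mod q); lra. }
  destruct (spine_der r) as [_ [_ [P N]]].
  assert (Ci' : RCont (fun r => RtoC (Re (/ spine_slope r))) r) by (apply (Cont_Re _ (fun r => / spine_slope r)%C), Cont_inv; auto).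
  assert (Nr : RtoC (Re (/ spine_slope r)%C) <> 0).
  { intros E. apply RtoC_inj in E. unfold spine_val' in P. rewrite E, Rinv_0 in P. lra. }
  assert (K := Cont_inv RtoC _ r Ci' Nr).
  destruct (Cont_nz RtoC _ r Ci' Nr) as [e [Pe Qe]].
  assert (Eq : forall s, RtoC (Re (/ spine_slope s)%C) <> 0 -> (/ RtoC (Re (/ spine_slope s)))%C = RtoC (spine_val' s)).
  { intros s Hs. unfold spine_val'. rewrite RtoC_inv; auto. intros E; apply Hs; rewrite E; auto. }
  apply (Cont_ext_loc RtoC (fun r => / RtoC (Re (/ spine_slope r)))%C _ r e Pe); auto.
Qed.

Lemma RDer_spine_disc r : RDer spine_disc r (- (RtoC (/2) * (1 - spine_disc r * spine_disc r)) * (RtoC (spine_val' r) / spine_slope r))%C.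
Proof.
  destruct (spine_der r) as [_ [B _]]. assert (N := one_plus_nz _ (Rlt_le _ _ (Re_Cexp_spine_log r))).
  eapply Der_eq. apply (Der_comp RtoC cay (fun r => Cexp (spine_log r))). apply CDer_cay; auto. apply Der_comp. apply CDer_Cexp. exact B.
  assert (H2 : RtoC 2 <> 0) by (intros E; apply RtoC_inj in E; lra).
  rewrite RtoC_inv by lra. unfold spine_disc. rewrite cay_sq by auto. field. split; auto. apply spine_der.
Qed.

(** This and the next estimate close the contour: the truncated curve ends near w = 1 and w = -1,
    the end points of the arc. *)
Lemma spine_disc_near_1 r : Cmod (spine_disc r - RtoC 1) <= 2 * exp r.
Proof.
  assert (H := Re_Cexp_spine_log r). assert (N := one_plus_nz _ (Rlt_le _ _ H)). unfold spine_disc, cay. set (X := Cexp (spine_log r)) in *.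
  replace ((1 - X) / (1 + X) - RtoC 1)%C with (- (RtoC 2 * X) / (1 + X))%C by (field; auto).
  rewrite Cmod_div, Cmod_opp, Cmod_mult, Cmod_R, Rabs_pos_eq by (auto; lra).
  assert (EX : Cmod X = exp r). { unfold X, spine_log. change (Cexp (RtoC r + Ci * RtoC (spine_arg r))) with (polar_pt r (spine_arg r)). rewrite polar_ptE, Cmod_mult, Cmod_cis, Cmod_R, Rabs_pos_eq. ring. apply Rlt_le, exp_pos. }
  rewrite EX. assert (1 <= Cmod (1 + X)). { eapply Rle_trans; [|apply Re_le_Cmod]. rewrite re_plus, re_RtoC. lra. }
  apply Rmult_le_reg_r with (Cmod (1 + X)). lra. unfold Rdiv. rewrite Rmult_assoc, Rinv_l by lra. generalize (exp_pos r). nra.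
Qed.

Lemma spine_disc_near_m1 r : Cmod (spine_disc r - RtoC (-1)) <= 2 * exp (- r).
Proof.
  assert (H := Re_Cexp_spine_log r). assert (N := one_plus_nz _ (Rlt_le _ _ H)). unfold spine_disc, cay. set (X := Cexp (spine_log r)) in *.
  replace ((1 - X) / (1 + X) - RtoC (-1))%C with (RtoC 2 / (1 + X))%C by (field; auto).
  rewrite Cmod_div, Cmod_R, Rabs_pos_eq by (auto; lra).
  assert (EX : Cmod X = exp r). { unfold X, spine_log. change (Cexp (RtoC r + Ci * RtoC (spine_arg r))) with (polar_pt r (spine_arg r)). rewrite polar_ptE, Cmod_mult, Cmod_cis, Cmod_R, Rabs_pos_eq. ring. apply Rlt_le, exp_pos. }
  assert (exp r <= Cmod (1 + X)).
  { rewrite <- EX. apply Rsqr_incr_0; try apply Cmod_ge_0. unfold Rsqr. rewrite !Cmod_sq, re_plus, im_plus, re_RtoC, im_RtoC. nra. }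
  assert (E := exp_pos r). rewrite exp_Ropp. unfold Rdiv. apply Rmult_le_compat_l. lra. apply Rinv_le_contravar; auto.
Qed.
End Spine.

(** * The dependence of the factors on tau *)

(* A multiple of xi - i x in the Cayley coordinate w. *)
Definition lin_factor (x : R) (w : C) : C := ((1 - Ci * RtoC x) - w * (1 + Ci * RtoC x))%C.

Lemma lin_factor_cay x xi : (1 + xi)%C <> 0 -> lin_factor x (cay xi) = (RtoC 2 * (xi - Ci * RtoC x) / (1 + xi))%C.
Proof. intros N. unfold lin_factor, cay. field; auto. Qed.

Lemma Re_1pix x : Re (1 + Ci * RtoC x) = 1 /\ Im (1 + Ci * RtoC x) = x /\ Re (1 - Ci * RtoC x) = 1 /\ Im (1 - Ci * RtoC x) = - x.
Proof. unfold Ci, Re, Im; simpl. repeat split; ring. Qed.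

Lemma nz_1mix x : (1 - Ci * RtoC x)%C <> 0.
Proof. apply slit_nz, slit_Re. rewrite (proj1 (proj2 (proj2 (Re_1pix x)))). lra. Qed.
Lemma nz_1pix x : (1 + Ci * RtoC x)%C <> 0.
Proof. apply slit_nz, slit_Re. rewrite (proj1 (Re_1pix x)). lra. Qed.

(** The inverse of cc x is cay (i x), the zero of [lin_factor x] on the unit circle. The condition
    Re (w * cc x) < 1 describes the half-plane bounded by the tangent at that zero. *)
Definition cc (x : R) : C := ((1 + Ci * RtoC x) / (1 - Ci * RtoC x))%C.

Lemma cc_mod x : Cmod (cc x) = 1.
Proof.
  unfold cc. rewrite Cmod_div by apply nz_1mix.
  replace (1 + Ci * RtoC x)%C with (Cconj (1 - Ci * RtoC x)) by (apply Ceq; unfold Cconj, Ci, Re, Im; simpl; ring).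
  rewrite Cmod_conj. apply Rinv_r. apply Rgt_not_eq, Cmod_gt_0, nz_1mix.
Qed.

Lemma lin_factor_unit x w : lin_factor x w = ((1 - Ci * RtoC x) * (1 - w * cc x))%C.
Proof. unfold lin_factor, cc. assert (N := nz_1mix x). field; auto. Qed.

Lemma lin_factor_nz x w : Re (w * cc x) < 1 -> lin_factor x w <> 0.
Proof.
  intros H. rewrite lin_factor_unit. apply Cmult_neq_0. apply nz_1mix. apply slit_nz, slit_Re. rewrite re_minus, re_RtoC. lra.
Qed.

(** On the upper arc the factor is a real number times a phase that does not depend on x, so
    quotients for different x are real there. *)
Lemma lin_factor_cis x p : lin_factor x (cis (2 * p)) = (- (RtoC 2 * Ci) * cis p * den (RtoC x) p)%C.
Proof.
  unfold lin_factor, den. replace (2 * p) with (p + p) by ring. rewrite cis_plus, cisE.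
  assert (E1 := RtoC_cs p). set (c := RtoC (cos p)) in *. set (s := RtoC (sin p)) in *.
  transitivity ((s * s + c * c) * (1 - Ci * RtoC x) - (c + Ci * s) * (c + Ci * s) * (1 + Ci * RtoC x))%C. rewrite E1; ring.
  assert (E2 : (Ci * Ci)%C = (- (1))%C) by apply Ci2.
  transitivity (- (RtoC 2 * Ci) * (c + Ci * s) * (RtoC x * c + s) + (1 + Ci * Ci) * (s * s - Ci * RtoC x * s * s))%C.
  ring. rewrite E2. ring.
Qed.

Lemma Re_lt_1 z : Cmod z <= 1 -> z <> 1 -> Re z < 1.
Proof.
  intros H N. assert (R := Re_le_Cmod z). destruct (Rle_lt_or_eq_dec (Re z) 1) as [|E]; try lra.
  exfalso. apply N. apply Ceq; rewrite ?re_RtoC, ?im_RtoC; auto. assert (K := Cmod_sq z). rewrite E in K.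
  assert (Cmod z = 1) by lra. rewrite H0 in K. nra.
Qed.

Definition ratio (x1 x2 : R) (w : C) : C := (lin_factor x1 w / lin_factor x2 w)%C.
(** The function M of the overview in the Cayley coordinate. *)
Definition log_ratio (x1 x2 : R) (w : C) : C := Clog (ratio x1 x2 w).
Definition dlog_ratio (x1 x2 : R) (w : C) : C := ((1 + Ci * RtoC x2) / lin_factor x2 w - (1 + Ci * RtoC x1) / lin_factor x1 w)%C.

Lemma CDer_lin_factor x w : CDer (lin_factor x) w (- (1 + Ci * RtoC x))%C.
Proof. eapply Der_eq. apply Der_minus. apply Der_const. apply Der_mult. apply Der_id. apply Der_const. cbv beta. ring. Qed.

Lemma CDer_log_ratio x1 x2 w : lin_factor x1 w <> 0 -> lin_factor x2 w <> 0 -> slit_plane (ratio x1 x2 w) -> CDer (log_ratio x1 x2) w (dlog_ratio x1 x2 w).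
Proof.
  intros N1 N2 H. eapply Der_eq. apply (Der_comp _ Clog (ratio x1 x2)). apply CDer_Clog; auto. apply Der_div. apply CDer_lin_factor. apply CDer_lin_factor. auto.
  unfold dlog_ratio, ratio. field; auto.
Qed.

Lemma ratio_Im x1 x2 xi : x1 < x2 -> 0 < Re xi -> 0 < Im (ratio x1 x2 (cay xi)).
Proof.
  intros H Hx. assert (N := one_plus_nz xi ltac:(lra)).
  assert (N2 : (xi - Ci * RtoC x2)%C <> 0). { apply slit_nz, slit_Re. unfold Ci, Re in *; simpl. lra. }
  unfold ratio. rewrite !lin_factor_cay by auto.
  replace (RtoC 2 * (xi - Ci * RtoC x1) / (1 + xi) / (RtoC 2 * (xi - Ci * RtoC x2) / (1 + xi)))%C with ((xi - Ci * RtoC x1) / (xi - Ci * RtoC x2))%C by (field; auto).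
  rewrite im_div by auto. apply Rdiv_lt_0_compat; [|apply norm_pos; auto].
  replace (Im (xi - Ci * RtoC x1) * Re (xi - Ci * RtoC x2) - Re (xi - Ci * RtoC x1) * Im (xi - Ci * RtoC x2)) with (Re xi * (x2 - x1)) by (unfold Ci, Re, Im; simpl; ring).
  apply Rmult_lt_0_compat; lra.
Qed.

Section TauRatio.
Variables (U : (nat -> Prop) -> Prop) (f : C -> C) (R0 : R).
Hypothesis HU : ultra U.
Hypothesis HR : regular f R0.
Variables x1 x2 : R.
Hypothesis Hx1 : 0 < x1.
Hypothesis Hx12 : x1 < x2.

Let w_disc w : Cmod w < 1 -> forall x, Re (w * cc x) < 1.
Proof. intros H x. eapply Rle_lt_trans; [apply Re_le_Cmod|]. rewrite Cmod_mult, cc_mod. lra. Qed.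

Let cis_side x p : 0 < x -> 0 <= p <= PI / 2 -> Re (cis (2 * p) * cc x) < 1.
Proof.
  intros Hx Hp. apply Re_lt_1. rewrite Cmod_mult, Cmod_cis, cc_mod; lra.
  intros E. assert (K := lin_factor_unit x (cis (2 * p))). rewrite E in K. rewrite lin_factor_cis in K.
  assert (den (RtoC x) p <> 0). { apply den_nz; auto. apply slit_Re. rewrite re_RtoC; auto. }
  assert (N : (- (RtoC 2 * Ci) * cis p * den (RtoC x) p)%C <> 0).
  { apply Cmult_neq_0; auto. apply Cmult_neq_0; [|apply cis_nz]. intros E'. apply (f_equal Im) in E'. unfold Ci, Im in E'; simpl in E'. lra. }
  apply N. rewrite K. ring.
Qed.

Let ratio_1 : ratio x1 x2 (RtoC 1) = RtoC (x1 / x2).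
Proof.
  unfold ratio, lin_factor. rewrite RtoC_div by lra. assert (RtoC x2 <> 0) by (intros E; apply RtoC_inj in E; lra). assert (N := Ci_nz).
  replace (1 - Ci * RtoC x1 - RtoC 1 * (1 + Ci * RtoC x1))%C with (- (RtoC 2 * Ci) * RtoC x1)%C by ring.
  replace (1 - Ci * RtoC x2 - RtoC 1 * (1 + Ci * RtoC x2))%C with (- (RtoC 2 * Ci) * RtoC x2)%C by ring. field. auto.
Qed.
Let ratio_m1 : ratio x1 x2 (RtoC (-1)) = RtoC 1.
Proof.
  unfold ratio, lin_factor.
  replace (1 - Ci * RtoC x1 - RtoC (-1) * (1 + Ci * RtoC x1))%C with (RtoC 2) by ring.
  replace (1 - Ci * RtoC x2 - RtoC (-1) * (1 + Ci * RtoC x2))%C with (RtoC 2) by ring. field.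
Qed.

Definition spine_angle (r : R) : R := Im (log_ratio x1 x2 (spine_disc f r)).

Let ratio_spine_disc r : 0 < Im (ratio x1 x2 (spine_disc f r)).
Proof. apply ratio_Im; auto. apply (Re_Cexp_spine_log f R0 HR). Qed.

Let NNw x r : lin_factor x (spine_disc f r) <> 0.
Proof. apply lin_factor_nz, w_disc, (spine_disc_mod f R0 HR). Qed.

Let CDer_MMw r : CDer (log_ratio x1 x2) (spine_disc f r) (dlog_ratio x1 x2 (spine_disc f r)).
Proof. apply CDer_log_ratio; try apply NNw. apply slit_Im. generalize (ratio_spine_disc r); lra. Qed.

Lemma spine_angle_bounds r : RCont (fun r => RtoC (spine_angle r)) r /\ 0 <= spine_angle r <= PI.
Proof.
  split.
  - apply (Cont_Im _ (fun r => log_ratio x1 x2 (spine_disc f r))). apply Cont_comp. eapply Der_Cont, CDer_MMw. eapply Der_Cont, (RDer_spine_disc f R0 HR).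
  - unfold spine_angle, log_ratio. generalize (Im_Clog_pos _ (ratio_spine_disc r)) (Im_Clog_bound (ratio x1 x2 (spine_disc f r))). lra.
Qed.

Let spine_val_ok a b r : a <= r <= b -> is_derive (spine_val f) r (spine_val' f r) /\ 0 <= spine_val f r /\ 0 <= spine_val' f r.
Proof.
  intros _. destruct (spine_der f R0 HR r) as [A [_ [B _]]]. generalize (spine_val_pos f R0 HR r). split; auto. lra.
Qed.

Lemma RtoC_CI (h : R -> R) a b : CI (fun r => RtoC (h r)) a b = RtoC (RInt h a b).
Proof.
  apply Ceq.
  - rewrite re_RtoC, CI_Re. apply RInt_ext. intros; apply re_RtoC.
  - rewrite im_RtoC, CI_Im. rewrite (RInt_ext _ (fun _ => 0)). rewrite RInt_const. unfold scal; simpl; unfold mult; simpl.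
    match goal with |- @eq _ ?u ?v => change (@eq R u v) end. ring. intros; apply im_RtoC.
Qed.

Lemma spine_limit t : 0 < t -> forall eps, 0 < eps -> exists T, 0 < T /\ forall k, T <= k ->
  Cmod (stieltjes (spine_val f) (spine_val' f) spine_angle (- k) k (RtoC t) - (angle_int (angle_up f t) (RtoC x1) - angle_int (angle_up f t) (RtoC x2))) < eps.
Proof.
  intros Ht. assert (PP := PI_RGT_0). assert (P2 := PI2_pos).
  destruct (log_shift_hol U f R0 HU HR t Ht) as [R1 [H1 [HLam Hsub]]].
  (* A convex domain, so that primitives exist, which contains the open disc and the closed upper
     arc but avoids the two singularities of [dlog_ratio] on the lower arc. *)
  set (Om := fun w => disc 0 R1 w /\ Re (w * cc x1) < 1 /\ Re (w * cc x2) < 1).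
  assert (Om_convex : convex Om).
  { assert (Hp : forall a b s c, Re (a * c) < 1 -> Re (b * c) < 1 -> 0 <= s <= 1 -> Re ((a + RtoC s * (b - a)) * c) < 1).
    { intros a b s c Ha Hb Hs. replace ((a + RtoC s * (b - a)) * c)%C with (RtoC (1 - s) * (a * c) + RtoC s * (b * c))%C by (rewrite RtoC_minus; ring).
      rewrite re_plus, !re_scal_l. destruct (Req_dec s 0) as [->|]. lra. nra. }
    intros a b s [A1 [A2 A3]] [B1 [B2 B3]] Hs. split; [|split]; auto. apply disc_convex; auto. }
  assert (Om_open : open_set Om).
  { assert (Hp : forall z x, Re (z * cc x) < 1 -> exists r, 0 < r /\ forall w, Cmod (w - z) < r -> Re (w * cc x) < 1).
    { intros z x Hz. exists (1 - Re (z * cc x)). split. lra. intros w Hw.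
      assert (K := Re_le_Cmod ((w - z) * cc x)). rewrite Cmod_mult, cc_mod in K.
      replace ((w - z) * cc x)%C with (w * cc x - z * cc x)%C in K by ring. rewrite re_minus in K. lra. }
    intros z [A1 [A2 A3]]. destruct (disc_open 0 R1 z A1) as [r1 [Pr1 Q1]]. destruct (Hp z x1 A2) as [r2 [Pr2 Q2]]. destruct (Hp z x2 A3) as [r3 [Pr3 Q3]].
    exists (Rmin r1 (Rmin r2 r3)). split. repeat apply Rmin_glb_lt; auto. intros w Hw.
    assert (L1 := Rlt_le_trans _ _ _ Hw (Rmin_l _ _)). assert (L23 := Rlt_le_trans _ _ _ Hw (Rmin_r _ _)).
    split; [|split]. apply Q1; auto. apply Q2. eapply Rlt_le_trans; [exact L23|apply Rmin_l]. apply Q3. eapply Rlt_le_trans; [exact L23|apply Rmin_r]. }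
  assert (Om_disc : forall w, Cmod w < 1 -> Om w).
  { intros w Hw. split; [|split]; auto. unfold disc. replace (w - RtoC 0)%C with w by ring. lra. }
  assert (Om_cis : forall p, 0 <= p <= PI / 2 -> Om (cis (2 * p))).
  { intros p Hp. split; [|split]. apply cis_disc; auto. apply cis_side; auto. apply cis_side; auto. lra. }
  assert (Om_1 : Om (RtoC 1)). { assert (K := Om_cis 0 ltac:(lra)). rewrite Rmult_0_r, cis_0 in K. exact K. }
  assert (Om_m1 : Om (RtoC (-1))). { assert (K := Om_cis (PI / 2) ltac:(lra)). replace (2 * (PI / 2)) with PI in K by field. rewrite cis_PI in K. exact K. }
  assert (HRR : forall w, Om w -> exists d, CDer (dlog_ratio x1 x2) w d).
  { intros w [_ [A2 A3]]. eexists. apply Der_minus; apply Der_div; try apply Der_const; try apply CDer_lin_factor; apply lin_factor_nz; auto. }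
  (* Y is a primitive of M' log (f + t). Its increment from 1 to -1 is evaluated along the upper arc
     in [Arc] and along the curve where f is real through [HE]. *)
  destruct (primitive Om (fun w => dlog_ratio x1 x2 w * log_shift f t w)%C Om_convex Om_open) as [Y HY].
  { exists (RtoC 1); auto. }
  { intros w Hw. destruct (HRR w Hw) as [d Hd]. destruct (HLam w (proj1 Hw)) as [e He]. eexists. apply Der_mult; eauto. }
  (* Along the upper arc the kernel is real, which turns the increment of Y into the logarithm of the Wiener-Hopf factor. *)
  assert (Arc : Im (Y (RtoC (-1))) - Im (Y (RtoC 1)) = PI * Re (angle_int (angle_up f t) (RtoC x1) - angle_int (angle_up f t) (RtoC x2))).
  { assert (S1 : slit_plane (RtoC x1)) by (apply slit_Re; rewrite re_RtoC; auto).
    assert (S2 : slit_plane (RtoC x2)) by (apply slit_Re; rewrite re_RtoC; lra).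
    assert (Ck : contI (fun p => (angle_ker (RtoC x2) p - angle_ker (RtoC x1) p) * log_shift f t (cis (2 * p)))%C 0 (PI / 2)).
    { apply contI_le. lra. intros p Hp. apply Cont_mult. apply Cont_minus; apply RCont_angle_ker; auto. apply (RCont_lin (fun s => log_shift f t (cis s))). eapply RCont_log_shift_cis; eauto. }
    assert (E : CI (fun p => (angle_ker (RtoC x2) p - angle_ker (RtoC x1) p) * log_shift f t (cis (2 * p)))%C 0 (PI / 2) = (Y (RtoC (-1)) - Y (RtoC 1))%C).
    { rewrite (CI_FTC (fun p => Y (cis (2 * p)))); auto.
      - replace (2 * (PI / 2)) with PI by field. rewrite cis_PI, Rmult_0_r, cis_0. reflexivity.
      - intros p Hp. rewrite Rmin_left, Rmax_right in Hp by lra. assert (Hd1 := den_nz _ p S1 Hp). assert (Hd2 := den_nz _ p S2 Hp).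
        eapply Der_eq. apply (Der_comp RtoC Y (fun p => cis (2 * p))). apply HY, Om_cis; auto.
        { apply Der_ext with (fun p => (cis p * cis p)%C). intros s. rewrite <- cis_plus. f_equal; ring. apply Der_mult; apply RDer_cis. }
        cbv beta. rewrite Cmult_comm, (Cmult_comm (dlog_ratio x1 x2 _)), Cmult_comm, <- Cmult_assoc, Cmult_comm. f_equal.
        unfold dlog_ratio. rewrite !lin_factor_cis. assert (Nc := cis_nz p). assert (NCi := Ci_nz).
        (* The contribution - i is the same for x1 and x2 and cancels in the difference. *)
        assert (KK : forall x, den (RtoC x) p <> 0 -> ((1 + Ci * RtoC x) / (- (RtoC 2 * Ci) * cis p * den (RtoC x) p) * (Ci * cis p * cis p + cis p * (Ci * cis p)))%C = (angle_ker (RtoC x) p - Ci)%C).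
        { intros x Nx. unfold angle_ker.
          transitivity (- (1 + Ci * RtoC x) * cis p / den (RtoC x) p)%C. field; auto.
          transitivity ((RtoC x * RtoC (sin p) - RtoC (cos p) - Ci * den (RtoC x) p) / den (RtoC x) p)%C; [|field; auto].
          f_equal. rewrite cisE. unfold den.
          transitivity (- (RtoC (cos p)) - Ci * RtoC (sin p) - Ci * RtoC x * RtoC (cos p) - (Ci * Ci) * RtoC x * RtoC (sin p))%C. ring. rewrite Ci2. ring. }
        transitivity ((angle_ker (RtoC x2) p - Ci) - (angle_ker (RtoC x1) p - Ci))%C. rewrite <- (KK x1), <- (KK x2) by auto. ring. ring. }
    rewrite <- im_minus, <- E, CI_Im.
    assert (Kr : forall x p, slit_plane (RtoC x) -> 0 <= p <= PI / 2 -> angle_ker (RtoC x) p = RtoC (Re (angle_ker (RtoC x) p))).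
    { intros x p Hx Hp. apply Ceq. rewrite re_RtoC; auto. rewrite Im_angle_ker, !im_RtoC by auto. ring. }
    assert (Cu : forall x, slit_plane (RtoC x) -> contI (fun p => angle_ker (RtoC x) p * RtoC (angle_up f t p))%C 0 (PI / 2)).
    { intros x Hx. apply contI_angle_int; auto. eapply angle_angle_up; eauto. }
    unfold angle_int. rewrite re_minus, !re_scal_l.
    replace (PI * (/ PI * Re (CI (fun p => (angle_ker (RtoC x1) p * RtoC (angle_up f t p))%C) 0 (PI / 2)) - / PI * Re (CI (fun p => (angle_ker (RtoC x2) p * RtoC (angle_up f t p))%C) 0 (PI / 2))))
      with (Re (CI (fun p => (angle_ker (RtoC x1) p * RtoC (angle_up f t p) - angle_ker (RtoC x2) p * RtoC (angle_up f t p))%C) 0 (PI / 2))).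
    2:{ rewrite CI_minus, re_minus by (apply Cu; auto). field. lra. }
    rewrite CI_Re. apply RInt_ext. intros p Hp. rewrite Rmin_left, Rmax_right in Hp by lra.
    rewrite (Kr x1), (Kr x2) by (auto; lra). unfold angle_up. rewrite <- !RtoC_mult, <- !RtoC_minus, re_RtoC, im_scal_l.
    match goal with |- @eq _ ?u ?v => change (@eq R u v) end. ring. }
  (* Integration by parts: M log (f + t) - Y has the derivative M f' / (f + t), which along the
     curve is M dlambda / (t + lambda). *)
  set (EE := fun w => (log_ratio x1 x2 w * log_shift f t w - Y w)%C).
  assert (HE : forall r, RDer (fun r => EE (spine_disc f r)) r (log_ratio x1 x2 (spine_disc f r) * (RtoC (spine_val' f r) / (RtoC t + RtoC (spine_val f r))))%C).
  { intros r. assert (Hw := spine_disc_mod f R0 HR r). assert (Df : CDer f (spine_disc f r) (deriv f (spine_disc f r))).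
    { apply (deriv_spec (disc 0 R0)). apply (reg_hol _ _ HR). unfold disc. replace (spine_disc f r - RtoC 0)%C with (spine_disc f r) by ring. generalize (reg_R0 _ _ HR); lra. }
    assert (Hs := reg_slit _ _ HR (spine_disc f r) t ltac:(lra) Ht). destruct (spine_der f R0 HR r) as [_ [_ [_ ND]]].
    eapply Der_eq. apply (Der_comp RtoC EE (spine_disc f)).
    - unfold EE. apply Der_minus. apply Der_mult. apply CDer_MMw. apply (Der_comp _ Clog (fun w => f w + RtoC t)%C). apply CDer_Clog; auto. apply Der_plus. exact Df. apply Der_const.
      apply HY, Om_disc; auto.
    - apply (RDer_spine_disc f R0 HR).
    - assert (Nf := slit_nz _ Hs). assert (Ef := f_spine_disc f R0 HR r). rewrite <- Ef. 
      assert (Nf' : (RtoC t + f (spine_disc f r))%C <> 0) by (rewrite Cplus_comm; auto).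
      transitivity (log_ratio x1 x2 (spine_disc f r) * (RtoC (spine_val' f r) / (f (spine_disc f r) + RtoC t)) * (spine_slope f r / spine_slope f r))%C.
      + unfold spine_slope at 2. fold (log_shift f t (spine_disc f r)). unfold log_shift. field. split; auto.
      + field. split; auto. }
  assert (Hu : forall k, 0 < k -> stieltjes (spine_val f) (spine_val' f) spine_angle (- k) k (RtoC t) = RtoC (- / PI * (Im (EE (spine_disc f k)) - Im (EE (spine_disc f (- k)))))).
  { intros k Hk. unfold stieltjes. rewrite (RtoC_mult (- / PI)). f_equal.
    assert (Hl : forall r, 0 < spine_val f r) by (intros r; apply (spine_val_pos f R0 HR)).
    rewrite (CI_ext _ (fun r => RtoC (spine_angle r * spine_val' f r / (t + spine_val f r)))).
    2:{ intros r _. rewrite <- RtoC_plus, <- RtoC_div; auto. generalize (Hl r); lra. }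
    rewrite RtoC_CI. f_equal. rewrite <- im_minus.
    assert (Cc : contI (fun r => log_ratio x1 x2 (spine_disc f r) * (RtoC (spine_val' f r) / (RtoC t + RtoC (spine_val f r))))%C (- k) k).
    { intros r _. apply Cont_mult. apply Cont_comp. eapply Der_Cont, CDer_MMw. eapply Der_Cont, (RDer_spine_disc f R0 HR).
      apply Cont_div. eapply RCont_spine_val'; eauto. apply Cont_plus. apply Cont_const. eapply Der_Cont. apply RDer_real. apply (spine_der f R0 HR).
      rewrite <- RtoC_plus. intros E. apply RtoC_inj in E. generalize (Hl r); lra. }
    rewrite <- (CI_FTC (fun r => EE (spine_disc f r)) _ (- k) k (fun r _ => HE r) Cc), CI_Im.
    apply RInt_ext. intros r _. rewrite <- RtoC_plus, <- RtoC_div, im_scal_r by (generalize (Hl r); lra). unfold spine_angle.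
    match goal with |- @eq _ ?u ?v => change (@eq R u v) end. field. generalize (Hl r); lra. }
  assert (CE : forall w, Om w -> slit_plane (ratio x1 x2 w) -> CCont EE w).
  { intros w Hw Hs. apply Cont_minus. apply Cont_mult. eapply Der_Cont. apply CDer_log_ratio; auto; apply lin_factor_nz; apply Hw.
    eapply hol_Cont; [exact HLam|apply Hw]. eapply Der_Cont, HY; auto. }
  assert (S1 : slit_plane (ratio x1 x2 (RtoC 1))). { rewrite ratio_1. apply slit_Re. rewrite re_RtoC. apply Rdiv_lt_0_compat; lra. }
  assert (S2 : slit_plane (ratio x1 x2 (RtoC (-1)))). { rewrite ratio_m1. apply slit_Re. rewrite re_RtoC. lra. }
  assert (IE : forall w, Im (ratio x1 x2 w) = 0 -> Im (f w) = 0 -> Im (EE w) = - Im (Y w)).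
  { intros w A B. unfold EE. rewrite im_minus, im_mult. unfold log_ratio, log_shift. rewrite (Im_Clog_real (ratio x1 x2 w)), (Im_Clog_real (f w + RtoC t)); auto. ring.
    rewrite im_plus, B, im_RtoC. ring. }
  (* At w = 1 and w = -1 both logarithms are real, so the product M log (f + t) contributes nothing
     to the imaginary part and only Y remains. *)
  assert (I1 : Im (EE (RtoC 1)) = - Im (Y (RtoC 1))). { apply IE. rewrite ratio_1. apply im_RtoC. apply (reg_1 _ _ HR). }
  assert (I2 : Im (EE (RtoC (-1))) = - Im (Y (RtoC (-1)))). { apply IE. rewrite ratio_m1. apply im_RtoC. apply (reg_m1 _ _ HR). }
  intros eps He.
  destruct (CE _ Om_1 S1 eps He) as [d1 [P1 Q1]]. destruct (CE _ Om_m1 S2 eps He) as [d2 [Pd2 Q2]].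
  set (d := Rmin d1 d2). assert (Pd : 0 < d) by (apply Rmin_glb_lt; auto).
  (* k > - ln (d / 2) makes the distance 2 exp (- k) of the truncated ends to 1 and -1 less than
     d. *)
  exists (Rmax 1 (1 - ln (d / 2))). split. eapply Rlt_le_trans; [|apply Rmax_l]. lra.
  intros k Hk. assert (Hk1 := Rle_trans _ _ _ (Rmax_l _ _) Hk). assert (Hk2 := Rle_trans _ _ _ (Rmax_r _ _) Hk).
  assert (Hexp : 2 * exp (- k) < d).
  { assert (exp (- k) < exp (ln (d / 2))) by (apply exp_increasing; lra). rewrite exp_ln in H by lra. lra. }
  rewrite Hu by lra.
  assert (A1 := spine_disc_near_1 f R0 HR (- k)). assert (A2 := spine_disc_near_m1 f R0 HR k).
  specialize (Q1 (spine_disc f (- k))). specialize (Q2 (spine_disc f k)).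
  assert (D1 : d <= d1) by apply Rmin_l. assert (D2 : d <= d2) by apply Rmin_r.
  specialize (Q1 ltac:(lra)). specialize (Q2 ltac:(lra)).
  assert (J1 := Rle_lt_trans _ _ _ (im_le_Cmod _) Q1). assert (J2 := Rle_lt_trans _ _ _ (im_le_Cmod _) Q2).
  rewrite im_minus in J1, J2. rewrite I1 in J1. rewrite I2 in J2. apply Rabs_def2 in J1. apply Rabs_def2 in J2.
  set (L := (angle_int (angle_up f t) (RtoC x1) - angle_int (angle_up f t) (RtoC x2))%C) in *.
  assert (HL : L = RtoC (Re L)).
  { apply Ceq. rewrite re_RtoC; auto. rewrite im_RtoC. unfold L. rewrite im_minus.
    assert (K := log_cbf_angle_int _ (angle_angle_up U f R0 HU HR t Ht)). rewrite !(proj2 (proj2 K)) by lra. ring. }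
  rewrite HL, <- RtoC_minus, Cmod_R.
  assert (EL : Re L = / PI * (Im (Y (RtoC (-1))) - Im (Y (RtoC 1)))) by (rewrite Arc; field; lra).
  rewrite EL.
  replace (- / PI * (Im (EE (spine_disc f k)) - Im (EE (spine_disc f (- k)))) - / PI * (Im (Y (RtoC (-1))) - Im (Y (RtoC 1)))) with
    (/ PI * ((Im (EE (spine_disc f (- k))) - - Im (Y (RtoC 1))) - (Im (EE (spine_disc f k)) - - Im (Y (RtoC (-1)))))) by ring.
  assert (IPI : 0 < / PI < / 2). { split. apply Rinv_0_lt_compat; auto. apply Rinv_lt_contravar. lra. generalize PI2_1; lra. }
  rewrite Rabs_mult, (Rabs_pos_eq (/ PI)) by lra.
  set (X := Im (EE (spine_disc f (- k))) - - Im (Y (RtoC 1))) in *. set (Z := Im (EE (spine_disc f k)) - - Im (Y (RtoC (-1)))) in *.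
  assert (HXZ : Rabs (X - Z) <= 2 * eps) by (apply Rabs_le; lra).
  assert (/ PI * Rabs (X - Z) <= / PI * (2 * eps)) by (apply Rmult_le_compat_l; lra).
  assert (/ PI * (2 * eps) < / 2 * (2 * eps)) by (apply Rmult_lt_compat_r; lra). lra.
Qed.

(** The curve is truncated to [- k, k] with k so large that at t = 1 the error is below 1. The value
    at 1 is then at most 1 plus the bounds of the two [angle_int], which by [log_cbf_stieltjes] puts
    all truncations in one class that does not depend on f. *)
Lemma regular_tau_ratio : exists v : nat -> C -> C,
  (forall k, log_cbf (8 * (PI * taylor_const (RtoC x1) + PI * taylor_const (RtoC x2) + 1)) (v k)) /\
  forall t, 0 < t -> Ulim U (fun k => v k (RtoC t)) (angle_int (angle_up f t) (RtoC x1) - angle_int (angle_up f t) (RtoC x2))%C.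
Proof.
  destruct (spine_limit 1 ltac:(lra) 1 ltac:(lra)) as [T1 [PT1 HT1]].
  set (v := fun n : nat => stieltjes (spine_val f) (spine_val' f) spine_angle (- (T1 + INR n)) (T1 + INR n)).
  assert (Pn := pos_INR).
  exists v. split.
  - intros n. unfold v. specialize (HT1 (T1 + INR n) ltac:(generalize (Pn n); lra)).
    apply log_cbf_stieltjes.
    + generalize (Pn n); lra.
    + intros r Hr. eapply spine_val_ok; eauto.
    + intros r Hr. eapply RCont_spine_val'; eauto.
    + intros r Hr. apply spine_angle_bounds.
    + assert (K := log_cbf_angle_int _ (angle_angle_up U f R0 HU HR 1 ltac:(lra))).
      assert (S1 : slit_plane (RtoC x1)) by (apply slit_Re; rewrite re_RtoC; auto).
      assert (S2 : slit_plane (RtoC x2)) by (apply slit_Re; rewrite re_RtoC; lra).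
      destruct (proj1 K _ S1) as [B1 _]. destruct (proj1 K _ S2) as [B2 _].
      set (g := stieltjes (spine_val f) (spine_val' f) spine_angle (- (T1 + INR n)) (T1 + INR n) (RtoC 1)) in *.
      set (a := angle_int (angle_up f 1) (RtoC x1)) in *. set (b := angle_int (angle_up f 1) (RtoC x2)) in *.
      assert (C1 := re_le_Cmod g). apply Rabs_le_between in C1.
      assert (C2 : Cmod g <= Cmod (g - (a - b)) + Cmod (a - b)). { replace g with ((g - (a - b)) + (a - b))%C at 1 by ring. apply Cmod_triangle. }
      assert (C3 : Cmod (a - b) <= Cmod a + Cmod b). { unfold Cminus. eapply Rle_trans; [apply Cmod_triangle|]. rewrite Cmod_opp; lra. }
      lra.
  - intros t Ht. apply Ulim_seq; auto. intros eps He. destruct (spine_limit t Ht eps He) as [T [PT HT]].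
    destruct (INR_unbounded T) as [N HN]. exists N. intros n Hn. apply HT. apply le_INR in Hn. generalize PT1; lra.
Qed.
End TauRatio.

(** * Reflection, which exchanges the two factors *)

Lemma CDer_conj f z d : CDer f (Cconj z) d -> CDer (fun w => Cconj (f (Cconj w))) z (Cconj d).
Proof.
  intros H. apply dom_CDer. intros eps He. destruct (Der_dom _ _ _ _ H eps He) as [del [P Q]].
  exists del. split; auto. intros s Hs. specialize (Q (Cconj s)). rewrite <- Cminus_conj, Cmod_conj in Q. specialize (Q Hs).
  rewrite <- (Cmod_conj (Cconj (f (Cconj s)) - _ - _)). rewrite !Cminus_conj, Cmult_conj, !Cconj_conj. rewrite Cminus_conj in *. exact Q.
Qed.

Lemma Cconj_RtoC x : Cconj (RtoC x) = RtoC x.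
Proof. apply Ceq; unfold Cconj, Re, Im; simpl; ring. Qed.

Lemma cay_conj_gen xi : (1 + xi)%C <> 0 -> cay (Cconj xi) = Cconj (cay xi).
Proof. intros N. unfold cay. rewrite Cdiv_conj, Cminus_conj, Cplus_conj, Cconj_RtoC by auto. reflexivity. Qed.

(** Conjugation swaps the two halves of the imaginary axis and preserves regularity, so results for
    [angle_up] carry over to [angle_down]. *)
Definition cstar (f : C -> C) (w : C) : C := Cconj (f (Cconj w)).

Lemma regular_conj f R0 : regular f R0 -> regular (cstar f) R0.
Proof.
  intros H. assert (Dc : forall w, disc 0 R0 w -> disc 0 R0 (Cconj w)).
  { unfold disc. intros w Hw. rewrite <- Cmod_conj, Cminus_conj, Cconj_conj, Cconj_RtoC. auto. }
  assert (Npy : forall y, (1 + Ci * RtoC y)%C <> 0) by (intros; apply nz_1pix).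
  assert (Nmy : forall y, (1 + - Ci * RtoC y)%C <> 0). { intros y. replace (1 + - Ci * RtoC y)%C with (1 - Ci * RtoC y)%C by ring. apply nz_1mix. }
  assert (C1 : forall y, Cconj (cay (- Ci * RtoC y)) = cay (Ci * RtoC y)).
  { intros y. rewrite <- cay_conj_gen by auto. f_equal. apply Ceq; unfold Cconj, Ci, Re, Im; simpl; ring. }
  assert (C2 : forall y, Cconj (cay (Ci * RtoC y)) = cay (- Ci * RtoC y)).
  { intros y. rewrite <- cay_conj_gen by auto. f_equal. apply Ceq; unfold Cconj, Ci, Re, Im; simpl; ring. }
  assert (Der_star : forall w, disc 0 R0 w -> CDer (cstar f) w (Cconj (deriv f (Cconj w)))).
  { intros w Hw. apply CDer_conj. apply (deriv_spec (disc 0 R0)); auto. apply (reg_hol _ _ H). }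
  split.
  - apply (reg_R0 _ _ H).
  - intros w Hw. eexists. apply Der_star; auto.
  - intros w t Hw Ht [E1 E2]. apply (reg_slit _ _ H (Cconj w) t); auto. rewrite Cmod_conj; auto.
    unfold cstar in *. rewrite im_plus, im_conj, im_RtoC in E1. rewrite re_plus, re_conj, re_RtoC in E2.
    split; rewrite ?im_plus, ?im_RtoC, ?re_plus, ?re_RtoC; lra.
  - intros y Hy. unfold cstar. rewrite im_conj, C1. generalize (reg_down _ _ H y Hy). lra.
  - intros y Hy. unfold cstar. rewrite im_conj, C2. generalize (reg_up _ _ H y Hy). lra.
  - intros w Hw E. unfold cstar in E. rewrite im_conj in E.
    destruct (reg_spine _ _ H (Cconj w)) as [A B]. rewrite Cmod_conj; auto. lra.
    assert (Ed : deriv (cstar f) w = Cconj (deriv f (Cconj w))).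
    { assert (Hw' : disc 0 R0 w). { unfold disc. replace (w - RtoC 0)%C with w by ring. generalize (reg_R0 _ _ H); lra. }
      apply (CDer_unique (cstar f) w); auto. apply (deriv_spec (disc 0 R0)); auto. intros z Hz. eexists. apply Der_star; auto. }
    split. unfold cstar. rewrite re_conj. auto.
    rewrite Ed. replace ((1 - w * w) * Cconj (deriv f (Cconj w)))%C with (Cconj ((1 - Cconj w * Cconj w) * deriv f (Cconj w))).
    rewrite re_conj; auto. rewrite Cmult_conj, Cminus_conj, Cmult_conj, Cconj_conj, Cconj_RtoC. reflexivity.
  - unfold cstar. rewrite Cconj_RtoC, im_conj, (reg_1 _ _ H). ring.
  - unfold cstar. rewrite Cconj_RtoC, im_conj, (reg_m1 _ _ H). ring.
Qed.

Lemma Im_Clog_conj z : Im (Clog (Cconj z)) = - Im (Clog z).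
Proof.
  unfold Clog. rewrite im_conj, re_conj, Cmod_conj. unfold Im at 1 3; cbn [snd].
  replace (- Im z / (Cmod z + Re z)) with (- (Im z / (Cmod z + Re z))) by (unfold Rdiv; ring). rewrite atan_opp. ring.
Qed.

Lemma angle_up_cstar f t p : angle_up (cstar f) t p = angle_down f t p.
Proof.
  unfold angle_up, angle_down, log_shift, cstar. rewrite cis_conj, <- cis_neg.
  replace (Cconj (f (cis (- (2 * p)))) + RtoC t)%C with (Cconj (f (cis (- (2 * p))) + RtoC t)) by (rewrite Cplus_conj, Cconj_RtoC; auto).
  rewrite Im_Clog_conj. ring.
Qed.

(** * Regularisation of a Rogers function *)

Section Regularise.
Variables (U : (nat -> Prop) -> Prop) (F : C -> C).
Hypothesis HU : ultra U.
Hypothesis HF : rogers F.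

Definition eta (n : nat) : R := / (INR n + 2).

Lemma eta_bounds n : 0 < eta n <= / 2.
Proof. unfold eta. generalize (pos_INR n). intros. split. apply Rinv_0_lt_compat; lra. apply Rinv_le_contravar; lra. Qed.

Definition pp (w : C) : C := (F (cay w) / cay w)%C.

Lemma Re_cay w : Cmod w < 1 -> 0 < Re (cay w) /\ (1 + w)%C <> 0 /\ cay (cay w) = w /\ cay w <> 0 /\ (1 + cay w)%C <> 0.
Proof.
  intros H. assert (N : (1 + w)%C <> 0).
  { intros E. assert (w = (- (1))%C) by (transitivity ((1 + w) - 1)%C; [ring|rewrite E; ring]). rewrite H0, Cmod_opp, Cmod_1 in H. lra. }
  assert (P : 0 < Re (cay w)).
  { unfold cay. rewrite re_div by auto. apply Rdiv_lt_0_compat; [|apply norm_pos; auto].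
    rewrite re_minus, re_plus, im_minus, im_plus, re_RtoC, im_RtoC. assert (K := Cmod_sq w). assert (0 <= Cmod w) by apply Cmod_ge_0. nra. }
  split; auto. split; auto. split. apply cay_invol; auto. split. apply slit_nz, slit_Re; auto. apply one_plus_nz; lra.
Qed.

Lemma pp_hol : hol (disc 0 1) pp.
Proof.
  intros w Hw. unfold disc in Hw. replace (w - RtoC 0)%C with w in Hw by ring. destruct (Re_cay w Hw) as [P [N [_ [Nz _]]]].
  destruct (proj2 (hol_holomorphic _ _) (proj1 HF) (cay w) P) as [d Hd].
  eexists. apply Der_div. apply Der_comp. exact Hd. apply CDer_cay; auto. apply CDer_cay; auto. auto.
Qed.

Lemma pp_pos w : Cmod w < 1 -> 0 <= Re (pp w).
Proof. intros Hw. apply (proj2 HF). apply Re_cay; auto. Qed.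

(** The dilation by 1 - eta makes F(xi)/xi holomorphic across the unit circle, and the summand eta
    makes its real part strictly positive. *)
Definition PP (n : nat) (w : C) : C := (pp (RtoC (1 - eta n) * w) + RtoC (eta n))%C.
Definition Den (n : nat) (w : C) : C := (RtoC (eta n) * ((1 - w) * PP n w) + (1 + w))%C.
(** Multiplication of [PP] by xi would leave a pole at xi = oo, that is w = -1. The Moebius map z /
    (eta z + 1) keeps the sign of imaginary parts and gives that point the finite real value 1 /
    eta. *)
Definition approx (n : nat) (w : C) : C := ((1 - w) * PP n w / Den n w)%C.

Let sc_mod n w : Cmod w < / (1 - eta n) -> Cmod (RtoC (1 - eta n) * w) < 1.
Proof.
  intros H. assert (E := eta_bounds n). rewrite Cmod_mult, Cmod_R, Rabs_pos_eq by lra.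
  apply Rmult_lt_compat_l with (r := 1 - eta n) in H; [|lra]. rewrite Rinv_r in H; lra.
Qed.

Lemma inv_eta n : 1 < / (1 - eta n).
Proof. assert (E := eta_bounds n). rewrite <- Rinv_1 at 1. apply Rinv_lt_contravar; lra. Qed.

Lemma Pscaled_hol n : hol (disc 0 (/ (1 - eta n))) (fun w => pp (RtoC (1 - eta n) * w)%C).
Proof.
  intros w Hw. unfold disc in Hw. replace (w - RtoC 0)%C with w in Hw by ring.
  destruct (pp_hol (RtoC (1 - eta n) * w)%C) as [d Hd]. { unfold disc. replace (RtoC (1 - eta n) * w - RtoC 0)%C with (RtoC (1 - eta n) * w)%C by ring. apply sc_mod; auto. }
  eexists. apply (Der_comp _ pp (fun w => RtoC (1 - eta n) * w)%C). exact Hd. apply Der_scal, Der_id.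
Qed.

Lemma PP_hol n : hol (disc 0 (/ (1 - eta n))) (PP n).
Proof. intros w Hw. destruct (Pscaled_hol n w Hw) as [d Hd]. eexists. apply Der_plus. exact Hd. apply Der_const. Qed.

Lemma Re_PP n w : Cmod w <= 1 -> eta n <= Re (PP n w).
Proof. intros H. unfold PP. rewrite re_plus, re_RtoC. assert (0 <= Re (pp (RtoC (1 - eta n) * w))). { apply pp_pos, sc_mod. generalize (inv_eta n); lra. } lra. Qed.

Let key w : Re ((1 + w) * Cconj (1 - w)) = 1 - Cmod w * Cmod w.
Proof. rewrite Cmod_sq. unfold Cconj, Re, Im; simpl. ring. Qed.

(** After multiplication by the conjugate of 1 - w the real part is eta |1 - w|^2 Re PP + 1 - |w|^2,
    a sum of nonnegative terms. It vanishes only at w = 1, where [Den] is 2. *)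
Lemma Den_nz n w : Cmod w <= 1 -> Den n w <> 0.
Proof.
  intros Hw E. assert (A := Re_PP n w Hw). assert (B := eta_bounds n). assert (W0 := Cmod_ge_0 w).
  assert (E2 : (RtoC (eta n) * (RtoC (Cmod (1 - w) ^ 2) * PP n w) + (1 + w) * Cconj (1 - w))%C = 0).
  { rewrite Cmod2_conj. transitivity (Den n w * Cconj (1 - w))%C. unfold Den; ring. rewrite E; ring. }
  apply (f_equal Re) in E2. rewrite re_plus, key, !re_scal_l, re_RtoC in E2.
  assert (0 <= Cmod (1 - w) ^ 2) by apply pow2_ge_0.
  assert (Z : Cmod (1 - w) ^ 2 = 0). { assert (0 < eta n * Re (PP n w)) by nra. nra. }
  assert (E1 : w = RtoC 1). { assert (Cmod (1 - w) = 0) by nra. apply Cmod_eq_0 in H0. apply Ceq_minus in H0. auto. }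
  subst w. unfold Den in E. replace (1 - RtoC 1)%C with (RtoC 0) in E by ring.
  assert (E3 : (1 + RtoC 1)%C = 0) by (rewrite <- E; ring). rewrite <- RtoC_plus in E3. apply RtoC_inj in E3. lra.
Qed.

(** A value - s with s > 0 would, by the same multiplication, give (1 + s eta) |1 - w|^2 Re PP = - s
    (1 - |w|^2). Both sides then vanish, so w = 1, but there the function is 0. *)
Lemma approx_slit n w t : Cmod w <= 1 -> 0 < t -> slit_plane (approx n w + RtoC t)%C.
Proof.
  intros Hw Ht [E1 E2]. assert (A := Re_PP n w Hw). assert (B := eta_bounds n). assert (W0 := Cmod_ge_0 w). assert (ND := Den_nz n w Hw).
  rewrite im_plus, im_RtoC in E1. rewrite re_plus, re_RtoC in E2.
  set (s := - Re (approx n w)). assert (Hs : t <= s) by (unfold s; lra).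
  assert (Ef : approx n w = RtoC (- s)). { apply Ceq. rewrite re_RtoC. unfold s; ring. rewrite im_RtoC; lra. }
  assert (E3 : ((1 - w) * PP n w = RtoC (- s) * Den n w)%C) by (rewrite <- Ef; unfold approx; field; auto).
  assert (E4 : (RtoC (1 + s * eta n) * (RtoC (Cmod (1 - w) ^ 2) * PP n w) = RtoC (- s) * ((1 + w) * Cconj (1 - w)))%C).
  { rewrite Cmod2_conj. rewrite RtoC_plus, RtoC_mult, RtoC_opp.
    transitivity (((1 - w) * PP n w + RtoC s * RtoC (eta n) * ((1 - w) * PP n w)) * Cconj (1 - w))%C. ring.
    rewrite E3 at 1. unfold Den. rewrite RtoC_opp. ring. }
  apply (f_equal Re) in E4. rewrite !re_scal_l, key in E4.
  assert (0 <= Cmod (1 - w) ^ 2) by apply pow2_ge_0.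
  assert (0 < (1 + s * eta n) * Re (PP n w)) by (apply Rmult_lt_0_compat; [nra|lra]).
  assert (Z : Cmod (1 - w) ^ 2 = 0).
  { assert (0 <= s * (1 - Cmod w * Cmod w)) by (apply Rmult_le_pos; nra). nra. }
  assert (Ew : w = RtoC 1). { assert (Cmod (1 - w) = 0) by nra. apply Cmod_eq_0 in H1. apply Ceq_minus in H1. auto. }
  assert (E5 : approx n w = 0). { unfold approx. rewrite Ew. unfold Cdiv. ring. }
  rewrite Ef in E5. apply RtoC_inj in E5. lra.
Qed.

(* In the coordinate xi = cay w the regularised function is z / (eta z + 1) with z = xi PP. *)
Lemma approx_cay n xi : 0 <= Re xi -> let z := (xi * PP n (cay xi))%C in
  (RtoC (eta n) * z + 1)%C <> 0 /\ approx n (cay xi) = (z / (RtoC (eta n) * z + 1))%C /\ Den n (cay xi) = (RtoC 2 * (RtoC (eta n) * z + 1) / (1 + xi))%C.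
Proof.
  intros Hx z. assert (N := one_plus_nz xi Hx). assert (ND := Den_nz n (cay xi) (cay_mod_le xi Hx)).
  assert (E : Den n (cay xi) = (RtoC 2 * (RtoC (eta n) * z + 1) / (1 + xi))%C).
  { unfold Den, z. set (P := PP n (cay xi)). unfold cay. field; auto. }
  assert (Nz : (RtoC (eta n) * z + 1)%C <> 0). { intros E'. apply ND. rewrite E, E'. unfold Cdiv; ring. }
  split; auto. split; auto. unfold approx. rewrite E. unfold z. set (P := PP n (cay xi)) in *. unfold cay. fold z. unfold z. field. split; auto.
Qed.

Lemma Im_mob e z : (RtoC e * z + 1)%C <> 0 -> Im (z / (RtoC e * z + 1)) = Im z / (Re (RtoC e * z + 1) * Re (RtoC e * z + 1) + Im (RtoC e * z + 1) * Im (RtoC e * z + 1)).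
Proof.
  intros N. rewrite im_div by auto. f_equal. rewrite re_plus, im_plus, re_scal_l, im_scal_l, re_RtoC, im_RtoC. ring.
Qed.

Lemma approx_regular n : exists R0, regular (approx n) R0.
Proof.
  assert (B := eta_bounds n).
  destruct (closed_disc_nbhd U (fun w => disc 0 (/ (1 - eta n)) w /\ Den n w <> 0) HU) as [R0 [H1 H2]].
  - intros z [D1 D2]. destruct (disc_open _ _ z D1) as [r1 [P1 Q1]].
    destruct (PP_hol n z D1) as [d Hd].
    assert (CD : CCont (Den n) z). { apply Cont_plus. apply Cont_mult. apply Cont_const. apply Cont_mult. apply Cont_minus. apply Cont_const. apply Cont_id. eapply Der_Cont; eauto. apply Cont_plus. apply Cont_const. apply Cont_id. }
    destruct (Cont_nz _ _ _ CD D2) as [r2 [P2 Q2]]. exists (Rmin r1 r2). split. apply Rmin_glb_lt; auto.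
    intros w Hw. split. apply Q1. eapply Rlt_le_trans; [exact Hw|apply Rmin_l]. apply Q2. eapply Rlt_le_trans; [exact Hw|apply Rmin_r].
  - intros w Hw. split. unfold disc. replace (w - RtoC 0)%C with w by ring. generalize (inv_eta n); lra. apply Den_nz; auto.
  (* The terms with eta cancel in the numerator, as the Moebius map z / (eta z + 1) has determinant
     1. *)
  - assert (Dfreg : forall w d, disc 0 R0 w -> CDer (PP n) w d -> CDer (approx n) w (((1 - w * w) * d - RtoC 2 * PP n w) / (Den n w * Den n w))%C).
    { intros w d Hw Hd. destruct (H2 w Hw) as [D1 D2].
      assert (D1m : CDer (fun w => 1 - w)%C w (- (1))%C). { eapply Der_eq. apply Der_minus. apply Der_const. apply Der_id. ring. }
      assert (DDen : CDer (Den n) w (RtoC (eta n) * (- (1) * PP n w + (1 - w) * d) + 1)%C).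
      { eapply Der_eq. apply Der_plus. apply Der_scal. apply Der_mult. exact D1m. exact Hd. apply Der_plus. apply Der_const. apply Der_id. ring. }
      eapply Der_eq. apply (Der_div _ (fun w => (1 - w) * PP n w)%C (Den n)). apply Der_mult. exact D1m. exact Hd. exact DDen. auto.
      f_equal. unfold Den. ring. }
    exists R0. split; auto.
    + intros w Hw. destruct (PP_hol n w (proj1 (H2 w Hw))) as [d Hd]. eexists. apply Dfreg; eauto.
    + intros w t. apply approx_slit.
    + intros y Hy. assert (Rx : Re (- Ci * RtoC y) = 0) by (unfold Ci, Re; simpl; ring).
      destruct (approx_cay n (- Ci * RtoC y)%C ltac:(lra)) as [N [E _]]. rewrite E, Im_mob by auto.
      assert (A := Re_PP n _ (cay_mod_le (- Ci * RtoC y)%C ltac:(lra))).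
      apply Ropp_lt_cancel. rewrite Ropp_0, <- Ropp_div. apply Rdiv_lt_0_compat; [|apply norm_pos; auto].
      replace (- Im (- Ci * RtoC y * PP n (cay (- Ci * RtoC y)))) with (y * Re (PP n (cay (- Ci * RtoC y)))).
      apply Rmult_lt_0_compat; lra. set (P := PP n (cay (- Ci * RtoC y))). unfold Ci, Re, Im; simpl; ring.
    + intros y Hy. assert (Rx : Re (Ci * RtoC y) = 0) by (unfold Ci, Re; simpl; ring).
      destruct (approx_cay n (Ci * RtoC y)%C ltac:(lra)) as [N [E _]]. rewrite E, Im_mob by auto.
      assert (A := Re_PP n _ (cay_mod_le (Ci * RtoC y)%C ltac:(lra))).
      apply Rdiv_lt_0_compat; [|apply norm_pos; auto].
      replace (Im (Ci * RtoC y * PP n (cay (Ci * RtoC y)))) with (y * Re (PP n (cay (Ci * RtoC y)))).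
      apply Rmult_lt_0_compat; lra. set (P := PP n (cay (Ci * RtoC y))). unfold Ci, Re, Im; simpl; ring.
    (* Where the function is real, z = xi P is a positive number zr, and (1 - w^2) times the
       derivative is a positive multiple of xi (1 - w^2) P' - 2 zr. Schwarz-Pick is applied to P -
       eta, which still has nonnegative real part; the gain of eta makes the inequality strict. *)
    + intros w Hw E. destruct (Re_cay w Hw) as [Px [N1 [Ew [Nx N2]]]]. set (xi := cay w) in *.
      destruct (approx_cay n xi ltac:(lra)) as [N [Ef ED]]. rewrite Ew in *. set (P := PP n w) in *. set (z := (xi * P)%C) in *.
      rewrite Ef, Im_mob in E by auto.
      assert (Im z = 0). { apply Rmult_integral in E. destruct E as [E|E]; auto. exfalso. apply Rinv_neq_0_compat in E; auto. apply Rgt_not_eq, norm_pos; auto. }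
      assert (Ez : z = RtoC (Re z)) by (apply Ceq; rewrite ?re_RtoC, ?im_RtoC; auto). set (zr := Re z) in *.
      assert (NX := norm_pos xi Nx).
      assert (EP : P = (RtoC zr / xi)%C) by (rewrite <- Ez; unfold z; field; auto).
      assert (RP : Re P * (Re xi * Re xi + Im xi * Im xi) = zr * Re xi). { rewrite EP, re_div, re_RtoC, im_RtoC by auto. field. lra. }
      assert (A := Re_PP n w ltac:(lra)). fold P in A.
      assert (Pz : 0 < zr). { apply Rmult_lt_reg_r with (Re xi); auto. rewrite Rmult_0_l, <- RP. apply Rmult_lt_0_compat; lra. }
      assert (Pd : 0 < eta n * zr + 1) by nra.
      assert (Ed : (RtoC (eta n) * z + 1)%C = RtoC (eta n * zr + 1)) by (rewrite Ez, RtoC_plus, RtoC_mult; auto).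
      split. { rewrite Ef, Ed, Ez, <- RtoC_div, re_RtoC by lra. apply Rdiv_lt_0_compat; auto. }
      assert (Dw : disc 0 R0 w). { unfold disc. replace (w - RtoC 0)%C with w by ring. lra. }
      destruct (Pscaled_hol n w (proj1 (H2 w Dw))) as [d Hd].
      assert (HdP : CDer (PP n) w d). { eapply Der_eq. apply Der_plus. exact Hd. apply Der_const. ring. }
      assert (SP := schwarz_pick _ (/ (1 - eta n)) (Pscaled_hol n) (inv_eta n)
         (fun t => pp_pos _ (sc_mod n (cis t) ltac:(rewrite Cmod_cis; apply inv_eta))) w d Hw Hd).
      assert (RPp : Re (pp (RtoC (1 - eta n) * w)) = Re P - eta n). { unfold P, PP. rewrite re_plus, re_RtoC. ring. }
      cbv beta in SP; rewrite RPp in SP.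
      assert (Ederiv : deriv (approx n) w = (((1 - w * w) * d - RtoC 2 * P) / (Den n w * Den n w))%C).
      { apply (CDer_unique (approx n) w). apply (deriv_spec (disc 0 R0)); auto. intros v Hv. destruct (PP_hol n v (proj1 (H2 v Hv))) as [e He]. eexists. apply Dfreg; eauto. apply Dfreg; auto. }
      assert (Esq : (1 - w * w)%C = (RtoC 4 * xi / ((1 + xi) * (1 + xi)))%C) by (rewrite <- Ew; apply cay_sq; auto).
      assert (H2n : RtoC 2 <> 0) by (intros E'; apply RtoC_inj in E'; lra).
      assert (Nd : RtoC (eta n * zr + 1) <> 0) by (intros E'; apply RtoC_inj in E'; lra).
      assert (Efin : ((1 - w * w) * deriv (approx n) w)%C = (RtoC (/ ((eta n * zr + 1) * (eta n * zr + 1))) * (xi * (1 - w * w) * d - RtoC (2 * zr)))%C).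
      { rewrite Ederiv, ED, Ed. rewrite (RtoC_mult 2), <- Ez. unfold z. rewrite RtoC_inv, RtoC_mult by (apply Rgt_not_eq; nra).
        rewrite Esq at 1. set (q := (1 - w * w)%C). field. auto. }
      rewrite Efin, re_scal_l. 
      assert (Hneg : Re (xi * (1 - w * w) * d - RtoC (2 * zr)) < 0).
      { rewrite re_minus, re_RtoC. eapply Rle_lt_trans. apply Rplus_le_compat_r, Re_le_Cmod.
        rewrite !Cmod_mult. assert (N2p := proj1 (Cmod_gt_0 _) N2). assert (Nxp := proj1 (Cmod_gt_0 _) Nx).
        set (X := Cmod (1 + xi)) in *.
        assert (M1 : Cmod (1 - w * w) = 4 * Cmod xi / (X * X)).
        { rewrite Esq, Cmod_div, !Cmod_mult, Cmod_R, Rabs_pos_eq by (try apply Cmult_neq_0; auto; lra). reflexivity. }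
        assert (M2 : 1 - Cmod w * Cmod w = 4 * Re xi / (X * X)).
        { rewrite <- (key w). replace ((1 + w) * Cconj (1 - w))%C with ((1 + cay xi) * Cconj (1 - cay xi))%C by (rewrite Ew; auto).
          unfold X. rewrite Cmod_sq. unfold cay. replace (1 + (1 - xi) / (1 + xi))%C with (RtoC 2 / (1 + xi))%C by (field; auto).
          replace (1 - (1 - xi) / (1 + xi))%C with (RtoC 2 * xi / (1 + xi))%C by (field; auto).
          rewrite Cdiv_conj, Cmult_conj, Cconj_RtoC by auto.
          replace (RtoC 2 / (1 + xi) * (RtoC 2 * Cconj xi / Cconj (1 + xi)))%C with (RtoC 4 * Cconj xi / ((1 + xi) * Cconj (1 + xi)))%C.
          2:{ field. split; auto. intros E'. apply N2. rewrite <- (Cconj_conj (1 + xi)), E'. apply Cconj_RtoC. }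
          rewrite <- Cmod2_conj. replace (RtoC 4 * Cconj xi / RtoC (Cmod (1 + xi) ^ 2))%C with (RtoC (4 / (Cmod (1 + xi) ^ 2)) * Cconj xi)%C.
          rewrite re_scal_l, re_conj. simpl (_ ^ 2). rewrite Rmult_1_r, Cmod_sq. field. generalize (norm_pos _ N2). lra.
          rewrite RtoC_div. unfold Cdiv; ring. apply Rgt_not_eq. fold X. nra. }
        rewrite M2 in SP. rewrite M1.
        assert (XX : 0 < X * X) by nra.
        (* |xi| |1 - w^2| |P'| <= 2 |xi|^2 (Re P - eta) / Re xi = 2 zr - 2 eta |xi|^2 / Re xi *)
        assert (S1 : Cmod d * (4 * / (X * X)) * Re xi <= 2 * (Re P - eta n)). { eapply Rle_trans; [|exact SP]. right. unfold Rdiv; ring. }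
        assert (S2 : (Cmod xi * Cmod xi) * (Cmod d * (4 * / (X * X)) * Re xi) <= (Cmod xi * Cmod xi) * (2 * (Re P - eta n))) by (apply Rmult_le_compat_l; nra).
        assert (S3 : (Cmod xi * Cmod xi) * Re P = zr * Re xi) by (rewrite Cmod_sq; lra).
        assert (S4 : Re xi * (Cmod xi * (4 * Cmod xi / (X * X)) * Cmod d) <= 2 * (zr * Re xi) - 2 * eta n * (Cmod xi * Cmod xi)).
        { replace (Re xi * (Cmod xi * (4 * Cmod xi / (X * X)) * Cmod d)) with ((Cmod xi * Cmod xi) * (Cmod d * (4 * / (X * X)) * Re xi)) by (unfold Rdiv; ring). lra. }
        assert (0 < eta n * (Cmod xi * Cmod xi)) by (apply Rmult_lt_0_compat; nra).
        apply Rmult_lt_reg_l with (Re xi); auto. rewrite Rmult_plus_distr_l, Rmult_0_r. lra. }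
      assert (0 < / ((eta n * zr + 1) * (eta n * zr + 1))) by (apply Rinv_0_lt_compat; nra). nra.
    + unfold approx. replace (1 - RtoC 1)%C with (RtoC 0) by ring. unfold Cdiv. rewrite !Cmult_0_l. apply im_RtoC.
    + assert (A := Re_PP n (RtoC (-1)) ltac:(rewrite Cmod_R, Rabs_left; lra)).
      assert (NP : PP n (RtoC (-1)) <> 0) by (apply slit_nz, slit_Re; lra).
      assert (Ne : RtoC (eta n) <> 0) by (intros E'; apply RtoC_inj in E'; lra).
      assert (H2n : RtoC 2 <> 0) by (intros E'; apply RtoC_inj in E'; lra).
      replace (approx n (RtoC (-1))) with (RtoC (/ eta n)). apply im_RtoC.
      unfold approx, Den. rewrite RtoC_inv by lra. replace (1 + RtoC (-1))%C with (RtoC 0) by ring. replace (1 - RtoC (-1))%C with (RtoC 2) by ring.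
      rewrite Cplus_0_r. field. auto.
Qed.
End Regularise.

Lemma log_cbf_ext B u v : (forall x, slit_plane x -> u x = v x) -> log_cbf B u -> log_cbf B v.
Proof.
  intros E [H1 [H2 H3]]. split; [|split].
  - intros x Hx. destruct (H1 x Hx) as [A [d [D1 D2]]]. rewrite <- E by auto. split; auto. exists d. split; auto.
    intros h Hh. rewrite <- E by (apply sdist_slit; auto). auto.
  - intros x Hx. rewrite <- E by (apply slit_Im; lra). auto.
  - intros t Ht. rewrite <- E by (apply slit_Re; rewrite re_RtoC; auto). auto.
Qed.

(** * Wiener-Hopf factors of a Rogers function *)

Section Existence.
Variables (U : (nat -> Prop) -> Prop) (F : C -> C).
Hypothesis HU : ultra U.
Hypothesis HF : rogers F.

Lemma eta_Ulim : Ulim U (fun n => RtoC (eta n)) (RtoC 0).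
Proof.
  apply Ulim_seq; auto. intros eps He. destruct (archimed_cor1 eps He) as [N [H1 H2]]. exists N. intros n Hn.
  replace (RtoC (eta n) - RtoC 0)%C with (RtoC (eta n)) by ring. assert (B := eta_bounds n).
  rewrite Cmod_R, Rabs_pos_eq by lra. apply Rle_lt_trans with (/ INR N); auto. unfold eta.
  apply Rinv_le_contravar. apply lt_0_INR; auto. apply le_INR in Hn. lra.
Qed.

(** At a fixed xi the approximations are values at eta n of one function G of a complex variable e,
    which is continuous at e = 0 with G 0 = F xi. *)
Lemma approx_Ulim xi : 0 < Re xi -> Ulim U (fun n => approx F n (cay xi)) (F xi).
Proof.
  intros Hx. assert (Hw := cay_mod xi Hx). set (w := cay xi) in *. assert (N := one_plus_nz xi ltac:(lra)).
  assert (Nx : xi <> 0) by (apply slit_nz, slit_Re; auto).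
  set (z := fun e : C => (xi * (pp F ((1 - e) * w) + e))%C). set (G := fun e : C => (z e / (e * z e + 1))%C).
  assert (Z0 : z 0 = F xi).
  { unfold z. replace ((1 - 0) * w)%C with w by ring. unfold pp, w. rewrite cay_invol by auto. field; auto. }
  replace (F xi) with (G (RtoC 0)). 2:{ unfold G. rewrite Z0. field. }
  apply (Ulim_ext U HU (fun n => G (RtoC (eta n)))).
  { intros n. destruct (approx_cay F HF n xi ltac:(lra)) as [_ [E _]]. unfold w. rewrite E. unfold G, z, PP. rewrite RtoC_minus. reflexivity. }
  apply Ulim_cont; auto. 2: apply eta_Ulim.
  assert (Cp : CCont (fun e => pp F ((1 - e) * w))%C (RtoC 0)).
  { destruct (pp_hol F HF w) as [d Hd]. { unfold disc. replace (w - RtoC 0)%C with w by ring. auto. }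
    apply (Der_Cont _ _ _ (d * (- (1) * w))%C). apply (Der_comp _ (pp F) (fun e => (1 - e) * w)%C).
    - replace ((1 - 0) * w)%C with w by ring. exact Hd.
    - eapply Der_eq. apply Der_mult. apply Der_minus. apply Der_const. apply Der_id. apply Der_const. cbv beta; ring. }
  assert (Cz : CCont z (RtoC 0)). { apply Cont_mult. apply Cont_const. apply Cont_plus; auto. apply Cont_id. }
  apply Cont_div; auto. apply Cont_plus. apply Cont_mult; auto. apply Cont_id. apply Cont_const.
  replace (0 * z 0 + 1)%C with (RtoC 1) by ring. intros E; apply RtoC_inj in E; lra.
Qed.

(** A value of F at or below - t on the real axis would make F(xi)/xi a negative multiple of 1/xi,
    with negative real part. *)
Lemma rogers_slit t xi : 0 < t -> 0 < Re xi -> slit_plane (F xi + RtoC t)%C.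
Proof.
  intros Ht Hx [E1 E2]. assert (H := proj2 HF xi Hx). assert (Nx : xi <> 0) by (apply slit_nz, slit_Re; auto).
  rewrite im_plus, im_RtoC in E1. rewrite re_plus, re_RtoC in E2. rewrite re_div in H by auto.
  assert (P := norm_pos xi Nx). assert (E : Im (F xi) = 0) by lra. rewrite E in H.
  assert (Re (F xi) * Re xi + 0 * Im xi < 0) by nra.
  assert (0 < / (Re xi * Re xi + Im xi * Im xi)) by (apply Rinv_0_lt_compat; auto). unfold Rdiv in H. nra.
Qed.

(* th is angle_up or angle_down. *)
Definition is_log_factor (th : (C -> C) -> R -> R -> R) (t : R) (v : C -> C) :=
  log_cbf PI v /\ forall x, slit_plane x -> Ulim U (fun n => angle_int (th (approx F n) t) x) (v x).

Definition log_factor (th : (C -> C) -> R -> R -> R) (t : R) : C -> C := epsilon (inhabits (fun _ => RtoC 0)) (is_log_factor th t).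

Section Side.
Variable th : (C -> C) -> R -> R -> R.
Hypothesis th_angle : forall f R0, regular f R0 -> forall t, 0 < t -> angle (th f t).
Hypothesis th_diff : forall f R0, regular f R0 -> forall t1 t2, 0 < t1 -> t1 <= t2 -> angle (fun p => th f t1 p - th f t2 p).
Hypothesis th_claim : forall f R0, regular f R0 -> forall x1 x2, 0 < x1 -> x1 < x2 -> exists v : nat -> C -> C,
  (forall k, log_cbf (8 * (PI * taylor_const (RtoC x1) + PI * taylor_const (RtoC x2) + 1)) (v k)) /\
  forall t, 0 < t -> Ulim U (fun k => v k (RtoC t)) (angle_int (th f t) (RtoC x1) - angle_int (th f t) (RtoC x2))%C.

Lemma log_factor_spec t : 0 < t -> is_log_factor th t (log_factor th t).
Proof.
  intros Ht. apply (epsilon_spec (inhabits (fun _ => RtoC 0)) (is_log_factor th t)).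
  destruct (log_cbf_Ulim U PI (fun n => angle_int (th (approx F n) t)) HU) as [v Hv].
  - intros n. destruct (approx_regular U F HU HF n) as [R0 HR]. apply log_cbf_angle_int. eapply th_angle; eauto.
  - exists v. exact Hv.
Qed.

Lemma log_factor_diff t1 t2 : 0 < t1 -> t1 <= t2 -> log_cbf PI (fun x => log_factor th t1 x - log_factor th t2 x)%C.
Proof.
  intros H1 H2. destruct (log_cbf_Ulim U PI (fun n => angle_int (fun p => th (approx F n) t1 p - th (approx F n) t2 p)) HU) as [v [V1 V2]].
  - intros n. destruct (approx_regular U F HU HF n) as [R0 HR]. apply log_cbf_angle_int. eapply th_diff; eauto.
  - apply (log_cbf_ext PI v); auto. intros x Hx. apply (Ulim_unique U HU _ _ _ (V2 x Hx)).
    destruct (log_factor_spec t1 H1) as [_ A1]. destruct (log_factor_spec t2 ltac:(lra)) as [_ A2].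
    apply (Ulim_ext U HU (fun n => angle_int (th (approx F n) t1) x - angle_int (th (approx F n) t2) x)%C).
    + intros n. destruct (approx_regular U F HU HF n) as [R0 HR]. apply angle_int_minus; auto; eapply th_angle; eauto; lra.
    + apply Ulim_minus; auto.
Qed.

(** Two successive limits: first over truncations of the curve for a fixed approximation, then over
    approximations. Both stay in one compact class because B depends on x1 and x2 alone. *)
Lemma log_factor_tau x1 x2 : 0 < x1 -> x1 < x2 -> exists B g, log_cbf B g /\ forall t, 0 < t -> g (RtoC t) = (log_factor th t (RtoC x1) - log_factor th t (RtoC x2))%C.
Proof.
  intros H1 H2. set (B := 8 * (PI * taylor_const (RtoC x1) + PI * taylor_const (RtoC x2) + 1)).
  assert (Q : forall n, exists g, log_cbf B g /\ forall t, 0 < t -> g (RtoC t) = (angle_int (th (approx F n) t) (RtoC x1) - angle_int (th (approx F n) t) (RtoC x2))%C).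
  { intros n. destruct (approx_regular U F HU HF n) as [R0 HR]. destruct (th_claim _ _ HR x1 x2 H1 H2) as [v [V1 V2]].
    destruct (log_cbf_Ulim U B v HU V1) as [g [G1 G2]]. exists g. split; auto. intros t Ht.
    apply (Ulim_unique U HU (fun k => v k (RtoC t))); auto. apply G2, slit_Re. rewrite re_RtoC; auto. }
  apply choice in Q. destruct Q as [gn Hg].
  destruct (log_cbf_Ulim U B gn HU) as [g [G1 G2]]. intros n; apply Hg.
  exists B, g. split; auto. intros t Ht. assert (St : slit_plane (RtoC t)) by (apply slit_Re; rewrite re_RtoC; auto).
  apply (Ulim_unique U HU _ _ _ (G2 _ St)).
  destruct (log_factor_spec t Ht) as [_ A].
  apply (Ulim_ext U HU (fun n => angle_int (th (approx F n) t) (RtoC x1) - angle_int (th (approx F n) t) (RtoC x2))%C).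
  - intros n. symmetry. apply (proj2 (Hg n)); auto.
  - apply Ulim_minus; auto; apply A, slit_Re; rewrite re_RtoC; lra.
Qed.
End Side.

Lemma tau_ratio_up f R0 : regular f R0 -> forall x1 x2, 0 < x1 -> x1 < x2 -> exists v : nat -> C -> C,
  (forall k, log_cbf (8 * (PI * taylor_const (RtoC x1) + PI * taylor_const (RtoC x2) + 1)) (v k)) /\
  forall t, 0 < t -> Ulim U (fun k => v k (RtoC t)) (angle_int (angle_up f t) (RtoC x1) - angle_int (angle_up f t) (RtoC x2))%C.
Proof. intros H x1 x2 H1 H2. exact (regular_tau_ratio U f R0 HU H x1 x2 H1 H2). Qed.

Lemma tau_ratio_down f R0 : regular f R0 -> forall x1 x2, 0 < x1 -> x1 < x2 -> exists v : nat -> C -> C,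
  (forall k, log_cbf (8 * (PI * taylor_const (RtoC x1) + PI * taylor_const (RtoC x2) + 1)) (v k)) /\
  forall t, 0 < t -> Ulim U (fun k => v k (RtoC t)) (angle_int (angle_down f t) (RtoC x1) - angle_int (angle_down f t) (RtoC x2))%C.
Proof.
  intros H x1 x2 H1 H2. destruct (tau_ratio_up _ R0 (regular_conj f R0 H) x1 x2 H1 H2) as [v [V1 V2]]. exists v. split; auto.
  intros t Ht. replace (angle_down f t) with (angle_up (cstar f) t) by (apply functional_extensionality; intros; apply angle_up_cstar). auto.
Qed.

(** The limit of [wh_formula]. The constant is the logarithm of the modulus at the centre w = 0 of
    the disc, which is the point xi = 1. *)
Lemma log_factor_formula t xi : 0 < t -> 0 < Re xi ->
  (F xi + RtoC t)%C = (RtoC (exp (Re (Clog (F 1 + RtoC t)))) * Cexp (log_factor angle_up t (- Ci * xi)) * Cexp (log_factor angle_down t (Ci * xi)))%C.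
Proof.
  intros Ht Hx. rewrite <- Cexp_RtoC, <- !Cexp_plus. rewrite <- (Cexp_Clog (F xi + RtoC t)) at 1 by (apply rogers_slit; auto). f_equal.
  assert (L : forall xi, 0 < Re xi -> Ulim U (fun n => log_shift (approx F n) t (cay xi)) (Clog (F xi + RtoC t))).
  { intros z Hz. apply (Ulim_cont U HU (fun w => Clog (w + RtoC t))%C). 2: apply approx_Ulim; auto.
    apply (Cont_comp _ Clog (fun w => w + RtoC t)%C). apply CCont_Clog, rogers_slit; auto. apply Cont_plus. apply Cont_id. apply Cont_const. }
  assert (S1 : slit_plane (- Ci * xi)%C).
  { intros [E1 E2]. destruct xi as [a b]. unfold Ci, Re, Im in *; simpl in *. lra. }
  assert (S2 : slit_plane (Ci * xi)%C).
  { intros [E1 E2]. destruct xi as [a b]. unfold Ci, Re, Im in *; simpl in *. lra. }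
  apply (Ulim_unique U HU _ _ _ (L xi Hx)).
  apply (Ulim_ext U HU (fun n => RtoC (Re (log_shift (approx F n) t (RtoC 0))) + angle_int (angle_up (approx F n) t) (- Ci * xi) + angle_int (angle_down (approx F n) t) (Ci * xi))%C).
  { intros n. destruct (approx_regular U F HU HF n) as [R0 HR]. symmetry. apply (wh_formula U _ R0); auto. }
  apply Ulim_plus; auto. apply Ulim_plus; auto.
  - apply (Ulim_cont U HU (fun z => RtoC (Re z)) (fun n => log_shift (approx F n) t (RtoC 0))).
    + apply Cont_Re, Cont_id.
    + apply (Ulim_ext U HU (fun n => log_shift (approx F n) t (cay 1))). intros n. f_equal. unfold cay. unfold Cdiv. ring.
      apply L. rewrite re_RtoC. lra.
  - apply (log_factor_spec angle_up (fun f R0 H => angle_angle_up U f R0 HU H)); auto.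
  - apply (log_factor_spec angle_down (fun f R0 H => angle_angle_down U f R0 HU H)); auto.
Qed.
End Existence.

(** * Growth of complete Bernstein functions and uniqueness of the factors *)

Lemma slit_RtoC t : 0 < t -> slit_plane (RtoC t).
Proof. intros H. apply slit_Re. rewrite re_RtoC; auto. Qed.

Lemma slit_square v : 0 < Re v -> slit_plane (v * v)%C.
Proof. intros H [E1 E2]. destruct v as [a b]. unfold Re, Im in *; simpl in *. assert (b = 0) by nra. subst. nra. Qed.

Lemma slit_root x : slit_plane x -> exists v, 0 < Re v /\ (v * v)%C = x.
Proof.
  intros H. exists (Cexp (Clog x / RtoC 2)). assert (N : RtoC 2 <> 0) by (intros E; apply RtoC_inj in E; lra). split.
  - rewrite Re_Cexp. assert (B := Im_Clog_bound x). apply Rmult_lt_0_compat. apply exp_pos.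
    replace (Im (Clog x / RtoC 2)) with (Im (Clog x) / 2). apply cos_gt_0; lra.
    unfold Cdiv. rewrite <- RtoC_inv, im_scal_r by lra. reflexivity.
  - rewrite <- Cexp_plus. rewrite <- (Cexp_Clog x H) at 3. f_equal. field; auto.
Qed.

Lemma slit_inv x : slit_plane x -> slit_plane (/ x)%C.
Proof.
  intros H. assert (N := slit_nz x H). assert (P := norm_pos x N). assert (P' := Rinv_0_lt_compat _ P).
  replace (/ x)%C with (RtoC 1 / x)%C by (field; auto).
  destruct (slit_cases x H) as [K|K].
  - apply slit_Re. rewrite re_div, re_RtoC, im_RtoC by auto. unfold Rdiv. nra.
  - apply slit_Im. rewrite im_div, re_RtoC, im_RtoC by auto. unfold Rdiv. intros E. apply Rmult_integral in E. destruct E; lra.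
Qed.

(* Conformal map of the unit disc onto the slit plane. *)
Definition phi (w : C) : C := (cay (- w) * cay (- w))%C.

Lemma disc01 w : disc 0 1 w <-> Cmod w < 1.
Proof. unfold disc. replace (w - RtoC 0)%C with w by ring. tauto. Qed.

Lemma disc01_opp w : disc 0 1 w -> 0 < Re (cay (- w)) /\ (1 + - w)%C <> 0.
Proof. intros H. rewrite disc01 in H. rewrite <- Cmod_opp in H. destruct (Re_cay _ H) as [A [B _]]. auto. Qed.

Lemma phi_slit w : disc 0 1 w -> slit_plane (phi w).
Proof. intros H. apply slit_square, disc01_opp; auto. Qed.

Lemma phi_onto x : slit_plane x -> exists w v, disc 0 1 w /\ phi w = x /\ 0 < Re v /\ (v * v)%C = x /\ w = (- cay v)%C.
Proof.
  intros H. destruct (slit_root x H) as [v [Hv E]]. exists (- cay v)%C, v. split; [|split; [|auto]].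
  - rewrite disc01. rewrite Cmod_opp. apply cay_mod; auto.
  - unfold phi. replace (- - cay v)%C with (cay v) by ring. rewrite cay_invol; auto. apply one_plus_nz; lra.
Qed.

Lemma phi_real s : -1 < s < 1 -> phi (RtoC s) = RtoC (((1 + s) / (1 - s)) * ((1 + s) / (1 - s))).
Proof.
  intros H. assert (N : (1 - RtoC s)%C <> 0). { rewrite <- RtoC_minus. intros E; apply RtoC_inj in E; lra. }
  unfold phi, cay. rewrite RtoC_mult, RtoC_div, RtoC_plus, RtoC_minus by lra. field; auto.
Qed.

Lemma phi_hol g : hol slit_plane g -> hol (disc 0 1) (fun w => g (phi w)).
Proof.
  intros Hg w Hw. destruct (Hg _ (phi_slit w Hw)) as [d Hd]. destruct (disc01_opp w Hw) as [_ N].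
  eexists. apply (Der_comp _ g phi). exact Hd.
  assert (D := Der_comp _ cay (fun w => - w)%C w _ _ (CDer_cay _ N) (Der_opp _ _ _ _ (Der_id _ w))).
  apply Der_mult; exact D.
Qed.

Lemma phi_conj w : disc 0 1 w -> phi (Cconj w) = Cconj (phi w).
Proof.
  intros H. destruct (disc01_opp w H) as [_ N]. unfold phi. rewrite Cmult_conj, <- cay_conj_gen by auto.
  replace (Cconj (- w)) with (- Cconj w)%C. reflexivity. apply Ceq; unfold Cconj, Re, Im; simpl; ring.
Qed.

(** Both the Cayley map of - w and the square of a number in the right half-plane multiply the
    imaginary part by a positive factor. Hence g composed with phi is typically real. *)
Lemma phi_im w : disc 0 1 w -> exists m, 0 < m /\ Im w = m * Im (phi w).
Proof.
  intros H. destruct (disc01_opp w H) as [P N]. assert (Q := norm_pos _ N).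
  assert (E : Im (cay (- w)) = 2 * Im w / (Re (1 + - w) * Re (1 + - w) + Im (1 + - w) * Im (1 + - w))).
  { unfold cay. rewrite im_div by auto. f_equal. rewrite re_minus, im_minus, re_plus, im_plus, re_RtoC, im_RtoC, re_opp, im_opp. ring. }
  set (D := Re (1 + - w) * Re (1 + - w) + Im (1 + - w) * Im (1 + - w)) in *.
  exists (D / (4 * Re (cay (- w)))). split. apply Rdiv_lt_0_compat; lra.
  replace (Im (phi w)) with (2 * Re (cay (- w)) * Im (cay (- w))) by (unfold phi, Re, Im; simpl; ring).
  rewrite E. field. split; lra.
Qed.

Section CBF.
Variable g : C -> C.
Hypothesis Hg : complete_bernstein g.

Lemma cbf_hol : hol slit_plane g.
Proof. apply hol_holomorphic, Hg. Qed.

Lemma cbf_real t : 0 < t -> g (RtoC t) = RtoC (Re (g (RtoC t))) /\ 0 <= Re (g (RtoC t)).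
Proof. intros H. destruct (proj2 (proj2 Hg) t H) as [A B]. split; auto. apply Ceq; rewrite ?re_RtoC, ?im_RtoC; auto. Qed.

Let phir s : -1 < s < 1 -> exists t, 0 < t /\ phi (RtoC s) = RtoC t.
Proof.
  intros H. eexists. split; [|apply phi_real; auto]. assert (0 < (1 + s) / (1 - s)) by (apply Rdiv_lt_0_compat; lra). nra.
Qed.

(** Schwarz reflection: both sides are holomorphic and agree on the positive axis, which is the real
    diameter in the disc coordinate, where the identity theorem applies. *)
Lemma cbf_conj x : slit_plane x -> g (Cconj x) = Cconj (g x).
Proof.
  intros Hx. destruct (phi_onto x Hx) as [w [v [Hw [E _]]]].
  assert (Hc : forall w, disc 0 1 w -> disc 0 1 (Cconj w)) by (intros z; rewrite !disc01, Cmod_conj; auto).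
  assert (K := identity_disc (fun w => g (phi w) - Cconj (g (phi (Cconj w))))%C 1).
  cbv beta in K. rewrite <- E, <- phi_conj by auto. apply Ceq_minus.
  rewrite <- (Cconj_conj w) at 2. apply K; auto.
  - intros z Hz. destruct (phi_hol g cbf_hol z Hz) as [d Hd]. destruct (phi_hol g cbf_hol _ (Hc z Hz)) as [e He].
    eexists. apply Der_minus. exact Hd. apply (CDer_conj (fun w => g (phi w))). exact He.
  - intros s Hs. rewrite Cconj_RtoC. destruct (phir s ltac:(lra)) as [t [Ht Et]]. rewrite Et. destruct (cbf_real t Ht) as [Er _].
    rewrite Er, Cconj_RtoC. ring.
Qed.

Lemma cbf_im x : slit_plane x -> 0 <= Im (g x) * Im x.
Proof.
  intros Hx. destruct (Rtotal_order (Im x) 0) as [H|[H|H]].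
  - assert (A := proj1 (proj2 Hg) (Cconj x)). rewrite im_conj, cbf_conj, im_conj in A by auto. specialize (A ltac:(lra)). nra.
  - rewrite H. lra.
  - assert (A := proj1 (proj2 Hg) x H). nra.
Qed.

(** In the disc coordinate g is typically real and g 1 = G 0, so the growth bounds for typically
    real functions apply. *)
Let G (w : C) : C := g (phi w).
Let G_hol : hol (disc 0 1) G.
Proof. apply phi_hol, cbf_hol. Qed.
Let G_im w : disc 0 1 w -> 0 <= Im (G w) * Im w.
Proof.
  intros H. destruct (phi_im w H) as [m [Pm Em]]. rewrite Em. unfold G. generalize (cbf_im _ (phi_slit w H)). intros.
  replace (Im (g (phi w)) * (m * Im (phi w))) with (m * (Im (g (phi w)) * Im (phi w))) by ring. apply Rmult_le_pos; lra.
Qed.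
Let G_re s : -1 < s < 1 -> Im (G (RtoC s)) = 0 /\ 0 <= Re (G (RtoC s)).
Proof. intros H. destruct (phir s H) as [t [Ht E]]. unfold G. rewrite E. apply Hg; auto. Qed.
Let phi0 : phi (RtoC 0) = RtoC 1.
Proof. rewrite phi_real by lra. f_equal. field. Qed.

(** With G 0 = 0 the bounds of [typ_real_bounds] force G to vanish on the real diameter. There |s|
    is split as r v with both factors in (0, 1), v being the midpoint of |s| and 1. *)
Lemma cbf_zero : g (RtoC 1) = 0 -> forall x, slit_plane x -> g x = 0.
Proof.
  intros E x Hx. destruct (phi_onto x Hx) as [w [v [Hw [Ew _]]]]. rewrite <- Ew.
  apply (identity_disc G 1); auto. intros s Hs.
  assert (E0 : Re (G (RtoC 0)) = 0) by (unfold G; rewrite phi0, E; apply re_RtoC).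
  destruct (G_re s ltac:(lra)) as [A B]. apply Ceq; rewrite ?re_RtoC, ?im_RtoC; auto. apply Rle_antisym; auto.
  destruct (Rtotal_order s 0) as [H|[H|H]].
  - destruct (typ_real_bounds G G_hol G_im G_re (2 * - s / (1 - s)) ((1 - s) / 2)) as [_ Q].
    + split. apply Rdiv_lt_0_compat; lra. apply Rmult_lt_reg_r with (1 - s). lra. unfold Rdiv. rewrite Rmult_assoc, Rinv_l; lra.
    + lra.
    + replace (- (2 * - s / (1 - s) * ((1 - s) / 2))) with s in Q by (field; lra). lra.
  - subst; lra.
  - destruct (typ_real_bounds G G_hol G_im G_re (2 * s / (1 + s)) ((1 + s) / 2)) as [Q _].
    + split. apply Rdiv_lt_0_compat; lra. apply Rmult_lt_reg_r with (1 + s). lra. unfold Rdiv. rewrite Rmult_assoc, Rinv_l; lra.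
    + lra.
    + replace (2 * s / (1 + s) * ((1 + s) / 2)) with s in Q by (field; lra). rewrite E0 in Q. lra.
Qed.

(** For t < 1 the bound on the negative radius gives g t <= g 1. For t > 1 and s = sqrt t, the
    choice v = (2 s - 1) / (2 s + 1) makes (1 + v) / (1 - v) equal to 2 s, hence the factor 4 t. *)
Lemma cbf_le t : 0 < t -> Re (g (RtoC t)) <= (1 + 4 * t) * Re (g (RtoC 1)).
Proof.
  intros Ht. set (s := sqrt t). assert (Hs : 0 < s) by (apply sqrt_lt_R0; auto). assert (Es : s * s = t) by (apply sqrt_sqrt; lra).
  assert (P1 := proj2 (cbf_real 1 ltac:(lra))).
  assert (E0 : Re (G (RtoC 0)) = Re (g (RtoC 1))) by (unfold G; rewrite phi0; auto).
  assert (Eg : G (RtoC ((s - 1) / (s + 1))) = g (RtoC t)).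
  { unfold G. rewrite phi_real. f_equal. f_equal. rewrite <- Es. field. lra.
    split. apply Rmult_lt_reg_r with (s + 1). lra. unfold Rdiv. rewrite Rmult_assoc, Rinv_l; lra.
    apply Rmult_lt_reg_r with (s + 1). lra. unfold Rdiv. rewrite Rmult_assoc, Rinv_l; lra. }
  assert (Q01 : forall a b, 0 < a < b -> 0 < a / b < 1).
  { intros a b H. split. apply Rdiv_lt_0_compat; lra. apply Rmult_lt_reg_r with b. lra. unfold Rdiv. rewrite Rmult_assoc, Rinv_l; lra. }
  destruct (Rtotal_order s 1) as [H|[H|H]].
  - destruct (typ_real_bounds G G_hol G_im G_re (1 - s) (/ (1 + s))) as [_ Q].
    + lra.
    + replace (/ (1 + s)) with (1 / (1 + s)) by (field; lra). apply Q01. lra.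
    + replace (- ((1 - s) * / (1 + s))) with ((s - 1) / (s + 1)) in Q by (field; lra). rewrite Eg, E0 in Q. nra.
  - replace t with 1 by (rewrite <- Es, H; ring). lra.
  - destruct (typ_real_bounds G G_hol G_im G_re ((s - 1) * (2 * s + 1) / ((s + 1) * (2 * s - 1))) ((2 * s - 1) / (2 * s + 1))) as [Q _].
    + apply Q01. nra.
    + apply Q01. lra.
    + replace ((s - 1) * (2 * s + 1) / ((s + 1) * (2 * s - 1)) * ((2 * s - 1) / (2 * s + 1))) with ((s - 1) / (s + 1)) in Q by (field; lra).
      rewrite Eg, E0 in Q. replace ((1 + (2 * s - 1) / (2 * s + 1)) / (1 - (2 * s - 1) / (2 * s + 1))) with (2 * s) in Q by (field; lra). nra.
Qed.

(** If x = v^2 lies on the right half of the unit circle, then |arg v| <= PI / 4, so |cay v| is at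
    most tan (PI / 8) < 1/2, the radius in [typ_real_sector]. *)
Lemma cbf_sector1 x : 0 <= Re x -> Cmod x = 1 -> Cmod (g x) <= 121 * Re (g (RtoC 1)).
Proof.
  intros Hx H1. assert (Sx : slit_plane x).
  { intros [A B]. assert (x = 0) by (apply Ceq; rewrite ?re_RtoC, ?im_RtoC; lra). subst. rewrite Cmod_0 in H1. lra. }
  destruct (phi_onto x Sx) as [w [v [Hw [E [Hv [Ev Ewv]]]]]].
  assert (E0 : Re (G (RtoC 0)) = Re (g (RtoC 1))) by (unfold G; rewrite phi0; auto).
  rewrite <- E, <- E0. apply (typ_real_sector G G_hol G_im G_re).
  rewrite Ewv, Cmod_opp. assert (N := one_plus_nz v ltac:(lra)).
  assert (M : Cmod v * Cmod v = 1) by (rewrite <- Cmod_mult, Ev; auto). assert (Mv := M). rewrite Cmod_sq in M.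
  assert (R : 0 <= Re v * Re v - Im v * Im v). { rewrite <- Ev in Hx. unfold Re, Im in *; simpl in *. lra. }
  unfold cay. rewrite Cmod_div by auto. apply Cmod_gt_0 in N.
  apply Rmult_le_reg_r with (Cmod (1 + v)); auto. unfold Rdiv. rewrite Rmult_assoc, Rinv_l, Rmult_1_r by lra.
  apply Rsqr_incr_0_var; [|lra]. unfold Rsqr.
  replace (1 * / 2 * Cmod (1 + v) * (1 * / 2 * Cmod (1 + v))) with (/ 4 * (Cmod (1 + v) * Cmod (1 + v))) by field.
  rewrite !Cmod_sq, re_minus, im_minus, re_plus, im_plus, re_RtoC, im_RtoC. nra.
Qed.
End CBF.

Lemma cbf_scale g r : 0 < r -> complete_bernstein g -> complete_bernstein (fun x => g (RtoC r * x)%C).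
Proof.
  intros Hr Hg. split; [|split].
  - apply hol_holomorphic. intros x Hx. destruct (cbf_hol g Hg (RtoC r * x)%C) as [d Hd].
    { intros [A B]. apply Hx. rewrite im_scal_l in A. rewrite re_scal_l in B. split; nra. }
    eexists. apply (Der_comp _ g (fun x => RtoC r * x)%C). exact Hd. apply Der_scal, Der_id.
  - intros x Hx. apply Hg. rewrite im_scal_l. nra.
  - intros t Ht. rewrite <- RtoC_mult. apply Hg. nra.
Qed.

Lemma cbf_sector g x : complete_bernstein g -> 0 <= Re x -> x <> 0 -> Cmod (g x) <= 121 * Re (g (RtoC (Cmod x))).
Proof.
  intros Hg Hx N. assert (P := proj1 (Cmod_gt_0 x) N). assert (Nr : RtoC (Cmod x) <> 0) by (intros E; apply RtoC_inj in E; lra).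
  assert (K := cbf_sector1 _ (cbf_scale g (Cmod x) P Hg) (x / RtoC (Cmod x))%C). cbv beta in K.
  replace (RtoC (Cmod x) * (x / RtoC (Cmod x)))%C with x in K by (field; auto). rewrite Cmult_1_r in K. apply K.
  - unfold Cdiv. rewrite <- RtoC_inv, re_scal_r by lra. apply Rmult_le_pos; auto. apply Rlt_le, Rinv_0_lt_compat; auto.
  - rewrite Cmod_div, Cmod_R, Rabs_pos_eq by (auto; lra). field; lra.
Qed.

Lemma cbf_growth g x : complete_bernstein g -> 0 <= Re x -> x <> 0 -> Cmod (g x) <= 121 * (1 + 4 * Cmod x) * Re (g (RtoC 1)).
Proof.
  intros Hg Hx N. eapply Rle_trans. apply cbf_sector; auto. rewrite Rmult_assoc. apply Rmult_le_compat_l. lra.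
  apply cbf_le; auto. apply Cmod_gt_0; auto.
Qed.

Lemma cbf_pos g t : complete_bernstein g -> nonzero_on slit_plane g -> 0 < t -> 0 < Re (g (RtoC t)).
Proof.
  intros Hg [x [Hx Nx]] Ht. destruct (cbf_real g Hg t Ht) as [E [P|P]]; auto. exfalso. apply Nx.
  assert (K := cbf_zero _ (cbf_scale g t Ht Hg)). cbv beta in K. rewrite Cmult_1_r, E, <- P in K.
  replace x with (RtoC t * (RtoC (/ t) * x))%C. apply K; auto.
  - intros [A B]. apply Hx. rewrite im_scal_l in A. rewrite re_scal_l in B. assert (0 < / t) by (apply Rinv_0_lt_compat; auto). split; nra.
  - rewrite Cmult_assoc, <- RtoC_mult, Rinv_r by lra. ring.
Qed.

(** Inversion of the variable and reciprocal of the value both reverse the sign of the imaginary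
    part. The transform turns upper bounds at x into lower bounds at 1/x. *)
Lemma cbf_inv g : complete_bernstein g -> (forall x, slit_plane x -> g x <> 0) -> complete_bernstein (fun x => / g (/ x))%C.
Proof.
  intros Hg N. split; [|split].
  - apply hol_holomorphic. intros x Hx. destruct (cbf_hol g Hg _ (slit_inv x Hx)) as [d Hd].
    eexists. apply (Der_inv _ (fun x => g (/ x))%C). apply (Der_comp _ g (fun x => / x)%C). exact Hd.
    apply (Der_inv _ (fun x => x)). apply Der_id. apply slit_nz; auto. apply N, slit_inv; auto.
  - intros x Hx. assert (Sx : slit_plane x) by (apply slit_Im; lra). assert (Nx := slit_nz x Sx). assert (Px := norm_pos x Nx).
    assert (Si := slit_inv x Sx). assert (Ng := N _ Si). assert (Pg := norm_pos _ Ng).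
    assert (A := cbf_im g Hg _ Si).
    assert (Ei : Im (/ x) < 0).
    { replace (/ x)%C with (RtoC 1 / x)%C by (field; auto). rewrite im_div, re_RtoC, im_RtoC by auto.
      assert (0 < / (Re x * Re x + Im x * Im x)) by (apply Rinv_0_lt_compat; auto). unfold Rdiv. nra. }
    replace (/ g (/ x))%C with (RtoC 1 / g (/ x))%C by (field; auto). rewrite im_div, re_RtoC, im_RtoC by auto.
    assert (0 < / (Re (g (/ x)%C) * Re (g (/ x)%C) + Im (g (/ x)%C) * Im (g (/ x)%C))) by (apply Rinv_0_lt_compat; auto).
    assert (Im (g (/ x)%C) <= 0) by nra. unfold Rdiv. nra.
  - intros t Ht. rewrite <- RtoC_inv by lra. destruct (cbf_real g Hg (/ t)) as [E P]. apply Rinv_0_lt_compat; auto.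
    assert (Ng := N (RtoC (/ t)) (slit_RtoC _ (Rinv_0_lt_compat _ Ht))). rewrite E in *. set (a := Re (g (RtoC (/ t)))) in *. rewrite re_RtoC in P.
    assert (a <> 0) by (intros Ea; apply Ng; rewrite Ea; auto). rewrite <- RtoC_inv by auto. split. apply im_RtoC. rewrite re_RtoC. apply Rlt_le, Rinv_0_lt_compat. lra.
Qed.

Lemma cbf_inv_growth g x : complete_bernstein g -> (forall x, slit_plane x -> g x <> 0) -> 0 <= Re x -> x <> 0 ->
  Cmod (/ g x) <= 121 * (1 + 4 / Cmod x) * Re (/ g (RtoC 1)).
Proof.
  intros Hg N Hx Nx. assert (K := cbf_growth _ (/ x)%C (cbf_inv g Hg N)). cbv beta in K.
  assert (Ei : (/ / x)%C = x) by (field; auto). assert (P := norm_pos x Nx).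
  rewrite Ei, (Cmod_inv x) in K by auto. replace (/ RtoC 1)%C with (RtoC 1) in K by field. apply K.
  - replace (/ x)%C with (RtoC 1 / x)%C by (field; auto). rewrite re_div, re_RtoC, im_RtoC by auto.
    apply Rmult_le_pos. lra. apply Rlt_le, Rinv_0_lt_compat; auto.
  - intros E. apply (f_equal (fun z => x * z)%C) in E. rewrite Cinv_r, Cmult_0_r in E by auto. apply RtoC_inj in E. lra.
Qed.

Lemma cbf_ratio_growth g h : complete_bernstein g -> complete_bernstein h -> (forall x, slit_plane x -> h x <> 0) ->
  exists K, 0 <= K /\ forall x, 0 <= Re x -> x <> 0 -> Cmod x * Cmod (g x / h x) <= K * ((1 + Cmod x) * (1 + Cmod x)).
Proof.
  intros Hg Hh N. set (a := Re (g (RtoC 1))). set (b := Re (/ h (RtoC 1))).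
  assert (Pa : 0 <= a) by (apply cbf_real; auto; lra).
  assert (Pb : 0 <= b). { generalize (cbf_real _ (cbf_inv h Hh N) 1 ltac:(lra)). cbv beta. intros [_ A]. unfold b. replace (RtoC 1) with (/ RtoC 1)%C; auto. field. }
  (* 121 comes from each sector bound, 16 from (1 + 4 X) (X + 4) <= 16 (1 + X)^2. *)
  exists (121 * 121 * (16 * (a * b))). split. assert (0 <= a * b) by nra. lra.
  intros x Hx Nx. assert (P := proj1 (Cmod_gt_0 x) Nx). unfold Cdiv. rewrite Cmod_mult.
  assert (A := cbf_growth g x Hg Hx Nx). assert (B := cbf_inv_growth h x Hh N Hx Nx). fold a in A. fold b in B.
  set (X := Cmod x) in *.
  apply Rle_trans with (X * ((121 * (1 + 4 * X) * a) * (121 * (1 + 4 / X) * b))).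
  { apply Rmult_le_compat_l. lra. apply Rmult_le_compat; auto; apply Cmod_ge_0. }
  replace (X * ((121 * (1 + 4 * X) * a) * (121 * (1 + 4 / X) * b))) with (121 * 121 * (a * b) * ((1 + 4 * X) * (X + 4))) by (field; lra).
  replace (121 * 121 * (16 * (a * b)) * ((1 + X) * (1 + X))) with (121 * 121 * (a * b) * (16 * ((1 + X) * (1 + X)))) by ring.
  apply Rmult_le_compat_l. assert (0 <= a * b) by nra. lra. nra.
Qed.

(** The bound near 0 leaves a0 = a1 = 0, so q x = a2 / x + a3 + a4 x. Positivity for both signs of x
    excludes the odd terms: a2 by small x, a4 by large x. *)
Lemma quartic_bound a0 a1 a2 a3 a4 K (q : R -> R) : 
  (forall x, x <> 0 -> 0 < q x) -> (forall x, x * (x * (x * q x)) = a0 + x * (a1 + x * (a2 + x * (a3 + x * a4)))) ->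
  (forall x, Rabs x <= 1 -> Rabs (x * (x * (x * q x))) <= K * (x * x)) ->
  0 < a3 /\ forall x, x <> 0 -> q x = a3.
Proof.
  intros Hq E HB.
  assert (A0 : a0 = 0). { specialize (E 0). lra. }
  assert (A1 : a1 = 0).
  { apply NNPP. intros N. set (S := K + Rabs a2 + Rabs a3 + Rabs a4 + Rabs a1).
    assert (0 <= K). { specialize (HB 1). rewrite Rabs_R1 in HB. generalize (Rabs_pos (1 * (1 * (1 * q 1)))). intros. specialize (HB ltac:(lra)). lra. }
    assert (P1 : 0 < Rabs a1) by (apply Rabs_pos_lt; auto). assert (B2 := Rabs_pos a2). assert (B3 := Rabs_pos a3). assert (B4 := Rabs_pos a4).
    assert (HS : 0 < S) by (unfold S; lra). set (x := Rabs a1 / (2 * S)).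
    assert (Hx : 0 < x) by (apply Rdiv_lt_0_compat; lra).
    assert (Hx1 : x * (2 * S) = Rabs a1) by (unfold x; field; lra).
    assert (Hx2 : x <= 1). { apply Rmult_le_reg_r with (2 * S). lra. rewrite Hx1. unfold S. lra. }
    specialize (HB x ltac:(rewrite Rabs_pos_eq; lra)). rewrite E, A0 in HB.
    apply Rabs_le_between in HB.
    assert (Rabs (x * (a2 + x * (a3 + x * a4))) <= x * (Rabs a2 + Rabs a3 + Rabs a4)).
    { rewrite Rabs_mult, (Rabs_pos_eq x) by lra. apply Rmult_le_compat_l. lra. eapply Rle_trans. apply Rabs_triang.
      rewrite Rabs_mult, (Rabs_pos_eq x) by lra. assert (Q := Rabs_triang a3 (x * a4)). rewrite Rabs_mult, (Rabs_pos_eq x) in Q by lra.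
      assert (0 <= Rabs (a3 + x * a4)) by apply Rabs_pos. nra. }
    apply Rabs_le_between in H0. set (r := x * (a2 + x * (a3 + x * a4))) in *.
    assert (HB' : - (K * x) <= a1 + r <= K * x) by (split; apply Rmult_le_reg_l with x; auto; lra).
    assert (Rabs a1 <= K * x + x * (Rabs a2 + Rabs a3 + Rabs a4)). { apply Rabs_le. lra. }
    unfold S in Hx1. nra. }
  subst a0 a1.
  assert (E' : forall x, x <> 0 -> x * q x = a2 + x * (a3 + x * a4)).
  { intros x Hx. specialize (E x). apply Rmult_eq_reg_l with (x * x). 2: nra. lra. }
  assert (D : forall x, 0 < x -> - (a3 * x) < a2 + a4 * (x * x) < a3 * x).
  { intros x Hx. assert (P := Hq x ltac:(lra)). assert (Q := Hq (- x) ltac:(lra)). assert (EP := E' x ltac:(lra)). assert (EQ := E' (- x) ltac:(lra)).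
    assert (0 < x * q x) by nra. assert (0 < x * q (- x)) by nra. lra. }
  assert (P3 : 0 < a3) by (specialize (D 1 ltac:(lra)); lra).
  assert (A4 : a4 = 0).
  { apply NNPP. intros N. assert (Pp : 0 < Rabs a4) by (apply Rabs_pos_lt; auto). 
    set (x := 1 + (a3 + Rabs a2) / Rabs a4). assert (B2 := Rabs_pos a2).
    assert (Hx : 1 <= x). { unfold x. assert (0 < (a3 + Rabs a2) / Rabs a4) by (apply Rdiv_lt_0_compat; lra). lra. }
    assert (Ex : Rabs a4 * x = Rabs a4 + a3 + Rabs a2) by (unfold x; field; lra).
    specialize (D x ltac:(lra)). assert (Rabs (a4 * (x * x)) <= a3 * x + Rabs a2).
    { generalize (Rle_abs a2) (Rle_abs (- a2)). rewrite Rabs_Ropp. intros. apply Rabs_le. lra. }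
    rewrite Rabs_mult, (Rabs_pos_eq (x * x)) in H by nra. nra. }
  subst a4.
  assert (A2 : a2 = 0).
  { apply NNPP. intros N. assert (Pp : 0 < Rabs a2) by (apply Rabs_pos_lt; auto). set (x := Rabs a2 / (2 * a3)).
    assert (Hx : 0 < x) by (apply Rdiv_lt_0_compat; lra). assert (Ex : a3 * x = Rabs a2 / 2) by (unfold x; field; lra).
    specialize (D x Hx). assert (Rabs a2 <= a3 * x) by (apply Rabs_le; lra). lra. }
  subst a2. split; auto. intros x Hx. specialize (E' x Hx). apply Rmult_eq_reg_l with x; auto. lra.
Qed.

Section Unique.
Variables (A1 B1 A B : C -> C) (c : R).
Hypothesis (HA1 : complete_bernstein A1) (HB1 : complete_bernstein B1) (HA : complete_bernstein A) (HB : complete_bernstein B).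
Hypothesis (ZA1 : nonzero_on slit_plane A1) (ZB1 : nonzero_on slit_plane B1).
Hypothesis (NA : forall x, slit_plane x -> A x <> 0) (NB : forall x, slit_plane x -> B x <> 0).
Hypothesis Hc : 0 < c.
Hypothesis Hfac : forall xi, 0 < Re xi -> (A1 (- Ci * xi) * B1 (Ci * xi) = RtoC c * A (- Ci * xi) * B (Ci * xi))%C.

Let rel_low x : Im x < 0 -> (A1 x * B1 (- x) = RtoC c * A x * B (- x))%C.
Proof.
  intros H. assert (K := Hfac (Ci * x)%C). replace (- Ci * (Ci * x))%C with x in K by (apply Ceq; unfold Ci, Re, Im; simpl; ring).
  replace (Ci * (Ci * x))%C with (- x)%C in K by (apply Ceq; unfold Ci, Re, Im; simpl; ring).
  apply K. unfold Ci, Re, Im in *; simpl in *. lra.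
Qed.

Let rel x : Im x <> 0 -> (A1 x * B1 (- x) = RtoC c * A x * B (- x))%C.
Proof.
  intros H. destruct (Rlt_le_dec (Im x) 0) as [L|L]. apply rel_low; auto.
  assert (K := rel_low (Cconj x) ltac:(rewrite im_conj; lra)). assert (S := slit_Im x H). assert (S' : slit_plane (- x)%C) by (apply slit_Im; rewrite im_opp; lra).
  replace (- Cconj x)%C with (Cconj (- x)) in K by (apply Ceq; unfold Cconj, Re, Im; simpl; ring).
  rewrite (cbf_conj A1), (cbf_conj B1), (cbf_conj A), (cbf_conj B) in K by auto. apply (f_equal Cconj) in K. rewrite !Cmult_conj, !Cconj_conj, Cconj_RtoC in K. auto.
Qed.

Let Nc : RtoC c <> 0.
Proof. intros E; apply RtoC_inj in E; lra. Qed.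

(** On the positive axis a nonzero complete Bernstein function is positive; elsewhere a zero of B1
    would make the zero-free right side of the factorisation vanish. *)
Let NB1 x : slit_plane x -> B1 x <> 0.
Proof.
  intros Hx E. destruct (Req_dec (Im x) 0) as [Z|Z].
  - destruct (slit_cases x Hx) as [P|]; auto. replace x with (RtoC (Re x)) in E by (apply Ceq; rewrite ?re_RtoC, ?im_RtoC; auto).
    generalize (cbf_pos B1 (Re x) HB1 ZB1 P). rewrite E, re_RtoC. lra.
  - assert (K := rel (- x)%C ltac:(rewrite im_opp; lra)). replace (- - x)%C with x in K by ring.
    rewrite E, Cmult_0_r in K. symmetry in K. revert K. apply Cmult_neq_0; auto. apply Cmult_neq_0; auto.
    apply NA, slit_Im. rewrite im_opp; lra.
Qed.

Let q1 x := (A1 x / A x)%C.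
Let q2 x := (RtoC c * (B (- x) / B1 (- x)))%C.
Let q x := if excluded_middle_informative (slit_plane x) then q1 x else q2 x.

Let q12 x : Im x <> 0 -> q1 x = q2 x.
Proof.
  intros H. unfold q1, q2. assert (S := slit_Im x H). assert (S' : slit_plane (- x)%C) by (apply slit_Im; rewrite im_opp; lra).
  assert (N1 := NA x S). assert (N2 := NB1 _ S'). assert (R := rel x H).
  replace (A1 x / A x)%C with (A1 x * B1 (- x) / (A x * B1 (- x)))%C by (field; auto). rewrite R. field. auto.
Qed.

Let q_1 x : slit_plane x -> q x = q1 x.
Proof. intros H. unfold q. destruct excluded_middle_informative; tauto. Qed.

Let q_2 x : slit_plane (- x)%C -> q x = q2 x.
Proof.
  intros H. unfold q. destruct excluded_middle_informative as [S|S]; auto. apply q12.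
  intros E. destruct H. rewrite im_opp, re_opp, E. split. lra. destruct (slit_cases x S); lra.
Qed.

Let cover (x : C) : x <> 0 -> slit_plane x \/ slit_plane (- x)%C.
Proof.
  intros N. destruct (classic (slit_plane x)) as [S|S]; auto. right. apply NNPP in S. unfold slit_plane. rewrite im_opp, re_opp. intros [E1 E2]. apply N.
  apply Ceq; rewrite ?re_RtoC, ?im_RtoC; lra.
Qed.

Let q_hol (x : C) : x <> 0 -> exists d, CDer q x d.
Proof.
  intros N. destruct (cover x N) as [S|S].
  - destruct (slit_open x S) as [r [P Q]]. destruct (cbf_hol A1 HA1 x S) as [d Hd]. destruct (cbf_hol A HA x S) as [e He].
    eexists. apply (Der_ext_loc _ q1 q x _ r P). intros s Hs. symmetry. apply q_1. apply Q. exact Hs. apply Der_div. exact Hd. exact He. auto.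
  - destruct (slit_open _ S) as [r [P Q]]. destruct (cbf_hol B1 HB1 _ S) as [d Hd]. destruct (cbf_hol B HB _ S) as [e He].
    eexists. apply (Der_ext_loc _ q2 q x _ r P).
    + intros s Hs. symmetry. apply q_2. apply Q. replace (- s - - x)%C with (- (s - x))%C by ring. rewrite Cmod_opp. exact Hs.
    + assert (Dn : CDer (fun s => - s)%C x (- (1))%C) by (apply Der_opp, Der_id).
      apply Der_scal. apply (Der_div _ (fun s => B (- s)%C) (fun s => B1 (- s)%C)).
      apply (Der_comp _ B (fun s => - s)%C). exact He. exact Dn. apply (Der_comp _ B1 (fun s => - s)%C). exact Hd. exact Dn. auto.
Qed.

(** The growth estimates hold in the closed right half-plane. For Re x < 0 the second expression of
    q is used, whose argument - x lies there. *)
Let q_bound : exists K, 0 <= K /\ forall x : C, x <> 0 -> Cmod x * Cmod (q x) <= K * ((1 + Cmod x) * (1 + Cmod x)).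
Proof.
  destruct (cbf_ratio_growth A1 A HA1 HA NA) as [K1 [P1 Q1]]. destruct (cbf_ratio_growth B B1 HB HB1 NB1) as [K2 [P2 Q2]].
  exists (K1 + c * K2). assert (0 <= c * K2) by nra. split. lra.
  intros x N. assert (X := Cmod_ge_0 x). assert (PX : 0 <= (1 + Cmod x) * (1 + Cmod x)) by nra.
  destruct (cover x N) as [S|S]; [rewrite (q_1 x S)|rewrite (q_2 x S)].
  - destruct (Rle_lt_dec 0 (Re x)) as [L|L]. { eapply Rle_trans. apply Q1; auto. apply Rmult_le_compat_r; lra. }
    assert (Im x <> 0) by (destruct (slit_cases x S); auto; lra). rewrite q12 by auto. unfold q2.
    assert (Z := Q2 (- x)%C ltac:(rewrite re_opp; lra)). rewrite Cmod_opp in Z. rewrite Cmod_mult, Cmod_R, Rabs_pos_eq by lra.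
    assert (Nm : (- x)%C <> 0). { intros E. apply N. rewrite <- (Copp_0). rewrite <- E. ring. }
    specialize (Z Nm). set (t := Cmod (B (- x)%C / B1 (- x)%C)) in *. nra.
  - destruct (Rle_lt_dec (Re x) 0) as [L|L].
    + unfold q2.
      assert (Z := Q2 (- x)%C ltac:(rewrite re_opp; lra)). rewrite Cmod_opp in Z. rewrite Cmod_mult, Cmod_R, Rabs_pos_eq by lra.
      assert (Nm : (- x)%C <> 0) by (apply slit_nz; auto).
      specialize (Z Nm). set (t := Cmod (B (- x)%C / B1 (- x)%C)) in *. nra.
    + assert (Im x <> 0). { destruct (slit_cases _ S) as [H1|H1]; rewrite ?re_opp, ?im_opp in H1; lra. } rewrite <- q12 by auto.
      eapply Rle_trans. apply Q1; auto; lra. apply Rmult_le_compat_r; lra.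
Qed.

(** The cube makes p quadratically small at 0, hence differentiable there, while p grows at most
    like |x|^4 at infinity. *)
Let p x := (x * (x * (x * q x)))%C.

(* q is the common continuation of A1 / A and c B(-x) / B1(-x); it is O(|x|) at infinity and O(1/|x|) at 0. *)
Let p_poly : exists a0 a1 a2 a3 a4 K, (forall x, p x = a0 + x * (a1 + x * (a2 + x * (a3 + x * a4))))%C /\
  forall x, Cmod x <= 1 -> Cmod (p x) <= K * (Cmod x * Cmod x).
Proof.
  destruct q_bound as [K [PK QK]].
  assert (Bp : forall x, Cmod (p x) <= K * ((1 + Cmod x) * (1 + Cmod x)) * (Cmod x * Cmod x)).
  { intros x. unfold p. rewrite !Cmod_mult. destruct (classic (x = 0)) as [E|N]. subst. rewrite Cmod_0. lra.
    specialize (QK x N). assert (0 <= Cmod x) by apply Cmod_ge_0.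
    replace (Cmod x * (Cmod x * (Cmod x * Cmod (q x)))) with (Cmod x * Cmod (q x) * (Cmod x * Cmod x)) by ring. apply Rmult_le_compat_r; nra. }
  assert (B4 : forall x, Cmod x <= 1 -> Cmod (p x) <= 4 * K * (Cmod x * Cmod x)).
  { intros x Hx. eapply Rle_trans. apply Bp. assert (0 <= Cmod x) by apply Cmod_ge_0. apply Rmult_le_compat_r. nra.
    rewrite (Rmult_comm 4). apply Rmult_le_compat_l; auto. nra. }
  assert (P0 : p (RtoC 0) = 0) by (unfold p; ring).
  assert (Hp : entire p).
  { intros x _. destruct (classic (x = 0)) as [E|N].
    - subst. exists 0. apply (quad_CDer p (RtoC 0) 0 1 (4 * K)). lra. intros h Hh. rewrite P0.
      replace (0 + h)%C with h by ring. replace (p h - 0 - 0 * h)%C with (p h) by ring. apply B4. lra.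
    - destruct (q_hol x N) as [d Hd]. eexists. apply Der_mult. apply Der_id. apply Der_mult. apply Der_id. apply Der_mult. apply Der_id. exact Hd. }
  destruct (liouville_poly 4 p K Hp PK) as [l [Hl El]].
  { intros x. eapply Rle_trans. apply Bp. assert (0 <= Cmod x) by apply Cmod_ge_0. rewrite Rmult_assoc. apply Rmult_le_compat_l; auto.
    simpl. rewrite Rmult_1_r. set (X := Cmod x) in *. replace ((1 + X) * ((1 + X) * ((1 + X) * (1 + X)))) with (((1 + X) * (1 + X)) * ((1 + X) * (1 + X))) by ring.
    apply Rmult_le_compat_l; nra. }
  destruct l as [|a0 [|a1 [|a2 [|a3 [|a4 [|]]]]]]; try discriminate.
  exists a0, a1, a2, a3, a4, (4 * K). split; auto. intros x. rewrite El. simpl. ring.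
Qed.

Let q_pos x : x <> 0 -> q (RtoC x) = RtoC (Re (q (RtoC x))) /\ 0 < Re (q (RtoC x)).
Proof.
  assert (D : forall u v, u = RtoC (Re u) -> v = RtoC (Re v) -> 0 < Re u -> 0 < Re v -> (u / v)%C = RtoC (Re (u / v)) /\ 0 < Re (u / v)).
  { intros u v Eu Ev Pu Pv. rewrite Eu, Ev, <- RtoC_div, re_RtoC by lra. split; auto. apply Rdiv_lt_0_compat; auto. }
  assert (ZA : nonzero_on slit_plane A) by (exists (RtoC 1); split; [|apply NA]; apply slit_RtoC; lra).
  assert (ZB : nonzero_on slit_plane B) by (exists (RtoC 1); split; [|apply NB]; apply slit_RtoC; lra).
  intros N. destruct (Rlt_le_dec 0 x) as [P|P].
  - rewrite q_1 by (apply slit_RtoC; auto). unfold q1. apply D; try (apply cbf_real; auto); apply cbf_pos; auto.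
  - rewrite q_2 by (rewrite <- RtoC_opp; apply slit_RtoC; lra). unfold q2. rewrite <- RtoC_opp.
    destruct (D (B (RtoC (- x))) (B1 (RtoC (- x)))) as [E Q]; try (apply cbf_real; auto; lra); try (apply cbf_pos; auto; lra).
    split. rewrite E, re_scal_l, re_RtoC, RtoC_mult. auto. rewrite re_scal_l. nra.
Qed.

Lemma wh_unique : exists k, 0 < k /\ (forall x, slit_plane x -> A1 x = RtoC k * A x)%C /\ (forall x, slit_plane x -> B1 x = RtoC (c / k) * B x)%C.
Proof.
  destruct p_poly as [a0 [a1 [a2 [a3 [a4 [K [Ep Bp]]]]]]].
  assert (Epr : forall x, p (RtoC x) = RtoC (x * (x * (x * Re (q (RtoC x)))))).
  { intros x. unfold p. destruct (Req_dec x 0) as [E|N]. subst. rewrite Rmult_0_l. ring.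
    destruct (q_pos x N) as [E _]. rewrite E at 1. rewrite !RtoC_mult. auto. }
  assert (ReP : forall x, Re (p (RtoC x)) = Re a0 + x * (Re a1 + x * (Re a2 + x * (Re a3 + x * Re a4)))).
  { intros x. rewrite Ep. rewrite !re_plus, !re_scal_l, !re_plus, !re_scal_l, !re_plus, !re_scal_l, !re_plus, !re_scal_l. auto. }
  assert (ImP : forall x, 0 = Im a0 + x * (Im a1 + x * (Im a2 + x * (Im a3 + x * Im a4)))).
  { intros x. transitivity (Im (p (RtoC x))). rewrite Epr, im_RtoC; auto. rewrite Ep. rewrite !im_plus, !im_scal_l, !im_plus, !im_scal_l, !im_plus, !im_scal_l, !im_plus, !im_scal_l. auto. }
  destruct (quartic_bound (Re a0) (Re a1) (Re a2) (Re a3) (Re a4) K (fun x => Re (q (RtoC x)))) as [P3 Q3].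
  - intros x N. apply q_pos; auto.
  - intros x. rewrite <- ReP, Epr, re_RtoC. auto.
  - intros x Hx. specialize (Bp (RtoC x)). rewrite Epr, !Cmod_R in Bp. specialize (Bp Hx). 
    replace (x * x) with (Rabs x * Rabs x) by (rewrite <- Rabs_mult; apply Rabs_pos_eq; nra). auto.
  - (* p and a3 x^3 are polynomials that agree on the real line *)
    assert (A2i : a0 = 0 /\ a1 = 0 /\ a2 = 0 /\ a3 = RtoC (Re a3) /\ a4 = 0).
    (* Five real points determine the coefficients of a quartic; 3 takes the place of 0 in the
       relation for the real parts, which holds for x <> 0 only. *)
    { assert (I0 := ImP 0). assert (I1 := ImP 1). assert (I2 := ImP (-1)). assert (I3 := ImP 2). assert (I4 := ImP (-2)).
      assert (R' : forall x, x <> 0 -> x * (x * (x * Re a3)) = Re a0 + x * (Re a1 + x * (Re a2 + x * (Re a3 + x * Re a4)))).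
      { intros x N. rewrite <- ReP, Epr, re_RtoC, Q3; auto. }
      assert (R1 := R' 1 ltac:(lra)). assert (R2 := R' (-1) ltac:(lra)). assert (R3 := R' 2 ltac:(lra)). assert (R4 := R' (-2) ltac:(lra)). assert (R5 := R' 3 ltac:(lra)).
      repeat split; apply Ceq; rewrite ?re_RtoC, ?im_RtoC; lra. }
    destruct A2i as [Z0 [Z1 [Z2 [Z3 Z4]]]].
    assert (Q : forall x : C, x <> 0 -> q x = RtoC (Re a3)).
    { intros x N. assert (E := Ep x). rewrite Z0, Z1, Z2, Z4, Z3 in E. unfold p in E.
      assert (N3 : (x * (x * x))%C <> 0) by (repeat apply Cmult_neq_0; auto).
      replace (q x) with ((x * (x * (x * q x))) / (x * (x * x)))%C by (field; auto). rewrite E. field; auto. }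
    exists (Re a3). split; auto. split.
    + intros x S. assert (E := Q x (slit_nz x S)). rewrite q_1 in E by auto. unfold q1 in E. rewrite <- E. field. auto.
    + intros x S. assert (Nx := slit_nz x S). assert (Nm : (- x)%C <> 0). { intros E. apply Nx. rewrite <- Copp_0, <- E. ring. }
      assert (S' : slit_plane (- - x)%C) by (replace (- - x)%C with x by ring; auto).
      assert (E := Q (- x)%C Nm). rewrite q_2 in E by auto. unfold q2 in E. replace (- - x)%C with x in E by ring.
      assert (N1 := NB1 x S). assert (Nk : RtoC (Re a3) <> 0) by (intros E'; apply RtoC_inj in E'; lra).
      rewrite RtoC_div by lra. rewrite <- E. field. auto.
Qed.
End Unique.

(** * Zero-free complete Bernstein functions: lower bounds and comparison *)

Lemma cbf_ext g h : (forall x, slit_plane x -> g x = h x) -> complete_bernstein g -> complete_bernstein h.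
Proof.
  intros E Hg. split; [|split].
  - apply hol_holomorphic. intros x Hx. destruct (cbf_hol g Hg x Hx) as [d Hd]. destruct (slit_open x Hx) as [r [P Q]].
    exists d. apply (Der_ext_loc _ g h x d r P). intros s Hs. apply E, Q. exact Hs. exact Hd.
  - intros x Hx. rewrite <- E by (apply slit_Im; lra). apply Hg; auto.
  - intros t Ht. rewrite <- E by (apply slit_RtoC; auto). apply Hg; auto.
Qed.

Lemma log_cbf_exp B u : log_cbf B u -> complete_bernstein (fun x => Cexp (u x)).
Proof. intros H. apply (cbf_ext (fun x => RtoC 1 * Cexp (u x))%C). intros; ring. apply (log_cbf_exp_scal B); auto. lra. Qed.

Lemma log_cbf_real B u t : log_cbf B u -> 0 < t -> u (RtoC t) = RtoC (Re (u (RtoC t))).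
Proof. intros H Ht. apply Ceq; rewrite ?re_RtoC, ?im_RtoC; auto. apply H; auto. Qed.

(** [cbf_sector] for the function 1 / g(1/x), evaluated at 1/x. *)
Lemma cbf_lower g x : complete_bernstein g -> (forall x, slit_plane x -> g x <> 0) -> 0 <= Re x -> x <> 0 ->
  Re (g (RtoC (Cmod x))) <= 121 * Cmod (g x).
Proof.
  intros Hg N Hx Nx. assert (P := norm_pos x Nx). assert (PM := proj1 (Cmod_gt_0 x) Nx).
  assert (Nix : (/ x)%C <> 0) by (apply Cinv_nz || (intros E; apply (f_equal (fun z => x * z)%C) in E; rewrite Cinv_r, Cmult_0_r in E by auto; apply RtoC_inj in E; lra)).
  assert (K := cbf_sector _ (/ x)%C (cbf_inv g Hg N)). cbv beta in K.
  assert (Sx : slit_plane x). { intros [A B]. apply Nx. apply Ceq; rewrite ?re_RtoC, ?im_RtoC; lra. }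
  assert (Ng := N x Sx). assert (St := slit_RtoC _ PM). assert (Nt := N _ St).
  replace (/ / x)%C with x in K by (field; auto). rewrite (Cmod_inv x), <- (RtoC_inv (/ Cmod x)), Rinv_inv in K by (auto; apply Rinv_neq_0_compat; lra).
  rewrite (Cmod_inv (g x)) in K by auto.
  destruct (cbf_real g Hg (Cmod x) PM) as [E Q]. rewrite E, <- RtoC_inv, re_RtoC in K.
  2:{ intros E'. apply Nt. rewrite E, E'. auto. }
  set (a := Re (g (RtoC (Cmod x)))) in *. assert (Pa : 0 < a). { destruct Q as [Q|Q]; auto. exfalso. apply Nt. rewrite E, <- Q. auto. }
  assert (Pg := proj1 (Cmod_gt_0 _) Ng). set (b := Cmod (g x)) in *.
  assert (L : / b <= 121 * / a).
  { apply K; auto. replace (/ x)%C with (RtoC 1 / x)%C by (field; auto). rewrite re_div, re_RtoC, im_RtoC by auto.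
    apply Rmult_le_pos. lra. apply Rlt_le, Rinv_0_lt_compat; auto. }
  apply Rmult_le_reg_l with (/ (a * b)). apply Rinv_0_lt_compat, Rmult_lt_0_compat; auto.
  replace (/ (a * b) * a) with (/ b) by (field; lra). replace (/ (a * b) * (121 * b)) with (121 * / a) by (field; lra). auto.
Qed.

(** [cbf_le] for the function 1 / g(1/x) at 1/t, where 1 + 4 / t <= 5. *)
Lemma cbf_ge g t : complete_bernstein g -> (forall x, slit_plane x -> g x <> 0) -> 1 <= t ->
  0 < Re (g (RtoC 1)) <= 5 * Re (g (RtoC t)).
Proof.
  intros Hg N Ht.
  assert (Pos : forall s, 0 < s -> 0 < Re (g (RtoC s))).
  { intros s Hs. apply cbf_pos; auto. exists (RtoC s). split; [|apply N]; apply slit_RtoC; auto. }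
  assert (It := Rinv_0_lt_compat t ltac:(lra)).
  assert (K := cbf_le _ (cbf_inv g Hg N) (/ t) It). cbv beta in K.
  rewrite <- !RtoC_inv, Rinv_inv, Rinv_1 in K by lra.
  assert (P1 := Pos 1 ltac:(lra)). assert (Pt := Pos t ltac:(lra)). split; auto.
  rewrite (proj1 (cbf_real g Hg t ltac:(lra))), (proj1 (cbf_real g Hg 1 ltac:(lra))), <- !RtoC_inv, !re_RtoC in K by lra.
  set (a := Re (g (RtoC 1))) in *. set (b := Re (g (RtoC t))) in *.
  assert (/ t <= 1) by (rewrite <- Rinv_1; apply Rinv_le_contravar; lra).
  assert (0 < / a) by (apply Rinv_0_lt_compat; auto).
  assert (L : / b <= 5 * / a) by nra.
  apply Rmult_le_reg_l with (/ (a * b)). apply Rinv_0_lt_compat, Rmult_lt_0_compat; auto.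
  replace (/ (a * b) * a) with (/ b) by (field; lra). replace (/ (a * b) * (5 * b)) with (5 * / a) by (field; lra). auto.
Qed.

(* On the imaginary axis a complete Bernstein function is comparable with its value at the modulus, so a bound for |g h| there bounds g, as h increases. *)
Lemma cbf_pair_bounded g h K : complete_bernstein g -> complete_bernstein h ->
  (forall x, slit_plane x -> g x <> 0) -> (forall x, slit_plane x -> h x <> 0) ->
  (forall t, 0 < t -> exists x y, Cmod x = t /\ Cmod y = t /\ 0 <= Re x /\ 0 <= Re y /\ Cmod (g x) * Cmod (h y) <= K) ->
  exists m M, 0 < m /\ forall t, 1 <= t -> m <= Re (g (RtoC t)) <= M.
Proof.
  intros Hg Hh Ng Nh H. exists (Re (g (RtoC 1)) / 5), (121 * 121 * 5 * K / Re (h (RtoC 1))).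
  split. generalize (cbf_ge g 1 Hg Ng ltac:(lra)). lra.
  intros t Ht. assert (G := cbf_ge g t Hg Ng Ht). assert (L := cbf_ge h t Hh Nh Ht). split. lra.
  destruct (H t ltac:(lra)) as [x [y [Ex [Ey [Rx [Ry HK]]]]]].
  assert (Nx : x <> 0) by (apply Cmod_gt_0; lra). assert (Ny : y <> 0) by (apply Cmod_gt_0; lra).
  assert (A := cbf_lower g x Hg Ng Rx Nx). assert (B := cbf_lower h y Hh Nh Ry Ny). rewrite Ex in A. rewrite Ey in B.
  set (g1 := Re (g (RtoC t))) in *. set (h1 := Re (h (RtoC t))) in *. set (h0 := Re (h (RtoC 1))) in *.
  apply Rmult_le_reg_r with h0. lra. replace (121 * 121 * 5 * K / h0 * h0) with (121 * 121 * 5 * K) by (field; lra).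
  apply Rle_trans with (g1 * (5 * h1)). apply Rmult_le_compat_l; lra.
  apply Rle_trans with (121 * Cmod (g x) * (5 * (121 * Cmod (h y)))). apply Rmult_le_compat; lra. lra.
Qed.

(** * Ratios of the normalised factors *)

Section Kappa.
Variables (w L : R -> C -> C).
Hypothesis Hw : forall t, 0 < t -> exists k, 0 < k /\ forall x, slit_plane x -> w t x = (RtoC k * Cexp (L t x))%C.
Hypothesis Hreal : forall t x, 0 < t -> 0 < x -> Im (L t (RtoC x)) = 0.
Hypothesis HL : forall t1 t2, 0 < t1 -> t1 <= t2 -> log_cbf PI (fun x => L t1 x - L t2 x)%C.
Hypothesis Htau : forall x1 x2, 0 < x1 -> x1 < x2 -> exists B g, log_cbf B g /\ forall t, 0 < t -> g (RtoC t) = (L t (RtoC x1) - L t (RtoC x2))%C.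
Hypothesis Hb : forall s t, 0 < s -> s <= t -> exists m M, 0 < m /\ forall x, 1 <= x -> m <= Re (Cexp (L s (RtoC x) - L t (RtoC x))) <= M.

Let lam t := real (Lim (fun eta => Re (w 1 (RtoC eta) / w t (RtoC eta))) p_infty).

Let Hb' t : 0 < t -> exists m M, 0 < m /\ forall x, 1 <= x -> m <= Re (Cexp (L 1 (RtoC x) - L t (RtoC x))) <= M.
Proof.
  intros Ht. destruct (Rle_lt_dec 1 t) as [H|H]. apply Hb; lra.
  destruct (Hb t 1 Ht ltac:(lra)) as [m [M [Pm Q]]]. exists (/ M), (/ m). 
  assert (PM : 0 < M) by (specialize (Q 1 ltac:(lra)); lra). split. apply Rinv_0_lt_compat; auto.
  intros x Hx. specialize (Q x Hx). rewrite Re_Cexp, im_minus, !Hreal, Rminus_0_r, cos_0, Rmult_1_r in * by lra.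
  replace (Re (L 1 (RtoC x) - L t (RtoC x))) with (- Re (L t (RtoC x) - L 1 (RtoC x))) by (rewrite !re_minus; ring).
  rewrite exp_Ropp. set (e := exp _) in *. split; apply Rinv_le_contravar; lra.
Qed.

(** [Lim] is evaluated along the integers and inherits the two positive bounds of the quotient.
    Positivity of the constant is all that the ratios require, so its value is not identified. *)
Let lam_pos t : 0 < t -> 0 < lam t.
Proof.
  intros Ht. destruct (Hw 1 ltac:(lra)) as [k1 [P1 Q1]]. destruct (Hw t Ht) as [k [P Q]]. destruct (Hb' t Ht) as [m [M [Pm B]]].
  assert (Hk : 0 < k1 / k) by (apply Rdiv_lt_0_compat; auto).
  assert (E : forall x, 1 <= x -> k1 / k * m <= Re (w 1 (RtoC x) / w t (RtoC x)) <= k1 / k * M).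
  { intros x Hx. specialize (B x Hx). rewrite Q1, Q by (apply slit_RtoC; lra). rewrite Cexp_minus in B.
    replace (RtoC k1 * Cexp (L 1 (RtoC x)) / (RtoC k * Cexp (L t (RtoC x))))%C with (RtoC (k1 / k) * (Cexp (L 1 (RtoC x)) / Cexp (L t (RtoC x))))%C.
    rewrite re_scal_l. split; apply Rmult_le_compat_l; lra.
    rewrite RtoC_div by lra. field. split. apply Cexp_nz. intros E'; apply RtoC_inj in E'; lra. }
  unfold lam, Lim. cbn [Rbar_loc_seq].
  assert (Lo : Rbar_le (Finite (k1 / k * m)) (Lim_seq (fun n => Re (w 1 (RtoC (INR n)) / w t (RtoC (INR n)))))).
  { rewrite <- Lim_seq_const. apply Lim_seq_le_loc. exists 1%nat. intros n Hn. apply E. apply le_INR in Hn. auto. }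
  assert (Hi : Rbar_le (Lim_seq (fun n => Re (w 1 (RtoC (INR n)) / w t (RtoC (INR n))))) (Finite (k1 / k * M))).
  { rewrite <- Lim_seq_const. apply Lim_seq_le_loc. exists 1%nat. intros n Hn. apply E. apply le_INR in Hn. auto. }
  destruct (Lim_seq _) as [l| |]; simpl in *; try tauto. assert (0 < k1 / k * m) by (apply Rmult_lt_0_compat; auto). lra.
Qed.

Lemma kappa_ratio_xi t1 t2 : 0 < t1 -> t1 < t2 ->
  complete_bernstein (fun x => (RtoC (lam t1) * w t1 x) / (RtoC (lam t2) * w t2 x))%C.
Proof.
  intros H1 H2. destruct (Hw t1 H1) as [k1 [P1 Q1]]. destruct (Hw t2 ltac:(lra)) as [k2 [P2 Q2]].
  assert (L1 := lam_pos t1 H1). assert (L2 := lam_pos t2 ltac:(lra)).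
  apply (cbf_ext (fun x => RtoC (lam t1 * k1 / (lam t2 * k2)) * Cexp (L t1 x - L t2 x))%C).
  - intros x Hx. rewrite Q1, Q2, Cexp_minus by auto. rewrite RtoC_div, !RtoC_mult. field.
    repeat split; try apply Cexp_nz; intros E; apply RtoC_inj in E; lra.
    apply Rgt_not_eq, Rmult_lt_0_compat; auto.
  - apply (log_cbf_exp_scal PI (fun x => L t1 x - L t2 x)%C). 2: apply HL; lra.
    apply Rlt_le, Rdiv_lt_0_compat; apply Rmult_lt_0_compat; auto.
Qed.

(** Both the normalising constant and the constant of the factorisation depend on t alone and
    cancel, which leaves the exponential of the difference in [Htau]. *)
Lemma kappa_ratio_tau x1 x2 : 0 < x1 -> x1 < x2 ->
  complete_bernstein_pos (fun t => (RtoC (lam t) * w t (RtoC x1)) / (RtoC (lam t) * w t (RtoC x2)))%C.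
Proof.
  intros H1 H2. destruct (Htau x1 x2 H1 H2) as [B [g [Hg Eg]]]. exists (fun x => Cexp (g x)). split. apply (log_cbf_exp B); auto.
  intros t Ht. destruct (Hw t Ht) as [k [P Q]]. assert (Lt := lam_pos t Ht).
  rewrite Eg, Cexp_minus, !Q by (auto; apply slit_RtoC; lra). field.
  repeat split; try apply Cexp_nz; intros E; apply RtoC_inj in E; lra.
Qed.
End Kappa.

(** * Identification of the chosen factors and bounds for their quotients *)

Section Main.
Variables (U : (nat -> Prop) -> Prop) (f : C -> C).
Hypothesis HU : ultra U.
Hypothesis Hf : rogers f.

Let LU := log_factor U f angle_up.
Let LD := log_factor U f angle_down.
Let aU : forall f R0, regular f R0 -> forall t, 0 < t -> angle (angle_up f t) := fun f R0 H => angle_angle_up U f R0 HU H.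
Let aD : forall f R0, regular f R0 -> forall t, 0 < t -> angle (angle_down f t) := fun f R0 H => angle_angle_down U f R0 HU H.
Let dU : forall f R0, regular f R0 -> forall t1 t2, 0 < t1 -> t1 <= t2 -> angle (fun p => angle_up f t1 p - angle_up f t2 p) := fun f R0 H => angle_up_decr U f R0 HU H.
Let dD : forall f R0, regular f R0 -> forall t1 t2, 0 < t1 -> t1 <= t2 -> angle (fun p => angle_down f t1 p - angle_down f t2 p) := fun f R0 H => angle_down_decr U f R0 HU H.

Let LCU t : 0 < t -> log_cbf PI (LU t).
Proof. intros Ht. apply (log_factor_spec U f HU Hf angle_up aU); auto. Qed.
Let LCD t : 0 < t -> log_cbf PI (LD t).
Proof. intros Ht. apply (log_factor_spec U f HU Hf angle_down aD); auto. Qed.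
Let LCUd t1 t2 : 0 < t1 -> t1 <= t2 -> log_cbf PI (fun x => LU t1 x - LU t2 x)%C.
Proof. intros. apply (log_factor_diff U f HU Hf angle_up aU dU); auto. Qed.
Let LCDd t1 t2 : 0 < t1 -> t1 <= t2 -> log_cbf PI (fun x => LD t1 x - LD t2 x)%C.
Proof. intros. apply (log_factor_diff U f HU Hf angle_down aD dD); auto. Qed.

Let cc t := exp (Re (Clog (f 1 + RtoC t))).
Let formula t xi : 0 < t -> 0 < Re xi -> (f xi + RtoC t)%C = (RtoC (cc t) * Cexp (LU t (- Ci * xi)) * Cexp (LD t (Ci * xi)))%C.
Proof. intros. apply (log_factor_formula U f HU Hf); auto. Qed.

Let wh_exists t : 0 < t -> exists p, is_wiener_hopf (fun xi => f xi + RtoC t)%C p.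
Proof.
  intros Ht. set (a := Re (LU t (RtoC 1))). set (b := Re (LD t (RtoC 1))).
  assert (Ea : Cexp (LU t (RtoC 1)) = RtoC (exp a)) by (rewrite (log_cbf_real PI (LU t)) by (auto; lra); apply Cexp_RtoC).
  assert (Eb : Cexp (LD t (RtoC 1)) = RtoC (exp b)) by (rewrite (log_cbf_real PI (LD t)) by (auto; lra); apply Cexp_RtoC).
  set (l := Re (Clog (f 1 + RtoC t))).
  assert (S1 : slit_plane (RtoC 1)) by (apply slit_RtoC; lra).
  assert (NZ : forall (r : R) z, (RtoC (exp r) * Cexp z)%C <> 0).
  { intros r z. apply Cmult_neq_0; [|apply Cexp_nz]. intros E; apply RtoC_inj in E. generalize (exp_pos r). lra. }
  (* The exponents add up to l and make both values at 1 equal to exp ((l + a + b) / 2), as the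
     normalisation of the factorisation demands. *)
  exists (fun x => RtoC (exp ((l + b - a) / 2)) * Cexp (LU t x), fun x => RtoC (exp ((l + a - b) / 2)) * Cexp (LD t x))%C.
  split; [|split; [|split; [|split; [|split]]]]; cbn [fst snd].
  - apply (log_cbf_exp_scal PI); auto. apply Rlt_le, exp_pos.
  - exists (RtoC 1). auto.
  - apply (log_cbf_exp_scal PI); auto. apply Rlt_le, exp_pos.
  - exists (RtoC 1). auto.
  - rewrite Ea, Eb, <- !RtoC_mult, <- !exp_plus. do 2 f_equal. field.
  - intros xi Hxi. rewrite formula by auto. unfold cc. fold l. replace l with ((l + b - a) / 2 + (l + a - b) / 2) at 1 by field.
    rewrite exp_plus, RtoC_mult. ring.
Qed.

Let wh_both t : 0 < t -> (exists k, 0 < k /\ forall x, slit_plane x -> wh_up f t x = (RtoC k * Cexp (LU t x))%C) /\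
  (exists k, 0 < k /\ forall x, slit_plane x -> wh_down f t x = (RtoC k * Cexp (LD t x))%C).
Proof.
  intros Ht. assert (H : is_wiener_hopf (fun xi => f xi + RtoC t)%C (wiener_hopf (fun xi => f xi + RtoC t)%C)).
  { exact (epsilon_spec (inhabits (fun _ => RtoC 0, fun _ => RtoC 0)) (is_wiener_hopf (fun xi => f xi + RtoC t)%C) (wh_exists t Ht)). }
  destruct H as [C1 [N1 [C2 [N2 [_ F]]]]].
  assert (Pc : 0 < cc t) by apply exp_pos.
  destruct (wh_unique _ _ (fun x => Cexp (LU t x)) (fun x => Cexp (LD t x)) (cc t) C1 C2 (log_cbf_exp PI _ (LCU t Ht)) (log_cbf_exp PI _ (LCD t Ht)) N1 N2
    (fun x _ => Cexp_nz _) (fun x _ => Cexp_nz _) Pc) as [k [Pk [Q1 Q2]]].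
  - intros xi Hxi. rewrite <- F by auto. apply formula; auto.
  - split. exists k. split; auto. exists (cc t / k). split; auto. apply Rdiv_lt_0_compat; auto.
Qed.

(** For real r > 0 the condition on f(r)/r gives Re (f r) >= 0, hence |f r + s| <= |f r + t|. By the
    factorisation the product is the quotient of these moduli times cc t / cc s. *)
Let product_bound s t : 0 < s -> s <= t -> exists K, forall r, 0 < r ->
  Cmod (Cexp (LU s (- Ci * RtoC r) - LU t (- Ci * RtoC r))) * Cmod (Cexp (LD s (Ci * RtoC r) - LD t (Ci * RtoC r))) <= K.
Proof.
  intros Hs Hst. exists (cc t / cc s). intros r Hr. assert (P1 : 0 < cc s) by apply exp_pos. assert (P2 : 0 < cc t) by apply exp_pos.
  assert (Rr : 0 < Re (RtoC r)) by (rewrite re_RtoC; auto).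
  assert (F1 := formula s (RtoC r) Hs Rr). assert (F2 := formula t (RtoC r) ltac:(lra) Rr).
  assert (Nr : RtoC r <> 0) by (intros E; apply RtoC_inj in E; lra).
  assert (Rf : 0 <= Re (f (RtoC r))).
  { assert (A := proj2 Hf (RtoC r) Rr). unfold Cdiv in A. rewrite <- RtoC_inv, re_scal_r in A by lra.
    apply Rmult_le_reg_r with (/ r). apply Rinv_0_lt_compat; auto. lra. }
  assert (M : Cmod (f (RtoC r) + RtoC s) <= Cmod (f (RtoC r) + RtoC t)).
  { apply Rsqr_incr_0_var; [|apply Cmod_ge_0]. unfold Rsqr. rewrite !Cmod_sq, !re_plus, !im_plus, !re_RtoC, !im_RtoC. nra. }
  rewrite F1, F2, !Cmod_mult, !Cmod_R, !Rabs_pos_eq in M by lra.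
  rewrite !Cexp_minus, !Cmod_div by apply Cexp_nz.
  assert (N1 := proj1 (Cmod_gt_0 _) (Cexp_nz (LU t (- Ci * RtoC r)))). assert (N2 := proj1 (Cmod_gt_0 _) (Cexp_nz (LD t (Ci * RtoC r)))).
  set (a1 := Cmod (Cexp (LU s (- Ci * RtoC r)))) in *. set (b1 := Cmod (Cexp (LD s (Ci * RtoC r)))) in *.
  set (a2 := Cmod (Cexp (LU t (- Ci * RtoC r)))) in *. set (b2 := Cmod (Cexp (LD t (Ci * RtoC r)))) in *.
  apply Rmult_le_reg_r with (cc s * (a2 * b2)). repeat apply Rmult_lt_0_compat; auto.
  replace (a1 / a2 * (b1 / b2) * (cc s * (a2 * b2))) with (cc s * a1 * b1) by (field; lra).
  replace (cc t / cc s * (cc s * (a2 * b2))) with (cc t * a2 * b2) by (field; lra). auto.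
Qed.

Let axis r : 0 < r -> Cmod (- Ci * RtoC r) = r /\ Cmod (Ci * RtoC r) = r /\ 0 <= Re (- Ci * RtoC r) /\ 0 <= Re (Ci * RtoC r).
Proof.
  intros Hr. rewrite !Cmod_mult, Cmod_opp, Cmod_R, Rabs_pos_eq by lra. assert (E : Cmod Ci = 1).
  { unfold Cmod, Ci; simpl. replace (0 * (0 * 1) + 1 * (1 * 1)) with 1 by ring. apply sqrt_1. }
  rewrite E. unfold Ci, Re; simpl. lra.
Qed.

Let boundU s t : 0 < s -> s <= t -> exists m M, 0 < m /\ forall x, 1 <= x -> m <= Re (Cexp (LU s (RtoC x) - LU t (RtoC x))) <= M.
Proof.
  intros Hs Hst. destruct (product_bound s t Hs Hst) as [K HK].
  apply (cbf_pair_bounded (fun x => Cexp (LU s x - LU t x)) (fun x => Cexp (LD s x - LD t x)) K).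
  apply (log_cbf_exp PI); auto. apply (log_cbf_exp PI); auto. intros; apply Cexp_nz. intros; apply Cexp_nz.
  intros r Hr. destruct (axis r Hr) as [A1 [A2 [A3 A4]]]. exists (- Ci * RtoC r)%C, (Ci * RtoC r)%C. auto 8.
Qed.

Let boundD s t : 0 < s -> s <= t -> exists m M, 0 < m /\ forall x, 1 <= x -> m <= Re (Cexp (LD s (RtoC x) - LD t (RtoC x))) <= M.
Proof.
  intros Hs Hst. destruct (product_bound s t Hs Hst) as [K HK].
  apply (cbf_pair_bounded (fun x => Cexp (LD s x - LD t x)) (fun x => Cexp (LU s x - LU t x)) K).
  apply (log_cbf_exp PI); auto. apply (log_cbf_exp PI); auto. intros; apply Cexp_nz. intros; apply Cexp_nz.
  intros r Hr. destruct (axis r Hr) as [A1 [A2 [A3 A4]]]. exists (Ci * RtoC r)%C, (- Ci * RtoC r)%C. rewrite Rmult_comm. auto 8.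
Qed.

Lemma rogers_kappa_ratios (tau1 tau2 : R) (htau1 : 0 < tau1) (htau12 : tau1 < tau2)
    (xi1 xi2 : R) (hxi1 : 0 < xi1) (hxi12 : xi1 < xi2) :
  complete_bernstein (fun xi : C => kappa_up f tau1 xi / kappa_up f tau2 xi)%C /\
  complete_bernstein (fun xi : C => kappa_down f tau1 xi / kappa_down f tau2 xi)%C /\
  complete_bernstein_pos
    (fun tau : R => kappa_up f tau (RtoC xi1) / kappa_up f tau (RtoC xi2))%C /\
  complete_bernstein_pos
    (fun tau : R => kappa_down f tau (RtoC xi1) / kappa_down f tau (RtoC xi2))%C.
Proof.
  assert (RU : forall t x, 0 < t -> 0 < x -> Im (LU t (RtoC x)) = 0) by (intros t x Ht Hx; apply (LCU t Ht); auto).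
  assert (RD : forall t x, 0 < t -> 0 < x -> Im (LD t (RtoC x)) = 0) by (intros t x Ht Hx; apply (LCD t Ht); auto).
  assert (WUw := fun t Ht => proj1 (wh_both t Ht)). assert (WDw := fun t Ht => proj2 (wh_both t Ht)).
  split; [|split; [|split]].
  - apply (kappa_ratio_xi (wh_up f) LU WUw RU LCUd boundU); auto.
  - apply (kappa_ratio_xi (wh_down f) LD WDw RD LCDd boundD); auto.
  - apply (kappa_ratio_tau (wh_up f) LU WUw RU (log_factor_tau U f HU Hf angle_up aU (tau_ratio_up U HU)) boundU); auto.
  - apply (kappa_ratio_tau (wh_down f) LD WDw RD (log_factor_tau U f HU Hf angle_down aD (tau_ratio_down U HU)) boundD); auto.
Qed.
End Main.

Theorem corollary10p5 (f : C -> C) (hf : nearly_balanced f)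
    (tau1 tau2 : R) (htau1 : 0 < tau1) (htau12 : tau1 < tau2)
    (xi1 xi2 : R) (hxi1 : 0 < xi1) (hxi12 : xi1 < xi2) :
  complete_bernstein (fun xi : C => kappa_up f tau1 xi / kappa_up f tau2 xi)%C /\
  complete_bernstein (fun xi : C => kappa_down f tau1 xi / kappa_down f tau2 xi)%C /\
  complete_bernstein_pos
    (fun tau : R => kappa_up f tau (RtoC xi1) / kappa_up f tau (RtoC xi2))%C /\
  complete_bernstein_pos
    (fun tau : R => kappa_down f tau (RtoC xi1) / kappa_down f tau (RtoC xi2))%C.
Proof.
  destruct free_ultrafilter as [U HU]. apply (rogers_kappa_ratios U f HU (proj1 hf)); auto.
Qed.
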